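(* Let $m\ge1$, $\nu>\frac nr-1$ real and $1\le q\le p<\infty$. There exists $C>0$ such that for all $f_1,\dots,f_m\in A^p_\nu(T_\Omega)$, $$\int_{T_\Omega}|\Box(f_1\cdots f_m)(z)|^q\prod_{j=1}^m|f_j(z)|^{p-q}\,\Delta^{m(\nu+\frac nr)+q}(\Im z)\frac{dV(z)}{\Delta^{2\frac nr}(\Im z)}\le C\,m^q\prod_{j=1}^m\|f_j\|^p_{A^p_\nu}.$$
   Context: Let $V$ be an $n$-dimensional Euclidean Jordan algebra (identified with $\mathbb R^n$) with inner product $(x|\xi)=\mathrm{tr}(x\xi)$, $\Omega\subset V$ an irreducible symmetric cone of rank $r\ge2$ with determinant $\Delta$, $T_\Omega=V+i\Omega$, $dV$ Lebesgue measure. For real $\nu>\frac nr-1$ and $1\le p<\infty$, $A^p_\nu(T_\Omega)$ is the space of holomorphic $f$ on $T_\Omega$ with $\|f\|_{A^p_\nu}^p=\int_{T_\Omega}|f(z)|^p\Delta^{\nu-\frac nr}(\Im z)dV(z)<\infty$. $\Box=\Delta(\frac1i\frac{\partial}{\partial x})$ is the differential operator of order $r$ on $\mathbb R^n$ determined by $\Box[e^{i(x|\xi)}]=\Delta(\xi)e^{i(x|\xi)}$, applied to holomorphic functions on $T_\Omega$ in the variable $x=\Re z$. For a product of holomorphic functions, $\Box(f_1\cdots f_m)$ is defined as $\sum_{j=1}^m f_1\cdots f_{j-1}(\Box f_j)f_{j+1}\cdots f_m$. *)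

(* Defs.v *)
From mathcomp Require Import all_boot all_order all_algebra.
From mathcomp Require Import all_classical all_reals all_analysis.
From mathcomp Require Import complex.
From mathcomp Require mpoly.

Set Implicit Arguments.
Unset Strict Implicit.
Unset Printing Implicit Defensive.

Import Order.TTheory GRing.Theory Num.Theory.
Import numFieldNormedType.Exports.
Local Open Scope ring_scope.
Local Open Scope classical_set_scope.

Definition dotr (R : realType) (n : nat) (x y : 'rV[R]_n) : R :=
  \sum_(k < n) x 0 k * y 0 k.

Fixpoint jpow (R : realType) (n : nat) (jm : 'rV[R]_n -> 'rV[R]_n -> 'rV[R]_n)
    (e x : 'rV[R]_n) (k : nat) : 'rV[R]_n :=
  match k with
  | 0 => e
  | k'.+1 => jm x (jpow jm e x k')
  end.

(* degree of the minimal polynomial of x = dim span{x^0, x^1, ..., x^n} *)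
Definition jdeg (R : realType) (n : nat) (jm : 'rV[R]_n -> 'rV[R]_n -> 'rV[R]_n)
    (e x : 'rV[R]_n) : nat :=
  \rank (\matrix_(i < n.+1, j < n) (jpow jm e x i) 0 j).

(* (V, jm, e) is a Euclidean Jordan algebra whose associative positive
   definite inner product is the standard one of R^n *)
Definition is_EJA (R : realType) (n : nat) (jm : 'rV[R]_n -> 'rV[R]_n -> 'rV[R]_n)
    (e : 'rV[R]_n) : Prop :=
  [/\ (forall (a : R) x y z, jm (a *: x + y) z = a *: jm x z + jm y z),
      (forall x y, jm x y = jm y x),
      (forall x y, jm (jm x x) (jm x y) = jm x (jm (jm x x) y)),
      (forall x, jm e x = x) &
      (forall x y z, dotr (jm x y) z = dotr y (jm x z))].

Definition is_jrank (R : realType) (n : nat) (jm : 'rV[R]_n -> 'rV[R]_n -> 'rV[R]_n)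
    (e : 'rV[R]_n) (r : nat) : Prop :=
  (forall x, (jdeg jm e x <= r)%N) /\ (exists x, jdeg jm e x = r).

Definition peval (R : realType) (n : nat) (P : mpoly.mpoly n R) (x : 'rV[R]_n) : R :=
  mpoly.meval (fun k => x 0 k) P.

(* tr and Delta are the (generic) trace and determinant of V: for every
   regular x (degree r), with minimal polynomial
     t^r - c_(r-1) t^(r-1) - ... - c_0,
   tr x = c_(r-1) and Delta x = (-1)^(r+1) c_0, i.e. Delta(x) is (-1)^r times
   the constant term of the minimal polynomial; tr is linear and Delta is a
   polynomial (these determine them uniquely since regular elements are
   dense). *)
Definition is_trace_det (R : realType) (n : nat)
    (jm : 'rV[R]_n -> 'rV[R]_n -> 'rV[R]_n) (e : 'rV[R]_n) (r : nat)
    (tr : 'rV[R]_n -> R) (Delta : mpoly.mpoly n R) : Prop :=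
  (forall (a : R) x y, tr (a *: x + y) = a * tr x + tr y) /\
  (forall x (c : nat -> R), jdeg jm e x = r ->
     jpow jm e x r = \sum_(k < r) c k *: jpow jm e x k ->
     tr x = c r.-1 /\ peval Delta x = (-1) ^+ r.+1 * c 0%N).

Definition sym_cone (R : realType) (n : nat)
    (jm : 'rV[R]_n -> 'rV[R]_n -> 'rV[R]_n) : set 'rV[R]_n :=
  interior [set jm x x | x in [set: 'rV[R]_n]].

Definition irreducible_cone (R : realType) (n : nat) (Om : set 'rV[R]_n) : Prop :=
  ~ exists (V1 V2 : 'M[R]_n) (A B : set 'rV[R]_n),
      [/\ V1 != 0, V2 != 0, (V1 :&: V2 == (0 : 'M[R]_n))%MS & (V1 + V2 == 1%:M)%MS] /\
      [/\ (forall a, A a -> (a <= V1)%MS),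
          (forall b, B b -> (b <= V2)%MS) &
          Om = [set a + b | a in A & b in B]].

(* Functions on the tube T_Om = V + i Om.  A point z = x + i y is      *)
(* encoded by w = row_mx x y : 'rV_(n+n).                              *)

Definition cmod (R : realType) (z : R[i]) : R :=
  Num.sqrt (complex.Re z ^+ 2 + complex.Im z ^+ 2).

Definition uncurryT (R : realType) (n : nat) (f : 'rV[R]_n -> 'rV[R]_n -> R[i])
    (w : 'rV[R]_(n + n)) : R[i] := f (lsubmx w) (rsubmx w).

Definition in_tube (R : realType) (n : nat) (Om : set 'rV[R]_n)
    (w : 'rV[R]_(n + n)) : Prop := Om (rsubmx w).

Definition ex (R : realType) (n : nat) (k : 'I_n) : 'rV[R]_(n + n) :=
  delta_mx 0 (lshift n k).
Definition ey (R : realType) (n : nat) (k : 'I_n) : 'rV[R]_(n + n) :=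
  delta_mx 0 (rshift n k).

Definition ReF (R : realType) (N : nat) (F : 'rV[R]_N -> R[i]) :=
  fun w => complex.Re (F w).
Definition ImF (R : realType) (N : nat) (F : 'rV[R]_N -> R[i]) :=
  fun w => complex.Im (F w).

Definition holo_tube (R : realType) (n : nat) (Om : set 'rV[R]_n)
    (f : 'rV[R]_n -> 'rV[R]_n -> R[i]) : Prop :=
  let F := uncurryT f in
  forall w, in_tube Om w ->
    [/\ differentiable (ReF F) w, differentiable (ImF F) w &
        forall k : 'I_n,
          'D_(ex R k) (ReF F) w = 'D_(ey R k) (ImF F) w /\
          'D_(ey R k) (ReF F) w = - 'D_(ex R k) (ImF F) w].

Definition pdx (R : realType) (n : nat) (k : 'I_n)
    (F : 'rV[R]_(n + n) -> R[i]) : 'rV[R]_(n + n) -> R[i] :=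
  fun w => Complex ('D_(ex R k) (ReF F) w) ('D_(ex R k) (ImF F) w).

Definition pdxm (R : realType) (n : nat) (al : mpoly.multinom n)
    (F : 'rV[R]_(n + n) -> R[i]) : 'rV[R]_(n + n) -> R[i] :=
  foldr (fun k G => iter (mpoly.fun_of_multinom al k) (pdx k) G) F (enum 'I_n).

(* Box = Delta((1/i) d/dx) = sum_alpha c_alpha (-i)^|alpha| d^alpha/dx^alpha *)
Definition BoxOp (R : realType) (n : nat) (Delta : mpoly.mpoly n R)
    (F : 'rV[R]_(n + n) -> R[i]) : 'rV[R]_(n + n) -> R[i] :=
  fun w => \sum_(al <- mpoly.msupp Delta)
     Complex (mpoly.mcoeff al Delta) 0 * (- 'i) ^+ (mpoly.mdeg al) * pdxm al F w.

(* Box(f_1 ... f_m) := sum_j f_1 ... f_(j-1) (Box f_j) f_(j+1) ... f_m *)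
Definition BoxProd (R : realType) (n m : nat) (Delta : mpoly.mpoly n R)
    (f : 'I_m -> 'rV[R]_n -> 'rV[R]_n -> R[i]) (w : 'rV[R]_(n + n)) : R[i] :=
  \sum_(j < m) (\prod_(i < m | i != j) uncurryT (f i) w) * BoxOp Delta (uncurryT (f j)) w.

(* Lebesgue integral over R^N of a nonnegative function, as an         *)
(* iterated one-dimensional Lebesgue integral (Tonelli).               *)
Fixpoint iint (R : realType) (N : nat) : ('rV[R]_N -> \bar R) -> \bar R :=
  match N return ('rV[R]_N -> \bar R) -> \bar R with
  | 0 => fun g => g 0
  | N'.+1 => fun g =>
      (\int[@lebesgue_measure R]_(t in [set: R])
          iint (fun v : 'rV[R]_N' => g (row_mx (const_mx t : 'rV[R]_1) v)))%E
  end.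

Definition Apnorm_p (R : realType) (n r : nat) (jm : 'rV[R]_n -> 'rV[R]_n -> 'rV[R]_n)
    (Delta : mpoly.mpoly n R) (p nu : R) (f : 'rV[R]_n -> 'rV[R]_n -> R[i]) : \bar R :=
  iint (fun w : 'rV[R]_(n + n) =>
    if `[< in_tube (sym_cone jm) w >] then
      ((cmod (uncurryT f w)) `^ p *
       (peval Delta (rsubmx w)) `^ (nu - n%:R / r%:R))%:E
    else 0%E).

Definition in_Apnu (R : realType) (n r : nat) (jm : 'rV[R]_n -> 'rV[R]_n -> 'rV[R]_n)
    (Delta : mpoly.mpoly n R) (p nu : R) (f : 'rV[R]_n -> 'rV[R]_n -> R[i]) : Prop :=
  holo_tube (sym_cone jm) f /\ (Apnorm_p r jm Delta p nu f < +oo)%E.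

Definition lhs9 (R : realType) (n r m : nat) (jm : 'rV[R]_n -> 'rV[R]_n -> 'rV[R]_n)
    (Delta : mpoly.mpoly n R) (p q nu : R)
    (f : 'I_m -> 'rV[R]_n -> 'rV[R]_n -> R[i]) : \bar R :=
  iint (fun w : 'rV[R]_(n + n) =>
    if `[< in_tube (sym_cone jm) w >] then
      ((cmod (BoxProd Delta f w)) `^ q *
       (\prod_(j < m) (cmod (uncurryT (f j) w)) `^ (p - q)) *
       (peval Delta (rsubmx w)) `^ (m%:R * (nu + n%:R / r%:R) + q) /
       (peval Delta (rsubmx w)) `^ (2 * (n%:R / r%:R)))%:E
    else 0%E).

(* Main.v *)
(* The estimate is local. Around each point z of the tube sits a neighbourhood
   T(z), affinely equivalent to a fixed neighbourhood of ie under the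
   automorphisms of the tube, on which Delta(Im w) is comparable to
   Delta(Im z). At ie the mean value property and Cauchy's formula bound
   |f(ie)|^p and |Box f(ie)|^p by a constant times the integral of |f|^p, and
   transporting this to z gives
     |f(z)|^p, |Delta(Im z) Box f(z)|^p
        <= C Delta(Im z)^(-2n/r) \int_{T(z)} |f|^p.
   For all but one factor the integral is at most
   C Delta(Im z)^(n/r - nu) ||f_j||^p, so the left-hand integrand is at most
   C m^q \prod_{j>1} ||f_j||^p Delta(Im z)^(nu - 3n/r) \int_{T(z)} |f_1|^p,
   and exchanging the integrations over z and w bounds its integral, because
   the set of z with w in T(z) has volume O(Delta(Im w)^(2n/r)).

   The automorphisms come from the spectral theorem in V: a point y of the cone
   is exp(x) with x in V, and the linear map exp(L(x)), where L(x) is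
   multiplication by x, sends e to y; it preserves the cone and multiplies
   Delta by exp(tr x) = Delta(y). Irreducibility gives tr L(x) = (n/r) tr x,
   hence the Jacobian det exp(L(x)) = Delta(y)^(n/r). *)
Require Import Defs.
From mathcomp Require Import all_boot all_order all_algebra.
From mathcomp Require Import all_classical all_reals all_analysis.
From mathcomp Require Import measurable_realfun complex ring lra.
From mathcomp Require mpoly.
Import (canonicals) mpoly.
Set Implicit Arguments.
Unset Strict Implicit.
Unset Printing Implicit Defensive.
Import Order.TTheory GRing.Theory Num.Theory.
Import numFieldNormedType.Exports.
Local Open Scope ring_scope.

(** * Euclidean Jordan algebras *)

Section Dot.
Variables (R : realType) (n : nat).
Implicit Types x y z : 'rV[R]_n.

(** The determinant is given only on regular elements, through minimal polynomials, so each property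
    of [Delta] must be carried over from them. One identity does most of the work: the derivative of
    [Delta] at w in the direction xw is tr(x) Delta(w). It comes from Hankel determinants of the
    moments (w^k|e). It yields the scaling of [Delta] along exp(tL(x)) and the vanishing of [Delta]
    on the boundary of the cone; invariance of the cone follows because a line of times is
    connected. Complex analysis is built from Goursat's lemma and stays on squares in complex lines
    with real direction: [Box] differentiates in real directions, and the mean value inequality uses
    the centre of a square. The role of 2 pi i is played by [kappa], the contour integral of 1/z,
    known only to be nonzero. Integrals are iterated one-dimensional ones, so Tonelli and the
    Jacobian formula go by induction on the dimension; the maps exp(L(x)) are positive definite, and
    the formula is proved for such matrices. Monotonicity of the integral holds for all nonnegative
    functions, so measurability is established for majorants only. *)

Lemma dotrC x y : dotr x y = dotr y x.
Proof. by apply: eq_bigr => k _; rewrite mulrC. Qed.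

Lemma dotrDl x y z : dotr (x + y) z = dotr x z + dotr y z.
Proof. by rewrite -big_split; apply: eq_bigr => k _; rewrite mxE mulrDl. Qed.

Lemma dotrDr x y z : dotr z (x + y) = dotr z x + dotr z y.
Proof. by rewrite dotrC dotrDl !(dotrC z). Qed.

Lemma dotrZl a x y : dotr (a *: x) y = a * dotr x y.
Proof. by rewrite /dotr mulr_sumr; apply: eq_bigr => k _; rewrite mxE mulrA. Qed.

Lemma dotrZr a x y : dotr x (a *: y) = a * dotr x y.
Proof. by rewrite dotrC dotrZl dotrC. Qed.

Lemma dotrNl x y : dotr (- x) y = - dotr x y.
Proof. by rewrite -scaleN1r dotrZl mulN1r. Qed.

Lemma dotrNr x y : dotr x (- y) = - dotr x y.
Proof. by rewrite -scaleN1r dotrZr mulN1r. Qed.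

Lemma dotr0l x : dotr 0 x = 0.
Proof. by rewrite -(scale0r 0) dotrZl mul0r. Qed.

Lemma dotr0r x : dotr x 0 = 0.
Proof. by rewrite dotrC dotr0l. Qed.

Lemma dotr_suml I (s : seq I) (P : pred I) (F : I -> 'rV[R]_n) x :
  dotr (\sum_(i <- s | P i) F i) x = \sum_(i <- s | P i) dotr (F i) x.
Proof.
by apply: (big_morph (fun y => dotr y x)) => [a b|]; rewrite ?dotrDl ?dotr0l.
Qed.

Lemma dotr_sumr I (s : seq I) (P : pred I) (F : I -> 'rV[R]_n) x :
  dotr x (\sum_(i <- s | P i) F i) = \sum_(i <- s | P i) dotr x (F i).
Proof. by rewrite dotrC dotr_suml; apply: eq_bigr => i _; rewrite dotrC. Qed.

Lemma dotr_ge0 x : 0 <= dotr x x.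
Proof. by apply: sumr_ge0 => k _; rewrite -expr2 sqr_ge0. Qed.

Lemma dotr_eq0 x : (dotr x x == 0) = (x == 0).
Proof.
apply/idP/eqP => [|->]; last by rewrite dotr0l.
rewrite psumr_eq0 => [/allP h|k _]; last by rewrite -expr2 sqr_ge0.
apply/rowP => k; rewrite mxE; apply/eqP.
by move: (h k (mem_index_enum _)); rewrite -expr2 sqrf_eq0.
Qed.

Lemma dotr_gt0 x : (0 < dotr x x) = (x != 0).
Proof. by rewrite lt_def dotr_eq0 dotr_ge0 andbT. Qed.

Lemma dotr_delta x k : dotr x (delta_mx 0 k) = x 0 k.
Proof.
rewrite /dotr (bigD1 k) //= mxE !eqxx mulr1 big1 ?addr0 // => i ik.
by rewrite mxE (negbTE ik) andbF mulr0.
Qed.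

Lemma dotr_inj x y : (forall z, dotr x z = dotr y z) -> x = y.
Proof. by move=> h; apply/rowP => k; rewrite -!dotr_delta h. Qed.

Lemma dotr_mulmx x y (A : 'M[R]_n) : dotr (x *m A) y = dotr x (y *m A^T).
Proof.
rewrite /dotr; under eq_bigr do rewrite mxE mulr_suml.
rewrite exchange_big; apply: eq_bigr => j _.
by rewrite mxE mulr_sumr; apply: eq_bigr => i _; rewrite mxE mulrAC mulrA.
Qed.

End Dot.

(** * The Jordan identity, power associativity, idempotents *)

Section EJA.
Variables (R : realType) (n : nat) (jm : 'rV[R]_n -> 'rV[R]_n -> 'rV[R]_n).
Variable e : 'rV[R]_n.
Hypothesis eja : is_EJA jm e.
Implicit Types x y z u v w : 'rV[R]_n.

Lemma jmC x y : jm x y = jm y x. Proof. by case: eja. Qed.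

Lemma jmDl x y z : jm (x + y) z = jm x z + jm y z.
Proof. by case: eja => /(_ 1 x y z) h _ _ _ _; rewrite -[x]scale1r h !scale1r. Qed.

Lemma jmDr x y z : jm z (x + y) = jm z x + jm z y.
Proof. by rewrite jmC jmDl !(jmC z). Qed.

Lemma jm0l x : jm 0 x = 0.
Proof. by apply: (addrI (jm 0 x)); rewrite -jmDl !addr0. Qed.

Lemma jmZl a x z : jm (a *: x) z = a *: jm x z.
Proof. by case: eja => /(_ a x 0 z); rewrite !addr0 jm0l addr0. Qed.

Lemma jmZr a x z : jm z (a *: x) = a *: jm z x.
Proof. by rewrite jmC jmZl jmC. Qed.

Lemma jmNl x y : jm (- x) y = - jm x y.
Proof. by rewrite -scaleN1r jmZl scaleN1r. Qed.

Lemma jmNr x y : jm x (- y) = - jm x y.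
Proof. by rewrite jmC jmNl jmC. Qed.

Lemma jm_suml I (s : seq I) (P : pred I) (F : I -> 'rV[R]_n) x :
  jm (\sum_(i <- s | P i) F i) x = \sum_(i <- s | P i) jm (F i) x.
Proof.
by apply: (big_morph (fun y => jm y x)) => [a b|]; rewrite ?jmDl ?jm0l.
Qed.

Lemma jm_sumr I (s : seq I) (P : pred I) (F : I -> 'rV[R]_n) x :
  jm x (\sum_(i <- s | P i) F i) = \sum_(i <- s | P i) jm x (F i).
Proof. by rewrite jmC jm_suml; apply: eq_bigr => i _; rewrite jmC. Qed.

Lemma jmel x : jm e x = x. Proof. by case: eja. Qed.
Lemma jmer x : jm x e = x. Proof. by rewrite jmC jmel. Qed.

Lemma dotr_jm x y z : dotr (jm x y) z = dotr y (jm x z).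
Proof. by case: eja. Qed.

Lemma jordan x y : jm (jm x x) (jm x y) = jm x (jm (jm x x) y).
Proof. by case: eja. Qed.

(** Polarization: the Jordan identity is cubic in [x], and the alternating sum of its instances at
    the seven partial sums of [x], [z], [u] leaves the trilinear part. *)
Lemma jordan_lin x z u y :
  jm (jm x z) (jm u y) + jm (jm z u) (jm x y) + jm (jm u x) (jm z y) =
  jm u (jm (jm x z) y) + jm x (jm (jm z u) y) + jm z (jm (jm u x) y).
Proof.
apply/rowP => k; have J a := congr1 (fun r : 'rV_n => r 0 k) (jordan a y).
have := J (x + z + u); have := J (x + z); have := J (x + u); have := J (z + u).
have := J x; have := J z; have := J u.
rewrite !(jmDl, jmDr) (jmC z x) (jmC u x) (jmC u z) !mxE => h1 h2 h3 h4 h5 h6 h7.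
lra.
Qed.

(* the right-hand side of [jordan_lin] is symmetric in all four variables *)
Lemma jordan_op x z u y :
  jm (jm (jm z x) u) y =
  jm (jm z u) (jm x y) + jm (jm x u) (jm z y) + jm (jm z x) (jm u y)
  - jm x (jm u (jm z y)) - jm z (jm u (jm x y)).
Proof.
have h1 := jordan_lin x z u y; have h2 := jordan_lin x z y u.
apply/rowP => k.
have := congr1 (fun r : 'rV_n => r 0 k) h1.
have := congr1 (fun r : 'rV_n => r 0 k) h2.
rewrite (jmC y u) (jmC x z) (jmC z y) (jmC y x).
rewrite (jmC (jm y z) u) (jmC (jm x y) u) (jmC u x) (jmC (jm (jm z x) u) y).
rewrite (jmC (jm y z) (jm x u)) (jmC (jm x y) (jm z u)) (jmC y z) !mxE.
lra.
Qed.

Local Notation pow := (jpow jm e).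

(** [jordan_op] writes L(x^(m+2)) through L(x), L(x^2), L(x^m) and L(x^(m+1)). The induction
    therefore carries two consecutive powers, and commutation with L(x^2) beside commutation with
    L(x). Power associativity ([jpowD]) follows. *)
Lemma jpow_comm x k y : jm x (jm (pow x k) y) = jm (pow x k) (jm x y).
Proof.
suff h m : (forall y, jm x (jm (pow x m) y) = jm (pow x m) (jm x y) /\
    jm (jm x x) (jm (pow x m) y) = jm (pow x m) (jm (jm x x) y)) /\
   (forall y, jm x (jm (pow x m.+1) y) = jm (pow x m.+1) (jm x y) /\
    jm (jm x x) (jm (pow x m.+1) y) = jm (pow x m.+1) (jm (jm x x) y)).
  by case: (h k) => /(_ y)[].
elim: m => [|m [IH1 IH2]]; split => // {}y; last first.
- have E v : jm (pow x m.+2) v = jm (pow x m.+1) (jm x v)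
      + jm (jm x x) (jm (pow x m) v) + jm (pow x m.+1) (jm x v)
      - jm x (jm x (jm (pow x m) v)) - jm (pow x m) (jm x (jm x v)).
    rewrite -[pow x m.+2]/(jm x (jm x (pow x m))) (jmC x (jm _ _)) (jmC x (pow x m)).
    by rewrite jordan_op /= (jmC (pow x m) x).
  rewrite !E !jmDr !jmNr; split.
    have J v := (IH1 v).1; have K v := (IH2 v).1; rewrite !K !J.
    by rewrite -!jordan J.
  have J v := (IH1 v); have K v := (IH2 v).
  rewrite (K _).2 (J _).2 !jordan -(J _).1 -(J _).2.
  by rewrite (J (jm x y)).1 (J (jm x (jm x y))).2 !jordan.
- by rewrite /= !jmer; split=> //; rewrite jordan.
- by rewrite /= !jmel.
Qed.

Lemma jpowD x i j : jm (pow x i) (pow x j) = pow x (i + j).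
Proof.
elim: j => [|j IHj]; first by rewrite addn0 jmer.
by rewrite addnS /= -jpow_comm IHj.
Qed.

Definition Lm x : 'M[R]_n := \matrix_(i, j) jm x (delta_mx 0 i) 0 j.

Lemma mul_Lm v x : v *m Lm x = jm x v.
Proof.
rewrite [in RHS](row_sum_delta v) jm_sumr mulmx_sum_row; apply: eq_bigr => i _.
by rewrite jmZr; congr (_ *: _); apply/rowP => j; rewrite !mxE.
Qed.

Lemma tr_Lm x : (Lm x)^T = Lm x.
Proof.
apply/matrixP => i j; rewrite !mxE -(dotr_delta (jm x (delta_mx 0 j))).
by rewrite -(dotr_delta (jm x (delta_mx 0 i))) dotr_jm dotrC.
Qed.

(** For L = L(c), [jordan_op] at [c] reads L = 3 L^2 - 2 L^3, so that the eigenvalues of L are among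
    0, 1/2, 1. The right-hand side displays the quadratic form as a sum of squares; at the
    eigenvalue 1/2 it reads 1/2 = 1/4 + 4 (1/2 - 1/4)^2. *)
Lemma dotr_idem c v : jm c c = c ->
  dotr (jm c v) v = dotr (jm c v) (jm c v)
    + 4 * dotr (jm c v - jm c (jm c v)) (jm c v - jm c (jm c v)).
Proof.
move=> cc; have E z : jm c z = 3 *: jm c (jm c z) - 2 *: jm c (jm c (jm c z)).
  by apply/rowP => k; have := congr1 (fun r : 'rV_n => r 0 k) (jordan_op c c c z);
    rewrite !cc !mxE; lra.
have T a b : dotr (jm c a) b = dotr a (jm c b) by rewrite dotr_jm.
have h1 := congr1 (fun z => dotr z v) (E v).
have h2 := congr1 (fun z => dotr z (jm c v)) (E v).
move: h1 h2; rewrite !(dotrDl,dotrDr,dotrNl,dotrNr,dotrZl,dotrZr) !T; lra.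
Qed.

Lemma dotr_idem_ge0 c v : jm c c = c -> 0 <= dotr (jm c v) v.
Proof.
by move=> cc; rewrite dotr_idem // addr_ge0 ?mulr_ge0 ?dotr_ge0.
Qed.

End EJA.

(** The spectral theorem for hermitian matrices over R[i], brought back to R because real matrices
    similar over R[i] are similar over R. [P] is merely invertible, so [exp_flow] has to recover
    symmetry by another route. *)
Lemma symmetric_diagonalizable (R : realType) n (S : 'M[R]_n) : S^T = S ->
  exists (P : 'M[R]_n) (d : 'rV[R]_n), P \in unitmx /\ P *m S = diag_mx d *m P.
Proof.
move=> Ssym; pose toC := real_complex R.
pose A : 'M[R[i]]_n := map_mx toC S.
have Areal : A \is a realmx.
  by apply/mxOverP => i j; rewrite mxE; apply/complex_realP; exists (S i j).
have Aherm : A \is hermsymmx.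
  apply: realsym_hermsym => //; apply/is_hermitianmxP.
  rewrite expr0 scale1r; apply/matrixP => i j.
by rewrite !mxE -[in LHS]Ssym mxE.
have := hermitian_spectral_diag_real Aherm.
set D := spectral_diag A => Dreal.
have /orthomx_spectralP E := hermitian_normalmx Aherm.
have [|//||P] := @real_similar _ _ A (diag_mx D).
- exists (spectralmx A); first exact: spectral_unit.
  apply/similarP; first exact: spectral_unit.
  by rewrite {2}E !mulmxA mulmxV ?spectral_unit // mul1mx.
- apply/mxOverP => i j; rewrite mxE; case: eqP => _; last by rewrite mulr0n rpred0.
  by rewrite mulr1n (mxOverP Dreal).
rewrite inE => /andP[Preal Punit] /(similarP Punit) PA.
pose P' : 'M[R]_n := map_mx (@complex.Re R) P.
have PE : P = map_mx toC P'.
  by apply/matrixP => i j; rewrite !mxE /toC RRe_real // (mxOverP Preal).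
have DE : D = map_mx toC (map_mx (@complex.Re R) D).
  by apply/matrixP => i j; rewrite !mxE /toC RRe_real // (mxOverP Dreal).
exists P', (map_mx (@complex.Re R) D); split.
  by rewrite -(map_unitmx toC) -PE.
apply: (map_mx_inj (f := toC)).
by rewrite !map_mxM -PE map_diag_mx -DE.
Qed.

(** Lagrange interpolation. In [spectral] these polynomials make the idempotents of an element
    polynomials in that element. *)
Lemma lagrange_sep (R : realType) (s : seq R) (a : R) :
  exists p : {poly R}, forall b, b \in s -> p.[b] = (b == a)%:R.
Proof.
pose q := \prod_(b <- s | b != a) ('X - b%:P).
have qE x : q.[x] = \prod_(b <- s | b != a) (x - b).
  by rewrite horner_prod; apply: eq_bigr => b _; rewrite !hornerE.
have qa : q.[a] != 0.
  by rewrite qE prodf_seq_neq0; apply/allP => b _; apply/implyP; rewrite subr_eq0 eq_sym.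
exists ((q.[a])^-1 *: q) => b bs; rewrite hornerZ.
case: eqVneq => [->|ba]; first by rewrite mulVf.
rewrite (qE b) (big_rem b) //= ba subrr mul0r mulr0 //.
Qed.

(** * Spectral decomposition and frames of idempotents *)

Section Frame.
Variables (R : realType) (n : nat) (jm : 'rV[R]_n -> 'rV[R]_n -> 'rV[R]_n).
Variable e : 'rV[R]_n.
Hypothesis eja : is_EJA jm e.

(** A complete system of orthogonal idempotents. They may fail to be primitive, so [m] can be
    smaller than the rank; when [m] is the rank each has trace 1 ([frame_tr1]). *)
Definition is_frame m (c : 'I_m -> 'rV[R]_n) : Prop :=
  [/\ forall i, c i != 0, forall i j, jm (c i) (c j) = if i == j then c i else 0
    & \sum_i c i = e].

Lemma spectral (w : 'rV[R]_n) : exists m (lam : 'I_m -> R) (c : 'I_m -> 'rV[R]_n),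
  [/\ injective lam, is_frame c & w = \sum_i lam i *: c i].
Proof.
have [P [d [Pu PS]]] := symmetric_diagonalizable (tr_Lm eja w).
(* The components of [e] in an eigenbasis of L(w). Then w^k is the sum of the d_i^k b_i, and a
   polynomial p in w is the sum of the p(d_i) b_i; power associativity makes this evaluation [ev]
   multiplicative. *)
pose b i : 'rV_n := (e *m invmx P) 0 i *: row i P.
have eb : e = \sum_i b i by rewrite -mulmx_sum_row mulmxKV.
have wb i : jm w (b i) = d 0 i *: b i.
  rewrite (jmZr eja) -(mul_Lm eja) -row_mul PS.
  by apply/rowP => j; rewrite mul_diag_mx !mxE mulrCA.
clearbody b.
have wk k : jpow jm e w k = \sum_i d 0 i ^+ k *: b i.
  elim: k => [|k IH] /=; first by under eq_bigr do rewrite expr0 scale1r.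
  rewrite IH (jm_sumr eja); apply: eq_bigr => i _.
  by rewrite (jmZr eja) wb scalerA exprSr.
pose ev (p : {poly R}) : 'rV_n := \sum_i p.[d 0 i] *: b i.
have evE p : ev p = \sum_(k < size p) p`_k *: jpow jm e w k.
  rewrite /ev; under eq_bigr do rewrite horner_coef scaler_suml.
  rewrite exchange_big; apply: eq_bigr => k _.
  rewrite wk scaler_sumr; apply: eq_bigr => i _.
  by rewrite scalerA.
have evX k q : jm (jpow jm e w k) (ev q) = ev ('X^k * q).
  rewrite evE (jm_sumr eja).
  under eq_bigr do rewrite (jmZr eja) (jpowD eja) wk scaler_sumr.
  rewrite exchange_big; apply: eq_bigr => i _.
  rewrite hornerM hornerXn horner_coef mulr_sumr scaler_suml.
  by apply: eq_bigr => l _; rewrite scalerA exprD mulrCA.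
have evM p q : jm (ev p) (ev q) = ev (p * q).
  rewrite (evE p) (jm_suml eja).
  under eq_bigr do rewrite (jmZl eja) evX scaler_sumr.
  rewrite exchange_big; apply: eq_bigr => i _.
  rewrite hornerM (horner_coef p) mulr_suml scaler_suml.
  by apply: eq_bigr => k _; rewrite scalerA hornerM hornerXn mulrA.
(* The distinct eigenvalues whose group of components does not sum to zero: an eigenvalue of L(w)
   that [e] does not see would give a zero idempotent. *)
pose s := [seq a <- undup [seq d 0 i | i <- enum 'I_n] |
           \sum_(i | d 0 i == a) b i != 0].
have us : uniq s by rewrite filter_uniq ?undup_uniq.
pose c (a : R) : 'rV_n := \sum_(i | d 0 i == a) b i.
have ds i : d 0 i \in undup [seq d 0 i | i <- enum 'I_n].
  by rewrite mem_undup; apply/map_f; rewrite mem_enum.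
have sumc (f : R -> R) : \sum_(a <- s) f a *: c a = \sum_i f (d 0 i) *: b i.
  rewrite /s big_filter -/c.
  rewrite (eq_bigr (fun a => f a *: c a)) //.
  transitivity (\sum_(a <- undup [seq d 0 i | i <- enum 'I_n]) f a *: c a).
    rewrite big_mkcond; apply: eq_bigr => a _.
    by case: eqP => // h; rewrite /c h scaler0.
  under eq_bigr do rewrite /c scaler_sumr.
  rewrite (exchange_big_dep predT) //=; apply: eq_bigr => i _.
  rewrite -big_filter (@eq_filter _ _ (pred1 (d 0 i))) => [|a]; last exact: eq_sym.
  by rewrite filter_pred1_uniq ?undup_uniq // big_seq1.
have cE a : exists p : {poly R}, c a = ev p /\ forall i, p.[d 0 i] = (d 0 i == a)%:R.
  have [p pE] := lagrange_sep [seq d 0 i | i <- enum 'I_n] a.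
  have pd i : p.[d 0 i] = (d 0 i == a)%:R.
    by apply: pE; apply/map_f; rewrite mem_enum.
  exists p; split => //; rewrite /c /ev big_mkcond; apply: eq_bigr => i _.
  by rewrite pd; case: eqP; rewrite ?scale1r ?scale0r.
exists (size s), (fun i => s`_i), (fun i => c s`_i); split.
- by move=> i j /eqP; rewrite nth_uniq // => /eqP/val_inj.
- split=> [i|i j|].
  + by have := mem_nth 0 (ltn_ord i); rewrite mem_filter => /andP[].
  + have [p [-> pE]] := cE s`_i; have [q [-> qE]] := cE s`_j.
    rewrite evM; case: eqP => [ij|/eqP ij].
      subst j; apply: eq_bigr => k _; rewrite hornerM pE qE -natrM mulnb andbb //.
    rewrite [LHS]big1 // => k _; rewrite hornerM pE qE -natrM mulnb.
    case: eqP => [->|_]; last by rewrite scale0r.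
    by rewrite nth_uniq // val_eqE (negbTE ij) scale0r.
  + have := sumc (fun=> 1); rewrite (big_nth 0) big_mkord.
    under eq_bigr do rewrite scale1r.
    by move=> ->; rewrite [in RHS]eb; under eq_bigr do rewrite scale1r.
- have := sumc id; rewrite (big_nth 0) big_mkord => ->.
  by have := wk 1%N; rewrite /= (jmer eja).
Qed.
End Frame.

Lemma coord_norm_le (R : realType) m n (x : 'M[R]_(m, n)) i j : `|x i j| <= `|x|.
Proof.
by rewrite {2}/Num.norm /= mx_normrE (le_bigmax _ (fun ij => `|x ij.1 ij.2|) (i, j)).
Qed.

Lemma norm_le_coord (R : realType) m n (x : 'M[R]_(m, n)) a : 0 <= a ->
  (forall i j, `|x i j| <= a) -> `|x| <= a.
Proof.
by move=> a0 h; rewrite {1}/Num.norm /= mx_normrE; apply/bigmax_leP; split => // -[].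
Qed.

Section FrameTheory.
Variables (R : realType) (n : nat) (jm : 'rV[R]_n -> 'rV[R]_n -> 'rV[R]_n).
Variable e : 'rV[R]_n.
Hypothesis eja : is_EJA jm e.
Variables (m : nat) (c : 'I_m -> 'rV[R]_n).
Hypothesis fr : is_frame jm e c.
Implicit Types (lam : 'I_m -> R).

Lemma frame_idem i : jm (c i) (c i) = c i.
Proof. by case: fr => _ -> _; rewrite eqxx. Qed.

Lemma frame_comb lam i : jm (\sum_j lam j *: c j) (c i) = lam i *: c i.
Proof.
rewrite (jm_suml eja) (bigD1 i) //= big1 => [|j ji].
  by rewrite (jmZl eja) frame_idem addr0.
by case: fr => _ h _; rewrite (jmZl eja) h (negbTE ji) scaler0.
Qed.

Lemma frame_jm lam mu :
  jm (\sum_j lam j *: c j) (\sum_j mu j *: c j) = \sum_j (lam j * mu j) *: c j.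
Proof.
rewrite (jm_sumr eja); apply: eq_bigr => i _.
by rewrite (jmZr eja) frame_comb scalerA mulrC.
Qed.

Lemma frame_sum1 : \sum_j 1 *: c j = e.
Proof. by case: fr => _ _ <-; apply: eq_bigr => i _; rewrite scale1r. Qed.

Lemma frame_jpow lam k :
  jpow jm e (\sum_j lam j *: c j) k = \sum_j lam j ^+ k *: c j.
Proof.
elim: k => [|k IH] /=; first by rewrite -frame_sum1; under eq_bigr do rewrite expr0.
by rewrite IH frame_jm; apply: eq_bigr => i _; rewrite exprS.
Qed.

Lemma frame_dot i j : i != j -> dotr (c i) (c j) = 0.
Proof.
move=> ij; rewrite -(jmer eja (c j)) -(dotr_jm eja).
by case: fr => _ h _; rewrite h eq_sym (negbTE ij) dotr0l.
Qed.

Lemma frame_dot_comb lam i : dotr (\sum_j lam j *: c j) (c i) = lam i * dotr (c i) (c i).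
Proof.
rewrite dotr_suml (bigD1 i) //= big1 ?addr0 ?dotrZl // => j ji.
by rewrite dotrZl frame_dot ?mulr0.
Qed.

Lemma frame_quad lam v :
  dotr (jm (\sum_j lam j *: c j) v) v = \sum_j lam j * dotr (jm (c j) v) v.
Proof.
by rewrite (jm_suml eja) dotr_suml; apply: eq_bigr => i _; rewrite (jmZl eja) dotrZl.
Qed.

Lemma frame_quad1 v : \sum_j dotr (jm (c j) v) v = dotr v v.
Proof.
have := frame_quad (fun=> 1) v; rewrite frame_sum1 (jmel eja) => ->.
by under [RHS]eq_bigr do rewrite mul1r.
Qed.

Lemma frame_quad_ge0 v i : 0 <= dotr (jm (c i) v) v.
Proof. exact: (dotr_idem_ge0 eja) (frame_idem i). Qed.

Lemma frame_free : row_free (\matrix_(i < m) c i).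
Proof.
apply: inj_row_free => v; rewrite mulmx_sum_row.
under eq_bigr do rewrite rowK.
move=> h; apply/rowP => i; rewrite mxE.
have := frame_dot_comb (v 0) i; rewrite h dotr0l => /esym/eqP.
by rewrite mulf_eq0 dotr_eq0; case: fr => /(_ i)/negbTE-> _ _; rewrite orbF => /eqP.
Qed.

(** The matrix of powers is a Vandermonde matrix times the matrix of the frame, and the latter has
    independent rows. Its n+1 rows are cut down to the first [m] by [pid_mx], which leaves an
    invertible square Vandermonde matrix. *)
Lemma frame_jdeg lam : injective lam -> jdeg jm e (\sum_j lam j *: c j) = m.
Proof.
move=> inj; rewrite /jdeg.
pose V : 'M[R]_(n.+1, m) := \matrix_(i, j) lam j ^+ i.
have -> : \matrix_(i < n.+1, j < n) (jpow jm e (\sum_j lam j *: c j) i) 0 j =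
    V *m \matrix_(i < m) c i.
  apply/row_matrixP => i; rewrite row_mul mulmx_sum_row.
  apply/rowP => j; rewrite !mxE frame_jpow !summxE; apply: eq_bigr => k _.
  by rewrite !mxE.
rewrite mxrankMfree ?frame_free //; apply/eqP; rewrite eqn_leq rank_leq_col /=.
have mn : (m <= n)%N by have /eqP <- := frame_free; exact: rank_leq_col.
pose E : 'M[R]_(m, n.+1) := pid_mx m.
apply: leq_trans (mxrankM_maxr E V).
have -> : E *m V = Vandermonde m (\row_j lam j).
  apply/matrixP => i j; rewrite !mxE.
  have im : (i < n.+1)%N by apply: ltn_trans (ltn_ord i) _; rewrite ltnS.
  rewrite (bigD1 (Ordinal im)) //= !mxE eqxx ltn_ord mul1r big1 ?addr0 // => k ki.
  rewrite !mxE; case: eqP => [ik|]; last by rewrite mul0r.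
  by case/eqP: ki; apply: val_inj.
rewrite mxrank_unit // unitmxE det_Vandermonde unitfE.
apply/prodf_neq0 => i _; apply/prodf_neq0 => j ij; rewrite !mxE subr_eq0.
by apply: contraTneq ij => /inj ->; rewrite ltnn.
Qed.

End FrameTheory.

(** * The cone as the elements with positive definite multiplication *)

Section Cone.
Variables (R : realType) (n : nat) (jm : 'rV[R]_n -> 'rV[R]_n -> 'rV[R]_n).
Variable e : 'rV[R]_n.
Hypothesis eja : is_EJA jm e.
Implicit Types x y u v : 'rV[R]_n.

(** Positivity of the quadratic form of L(x), visibly convex and closed. [psdP] identifies [psd]
    with the squares and [sym_coneP] identifies [pd], its uniformly strict form, with the cone. *)
Definition psd x := forall v, 0 <= dotr (jm x v) v.
Definition pd x := exists2 a, 0 < a & forall v, a * dotr v v <= dotr (jm x v) v.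

Lemma psd_sqr u : psd (jm u u).
Proof.
have [m [lam [c [_ fr ->]]]] := spectral eja u.
move=> v; rewrite (frame_jm eja fr) (frame_quad eja); apply: sumr_ge0 => i _.
by rewrite mulr_ge0 ?(frame_quad_ge0 eja fr) // -expr2 sqr_ge0.
Qed.

Lemma psd_frame m (lam : 'I_m -> R) c i : is_frame jm e c ->
  psd (\sum_j lam j *: c j) -> 0 <= lam i.
Proof.
move=> fr /(_ (c i)); rewrite (frame_comb eja fr) dotrZl pmulr_lge0 //.
by rewrite dotr_gt0; case: fr.
Qed.

Lemma psdP x : psd x <-> exists u, jm u u = x.
Proof.
split=> [px|[u <-]]; last exact: psd_sqr.
have [m [lam [c [_ fr E]]]] := spectral eja x; rewrite E in px *.
exists (\sum_i Num.sqrt (lam i) *: c i); rewrite (frame_jm eja fr).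
by apply: eq_bigr => i _; rewrite -expr2 sqr_sqrtr // (psd_frame _ fr px).
Qed.

Lemma pd_frame m (lam : 'I_m -> R) c : is_frame jm e c ->
  pd (\sum_j lam j *: c j) <-> forall i, 0 < lam i.
Proof.
move=> fr; split=> [[a a0 h] i|h].
  have ci : 0 < dotr (c i) (c i) by rewrite dotr_gt0; case: fr.
  have := h (c i); rewrite (frame_comb eja fr) dotrZl ler_pM2r //.
  exact: lt_le_trans.
(* The start value 1 keeps the minimum positive, including for an empty frame. *)
pose a := \big[Order.min/1]_i lam i.
have a0 : 0 < a by rewrite /a; elim/big_ind: _ => // x y x0 y0; rewrite lt_min x0.
exists a => // v; rewrite (frame_quad eja) -(frame_quad1 eja fr) mulr_sumr.
apply: ler_sum => i _; apply: ler_wpM2r; first exact: (frame_quad_ge0 eja fr).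
exact: bigmin_le_cond.
Qed.

Lemma quad_bound x : exists2 B, 0 <= B & forall v, `|dotr (jm x v) v| <= B * dotr v v.
Proof.
have [m [lam [c [_ fr ->]]]] := spectral eja x.
exists (\sum_i `|lam i|); first exact: sumr_ge0.
move=> v; rewrite (frame_quad eja); apply: le_trans (ler_norm_sum _ _ _) _.
rewrite mulr_suml; apply: ler_sum => i _; rewrite normrM.
rewrite (ger0_norm (frame_quad_ge0 eja fr v i)) ler_wpM2l //.
rewrite -(frame_quad1 eja fr) (bigD1 i) //= lerDl.
by apply: sumr_ge0 => j _; exact: (frame_quad_ge0 eja fr).
Qed.

Lemma quad_bound_norm : exists2 B, 0 < B &
  forall x v, `|dotr (jm x v) v| <= B * `|x| * dotr v v.
Proof.
have /choice [B hB] : forall k : 'I_n, exists B, 0 <= B /\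
    forall v, `|dotr (jm (delta_mx 0 k) v) v| <= B * dotr v v.
  by move=> k; have [B B0 h] := quad_bound (delta_mx 0 k); exists B.
exists (1 + \sum_k B k).
  by rewrite ltr_pwDl // sumr_ge0 // => k _; case: (hB k).
move=> x v; rewrite {1}(row_sum_delta x) (jm_suml eja) dotr_suml.
apply: le_trans (ler_norm_sum _ _ _) _.
apply: (@le_trans _ _ ((\sum_k B k) * `|x| * dotr v v)); last first.
  by rewrite !ler_wpM2r ?dotr_ge0 ?normr_ge0 // lerDr.
rewrite !mulr_suml; apply: ler_sum => k _; rewrite (jmZl eja) dotrZl normrM.
have [B0 hk] := hB k; rewrite -mulrA [X in _ <= X]mulrCA.
by apply: ler_pM => //; exact: coord_norm_le.
Qed.

End Cone.

Section Cone2.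
Local Open Scope classical_set_scope.
Variables (R : realType) (n : nat) (jm : 'rV[R]_n -> 'rV[R]_n -> 'rV[R]_n).
Variable e : 'rV[R]_n.
Hypothesis eja : is_EJA jm e.
Implicit Types x y u v : 'rV[R]_n.

Lemma pdW x : pd jm x -> psd jm x.
Proof. by case=> a a0 h v; apply: le_trans (h v); rewrite mulr_ge0 ?dotr_ge0 // ltW. Qed.

Lemma pdD x y : pd jm x -> psd jm y -> pd jm (x + y).
Proof.
case=> a a0 h hy; exists a => // v.
by rewrite (jmDl eja) dotrDl (le_trans (h v)) // lerDl.
Qed.

Lemma pdZ a x : 0 < a -> pd jm x -> pd jm (a *: x).
Proof.
move=> a0 [b b0 h]; exists (a * b); first exact: mulr_gt0.
by move=> v; rewrite (jmZl eja) dotrZl -mulrA ler_wpM2l // ltW.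
Qed.

Lemma pd_e : pd jm e.
Proof. by exists 1 => // v; rewrite mul1r (jmel eja). Qed.

(** An interior point of the squares remains a square after subtraction of a small multiple of [e],
    and adding it back makes the form strictly positive. Conversely a bound [a] on the form survives
    perturbations of norm below [a / B], with [B] from [quad_bound_norm]. *)
Lemma sym_coneP x : sym_cone jm x <-> pd jm x.
Proof.
split=> [/nbhs_normP[r /= r0 h]|[a a0 h]].
  pose t := r / (2 * (`|e| + 1)).
  have e1 : 0 < `|e| + 1 by rewrite ltr_wpDl.
  have t0 : 0 < t by rewrite divr_gt0 // mulr_gt0.
  have /h [u _ E] : ball_ Num.Def.normr x r (x - t *: e).
    rewrite /ball_ /= opprB addrC subrK normrZ gtr0_norm // /t mulrAC.
    rewrite ltr_pdivrMr ?mulr_gt0 // ltr_pM2l //.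
    by have := normr_ge0 e; lra.
  have pu : psd jm (x - t *: e) by rewrite -E; exact: (psd_sqr eja).
  have -> : x = t *: e + (x - t *: e) by rewrite addrC subrK.
  by apply: pdD => //; apply: pdZ => //; exact: pd_e.
have [B B0 hB] := quad_bound_norm eja.
rewrite /sym_cone /interior /=.
apply/nbhs_ballP; exists (a / B) => /=; first exact: divr_gt0.
move=> y; rewrite -ball_normE /ball_ /= ltr_pdivlMr // => xy.
have /(psdP eja)[u E] : psd jm y; last by exists u.
move=> v; have -> : y = x - (x - y) by rewrite subKr.
rewrite (jmDl eja) (jmNl eja) dotrDl dotrNl subr_ge0.
apply: le_trans (ler_norm _) _; apply: le_trans (hB _ _) _.
apply: le_trans (h v); rewrite ler_wpM2r ?dotr_ge0 // mulrC; exact: ltW.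
Qed.

Lemma sym_cone_open : open (sym_cone jm).
Proof. exact: open_interior. Qed.

Lemma psd_closed x : (forall r : R, 0 < r -> exists2 y, psd jm y & `|x - y| < r) ->
  psd jm x.
Proof.
move=> h v; rewrite leNgt; apply/negP => neg.
have [B B0 hB] := quad_bound_norm eja.
have v0 : 0 < dotr v v.
  by rewrite dotr_gt0; apply: contraTneq neg => ->; rewrite dotr0r ltxx.
have [|y py xy] := h (- dotr (jm x v) v / (B * dotr v v)).
  by rewrite divr_gt0 ?mulr_gt0 // oppr_gt0.
have := py v; have -> : y = x - (x - y) by rewrite subKr.
rewrite (jmDl eja) (jmNl eja) dotrDl dotrNl => p.
have := le_trans (ler_norm _) (hB (- (x - y)) v).
rewrite (jmNl eja) dotrNl normrN.
by move: xy; rewrite ltr_pdivlMr ?mulr_gt0 // mulrCA mulrA; lra.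
Qed.

End Cone2.

(** * Trace and determinant on a frame of maximal size *)

Section TraceDet.
Variables (R : realType) (n r : nat) (jm : 'rV[R]_n -> 'rV[R]_n -> 'rV[R]_n).
Variables (e : 'rV[R]_n) (tr : 'rV[R]_n -> R) (Delta : mpoly.mpoly n R).
Hypothesis eja : is_EJA jm e.
Hypothesis jrank : is_jrank jm e r.
Hypothesis r2 : (1 < r)%N.
Hypothesis trdet : is_trace_det jm e r tr Delta.
Hypothesis dottr : forall x y : 'rV[R]_n, dotr x y = tr (jm x y).

(** With distinct coefficients the element is regular and its minimal polynomial is the product of
    the X - mu_j, whose coefficients are read off. For repeated coefficients [is_trace_det] says
    nothing directly. *)
Lemma frame_trdet (c : 'I_r -> 'rV[R]_n) (mu : 'I_r -> R) :
  is_frame jm e c -> injective mu ->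
  tr (\sum_j mu j *: c j) = \sum_j mu j /\
  peval Delta (\sum_j mu j *: c j) = \prod_j mu j.
Proof.
move=> fr inj; set w := \sum_j _.
pose s := [seq mu i | i <- enum 'I_r].
have ss : size s = r by rewrite size_map size_enum_ord.
pose p := \prod_(a <- s) ('X - a%:P).
have sp : size p = r.+1 by rewrite size_prod_XsubC ss.
have pr : p`_r = 1.
  by have := monic_prod_XsubC s predT id; rewrite -/p => /monicP; rewrite lead_coefE sp.
have [] := trdet.2 w (fun k => - p`_k).
- exact: frame_jdeg.
- rewrite (frame_jpow eja fr); under [RHS]eq_bigr do rewrite (frame_jpow eja fr) scaler_sumr.
  rewrite exchange_big; apply: eq_bigr => j _ /=.
  under eq_bigr do rewrite scalerA.
  rewrite -scaler_suml; congr (_ *: _).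
  have : p.[mu j] = 0.
    by apply/rootP; rewrite root_prod_XsubC map_f // mem_enum.
  rewrite horner_coef sp big_ord_recr /= pr mul1r => /eqP; rewrite addrC addr_eq0 => /eqP ->.
  by rewrite -sumrN; apply: eq_bigr => k _; rewrite mulNr.
have r0 : size s != 0 by rewrite ss -lt0n ltnW.
have -> : r.-1 = (size s).-1 by rewrite ss.
rewrite coefPn_prod_XsubC // opprK coef0_prod_XsubC ss => -> ->; split.
  by rewrite /s big_map big_enum.
rewrite mulrN mulrA -exprD addSn exprS mulN1r mulNr opprK addnn -mul2n exprM sqrrN.
by rewrite expr1n expr1n mul1r /s big_map big_enum.
Qed.

Lemma regular_exists : exists c : 'I_r -> 'rV[R]_n, is_frame jm e c.
Proof.
have [_ [x xr]] := jrank; have [m [lam [c [inj fr xE]]]] := spectral eja x.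
by move: xr; rewrite xE (frame_jdeg eja fr inj) => mr; subst m; exists c.
Qed.

Lemma frame_size_le m (c : 'I_m -> 'rV[R]_n) : is_frame jm e c -> (m <= r)%N.
Proof.
move=> fr; have [h _] := jrank.
have inj : injective (fun j : 'I_m => (j : nat)%:R : R).
  by move=> i j /eqP; rewrite eqr_nat => /eqP/val_inj.
by have := h (\sum_(j < m) (j : nat)%:R *: c j); rewrite (frame_jdeg eja fr inj).
Qed.

Lemma tr_dot x : tr x = dotr e x.
Proof. by rewrite dottr (jmel eja). Qed.

Lemma tr_sum I (s : seq I) (P : pred I) F :
  tr (\sum_(i <- s | P i) F i) = \sum_(i <- s | P i) tr (F i).
Proof. by rewrite tr_dot dotr_sumr; apply: eq_bigr => i _; rewrite tr_dot. Qed.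

Lemma trZ a x : tr (a *: x) = a * tr x.
Proof. by rewrite !tr_dot dotrZr. Qed.

Lemma frame_tr1 (c : 'I_r -> 'rV[R]_n) i : is_frame jm e c -> tr (c i) = 1.
Proof.
move=> fr; pose mu (j : 'I_r) : R := (j : nat)%:R.
(* Replacing the coefficient i by r, larger than all the others, keeps the family injective. The two
   traces are then known, and by linearity they differ by (r - i) tr(c_i). *)
pose nu (j : 'I_r) : R := if j == i then r%:R else mu j.
have imu : injective mu by move=> j k /eqP; rewrite eqr_nat => /eqP/val_inj.
have inu : injective nu.
  move=> j k; rewrite /nu; case: eqP => [->|_]; case: eqP => [->|_] //; last exact: imu.
    by move=> /eqP; rewrite eqr_nat => /eqP E; have := ltn_ord k; rewrite -E ltnn.
  by move=> /eqP; rewrite eqr_nat => /eqP E; have := ltn_ord j; rewrite E ltnn.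
have [h1 _] := frame_trdet fr imu; have [h2 _] := frame_trdet fr inu.
have ri : 0 < r%:R - mu i by rewrite subr_gt0 ltr_nat.
apply: (mulfI (lt0r_neq0 ri)); rewrite mulr1.
have : tr (\sum_j nu j *: c j) - tr (\sum_j mu j *: c j) = r%:R - mu i.
  rewrite h1 h2 -sumrB (bigD1 i) //= {1}/nu eqxx big1 ?addr0 // => j ji.
  by rewrite /nu (negbTE ji) subrr.
move=> E; rewrite -[RHS]E !tr_sum -sumrB (bigD1 i) //= big1 => [|j ji].
  by rewrite addr0 !trZ /nu eqxx mulrBl.
by rewrite /nu (negbTE ji) subrr.
Qed.

Lemma frame_dot1 (c : 'I_r -> 'rV[R]_n) i : is_frame jm e c -> dotr (c i) (c i) = 1.
Proof. by move=> fr; rewrite dottr (frame_idem fr) frame_tr1. Qed.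

Lemma tr_e : tr e = r%:R.
Proof.
have [c fr] := regular_exists; rewrite -(frame_sum1 fr) tr_sum.
under eq_bigr do rewrite scale1r (frame_tr1 _ fr).
by rewrite sumr_const card_ord.
Qed.

End TraceDet.

(** Induction on the ring generated by constants and variables, suited to statements about
    evaluation. *)
Lemma mpoly_ring_ind (R : realType) n (Q : mpoly.mpoly n R -> Prop) :
  (forall c, Q (mpoly.mpolyC n c)) -> (forall i, Q (mpoly.mpolyX R (mpoly.mnm1 i))) ->
  (forall p q, Q p -> Q q -> Q (p + q)) -> (forall p q, Q p -> Q q -> Q (p * q)) ->
  forall p, Q p.
Proof.
move=> QC QX QD QM p; elim/mpoly.mpolyind: p => [|c m p _ _ IH].
  by have := QC 0; rewrite mpoly.mpolyC0.
apply: (QD) => //; rewrite -mpoly.mul_mpolyC; apply: (QM) => //.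
rewrite mpoly.mpolyXE_id; elim/big_ind: _ => //.
  by have := QC 1; rewrite mpoly.mpolyC1.
move=> i _; elim: (mpoly.fun_of_multinom m i) => [|k IHk]; first by have := QC 1; rewrite mpoly.mpolyC1.
by rewrite exprS; apply: (QM).
Qed.

(** * Polynomials restricted to lines, to first order *)

Section Line.
Variables (R : realType) (n : nat).
Implicit Types (w h : 'rV[R]_n) (P : mpoly.mpoly n R).

Lemma pevalD w P Q : peval (P + Q) w = peval P w + peval Q w.
Proof. exact: mpoly.mevalD. Qed.
Lemma pevalM w P Q : peval (P * Q) w = peval P w * peval Q w.
Proof. exact: mpoly.mevalM. Qed.
Lemma pevalC w c : peval (mpoly.mpolyC n c) w = c.
Proof. exact: mpoly.mevalC. Qed.
Lemma pevalX w i : peval (mpoly.mpolyX R (mpoly.mnm1 i)) w = w 0 i.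
Proof. exact: mpoly.mevalXU. Qed.

Definition grad P w h := \sum_(k < n) h 0 k * peval (mpoly.mderiv k P) w.

Lemma gradC c w h : grad (mpoly.mpolyC n c) w h = 0.
Proof.
rewrite /grad big1 // => k _.
by rewrite mpoly.mderivC -mpoly.mpolyC0 pevalC mulr0.
Qed.

Lemma gradX i w h : grad (mpoly.mpolyX R (mpoly.mnm1 i)) w h = h 0 i.
Proof.
rewrite /grad (bigD1 i) //= big1 => [|k ki].
  rewrite addr0 mpoly.mderivX mpoly.mnm1E eqxx scale1r.
  have -> : mpoly.mnm_sub (mpoly.mnm1 i) (mpoly.mnm1 i) = mpoly.mnm0.
    by apply/mpoly.mnmP => j; rewrite mpoly.mnmBE mpoly.mnm0E subnn.
  rewrite mpoly.mpolyX0.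
  by rewrite -mpoly.mpolyC1 pevalC mulr1.
rewrite mpoly.mderivX mpoly.mnm1E eq_sym (negbTE ki) scale0r.
by rewrite -mpoly.mpolyC0 pevalC mulr0.
Qed.

Lemma gradD P Q w h : grad (P + Q) w h = grad P w h + grad Q w h.
Proof.
rewrite /grad -big_split; apply: eq_bigr => k _.
by rewrite mpoly.mderivD pevalD mulrDr.
Qed.

Lemma gradM P Q w h : grad (P * Q) w h = grad P w h * peval Q w + peval P w * grad Q w h.
Proof.
rewrite /grad mulr_suml mulr_sumr -big_split; apply: eq_bigr => k _.
by rewrite mpoly.mderivM pevalD !pevalM mulrDr mulrA mulrCA.
Qed.

Lemma peval_line P w h : exists p : {poly R},
  [/\ forall t, p.[t] = peval P (w + t *: h), p`_0 = peval P w & p`_1 = grad P w h].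
Proof.
elim/mpoly_ring_ind: P => [c|i|P Q [p [p1 p2 p3]] [q [q1 q2 q3]]|P Q [p [p1 p2 p3]] [q [q1 q2 q3]]].
- by exists c%:P; split=> [t||]; rewrite ?gradC ?hornerC ?coefC ?pevalC.
- exists ((w 0 i)%:P + h 0 i *: 'X); split=> [t||].
  + by rewrite pevalX !mxE !hornerE mulrC.
  + by rewrite pevalX coefD coefC coefZ coefX mulr0 addr0.
  + by rewrite gradX coefD coefC coefZ coefX mulr1 add0r.
- exists (p + q); split=> [t||]; first by rewrite hornerD p1 q1 pevalD.
    by rewrite coefD p2 q2 pevalD.
  by rewrite coefD p3 q3 gradD.
- exists (p * q); split=> [t||]; first by rewrite hornerM p1 q1 pevalM.
    by rewrite coefM big_ord_recr big_ord0 /= add0r p2 q2 pevalM.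
  rewrite coefM !big_ord_recr big_ord0 /= add0r p2 q2 p3 q3 gradM addrC //.
Qed.

Lemma poly_eq0_fun (p : {poly R}) : (forall t, p.[t] = 0) -> p = 0.
Proof.
move=> h; apply/eqP; apply: contraT => p0.
pose s := [seq (k%:R : R) | k <- iota 0 (size p)].
have us : uniq s by rewrite map_inj_uniq ?iota_uniq // => i j /eqP; rewrite eqr_nat => /eqP.
have := max_poly_roots p0 _ us; rewrite size_map size_iota ltnn => -> //.
by apply/allP => x _; apply/rootP.
Qed.

Lemma poly_eq_fun (p q : {poly R}) : (forall t, p.[t] = q.[t]) -> p = q.
Proof.
move=> h; apply/eqP; rewrite -subr_eq0; apply/eqP/poly_eq0_fun => t.
by rewrite hornerD hornerN h subrr.
Qed.

(** Equality modulo X^2, hence of value and first derivative at 0. Being compatible with sums and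
    products, it passes to determinants. *)
Definition eqmod2 (p q : {poly R}) := p`_0 = q`_0 /\ p`_1 = q`_1.

Lemma eqmod2D p p' q q' : eqmod2 p p' -> eqmod2 q q' -> eqmod2 (p + q) (p' + q').
Proof. by move=> [a b] [c d]; split; rewrite !coefD ?a ?b ?c ?d. Qed.

Lemma eqmod2M p p' q q' : eqmod2 p p' -> eqmod2 q q' -> eqmod2 (p * q) (p' * q').
Proof.
by move=> [a b] [c d]; split; rewrite !coefM !big_ord_recr !big_ord0 /= ?a ?b ?c ?d.
Qed.

Lemma eqmod2_det m (A B : 'M[{poly R}]_m) :
  (forall i j, eqmod2 (A i j) (B i j)) -> eqmod2 (\det A) (\det B).
Proof.
move=> h; rewrite /determinant; elim/big_ind2: _ => //.
  by move=> *; exact: eqmod2D.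
move=> s _; apply: eqmod2M => //; elim/big_ind2: _ => //.
by move=> *; exact: eqmod2M.
Qed.

End Line.

Section JordanLine.
Variables (R : realType) (n : nat) (jm : 'rV[R]_n -> 'rV[R]_n -> 'rV[R]_n).
Variable e : 'rV[R]_n.
Hypothesis eja : is_EJA jm e.
Implicit Types (w h : 'rV[R]_n).

(** The first-order coefficient of (w + th)^k need not be k w^(k-1) h, since L(h) and L(w) may fail
    to commute. Its inner product with every power of w is nevertheless the expected one, by
    associativity of the inner product; this is why the induction carries an extra exponent [j]. *)
Lemma jpow_line w h : exists F : nat -> {poly R}, forall k,
  [/\ forall t, (F k).[t] = dotr (jpow jm e (w + t *: h) k) e,
      (F k)`_0 = dotr (jpow jm e w k) e &
      (F k)`_1 = k%:R * dotr (jpow jm e w k.-1) h].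
Proof.
suff H k : exists q : 'I_n -> {poly R},
  [/\ forall t l, (q l).[t] = jpow jm e (w + t *: h) k 0 l,
      forall l, (q l)`_0 = jpow jm e w k 0 l &
      forall j, dotr (\row_l (q l)`_1) (jpow jm e w j) =
                k%:R * dotr (jpow jm e w (k.-1 + j)) h].
  have /choice [F hF] : forall k, exists p : {poly R},
    [/\ forall t, p.[t] = dotr (jpow jm e (w + t *: h) k) e,
      p`_0 = dotr (jpow jm e w k) e & p`_1 = k%:R * dotr (jpow jm e w k.-1) h].
    move=> k; have [q [q1 q2 q3]] := H k; exists (\sum_l (e 0 l) *: q l); split.
    - move=> t; rewrite horner_sum; apply: eq_bigr => l _.
      by rewrite hornerZ q1 mulrC.
    - by rewrite coef_sum; apply: eq_bigr => l _; rewrite coefZ q2 mulrC.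
    - have := q3 0; rewrite addn0 => <-; rewrite coef_sum; apply: eq_bigr => l _.
      by rewrite coefZ mxE mulrC.
  by exists F.
elim: k => [|k [q [q1 q2 q3]]].
  exists (fun l => (e 0 l)%:P); split=> [t l|l|j]; rewrite ?hornerC ?coefC //.
  rewrite mul0r (_ : \row_l _ = 0) ?dotr0l //.
  by apply/rowP => l; rewrite !mxE coefC.
pose A x l i := jm x (delta_mx 0 i) 0 l.
have jmE x v l : jm x v 0 l = \sum_i v 0 i * A x l i.
  rewrite {1}(row_sum_delta v) (jm_sumr eja) summxE; apply: eq_bigr => i _.
  by rewrite (jmZr eja) mxE.
exists (fun l => \sum_i A w l i *: q i + 'X * \sum_i A h l i *: q i); split.
- move=> t l /=; rewrite (jmDl eja) (jmZl eja) !mxE !jmE hornerD hornerM hornerX.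
  rewrite !horner_sum; congr (_ + _ * _); apply: eq_bigr => i _;
  by rewrite hornerZ q1 mulrC.
- move=> l; rewrite coefD coefXM addr0 coef_sum /= jmE; apply: eq_bigr => i _.
  by rewrite coefZ q2 mulrC.
move=> j.
have -> : \row_l (\sum_i A w l i *: q i + 'X * (\sum_i A h l i *: q i))`_1 =
    jm w (\row_l (q l)`_1) + jm h (jpow jm e w k).
  apply/rowP => l; rewrite !mxE coefD coefXM /= !jmE !coef_sum.
  by congr (_ + _); apply: eq_bigr => i _; rewrite coefZ ?q2 ?mxE mulrC.
rewrite dotrDl (dotr_jm eja w) -[jm w _]/(jpow jm e w j.+1) q3 (jmC eja h).
rewrite (dotr_jm eja) (dotrC h) !(jpowD eja) -natr1 mulrDl mul1r /=.
congr (_ + _); case: k {q q1 q2 q3} => [|k]; first by rewrite !mul0r.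
by rewrite addnS addSn.
Qed.
End JordanLine.

(** * The logarithmic derivative of the determinant *)

Section TraceDetDeriv.
Variables (R : realType) (n r : nat) (jm : 'rV[R]_n -> 'rV[R]_n -> 'rV[R]_n).
Variables (e : 'rV[R]_n) (tr : 'rV[R]_n -> R) (Delta : mpoly.mpoly n R).
Hypothesis eja : is_EJA jm e.
Hypothesis jrank : is_jrank jm e r.
Hypothesis r2 : (1 < r)%N.
Hypothesis trdet : is_trace_det jm e r tr Delta.
Hypothesis dottr : forall x y : 'rV[R]_n, dotr x y = tr (jm x y).

(** Applied to the moments (w^k|e) of w = sum mu_j c_j on a frame of size r, this is V diag(mu^s)
    V^T with V the Vandermonde matrix of mu. For s = 0 its determinant is the discriminant, and for
    s = 1 it has the product of the mu_j as an additional factor. So [Delta] is a quotient of two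
    polynomials in the moments. The entries are of any type because numbers and polynomials both
    occur. *)
Definition hankel (T : Type) (s : nat) (F : nat -> T) : 'M[T]_r :=
  \matrix_(i < r, j < r) F (i + j + s)%N.
Definition gram s (w : 'rV[R]_n) := hankel s (fun k => dotr (jpow jm e w k) e).

Lemma frame_pow_dot m (c : 'I_m -> 'rV[R]_n) (mu : 'I_m -> R) k : is_frame jm e c ->
  dotr (jpow jm e (\sum_j mu j *: c j) k) e = \sum_j mu j ^+ k * dotr (c j) (c j).
Proof.
move=> fr; rewrite (frame_jpow eja fr) dotr_suml; apply: eq_bigr => j _.
by rewrite dotrZl -{1}(frame_idem fr j) (dotr_jm eja) (jmer eja).
Qed.

Lemma gram_frame (c : 'I_r -> 'rV[R]_n) (mu : 'I_r -> R) s : is_frame jm e c ->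
  \det (gram s (\sum_j mu j *: c j)) =
  (\prod_j mu j) ^+ s * \det (Vandermonde r (\row_j mu j)) ^+ 2.
Proof.
move=> fr; set V := Vandermonde _ _.
have -> : gram s (\sum_j mu j *: c j) = V *m diag_mx (\row_j mu j ^+ s) *m V^T.
  apply/matrixP => i j; rewrite !mxE frame_pow_dot //; apply: eq_bigr => k _.
  by rewrite mul_mx_diag !mxE (frame_dot1 eja r2 trdet dottr) // mulr1 !exprD mulrAC.
rewrite !det_mulmx det_tr det_diag mulrAC -expr2 mulrC; congr (_ * _).
by rewrite -prodrXl; apply: eq_bigr => i _; rewrite mxE.
Qed.

(** The matrix factors through R^m, with m the number of spectral idempotents of w; a nonzero
    determinant of size r forces m = r. *)
Lemma gram_regular w : \det (gram 0 w) != 0 ->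
  exists (c : 'I_r -> 'rV[R]_n) (mu : 'I_r -> R),
    [/\ is_frame jm e c, injective mu & w = \sum_j mu j *: c j].
Proof.
have [m [lam [c [inj fr ->]]]] := spectral eja w => d0.
suff mr : m = r by subst m; exists c, lam.
apply/eqP; rewrite eqn_leq (frame_size_le eja jrank fr) /=.
pose V : 'M[R]_(r, m) := Vandermonde r (\row_j lam j).
pose D := diag_mx (\row_j dotr (c j) (c j)).
have E : gram 0 (\sum_j lam j *: c j) = V *m (D *m V^T).
  apply/matrixP => i j; rewrite !mxE frame_pow_dot // addn0; apply: eq_bigr => k _.
  by rewrite mul_diag_mx !mxE exprD -mulrA [X in _ * X]mulrC.
have <- : \rank (gram 0 (\sum_j lam j *: c j)) = r.
  by apply: mxrank_unit; rewrite unitmxE unitfE.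
by rewrite E; apply: leq_trans (mxrankM_maxl _ _) (rank_leq_col _).
Qed.

Lemma Delta_gram w : \det (gram 0 w) != 0 ->
  peval Delta w * \det (gram 0 w) = \det (gram 1 w).
Proof.
move=> /gram_regular[c [mu [fr inj ->]]]; rewrite !gram_frame // expr0 mul1r expr1.
by have [_ ->] := frame_trdet eja r2 trdet fr inj.
Qed.

Lemma frame_Delta_gram (c : 'I_r -> 'rV[R]_n) (mu : 'I_r -> R) : is_frame jm e c ->
  (\prod_j mu j) * \det (gram 0 (\sum_j mu j *: c j)) =
  \det (gram 1 (\sum_j mu j *: c j)).
Proof. by move=> fr; rewrite !gram_frame // expr0 mul1r expr1. Qed.

Lemma horner_hankel (F : nat -> {poly R}) s t :
  (\det (hankel s F)).[t] = \det (hankel s (fun k => (F k).[t])).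
Proof.
rewrite -horner_evalE -det_map_mx; congr (\det _).
by apply/matrixP => i j; rewrite !mxE.
Qed.

Lemma gram_line w h : exists G : nat -> {poly R},
  forall s t, (\det (hankel s G)).[t] = \det (gram s (w + t *: h)).
Proof.
have [F hF] := jpow_line eja w h; exists F => s t; rewrite horner_hankel.
by congr (\det (hankel _ _)); apply/funext => k; case: (hF k) => ->.
Qed.

Lemma gram_poly_neq0 (A p q : {poly R}) : A != 0 ->
  (forall t, A.[t] != 0 -> p.[t] = q.[t]) -> p = q.
Proof.
move=> A0 h; apply/eqP; rewrite -subr_eq0; apply/eqP.
apply: (mulIf A0); rewrite mul0r; apply: poly_eq0_fun => t.
rewrite hornerM hornerD hornerN.
by have [->|/h ->] := eqVneq A.[t] 0; rewrite ?mulr0 // subrr mul0r.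
Qed.

Lemma coef1_prod (I : Type) (s : seq I) (a b : I -> R) :
  (\prod_(i <- s) ((a i)%:P * (1 + b i *: 'X)))`_0 = \prod_(i <- s) a i /\
  (\prod_(i <- s) ((a i)%:P * (1 + b i *: 'X)))`_1 =
    (\prod_(i <- s) a i) * \sum_(i <- s) b i.
Proof.
elim: s => [|x s [IH0 IH1]]; first by rewrite !big_nil !coefC mulr0.
have X0 : ((a x)%:P * (1 + b x *: 'X))`_0 = a x.
  by rewrite mul_polyC !(coefZ, coefD, coefX, coefC) /= mulr0 addr0 mulr1.
have X1 : ((a x)%:P * (1 + b x *: 'X))`_1 = a x * b x.
  by rewrite mul_polyC !(coefZ, coefD, coefX, coefC) /= mulr1 add0r.
rewrite !big_cons !coefM !big_ord_recr !big_ord0 /= !add0r X0 X1 IH0 IH1; split => //.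
ring.
Qed.

(** By [jpow_line] the moments of w + t xw depend to first order on the components (c_i|x) alone.
    Hence x may be replaced by its diagonal part [x'], and w + t x'w has the coefficients lam_i (1 +
    t (c_i|x)) in the frame of w, with determinant their product. *)
Lemma grad_regular w x : \det (gram 0 w) != 0 ->
  grad Delta w (jm x w) = tr x * peval Delta w.
Proof.
move=> reg; have [c [lam [fr inj wE]]] := gram_regular reg.
pose x' := \sum_i dotr (c i) x *: c i.
have [F hF] := jpow_line eja w (jm x w).
have [F' hF'] := jpow_line eja w (jm x' w).
have c1 i : dotr (c i) (c i) = 1 by rewrite (frame_dot1 eja r2 trdet dottr).
have FF k : eqmod2 (F k) (F' k).
  have [_ a0 a1] := hF k; have [_ b0 b1] := hF' k.
  split; rewrite ?a0 ?b0 // a1 b1; congr (_ * _).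
  have E y : dotr (jpow jm e w k.-1) (jm y w) = \sum_j lam j ^+ k.-1 * lam j * dotr (c j) y.
    rewrite (jmC eja y) -(dotr_jm eja) (jmC eja).
    rewrite -(jmer eja (jm _ _)) -/(jpow jm e w 1).
    rewrite (jmer eja) (jmC eja) -[X in jm _ X]/(jpow jm e w k.-1).
    rewrite wE (frame_jpow eja fr) (frame_jm eja fr) dotr_suml; apply: eq_bigr => j _.
    by rewrite dotrZl [lam j * _]mulrC.
  rewrite !E; apply: eq_bigr => j _; congr (_ * _).
  by rewrite [RHS]dotrC (frame_dot_comb eja fr) c1 mulr1.
have D s : eqmod2 (\det (hankel s F)) (\det (hankel s F')).
  by apply: eqmod2_det => i j; rewrite !mxE.
have FE s t : (\det (hankel s F)).[t] = \det (gram s (w + t *: jm x w)).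
  by rewrite horner_hankel; congr (\det (hankel _ _)); apply/funext => k; case: (hF k) => ->.
have FE' s t : (\det (hankel s F')).[t] = \det (gram s (w + t *: jm x' w)).
  by rewrite horner_hankel; congr (\det (hankel _ _)); apply/funext => k; case: (hF' k) => ->.
have [a [aE a0 a1]] := peval_line Delta w (jm x w).
have [a' [aE' a0' a1']] := peval_line Delta w (jm x' w).
have A0 : (\det (hankel 0 F))`_0 = \det (gram 0 w).
  by rewrite -horner_coef0 FE scale0r addr0.
have A0' : (\det (hankel 0 F'))`_0 = \det (gram 0 w).
  by rewrite -horner_coef0 FE' scale0r addr0.
have nz : \det (hankel 0 F) != 0.
  by apply: contraNneq reg => E; rewrite -A0 E coef0.
have nz' : \det (hankel 0 F') != 0.
  by apply: contraNneq reg => E; rewrite -A0' E coef0.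
(* [Delta_gram] holds off the zeros of a nonzero polynomial in t, hence as an identity of
   polynomials; comparing coefficients of X then determines the one of [a]. *)
have aM : a * \det (hankel 0 F) = \det (hankel 1 F).
  apply: (gram_poly_neq0 nz) => t; rewrite hornerM !FE aE; exact: Delta_gram.
have aM' : a' * \det (hankel 0 F') = \det (hankel 1 F').
  apply: (gram_poly_neq0 nz') => t; rewrite hornerM !FE' aE'; exact: Delta_gram.
have aa : a`_1 = a'`_1.
  have := D 1%N; rewrite -aM -aM' => -[_].
  rewrite !coefM !big_ord_recr !big_ord0 /= !add0r a0 a0' A0 A0' (D 0%N).2.
  by move=> /addrI/(mulIf reg).
pose b := \prod_i ((lam i)%:P * (1 + dotr (c i) x *: 'X)).
have ab : a' = b.
  apply: (mulIf nz'); rewrite aM'; apply: poly_eq_fun => t.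
  rewrite hornerM !FE' /b horner_prod.
  have -> : w + t *: jm x' w = \sum_i (lam i * (1 + dotr (c i) x * t)) *: c i.
    rewrite {2}wE (frame_jm eja fr) {1}wE scaler_sumr -big_split; apply: eq_bigr => i _.
    by rewrite scalerA /= -scalerDl; congr (_ *: _); ring.
  rewrite -frame_Delta_gram //; congr (_ * _); apply: eq_bigr => i _.
  by rewrite !hornerE.
have [_ b1] := coef1_prod (index_enum 'I_r) lam (fun i => dotr (c i) x).
rewrite -a1 aa ab /b b1 mulrC; congr (_ * _).
  by rewrite (tr_dot eja dottr) -(frame_sum1 fr) dotr_suml; apply: eq_bigr => i _; rewrite scale1r.
by have [_ h] := frame_trdet eja r2 trdet fr inj; rewrite wE h.
Qed.

(** On the line from w to a regular element both sides are polynomials in t. They agree wherever the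
    discriminant is nonzero, that is for all but finitely many t, and so at t = 0. *)
Lemma grad_Delta w x : grad Delta w (jm x w) = tr x * peval Delta w.
Proof.
have [c fr] := regular_exists eja jrank.
pose w0 := \sum_(i < r) (i : nat)%:R *: c i; pose h := w0 - w.
have [G hG] := gram_line w h.
have nz : \det (hankel 0 G) != 0.
  apply: contraTneq isT => E; have := hG 0%N 1; rewrite E horner0 scale1r addrC subrK.
  rewrite gram_frame // expr0 mul1r => /esym/eqP.
  rewrite sqrf_eq0 det_Vandermonde => /prodf_eq0[i _ /prodf_eq0[j ij]].
  by rewrite !mxE subr_eq0 eqr_nat gtn_eqF.
have /choice [q hq] k := peval_line (mpoly.mderiv k Delta) w h.
have [p [hp _ _]] := peval_line Delta w h.
pose lhs := \sum_k ((jm x w 0 k)%:P + jm x h 0 k *: 'X) * q k.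
have E t : lhs.[t] = grad Delta (w + t *: h) (jm x (w + t *: h)).
  rewrite /lhs horner_sum; apply: eq_bigr => k _; case: (hq k) => qk _ _.
  rewrite hornerM qk; congr (_ * _).
  by rewrite (jmDr eja) (jmZr eja) !mxE !hornerE mulrC.
have : lhs = tr x *: p.
  apply: (gram_poly_neq0 nz) => t; rewrite hG E hornerZ hp; exact: grad_regular.
by move=> /(congr1 (fun p => p.[0])); rewrite E hornerZ hp scale0r addr0.
Qed.

End TraceDetDeriv.

(** * Automorphisms of the cone *)

Section Flow.
Local Open Scope classical_set_scope.
Variables (R : realType) (n : nat).

Lemma is_derive_peval (P : mpoly.mpoly n R) (g : R -> 'rV[R]_n) (h : 'rV[R]_n) (t : R) :
  (forall k, is_derive t (1 : R) (fun s => g s 0 k) (h 0 k)) ->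
  is_derive t (1 : R) (fun s => peval P (g s)) (grad P (g t) h).
Proof.
move=> gh; elim/mpoly_ring_ind: P => [c|i|P Q IP IQ|P Q IP IQ].
- rewrite gradC (_ : (fun s => _) = cst c); first exact: is_derive_cst.
  by apply/funext => s; rewrite pevalC.
- by rewrite gradX (_ : (fun s => _) = (fun s => g s 0 i)) //; apply/funext => s; rewrite pevalX.
- rewrite gradD (_ : (fun s => _) = (fun s => peval P (g s)) + (fun s => peval Q (g s))).
    exact: is_deriveD.
  by apply/funext => s; rewrite pevalD.
- rewrite gradM (_ : (fun s => _) = (fun s => peval P (g s)) * (fun s => peval Q (g s))).
    apply: is_derive_eq; rewrite addrC; congr (_ + _).
    by rewrite [LHS]mulrC.
  by apply/funext => s; rewrite pevalM.
Qed.

Lemma cvg_rV (T : topologicalType) (F : set_system T) (FF : Filter F) (g : T -> 'rV[R]_n)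
    (l : 'rV[R]_n) :
  (forall k, (fun t => g t 0 k) @ F --> l 0 k) -> g @ F --> l.
Proof.
move=> h; apply/cvg_ballP => eps eps0.
have H k : \forall t \near F, ball (l 0 k) eps (g t 0 k).
  by have /cvg_ballP/(_ eps eps0) := h k.
have : \forall t \near F, forall k, ball (l 0 k) eps (g t 0 k) by apply: filter_forall.
by apply: filterS => t ht; split=> // i j; rewrite ord1.
Qed.

Lemma is_derive_expRM (a t : R) :
  is_derive t (1 : R) (fun s => expR (s * a)) (a * expR (t * a)).
Proof.
have dl : is_derive t (1 : R) (@id R * cst a) (t *: 0 + a *: 1) by apply: is_deriveM.
apply: is_derive_eq.
by rewrite scaler0 add0r [a *: 1]mulr1 mulrC.
Qed.

Lemma exp_flow (S : 'M[R]_n) : S^T = S -> exists E : R -> 'M[R]_n,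
  [/\ E 0 = 1%:M, forall s t, E (s + t) = E s *m E t &
   [/\ forall t, (E t)^T = E t,
    forall (v : 'rV[R]_n) k (t : R), is_derive t (1 : R) (fun s => (v *m E s) 0 k) ((v *m E t *m S) 0 k),
    forall t, \det (E t) = expR (t * \tr S) &
    forall (v : 'rV_n) a t, v *m S = a *: v -> v *m E t = expR (t * a) *: v]].
Proof.
move=> Ssym; have [P [d [Pu PS]]] := symmetric_diagonalizable Ssym.
pose X t := diag_mx (\row_i expR (t * d 0 i)).
pose E t := invmx P *m X t *m P.
have PE t : P *m E t = X t *m P by rewrite /E !mulmxA mulmxV // mul1mx.
have SE : S = invmx P *m diag_mx d *m P by rewrite -mulmxA -PS mulKmx.
exists E; split; last split.
- rewrite /E (_ : X 0 = 1%:M) ?mulmx1 ?mulVmx //.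
  by apply/matrixP => i j; rewrite !mxE mul0r expR0.
- move=> s t; rewrite /E -!mulmxA; congr (_ *m _).
  rewrite [P *m _]mulKVmx // !mulmxA; congr (_ *m _).
  apply/matrixP => i j; rewrite mul_mx_diag !mxE; case: eqP => [->|_].
    by rewrite !mulr1n mulrDl expRD.
  by rewrite !mulr0n mul0r.
(* Symmetry of [E t] although [P] may not be orthogonal: the Gram matrix [G] of the eigenvectors
   commutes with the diagonal matrix of eigenvalues, hence with that of their exponentials. *)
- move=> t; pose G := P *m P^T.
  have GD i j : d 0 i * G i j = G i j * d 0 j.
    have : diag_mx d *m G = G *m diag_mx d.
      rewrite /G mulmxA -PS -!mulmxA; congr (_ *m _).
      by rewrite -{1}Ssym -trmx_mul PS trmx_mul tr_diag_mx.
    by move/matrixP/(_ i j); rewrite mul_diag_mx mul_mx_diag !mxE.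
  have H : P *m (E t)^T *m P^T = P *m E t *m P^T.
    rewrite PE -mulmxA -trmx_mul PE trmx_mul tr_diag_mx mulmxA -(mulmxA (X t)) -/G.
    apply/matrixP => i j; rewrite mul_mx_diag mul_diag_mx !mxE -!/(G i j).
    case: (eqVneq (d 0 i) (d 0 j)) => [->|dij]; first by rewrite mulrC.
    have /eqP := GD i j; rewrite mulrC -subr_eq0 -mulrBr mulf_eq0 subr_eq0 (negbTE dij).
    by rewrite orbF => /eqP; rewrite /G mxE => ->; rewrite mul0r mulr0.
  have := congr1 (fun A => invmx P *m A *m invmx P^T) H.
  by rewrite !mulmxA !mulVmx ?unitmx_tr // !mul1mx !mulmxK ?unitmx_tr.
- move=> v k t; pose u := v *m invmx P.
  have E1 s : (v *m E s) 0 k = \sum_i (u 0 i * P i k) * expR (s * d 0 i).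
    rewrite /E !mulmxA -/u mxE; apply: eq_bigr => i _.
    by rewrite mul_mx_diag !mxE mulrAC.
  have -> : (v *m E t *m S) 0 k = \sum_i (u 0 i * P i k) * (d 0 i * expR (t * d 0 i)).
    rewrite SE /E !mulmxA -/u mulmxK // mxE; apply: eq_bigr => i _.
    by rewrite !mul_mx_diag !mxE; ring.
  rewrite (_ : (fun s => _) = \sum_i (fun s => (u 0 i * P i k) * expR (s * d 0 i))); last first.
    by apply/funext => s; rewrite E1 fct_sumE.
  apply: is_derive_sum => i.
  have -> : (fun s : R => u 0 i * P i k * expR (s * d 0 i)) =
      (u 0 i * P i k) *: (fun s => expR (s * d 0 i)) by [].
  by apply: is_deriveZ; exact: is_derive_expRM.
- move=> t; rewrite /E !det_mulmx det_inv mulrAC mulVf ?mul1r; last by rewrite -unitfE -unitmxE.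
  rewrite det_diag SE mxtrace_mulC !mulmxA mulmxV // mul1mx mxtrace_diag mulr_sumr expR_sum.
  by apply: eq_bigr => i _; rewrite mxE.
- move=> v a t vS; pose u := v *m invmx P.
  have uD i : u 0 i * d 0 i = a * u 0 i.
    have : u *m diag_mx d = a *: u.
      by rewrite /u scalemxAl -vS SE !mulmxA mulmxK.
    by move/matrixP/(_ 0 i); rewrite mul_mx_diag !mxE.
  have -> : v *m E t = (u *m X t) *m P by rewrite /E !mulmxA.
  rewrite -[v in RHS](mulmxKV Pu) -/u scalemxAl; congr (_ *m _); clearbody u.
  apply/rowP => i; rewrite mul_mx_diag !mxE.
  have [->|u0] := eqVneq (u 0 i) 0; first by rewrite mul0r mulr0.
  have -> : d 0 i = a by apply: (mulfI u0); rewrite uD mulrC.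
  by rewrite mulrC.
Qed.

(** [E t] is the square of the symmetric invertible matrix [E (t / 2)]. *)
Lemma exp_flow_pd (E : R -> 'M[R]_n) : E 0 = 1%:M -> (forall s t, E (s + t) = E s *m E t) ->
  (forall t, (E t)^T = E t) -> forall t v, v != 0 -> 0 < dotr (v *m E t) v.
Proof.
move=> E0 ED ET t v v0.
have -> : E t = E (t / 2) *m E (t / 2) by rewrite -ED -splitr.
rewrite mulmxA dotr_mulmx ET dotr_gt0; apply: contraNneq v0 => h.
by rewrite -[v]mulmx1 -E0 -(subrr (t / 2)) ED mulmxA h mul0mx.
Qed.

End Flow.

Section ConeAut.
Local Open Scope classical_set_scope.
Variables (R : realType) (n r : nat) (jm : 'rV[R]_n -> 'rV[R]_n -> 'rV[R]_n).
Variables (e : 'rV[R]_n) (tr : 'rV[R]_n -> R) (Delta : mpoly.mpoly n R).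
Hypothesis eja : is_EJA jm e.
Hypothesis jrank : is_jrank jm e r.
Hypothesis r2 : (1 < r)%N.
Hypothesis trdet : is_trace_det jm e r tr Delta.
Hypothesis dottr : forall x y : 'rV[R]_n, dotr x y = tr (jm x y).

(** The rank being at least 2, [e] is not regular. Its determinant is read off the line e + t w0,
    whose points are regular for t different from 0. *)
Lemma Delta_e : peval Delta e = 1.
Proof.
have [c fr] := regular_exists eja jrank.
pose w0 := \sum_(i < r) (i : nat)%:R *: c i.
have [p [pE _ _]] := peval_line Delta e w0.
pose q := \prod_(i < r) (1 + (i : nat)%:R *: 'X : {poly R}).
suff pq : p = q.
  have <- : p.[0] = peval Delta e by rewrite pE scale0r addr0.
  by rewrite pq horner_prod big1 // => i _; rewrite hornerD hornerZ hornerX hornerC mulr0 addr0.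
have X0 : 'X != 0 :> {poly R} by rewrite polyX_eq0.
apply: (gram_poly_neq0 X0) => t; rewrite hornerX pE => t0.
have -> : e + t *: w0 = \sum_(i < r) (1 + (i : nat)%:R * t) *: c i.
  rewrite -(frame_sum1 fr) scaler_sumr -big_split; apply: eq_bigr => i _.
  by rewrite scalerA /= -scalerDl mulrC.
have inj : injective (fun i : 'I_r => 1 + (i : nat)%:R * t).
  by move=> i j /addrI/(mulIf t0)/eqP; rewrite eqr_nat => /eqP/val_inj.
have [_ h] := frame_trdet eja r2 trdet fr inj.
rewrite h /q horner_prod; apply: eq_bigr => i _.
by rewrite hornerD hornerZ hornerX hornerC.
Qed.

(** If an eigenvalue of w vanishes, with idempotent c_i, then c_i w = 0. So [grad_Delta] in that
    direction gives tr(c_i) Delta(w) = 0, where tr(c_i) = (c_i|c_i) > 0. This covers elements that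
    are not regular. *)
Lemma psd_pd w : psd jm w -> peval Delta w != 0 -> pd jm w.
Proof.
have [m [lam [c [inj fr ->]]]] := spectral eja w => pw D0.
apply/(pd_frame eja lam fr) => i.
rewrite lt_def (psd_frame eja i fr pw) andbT; apply: contraNneq D0 => l0.
have := grad_Delta eja jrank r2 trdet dottr (\sum_j lam j *: c j) (c i).
rewrite (jmC eja) (frame_comb eja fr) l0 scale0r.
have -> : tr (c i) = dotr (c i) (c i).
  by rewrite (tr_dot eja dottr) -{1}(frame_idem fr i) dotrC (dotr_jm eja) (jmer eja).
have -> h : grad Delta h 0 = 0.
  by rewrite /grad big1 // => k _; rewrite mxE mul0r.
move/esym/eqP; rewrite mulf_eq0 dotr_eq0 => /orP[|/eqP//].
by case: fr => /(_ i)/negbTE ->.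
Qed.

Lemma Delta_flow x (E : R -> 'M[R]_n) :
  E 0 = 1%:M ->
  (forall (v : 'rV[R]_n) k (t : R),
    is_derive t (1 : R) (fun s => (v *m E s) 0 k) ((v *m E t *m Lm jm x) 0 k)) ->
  forall xi t, peval Delta (xi *m E t) = expR (t * tr x) * peval Delta xi.
Proof.
move=> E0 dE xi t.
(* By [grad_Delta] this quotient of the two sides has derivative 0. *)
pose phi s := peval Delta (xi *m E s) * expR (s * - tr x).
have dphi (s : R) : is_derive s (1 : R) phi 0.
  have d1 : is_derive s (1 : R) (fun s => peval Delta (xi *m E s))
      (grad Delta (xi *m E s) (xi *m E s *m Lm jm x)).
    by apply: (@is_derive_peval _ _ Delta (fun s => xi *m E s)) => k; exact: dE.
  have d2 := is_derive_expRM (- tr x) s.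
  rewrite (_ : phi = (fun s => peval Delta (xi *m E s)) * (fun s => expR (s * - tr x))) //.
  apply: is_derive_eq; rewrite (mul_Lm eja) (grad_Delta eja jrank r2 trdet dottr).
  rewrite /GRing.scale /=; ring.
have := is_derive_0_is_cst t 0 dphi.
rewrite /phi E0 mulmx1 mul0r expR0 mulr1 mulrN expRN => <-.
by rewrite mulrC mulrVK // unitfE lt0r_neq0 // expR_gt0.
Qed.

Lemma flow_continuous x (E : R -> 'M[R]_n) :
  (forall (v : 'rV[R]_n) k (t : R),
    is_derive t (1 : R) (fun s => (v *m E s) 0 k) ((v *m E t *m Lm jm x) 0 k)) ->
  forall xi : 'rV[R]_n, continuous (fun t => xi *m E t).
Proof.
move=> dE xi t; apply: cvg_rV => k.
apply: differentiable_continuous; apply/derivable1_diffP.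
by have := dE xi k t => -[].
Qed.

(** The set of times at which the orbit is in the cone contains 0 and is open, as the cone is. It is
    also closed: a limit is [psd], its determinant is nonzero by [Delta_flow], and [psd_pd] applies.
    The line is connected. *)
Lemma flow_pd x (E : R -> 'M[R]_n) :
  E 0 = 1%:M ->
  (forall (v : 'rV[R]_n) k (t : R),
    is_derive t (1 : R) (fun s => (v *m E s) 0 k) ((v *m E t *m Lm jm x) 0 k)) ->
  forall xi t, pd jm xi -> peval Delta xi != 0 -> pd jm (xi *m E t).
Proof.
move=> E0 dE xi t pxi D0.
have ct : continuous (fun s : R => xi *m E s) by move=> s; exact: (flow_continuous dE).
pose B := [set s | pd jm (xi *m E s)].
suff BT : B = setT :> set R by have : B t by rewrite BT.
have conn : connected [set: R] by apply/connected_intervalP => a b _ _ c _.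
apply: conn.
- by exists 0; rewrite /B /= E0 mulmx1.
- exists B; last by rewrite setTI.
  have -> : B = (fun s => xi *m E s) @^-1` sym_cone jm.
    by apply/seteqP; split => s /= /(sym_coneP eja).
  by apply: open_comp => [s _|]; [exact: ct|exact: sym_cone_open].
- exists B; last by rewrite setTI.
  have -> : B = (fun s => xi *m E s) @^-1` [set y | psd jm y].
    apply/seteqP; split => s /=; first exact: pdW.
    move=> h; apply: psd_pd => //.
    by rewrite (Delta_flow E0 dE) mulf_neq0 // lt0r_neq0 // expR_gt0.
  apply: closed_comp => [s _|]; first exact: ct.
  rewrite closedE => y /= hy; apply: (psd_closed eja) => eps eps0.
  apply: contrapT => no; apply: hy.
  apply/nbhs_ballP; exists eps => //= z; rewrite -ball_normE /= => yz pz.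
  by apply: no; exists z.
Qed.

End ConeAut.

(** * The trace of multiplications and irreducibility *)

Section TraceL.
Local Open Scope classical_set_scope.
Variables (R : realType) (n r : nat) (jm : 'rV[R]_n -> 'rV[R]_n -> 'rV[R]_n).
Variables (e : 'rV[R]_n) (tr : 'rV[R]_n -> R) (Delta : mpoly.mpoly n R).
Hypothesis eja : is_EJA jm e.
Hypothesis jrank : is_jrank jm e r.
Hypothesis r2 : (1 < r)%N.
Hypothesis trdet : is_trace_det jm e r tr Delta.
Hypothesis dottr : forall x y : 'rV[R]_n, dotr x y = tr (jm x y).
Hypothesis irr : irreducible_cone (sym_cone jm).

(** Both sides are expanded by [jordan_op]; the double products agree up to symmetry and the triple
    ones by cyclic invariance of the trace. *)
Lemma trace_Lm_assoc x z u : \tr (Lm jm (jm (jm x z) u)) = \tr (Lm jm (jm x (jm z u))).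
Proof.
have op a b c : Lm jm (jm (jm b a) c) =
    Lm jm a *m Lm jm (jm b c) + Lm jm b *m Lm jm (jm a c) + Lm jm c *m Lm jm (jm b a)
    - Lm jm b *m Lm jm c *m Lm jm a - Lm jm a *m Lm jm c *m Lm jm b.
  apply/row_matrixP => i; rewrite !rowE !(mulmxN, mulmxDr) !mulmxA !(mul_Lm eja).
  exact: (jordan_op eja).
have cyc a b c : \tr (Lm jm a *m Lm jm b *m Lm jm c) = \tr (Lm jm b *m Lm jm c *m Lm jm a).
  by rewrite -mulmxA mxtrace_mulC.
rewrite (jmC eja x (jm z u)) !op !(raddfB, raddfD) /= (jmC eja u x) (jmC eja z x).
rewrite (cyc x u z) (cyc u z x) (cyc z u x); ring.
Qed.

Lemma trace_Lm_dot : exists a, forall x, \tr (Lm jm x) = dotr a x.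
Proof.
exists (\row_k \tr (Lm jm (delta_mx 0 k))) => x.
have E v : \tr (Lm jm v) = \sum_i jm v (delta_mx 0 i) 0 i.
  by apply: eq_bigr => i _; rewrite mxE.
rewrite E {1}(row_sum_delta x).
under eq_bigr => i _.
  rewrite (jm_suml eja) summxE.
  under eq_bigr do rewrite (jmZl eja) mxE.
  over.
rewrite exchange_big; apply: eq_bigr => k _.
by rewrite -mulr_sumr mxE E mulrC.
Qed.

(* the representing vector of the trace form is central; if it were not a multiple of [e],
   an idempotent from its spectral decomposition would split the cone *)
Lemma trace_Lm x : \tr (Lm jm x) = n%:R / r%:R * tr x.
Proof.
have [a aE] := trace_Lm_dot.
(* Associativity of the trace form says that L(a) commutes with every multiplication. *)
have cen y z : jm a (jm y z) = jm z (jm a y).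
  apply: dotr_inj => u.
  rewrite (jmC eja a) (dotr_jm eja (jm y z)) -aE trace_Lm_assoc aE.
  by rewrite (jmC eja a) -(dotr_jm eja y) -(dotr_jm eja z).
have [m [lam [c [inj fr aF]]]] := spectral eja a.
have ac i : jm a (c i) = lam i *: c i by rewrite aF (frame_comb eja fr).
have aci i z : jm a (jm (c i) z) = lam i *: jm (c i) z.
  by rewrite cen ac (jmZr eja) (jmC eja z).
have cz_sum z : \sum_i jm (c i) z = z.
  by rewrite -(jm_suml eja); case: fr => _ _ ->; rewrite (jmel eja).
(* The product of two eigenvectors of L(a) is an eigenvector for both eigenvalues, since L(a) passes
   to either factor; distinct eigenvalues make it zero. *)
have ort i j u v : i != j -> jm a u = lam i *: u -> jm a v = lam j *: v -> jm u v = 0.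
  move=> ij au av.
  have h1 : jm a (jm u v) = lam i *: jm u v by rewrite cen au (jmZr eja) (jmC eja v).
  have h2 : jm a (jm u v) = lam j *: jm u v by rewrite (jmC eja u) cen av (jmZr eja) (jmC eja u).
  have /eqP : (lam i - lam j) *: jm u v = 0 by rewrite scalerBl -h1 -h2 subrr.
  by rewrite scaler_eq0 subr_eq0 => /orP[/eqP/inj/eqP|/eqP //]; rewrite (negbTE ij).
have cicj i j z : i != j -> jm (c i) (jm (c j) z) = 0.
  by move=> ij; apply: (ort i j).
have cc i z : jm (c i) (jm (c i) z) = jm (c i) z.
  rewrite -{2}(cz_sum (jm (c i) z)) (bigD1 i) //= big1 ?addr0 // => j ji.
  by rewrite cicj.
have r0 : r%:R != 0 :> R by rewrite pnatr_eq0 -lt0n ltnW.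
have tre := tr_e eja jrank r2 trdet dottr.
have [i0 _|none] := pickP (fun _ : 'I_m => true); last first.
  have e0 : e = 0 by case: fr => _ _ <-; rewrite big1 // => i; have := none i.
  by move: tre; rewrite (tr_dot eja dottr) e0 dotr0r => /esym/eqP; rewrite (negbTE r0).
(* With a single idempotent [a] is a multiple lam of [e], and evaluating the trace at [e] gives n =
   lam r. *)
have [/forallP all0|/forallPn[i1 i01]] := boolP [forall i : 'I_m, i == i0].
  have aL : a = lam i0 *: e.
    case: fr => _ _ <-; rewrite scaler_sumr aF; apply: eq_bigr => i _.
    by rewrite (eqP (all0 i)).
  have := aE e; have -> : Lm jm e = 1%:M.
    by apply/row_matrixP => i; rewrite !rowE (mul_Lm eja) mulmx1 (jmel eja).
  rewrite mxtrace1 aL dotrZl -(tr_dot eja dottr) tre => ->.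
  by rewrite aE aL dotrZl -(tr_dot eja dottr) mulfK.
exfalso; apply: irr.
(* [p] and [p'] are complementary projections onto two ideals that annihilate each other. The
   quadratic form of L splits accordingly, so the cone is the sum of its two images, which
   contradicts irreducibility. *)
pose p z := jm (c i0) z; pose p' z := z - p z.
have p'E z : p' z = \sum_(j | j != i0) jm (c j) z.
  by rewrite /p' -[X in X - _](cz_sum z) (bigD1 i0) //= addrAC subrr add0r.
have pp' u v : jm (p u) (p' v) = 0.
  rewrite p'E (jm_sumr eja) big1 // => j ji.
  by apply: (ort i0 j _ _ _ (aci _ _) (aci _ _)); rewrite eq_sym.
have pz z : z = p z + p' z by rewrite /p' addrC subrK.
have dpp' u v : dotr (p u) (p' v) = 0.
  by rewrite -(jmer eja (p' v)) -(dotr_jm eja) (jmC eja) pp' dotr0l.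
have qp u w : dotr (jm (p u) w) w = dotr (jm u (p w)) (p w).
  have -> : jm (p u) w = jm u (p w).
    by rewrite {1}(pz w) {2}(pz u) (jmDr eja) (jmDl eja) pp' (jmC eja (p' u)) pp'.
  rewrite {2}(pz w) dotrDr (jmC eja u) [X in _ + X](dotr_jm eja) pp' dotr0r addr0 //.
have qp' u w : dotr (jm (p' u) w) w = dotr (jm u (p' w)) (p' w).
  have -> : jm (p' u) w = jm u (p' w).
    by rewrite {1}(pz w) {2}(pz u) (jmDr eja) (jmDl eja) pp' (jmC eja (p' u)) pp' !(addr0, add0r).
  rewrite {2}(pz w) dotrDr (jmC eja u) [X in X + _](dotr_jm eja) (jmC eja (p' w)) pp' dotr0r add0r //.
have psub u : p u = u *m Lm jm (c i0) by rewrite (mul_Lm eja).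
have p'sub u : p' u = u *m (1%:M - Lm jm (c i0)) by rewrite mulmxBr mulmx1 (mul_Lm eja).
have ci0 : c i0 != 0 by case: fr.
have ci1 : c i1 != 0 by case: fr.
exists (Lm jm (c i0)), (1%:M - Lm jm (c i0)), [set p u | u in sym_cone jm],
  [set p' u | u in sym_cone jm]; split; split.
- apply: contra_neq ci0 => E.
  by rewrite -(jmer eja (c i0)) -[jm _ _]/(p e) psub E mulmx0.
- apply: contra_neq ci1 => E.
  have : p' (c i1) = 0 by rewrite p'sub E mulmx0.
  by rewrite /p' /p -(jmer eja (c i1)) cicj ?(jmer eja) ?subr0 // eq_sym.
- rewrite sub0mx andbT; apply/rV_subP => v; rewrite sub_capmx => /andP[/submxP[u uE] /submxP[w wE]].
  have : p v = 0 by rewrite wE -p'sub (pz (p (p' w))) /p' /p cc subrr addr0;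
    have := cc i0 w; rewrite (jmDr eja) (jmNr eja) cc subrr.
  by rewrite uE -psub /p cc => ->; exact: sub0mx.
- rewrite submx1 /=; apply: (submx_trans _ (addmx_sub_adds (submx_refl _) (submx_refl _))).
  by rewrite addrC subrK.
- by move=> _ [u _ <-]; rewrite psub; exact: submxMl.
- by move=> _ [u _ <-]; rewrite p'sub; exact: submxMl.
apply/seteqP; split => [u ou|_ [_ [u /(sym_coneP eja)[al al0 hu] <-] [_ [v /(sym_coneP eja)[be be0 hv] <-] <-]]].
  by exists (p u); [exists u|exists (p' u); [exists u|rewrite -pz]].
apply/(sym_coneP eja); exists (Order.min al be); first by rewrite lt_min al0.
move=> w; rewrite (jmDl eja) dotrDl qp qp'; clear p'E; clearbody p'.
have -> : dotr w w = dotr (p w) (p w) + dotr (p' w) (p' w).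
  by rewrite {1 2}(pz w) !(dotrDl, dotrDr) dpp' (dotrC (p' w)) dpp' addr0 add0r.
rewrite mulrDr; apply: lerD.
  by apply: le_trans (hu _); rewrite ler_wpM2r ?dotr_ge0 // ge_min lexx.
by apply: le_trans (hv _); rewrite ler_wpM2r ?dotr_ge0 // ge_min lexx orbT.
Qed.

(** x is the logarithm of y in a frame of y. Each c_i is an eigenvector of L(x) with eigenvalue
    ln(lam_i), so that exp(L(x)) sends e, the sum of the c_i, to y. *)
Lemma pd_exp y : pd jm y -> exists x (E : R -> 'M[R]_n),
  [/\ E 0 = 1%:M, forall s t, E (s + t) = E s *m E t, e *m E 1 = y &
   [/\ forall t, (E t)^T = E t,
    forall (v : 'rV[R]_n) k (t : R),
      is_derive t (1 : R) (fun s => (v *m E s) 0 k) ((v *m E t *m Lm jm x) 0 k) &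
    forall t, \det (E t) = expR (t * \tr (Lm jm x))]].
Proof.
have [m [lam [c [inj fr ->]]]] := spectral eja y => /(pd_frame eja _ fr) lam0.
pose x := \sum_j ln (lam j) *: c j.
have [E [E0 ED [ET dE detE eigE]]] := exp_flow (tr_Lm eja x).
exists x, E; split=> //.
rewrite -(frame_sum1 fr) mulmx_suml; apply: eq_bigr => i _.
rewrite scale1r (eigE _ (ln (lam i))); first by rewrite mul1r lnK // posrE.
by rewrite (mul_Lm eja) (frame_comb eja fr).
Qed.

Lemma Delta_gt0 y : pd jm y -> 0 < peval Delta y.
Proof.
move=> /pd_exp[x [E [E0 ED <- [ET dE _]]]].
rewrite (Delta_flow eja jrank r2 trdet dottr E0 dE).
by rewrite (Delta_e eja jrank r2 trdet) mulr1 expR_gt0.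
Qed.

Lemma cone_automorphism y : pd jm y -> exists g : 'M[R]_n,
  [/\ forall v : 'rV[R]_n, v != 0 -> 0 < dotr (v *m g) v, g^T = g, e *m g = y &
  [/\ forall xi, pd jm (xi *m g) <-> pd jm xi,
      forall xi, peval Delta (xi *m g) = peval Delta y * peval Delta xi &
      \det g = peval Delta y `^ (n%:R / r%:R)]].
Proof.
move=> /pd_exp[x [E [E0 ED <- [ET dE detE]]]].
have DE xi t := Delta_flow eja jrank r2 trdet dottr E0 dE xi t.
have Dpos xi (h : pd jm xi) := lt0r_neq0 (Delta_gt0 h).
exists (E 1); split => //; first exact: exp_flow_pd.
split=> [xi|xi|].
- split=> h; last by apply: (flow_pd eja jrank r2 trdet dottr E0 dE) => //; exact: Dpos.
  have := flow_pd eja jrank r2 trdet dottr E0 dE (-1) h (Dpos _ h).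
  by rewrite -mulmxA -ED subrr E0 mulmx1.
- by rewrite !DE (Delta_e eja jrank r2 trdet) mulr1 mul1r.
- rewrite detE !mul1r trace_Lm DE (Delta_e eja jrank r2 trdet) mulr1 mul1r.
  by rewrite /powR gt_eqF ?expR_gt0 // expRK.
Qed.

End TraceL.

(** * Iterated integrals *)

Section Integral.
Local Open Scope classical_set_scope.
Local Open Scope ereal_scope.
Variable R : realType.
Notation mu := (@lebesgue_measure R).

(** The integral of a nonnegative function is a supremum over the simple functions below it, so
    monotonicity holds with no measurability at all. This allows the integrand of the theorem to be
    majorized as it stands. *)
Lemma le_int d (T : measurableType d) (m : {measure set T -> \bar R}) (f g : T -> \bar R) :
  (forall x, 0 <= f x) -> (forall x, f x <= g x) ->
  \int[m]_(x in setT) f x <= \int[m]_(x in setT) g x.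
Proof.
move=> f0 fg; have g0 x : 0 <= g x by apply: le_trans (fg x).
rewrite !ge0_integralTE //; apply: le_ereal_sup => _ [h /= hf <-].
by exists h => // x; apply: le_trans (fg x).
Qed.

(** The push-forward of Lebesgue measure under t -> at + b, scaled by a, has the right value on
    half-open intervals, which determine the measure. *)
Lemma int_affine (a b : R) (f : R -> \bar R) : (0 < a)%R ->
  measurable_fun [set: R] f -> (forall x, 0 <= f x) ->
  a%:E * \int[mu]_(t in setT) f (a * t + b)%R = \int[mu]_(t in setT) f t.
Proof.
move=> a0 mf f0.
pose phi (t : measurableTypeR R) : measurableTypeR R := (a * t + b)%R.
have mphi : measurable_fun setT phi.
  by apply: measurable_funD => //; apply: measurable_funM.
have a0' : (0 <= a)%R := ltW a0.
pose m1 : {measure set (measurableTypeR R) -> \bar R} :=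
  measure_function_pushforward__canonical__measure_function_Measure mu mphi.
pose m' : {measure set (measurableTypeR R) -> \bar R} := mscale (NngNum a0') m1.
have E A : measurable A -> mu A = m' A.
  move=> mA; apply: (@lebesgue_measure_unique R m') => // _ [[x y]] _ <-.
  transitivity (a%:E * mu (phi @^-1` `]x, y])) => //.
  have -> : phi @^-1` `]x, y] = `]((x - b) / a)%R, ((y - b) / a)%R]%classic.
    apply/seteqP; split => t; rewrite /= !in_itv /phi /=
      ltr_pdivrMr // ler_pdivlMr // [(t * a)%R]mulrC ltrBlDr lerBrDr //.
  rewrite !lebesgue_measure_itv /= !lte_fin ltr_pM2r ?invr_gt0 // ltrD2r.
  case: ifP => _; last by rewrite mule0.
  by rewrite -!EFinB -EFinM; congr (_%:E); field; rewrite gt_eqF.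
transitivity (\int[m']_(t in setT) f t).
  rewrite ge0_integral_mscale //= ge0_integral_pushforward //.
by apply: eq_measure_integral => A mA _; exact/esym/E.
Qed.

Lemma int_shift (b : R) (f : R -> \bar R) :
  measurable_fun [set: R] f -> (forall x, 0 <= f x) ->
  \int[mu]_(t in setT) f (t + b)%R = \int[mu]_(t in setT) f t.
Proof.
move=> mf f0; rewrite -(int_affine b ltr01 mf f0) mul1e.
by apply: eq_integral => t _; rewrite mul1r.
Qed.

End Integral.

(** * Borel functions of a row vector *)

Section Borel.
Local Open Scope classical_set_scope.
Local Open Scope ereal_scope.
Variable R : realType.
Notation mu := (@lebesgue_measure R).

(** Borel measurability expressed by composition: every substitution of measurable coordinates gives
    a measurable function. In this form the notion is stable under reindexing, gluing and freezing
    of coordinates, the operations that iterated integrals ask for. *)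
Definition borel K (g : 'rV[R]_K -> \bar R) : Prop :=
  forall d (T : measurableType d) (L : T -> 'rV[R]_K),
    (forall k, measurable_fun setT (fun x => L x 0%R k)) -> measurable_fun setT (fun x => g (L x)).

Lemma measurable_preimage_open K (A : set 'rV[R]_K) d (T : measurableType d)
    (L : T -> 'rV[R]_K) :
  (forall k, measurable_fun setT (fun x => L x 0%R k)) -> open A -> measurable (L @^-1` A).
Proof.
move=> mL oA.
(* Boxes with rational centre and radius 1/(j+1): countably many, enumerated by [unpickle], and
   those contained in [A] cover it. *)
pose box (q : 'rV[rat]_K) (j : nat) :=
  [set x : 'rV[R]_K | forall k, (`|x 0%R k - ratr (q 0%R k)| < j.+1%:R^-1)%R].
pose J := ('rV[rat]_K * nat)%type.
pose F (i : nat) : set T := match @unpickle J i with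
  | Some qj => if `[< box qj.1 qj.2 `<=` A >] then L @^-1` box qj.1 qj.2 else set0
  | None => set0 end.
have mF i : measurable (F i).
  rewrite /F; case: unpickle => [[q j]|//]; case: ifP => // _.
  have -> : L @^-1` box q j = \bigcap_(k in [set: 'I_K])
      ((fun x => L x 0%R k) @^-1` ball (ratr (q 0%R k) : R) j.+1%:R^-1).
    apply/seteqP; split => x /= h k; last by have := h k I; rewrite -ball_normE /= distrC.
    by move=> _; rewrite -ball_normE /= distrC; exact: h.
  apply: fin_bigcap_measurable => // k _; rewrite -[X in measurable X]setTI.
  by apply: mL => //; exact: measurable_ball.
have -> : L @^-1` A = \bigcup_i F i; last exact: bigcup_measurable.
apply/seteqP; split => [x /= Ax|x [i _]]; last first.
  rewrite /F; case: unpickle => [[q j]|//]; case: ifP => // /asboolP h; exact: h.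
have /nbhs_ballP[eps /= eps0 h] : nbhs (L x) A by exact: open_nbhs_nbhs.
have e2 : (0 < eps / 2)%R by rewrite divr_gt0.
have [j] := ltr_add_invr e2; rewrite add0r => hj.
have /choice [q hq] : forall k, exists q : rat, (`|L x 0%R k - ratr q| < j.+1%:R^-1)%R.
  move=> k; have j0 : (0 < j.+1%:R^-1 :> R)%R by rewrite invr_gt0.
  have /rat_in_itvoo[q] : (L x 0 k - j.+1%:R^-1 < L x 0 k + j.+1%:R^-1)%R.
    by rewrite ltrBlDr -addrA ltrDl addr_gt0.
  by move=> /itvP qE; exists q; rewrite distrC ltr_distl !qE.
exists (pickle ((\row_k q k)%R, j)) => //; rewrite /F pickleK.
case: ifPn => [_ k|/asboolP[]]; first by rewrite mxE.
move=> y hy; apply: h; rewrite -ball_normE /=.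
apply: le_lt_trans (norm_le_coord (a := (j.+1%:R^-1 + j.+1%:R^-1)%R) _ _) _.
- by rewrite addr_ge0.
- move=> i k; rewrite ord1 !mxE.
  have := hy k; have := hq k; rewrite !mxE => h1 h2.
  apply: le_trans (ler_distD (ratr (q k)) _ _) _.
  by rewrite lerD // ltW // distrC.
- by rewrite [ltRHS]splitr ltrD.
Qed.

Lemma borel_lsc K (g : 'rV[R]_K -> \bar R) :
  (forall a : R, open [set x | a%:E < g x]) -> borel g.
Proof.
move=> og d T L mL.
apply: (measurability _ (ErealGenOInfty.measurableE R)) => //= _ [_ [a ->]] <-.
rewrite setTI (_ : _ @^-1` _ = L @^-1` [set x | a%:E < g x]).
  exact: measurable_preimage_open.
by apply/seteqP; split => x /=; rewrite in_itv /= andbT.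
Qed.

Lemma borel_comp K K' (g : 'rV[R]_K -> \bar R) (h : 'rV[R]_K' -> 'rV[R]_K) :
  (forall k, borel (fun x => (h x 0%R k)%:E)) -> borel g -> borel (fun x => g (h x)).
Proof.
move=> bh bg d T L mL; apply: bg => k.
by apply/measurable_EFinP; apply: bh.
Qed.

Lemma borel_coord K k : borel (fun x : 'rV[R]_K => (x 0%R k)%:E).
Proof. by move=> d T L mL; apply/measurable_EFinP; exact: mL. Qed.

Lemma borel_cst K c : borel (fun _ : 'rV[R]_K => c).
Proof. by move=> d T L mL. Qed.

Lemma borelM_fin K (f g : 'rV[R]_K -> R) : borel (fun x => (f x)%:E) ->
  borel (fun x => (g x)%:E) -> borel (fun x => (f x * g x)%:E).
Proof.
move=> bf bg d T L mL; apply/measurable_EFinP/measurable_funM; apply/measurable_EFinP.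
  exact: bf.
exact: bg.
Qed.

Lemma borelD_fin K (f g : 'rV[R]_K -> R) : borel (fun x => (f x)%:E) ->
  borel (fun x => (g x)%:E) -> borel (fun x => (f x + g x)%:E).
Proof.
move=> bf bg d T L mL; apply/measurable_EFinP/measurable_funD; apply/measurable_EFinP.
  exact: bf.
exact: bg.
Qed.

Lemma borelM K (f g : 'rV[R]_K -> \bar R) : borel f -> borel g -> borel (fun x => f x * g x).
Proof. by move=> bf bg d T L mL; apply: emeasurable_funM; [exact: bf|exact: bg]. Qed.

Lemma borel_sum_fin K I (s : seq I) (F : I -> 'rV[R]_K -> R) :
  (forall i, borel (fun x => (F i x)%:E)) -> borel (fun x => (\sum_(i <- s) F i x)%:E).
Proof.
move=> bF; elim: s => [|i s IH].
  by under eq_fun do rewrite big_nil; exact: borel_cst.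
by under eq_fun do rewrite big_cons; exact: (borelD_fin (bF i) IH).
Qed.

Lemma borel_mulmx K K' (A : 'M[R]_(K', K)) (g : 'rV[R]_K -> \bar R) :
  borel g -> borel (fun x => g (x *m A)).
Proof.
apply: borel_comp => k; under eq_fun do rewrite mxE.
apply: (@borel_sum_fin _ _ _ (fun j x => (x 0 j * A j k)%R)) => j.
exact: (borelM_fin (borel_coord j) (@borel_cst _ (A j k)%:E)).
Qed.

Lemma borel_shift K (c : 'rV[R]_K) (g : 'rV[R]_K -> \bar R) :
  borel g -> borel (fun x => g (x + c)%R).
Proof.
apply: borel_comp => k; under eq_fun do rewrite mxE.
exact: (borelD_fin (borel_coord k) (@borel_cst _ (c 0%R k)%:E)).
Qed.

Lemma measurable_row_mx K N d (T : measurableType d) (f : T -> 'rV[R]_K) (g : T -> 'rV[R]_N) :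
  (forall k, measurable_fun setT (fun x => f x 0%R k)) ->
  (forall k, measurable_fun setT (fun x => g x 0%R k)) ->
  forall k, measurable_fun setT (fun x => row_mx (f x) (g x) 0%R k).
Proof.
move=> mf mg k; case: (splitP k) => j kj.
  have -> : k = lshift N j by apply: val_inj.
  by under eq_fun do rewrite row_mxEl; exact: mf.
have -> : k = rshift K j by apply: val_inj.
by under eq_fun do rewrite row_mxEr; exact: mg.
Qed.

Lemma borel_row_mx K N K' (g : 'rV[R]_(K + N) -> \bar R) (a : 'rV[R]_K' -> 'rV[R]_K)
    (b : 'rV[R]_K' -> 'rV[R]_N) :
  (forall k, borel (fun x => (a x 0%R k)%:E)) -> (forall k, borel (fun x => (b x 0%R k)%:E)) ->
  borel g -> borel (fun x => g (row_mx (a x) (b x))).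
Proof.
move=> ba bb bg d T L mL; apply: bg.
apply: measurable_row_mx => k; apply/measurable_EFinP; first exact: ba.
exact: bb.
Qed.

Lemma borel_lsubmx K N k : borel (fun x : 'rV[R]_(K + N) => (lsubmx x 0%R k)%:E).
Proof. by under eq_fun do rewrite mxE; exact: borel_coord. Qed.

Lemma borel_rsubmx K N k : borel (fun x : 'rV[R]_(K + N) => (rsubmx x 0%R k)%:E).
Proof. by under eq_fun do rewrite mxE; exact: borel_coord. Qed.

End Borel.

(** * Tonelli for the iterated integral *)

Section Iint.
Local Open Scope classical_set_scope.
Local Open Scope ereal_scope.
Variable R : realType.
Notation mu := (@lebesgue_measure R).

Lemma row_mx_ord0 N (a : 'rV[R]_1) (v : 'rV[R]_N) : (row_mx a v : 'rV_N.+1) 0%R ord0 = a 0%R 0%R.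
Proof.
rewrite -(@row_mxEl _ _ 1 N a v 0%R 0%R); congr (row_mx a v _ _); exact: val_inj.
Qed.

Lemma row_mx_lift0 N (a : 'rV[R]_1) (v : 'rV[R]_N) j :
  (row_mx a v : 'rV_N.+1) 0%R (lift ord0 j) = v 0%R j.
Proof.
rewrite -(@row_mxEr _ _ 1 N a v 0%R j); congr (row_mx a v _ _); exact: val_inj.
Qed.

Lemma rsubmx_lift0 N (v : 'rV[R]_N.+1) j : (rsubmx (v : 'rV_(1 + N))) 0%R j = v 0%R (lift ord0 j).
Proof. by rewrite mxE; congr (v _ _); exact: val_inj. Qed.

Lemma iint_ge0 N (g : 'rV[R]_N -> \bar R) : (forall x, 0 <= g x) -> 0 <= iint g.
Proof. by elim: N g => [|N IH] g g0 //=; apply: integral_ge0 => t _; exact: IH. Qed.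

Lemma le_iint N (f g : 'rV[R]_N -> \bar R) : (forall x, 0 <= f x) -> (forall x, f x <= g x) ->
  iint f <= iint g.
Proof.
elim: N f g => [|N IH] f g f0 fg //=.
apply: le_int => t; first by apply: iint_ge0 => v.
exact: IH.
Qed.

Lemma eq_iint N (f g : 'rV[R]_N -> \bar R) : (forall x, f x = g x) -> iint f = iint g.
Proof. by move=> fg; congr iint; apply/funext. Qed.

(* row_mx reassociated: the types ['rV_(K + N.+1)] and ['rV_((K + 1) + N)] are not convertible *)
Lemma borel_assoc K N (g : 'rV[R]_(K + N.+1) -> \bar R) : borel g ->
  borel (fun w : 'rV[R]_((K + 1) + N) =>
    g (row_mx (lsubmx (lsubmx w)) (row_mx (rsubmx (lsubmx w)) (rsubmx w) : 'rV_(1 + N)))).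
Proof.
move=> bg d T L mL; apply: bg => k.
apply: (@measurable_row_mx R K N.+1); first by move=> j; under eq_fun do rewrite !mxE; exact: mL.
by apply: (@measurable_row_mx R 1 N) => j; under eq_fun do rewrite !mxE; exact: mL.
Qed.

(** The parameter ranges over an arbitrary measurable space [T] because the induction moves the
    first integration variable into it, replacing [T] by [T * R]. *)
Lemma measurable_iint N : forall K d (T : measurableType d) (L : T -> 'rV[R]_K)
    (g : 'rV[R]_(K + N) -> \bar R),
  (forall k, measurable_fun setT (fun x => L x 0%R k)) -> borel g -> (forall x, 0 <= g x) ->
  measurable_fun setT (fun x => iint (fun v : 'rV[R]_N => g (row_mx (L x) v))).
Proof.
elim: N => [|N IH] K d T L g mL bg g0 /=.
  by apply: bg; apply: measurable_row_mx => // -[].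
pose g' (w : 'rV[R]_((K + 1) + N)) :=
  g (row_mx (lsubmx (lsubmx w)) (row_mx (rsubmx (lsubmx w)) (rsubmx w) : 'rV_(1 + N))).
have m1 : measurable_fun setT (fun xt : T * R =>
    iint (fun v : 'rV[R]_N => g' (row_mx (row_mx (L xt.1) (const_mx xt.2 : 'rV_1)) v))).
  apply: IH; [|exact: (borel_assoc bg)|by move=> x; exact: g0].
  apply: measurable_row_mx => k; first exact: measurableT_comp (mL k) _.
  by under eq_fun do rewrite mxE; exact: measurable_snd.
have := measurable_fun_fubini_tonelli_F (m2 := mu) _ m1; rewrite /fubini_F /=.
have E x t v : g' (row_mx (row_mx (L x) (const_mx t : 'rV_1)) v) =
   g (row_mx (L x) (row_mx (const_mx t : 'rV_1) v)) by rewrite /g' !row_mxKl !row_mxKr.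
move=> h; apply: eq_measurable_fun (h _) => [x _|x]; last by apply: iint_ge0 => v; exact: g0.
by apply: eq_integral => t _; apply: eq_iint => v; rewrite E.
Qed.

Lemma borel_iint K N (g : 'rV[R]_(K + N) -> \bar R) : borel g -> (forall x, 0 <= g x) ->
  borel (fun u : 'rV[R]_K => iint (fun v : 'rV[R]_N => g (row_mx u v))).
Proof. by move=> bg g0 d T L mL; exact: measurable_iint. Qed.

Lemma measurable_iint1 N (g : 'rV[R]_(1 + N) -> \bar R) : borel g -> (forall x, 0 <= g x) ->
  measurable_fun [set: R] (fun t : R => iint (fun v : 'rV[R]_N => g (row_mx (const_mx t) v))).
Proof.
move=> bg g0; apply: (measurable_iint (L := fun t : R => const_mx t : 'rV_1)) => // k.
by under eq_fun do rewrite mxE; exact: measurable_id.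
Qed.

Lemma borel_section K N (g : 'rV[R]_(K + N) -> \bar R) (u : 'rV[R]_K) : borel g ->
  borel (fun v : 'rV[R]_N => g (row_mx u v)).
Proof.
move=> bg d T L mL; apply: bg; apply: measurable_row_mx => // k.
Qed.

Lemma iint_shift N (g : 'rV[R]_N -> \bar R) (c : 'rV[R]_N) : borel g -> (forall x, 0 <= g x) ->
  iint (fun v => g (v + c)%R) = iint g.
Proof.
elim: N g c => [|N IH] g c bg g0 /=; first by congr g; apply/rowP => -[].
rewrite -(int_shift (c 0 0)%R (measurable_iint1 bg g0)); last first.
  by move=> t; apply: iint_ge0 => v; exact: g0.
apply: eq_integral => t _.
rewrite -(IH (fun v => g (row_mx (const_mx (t + c 0 0)%R : 'rV_1) v)) (@rsubmx _ _ 1 N c)) //.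
  apply: eq_iint => v; congr g; apply/rowP => k.
  rewrite mxE; case: (unliftP ord0 k) => [j|] ->.
    by rewrite !row_mx_lift0 mxE rsubmx_lift0.
  by rewrite !row_mx_ord0 !mxE.
exact: (@borel_section 1 N).
Qed.

(** Two-dimensional Tonelli exchanges t with the first coordinate s of the vector; the induction
    hypothesis, with s frozen ([gs]), exchanges t with the others. *)
Lemma int_iint_swap N (g : 'rV[R]_(1 + N) -> \bar R) : borel g -> (forall x, 0 <= g x) ->
  \int[mu]_(t in [set: R]) iint (fun v : 'rV[R]_N => g (row_mx (const_mx t) v)) =
  iint (fun v : 'rV[R]_N => \int[mu]_(t in [set: R]) g (row_mx (const_mx t) v)).
Proof.
elim: N g => [|N IH] g bg g0 //=.
pose g2 (w : 'rV[R]_((1 + 1) + N)) :=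
  g (row_mx (lsubmx (lsubmx w)) (row_mx (rsubmx (lsubmx w)) (rsubmx w) : 'rV_(1 + N))).
have bg2 : borel g2 := borel_assoc (K := 1) bg.
pose L (ts : R * R) : 'rV[R]_(1 + 1) := row_mx (const_mx ts.1) (const_mx ts.2).
have mL k : measurable_fun setT (fun x => L x 0%R k).
  by apply: measurable_row_mx => j; under eq_fun do rewrite mxE;
    [exact: measurable_fst|exact: measurable_snd].
have m2 := measurable_iint mL bg2 (fun w => g0 _).
have E t s v : g2 (row_mx (L (t, s)) v) =
    g (row_mx (const_mx t : 'rV_1) (row_mx (const_mx s : 'rV_1) v)).
  by rewrite /g2 /L !row_mxKl !row_mxKr.
transitivity (\int[mu]_(t in [set: R]) \int[mu]_(s in [set: R])
    iint (fun v => g2 (row_mx (L (t, s)) v))).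
  by apply: eq_integral => t _; apply: eq_integral => s _; apply: eq_iint => v; rewrite E.
rewrite (fubini_tonelli (m1 := mu) (m2 := mu) _ m2); last first.
  by move=> x; apply: iint_ge0 => v; exact: g0.
apply: eq_integral => s _ /=.
pose gs (w : 'rV[R]_(1 + N)) :=
  g (row_mx (lsubmx w) (row_mx (const_mx s : 'rV_1) (rsubmx w))).
have bgs : borel gs.
  move=> d T K mK; apply: bg; apply: (@measurable_row_mx _ 1 N.+1) => k.
    by under eq_fun do rewrite mxE; exact: mK.
  apply: (@measurable_row_mx _ 1 N) => j; under eq_fun do rewrite mxE; first exact: measurable_cst.
  exact: mK.
transitivity (\int[mu]_(t in [set: R]) iint (fun v => gs (row_mx (const_mx t) v))).
  apply: eq_integral => t _; apply: eq_iint => v.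
  by rewrite E /gs row_mxKl row_mxKr.
rewrite (IH gs bgs (fun w => g0 _)).
apply: eq_iint => v; apply: eq_integral => t _.
by rewrite /gs row_mxKl row_mxKr.
Qed.

Lemma iint_split K N (g : 'rV[R]_(K + N) -> \bar R) :
  iint g = iint (fun u : 'rV[R]_K => iint (fun v : 'rV[R]_N => g (row_mx u v))).
Proof.
elim: K g => [|K IH] g /=.
  apply: eq_iint => v; congr g; apply/rowP => k.
  case: (splitP (m := 0) k) => [[]//|j kj].
  have -> : k = @rshift 0 N j by apply: val_inj.
  by rewrite row_mxEr; congr (v _ _); apply: val_inj.
apply: eq_integral => t _; rewrite IH; apply: eq_iint => u; apply: eq_iint => v.
congr g; apply/rowP => k; case: (unliftP ord0 k) => [j|] ->.
  rewrite row_mx_lift0; case: (splitP j) => i ji.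
    have -> : j = lshift N i by apply: val_inj.
    have -> : lift ord0 (lshift N i) = @lshift K.+1 N (lift ord0 i) by apply: val_inj.
    by rewrite !row_mxEl row_mx_lift0.
  have -> : j = rshift K i by apply: val_inj.
  have -> : lift ord0 (rshift K i) = @rshift K.+1 N i by apply: val_inj.
  by rewrite !row_mxEr.
rewrite row_mx_ord0.
have -> : ord0 = @lshift K.+1 N ord0 by apply: val_inj.
by rewrite (@row_mxEl _ _ K.+1 N) row_mx_ord0.
Qed.

Lemma iint_swap K : forall N (g : 'rV[R]_(K + N) -> \bar R), borel g -> (forall x, 0 <= g x) ->
  iint (fun u : 'rV[R]_K => iint (fun v : 'rV[R]_N => g (row_mx u v))) =
  iint (fun v : 'rV[R]_N => iint (fun u : 'rV[R]_K => g (row_mx u v))).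
Proof.
elim: K => [|K IH] N g bg g0 //=.
pose gt t (w : 'rV[R]_(K + N)) :=
  g (row_mx (row_mx (const_mx t : 'rV_1) (lsubmx w) : 'rV_K.+1) (rsubmx w)).
have bgt t : borel (gt t).
  move=> d T L mL; apply: bg; apply: (@measurable_row_mx _ K.+1 N) => k.
    apply: (@measurable_row_mx _ 1 K) => j; under eq_fun do rewrite mxE; first exact: measurable_cst.
    exact: mL.
  by under eq_fun do rewrite mxE; exact: mL.
have gtE t u v : gt t (row_mx u v) = g (row_mx (row_mx (const_mx t : 'rV_1) u : 'rV_K.+1) v).
  by rewrite /gt row_mxKl row_mxKr.
pose h (w : 'rV[R]_(1 + N)) := iint (fun u : 'rV[R]_K =>
  g (row_mx (row_mx (lsubmx w) u : 'rV_K.+1) (rsubmx w))).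
have bh : borel h.
  move=> d T L mL.
  pose g3 (w : 'rV[R]_((1 + N) + K)) :=
    g (row_mx (row_mx (lsubmx (lsubmx w)) (rsubmx w) : 'rV_K.+1) (rsubmx (lsubmx w))).
  have bg3 : borel g3.
    move=> d' T' L' mL'; apply: bg; apply: (@measurable_row_mx _ K.+1 N) => k.
      by apply: (@measurable_row_mx _ 1 K) => j; under eq_fun do rewrite !mxE; exact: mL'.
    by under eq_fun do rewrite !mxE; exact: mL'.
  have := measurable_iint mL bg3 (fun w => g0 _).
  apply: eq_measurable_fun => x _; apply: eq_iint => u.
  by rewrite /g3 !row_mxKl !row_mxKr.
have := int_iint_swap bh (fun w => iint_ge0 (fun u => g0 _)).
rewrite /h => H.
transitivity (\int[mu]_(t in [set: R]) iint (fun v : 'rV[R]_N => iint (fun u : 'rV[R]_K =>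
    g (row_mx (row_mx (lsubmx (row_mx (const_mx t : 'rV_1) v)) u : 'rV_K.+1)
              (rsubmx (row_mx (const_mx t : 'rV_1) v)))))).
  apply: eq_integral => t _.
  have := IH N (gt t) (bgt t) (fun w => g0 _).
  under [iint _ in X in X = _ -> _]eq_iint do under eq_iint do rewrite gtE.
  move=> ->; apply: eq_iint => v; apply: eq_iint => u.
  by rewrite gtE row_mxKl row_mxKr.
rewrite H; apply: eq_iint => v; apply: eq_integral => t _; apply: eq_iint => u.
by rewrite row_mxKl row_mxKr.
Qed.

Lemma iintZl N (g : 'rV[R]_N -> \bar R) (c : R) : (0 <= c)%R -> borel g -> (forall x, 0 <= g x) ->
  iint (fun v => c%:E * g v) = c%:E * iint g.
Proof.
move=> c0; elim: N g => [|N IH] g bg g0 //=.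
rewrite -ge0_integralZl //.
- by apply: eq_integral => t _; rewrite IH // => d T L mL; exact: (borel_section (K := 1)).
- exact: measurable_iint1.
- by move=> t _; apply: iint_ge0 => v; exact: g0.
Qed.

End Iint.

(** * Linear change of variables by a positive definite matrix *)

Section LinearChange.
Local Open Scope classical_set_scope.
Local Open Scope ereal_scope.
Variable R : realType.
Notation mu := (@lebesgue_measure R).

Definition posdef N (A : 'M[R]_N) := A^T = A /\ forall v : 'rV[R]_N, v != 0%R -> (0 < dotr (v *m A) v)%R.

Lemma dotr_row_mx K N (a a' : 'rV[R]_K) (b b' : 'rV[R]_N) :
  dotr (row_mx a b) (row_mx a' b') = (dotr a a' + dotr b b')%R.
Proof.
rewrite /dotr big_split_ord /=; congr (_ + _)%R; apply: eq_bigr => i _.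
  by rewrite !row_mxEl.
by rewrite !row_mxEr.
Qed.

Lemma row_mx_congr K N (a a' : 'rV[R]_K) (b b' : 'rV[R]_N) :
  a = a' -> b = b' -> row_mx a b = row_mx a' b'.
Proof. by move=> -> ->. Qed.

(* induction through the Schur complement: [A] is a shear, a positive scaling of the first
   coordinate and a smaller positive definite matrix, and each factor changes one integral *)
Lemma iint_posdef N (A : 'M[R]_N) (g : 'rV[R]_N -> \bar R) : posdef A ->
  borel g -> (forall x, 0 <= g x) ->
  (0 < \det A)%R /\ (\det A)%:E * iint (fun v => g (v *m A)) = iint g.
Proof.
elim: N A g => [|N IH] A g [As Ap] bg g0.
  split; first by rewrite det_mx00.
  rewrite det_mx00 mul1e /=; congr g; apply/rowP => -[] //.
pose A' : 'M[R]_(1 + N) := A.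
pose a := A' 0%R 0%R.
pose b : 'rV[R]_N := ursubmx A'.
pose B : 'M[R]_N := drsubmx A'.
have AE : A' = block_mx (a%:M)%R b (b^T)%R B.
  rewrite -[LHS]submxK; congr block_mx.
    by apply/matrixP => i j; rewrite !ord1 !mxE /= mulr1n; congr (A _ _); apply: val_inj.
  by rewrite /b trmx_ursub; congr dlsubmx; rewrite /A' As.
have Bs : B^T = B by rewrite /B trmx_drsub; congr drsubmx; rewrite /A' As.
have mulA (t : 'rV[R]_1) v : row_mx t v *m A' = row_mx (a *: t + v *m b^T)%R (t *m b + v *m B)%R.
  by rewrite AE mul_row_block mul_mx_scalar.
clearbody a b B.
have Ap' (t : 'rV[R]_1) (v : 'rV[R]_N) : row_mx t v != 0%R ->
    (0 < dotr (a *: t + v *m b^T)%R t + dotr (t *m b + v *m B)%R v)%R.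
  by move=> h; rewrite -dotr_row_mx -mulA; exact: (Ap _ h).
have dot1 (x y : 'rV[R]_1) : dotr x y = (x 0 0 * y 0 0)%R by rewrite /dotr big_ord1.
have a0 : (0 < a)%R.
  have := Ap' (const_mx 1%R) 0%R; rewrite mul0mx addr0 dotr0r addr0 dot1 !mxE !mulr1; apply.
  apply/eqP => /(congr1 (@lsubmx _ _ 1 N)) /rowP /(_ 0%R).
  by rewrite row_mxKl !mxE => /eqP; rewrite oner_eq0.
have an0 : a != 0%R by rewrite gt_eqF.
pose S := (B - a^-1 *: (b^T *m b))%R.
have Ss : S^T = S by rewrite /S linearB /= linearZ /= trmx_mul trmxK Bs.
have Sp : posdef S.
  split=> // v v0.
  (* The first coordinate that minimizes the form for given v; at this vector the form of [A]
     reduces to that of the Schur complement. *)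
  have := Ap' (- a^-1 *: (v *m b^T))%R v.
  rewrite !scalerA mulrN mulfV // scaleN1r addNr dotr0l add0r dotrC.
  rewrite dotrC scaleNr mulNmx -scalemxAl [X in dotr X _]addrC /S mulmxBr -scalemxAr mulmxA; apply.
  apply: contra_neq v0 => /(congr1 (@rsubmx _ _ 1 N)).
  by rewrite row_mxKr => ->; apply/rowP => i; rewrite !mxE.
have dA : \det A = (a * \det S)%R.
  pose U : 'M[R]_(1 + N) := block_mx (1%:M)%R 0%R (a^-1 *: b^T)%R (1%:M)%R.
  pose W : 'M[R]_(1 + N) := block_mx (a%:M)%R b 0%R S.
  have -> : A = (U *m W)%R.
    rewrite -[LHS]/A' AE /U /W mulmx_block !mul1mx !mul0mx !addr0 mul_mx_scalar scalerA mulfV //.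
    by rewrite scale1r /S -scalemxAl addrC subrK.
  by rewrite (@det_mulmx _ N.+1) (@det_lblock _ 1 N) (@det_ublock _ 1 N) !det1 !mul1r det_scalar expr1.
have [dS _] := IH S (fun=> 0) Sp (@borel_cst _ _ _) (fun=> lexx _).
split; first by rewrite dA mulr_gt0.
pose H (t : R) := iint (fun v : 'rV[R]_N => g (row_mx (const_mx t : 'rV_1) v)).
pose G (w : 'rV[R]_(1 + N)) := g (row_mx (a *: lsubmx w)%R (lsubmx w *m b + rsubmx w *m S)%R : 'rV_(1 + N)).
pose beta (v : 'rV[R]_N) := (a^-1 * (v *m b^T) 0 0)%R.
have bS K (f : 'rV[R]_K -> 'rV[R]_N) M (C : 'M[R]_(N, M)) k :
    (forall k, borel (fun w => (f w 0%R k)%:E)) -> borel (fun w => ((f w *m C) 0%R k)%:E).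
  move=> bf; exact: (borel_comp bf (borel_mulmx C (borel_coord k))).
have bS1 K (f : 'rV[R]_K -> 'rV[R]_1) M (C : 'M[R]_(1, M)) k :
    (forall k, borel (fun w => (f w 0%R k)%:E)) -> borel (fun w => ((f w *m C) 0%R k)%:E).
  move=> bf; exact: (borel_comp bf (borel_mulmx C (borel_coord k))).
have bG : borel G.
  apply: (borel_row_mx (K := 1) (N := N)) => // k.
    under eq_fun do rewrite mxE.
    exact: (borelM_fin (@borel_cst _ _ a%:E) (borel_lsubmx k)).
  under eq_fun do rewrite mxE.
  exact: (borelD_fin (bS1 _ _ _ _ _ (@borel_lsubmx _ _ _)) (bS _ _ _ _ _ (@borel_rsubmx _ _ _))).
have G0 w : 0 <= G w by exact: g0.
(* [v *m A] has first block a (t + beta v), so in terms of [G] the matrix acts through the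
   translation of t by [beta v]. *)
pose Gs (w : 'rV[R]_(1 + N)) := G (row_mx (lsubmx w + const_mx (beta (rsubmx w)))%R (rsubmx w)).
have bGs : borel Gs.
  apply: (borel_row_mx (K := 1) (N := N)) => // k; last exact: borel_rsubmx.
  under eq_fun do rewrite mxE [X in (_ + X)%R]mxE.
  have bb : borel (fun w : 'rV[R]_(1 + N) => (beta (rsubmx w))%:E).
    exact: (borelM_fin (@borel_cst _ _ (a^-1)%:E) (bS _ _ _ _ _ (@borel_rsubmx _ _ _))).
  exact: (borelD_fin (borel_lsubmx _) bb).
have gA (t : R) v : g (row_mx (const_mx t : 'rV_1) v *m A') = Gs (row_mx (const_mx t) v).
  rewrite mulA /Gs /G !row_mxKl !row_mxKr; apply: (congr1 g); apply: (@row_mx_congr 1 N).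
    apply/rowP => i; rewrite !ord1 !mxE mulrDr /beta mulrA mulfV // mul1r; congr (_ + _)%R.
    by rewrite mxE.
  rewrite mulmxDl -addrA; congr (_ + _)%R.
  have -> : (const_mx (beta v) : 'rV_1) = (a^-1 *: (v *m b^T))%R.
    by apply/rowP => i; rewrite !ord1 mxE /beta [RHS]mxE.
  by rewrite /S mulmxBr -scalemxAr mulmxA -scalemxAl [(_ + (_ - _))%R]addrC subrK.
(* The translation of t depends on v: the integrations are exchanged, the translation is removed for
   fixed v, and the order is restored. *)
have step1 : iint (fun v => g (v *m A)) = \int[mu]_(t in [set: R]) iint (fun v => G (row_mx (const_mx t) v)).
  transitivity (\int[mu]_(t in [set: R]) iint (fun v => Gs (row_mx (const_mx t) v))).
    by apply: eq_integral => t _; apply: eq_iint => v; exact: gA.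
  rewrite (int_iint_swap bGs (fun w => G0 _)) (int_iint_swap bG G0).
  apply: eq_iint => v.
  rewrite -(@int_shift _ (beta v) (fun t => G (row_mx (const_mx t) v))).
  - apply: eq_integral => t _; rewrite /Gs row_mxKl row_mxKr; apply: (congr1 G); apply: (@row_mx_congr 1 N).
    by apply/rowP => i; rewrite !mxE.
    by [].
  - apply: (bG _ _ (fun t : R => row_mx (const_mx t) v)); apply: (@measurable_row_mx _ 1 N) => k //.
    by under eq_fun do rewrite mxE; exact: measurable_id.
  - by move=> t; exact: G0.
have step2 t : (\det S)%:E * iint (fun v => G (row_mx (const_mx t) v)) = H (a * t + 0)%R.
  rewrite addr0 /H.
  pose k (v : 'rV[R]_N) := g (row_mx (const_mx (a * t)%R : 'rV_1) (v + (const_mx t : 'rV_1) *m b)%R).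
  have bk0 := @borel_section _ 1 N g (const_mx (a * t)%R) bg.
  have bk : borel k by exact: (borel_shift _ bk0).
  have [_ IHk] := IH S k Sp bk (fun v => g0 _).
  rewrite -(iint_shift ((const_mx t : 'rV_1) *m b) bk0) // -IHk; congr (_ * _).
  apply: eq_iint => v; rewrite /G /k row_mxKl row_mxKr addrC; apply: (congr1 g); apply: (@row_mx_congr 1 N).
  by apply/rowP => i; rewrite !mxE.
  by [].
apply: eq_trans (congr1 (fun z => (\det A)%:E * z) step1) _.
rewrite dA EFinM -muleA -ge0_integralZl //; last 3 first.
- exact: measurable_iint1.
- by move=> t _; apply: iint_ge0 => v; exact: G0.
- exact: ltW.
under eq_integral do rewrite step2.
rewrite int_affine //; first exact: measurable_iint1.
by move=> t; apply: iint_ge0 => v; exact: g0.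
Qed.
End LinearChange.

(** * Cauchy's formula on squares *)

Section Segment.
Local Open Scope classical_set_scope.
Variable R : realType.
Notation mu := (@lebesgue_measure R).
Implicit Types (f g F G : R -> R) (a b c : R).

Definition segint f a b : R := \int[mu]_(x in `[a, b]) f x.

Definition cont_on f a b := forall x, a <= x <= b -> {for x, continuous f}.

Lemma cont_on_within f a b : cont_on f a b -> {within `[a, b], continuous f}.
Proof.
move=> cf; apply/continuous_in_subspaceT => x; rewrite inE /= in_itv /= => hx.
exact: cf.
Qed.

Lemma is_derive_cont_on F f a b : (forall x, a <= x <= b -> is_derive x (1 : R) F (f x)) ->
  cont_on F a b.
Proof.
move=> dF x /dF h; apply: differentiable_continuous; apply/derivable1_diffP.
by case: h.
Qed.

Lemma segint_prim f F a b : a <= b -> cont_on f a b ->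
  (forall x, a <= x <= b -> is_derive x (1 : R) F (f x)) -> segint f a b = F b - F a.
Proof.
rewrite le_eqVlt => /predU1P[->|ab] cf dF.
  by rewrite /segint set_itv1 Rintegral_set1 subrr.
rewrite /segint /Rintegral (@continuous_FTC2 _ f F a b) //; first exact: cont_on_within.
  have cF := is_derive_cont_on dF; split.
  - move=> x; rewrite in_itv /= => /andP[/ltW ax /ltW xb].
    by case: (dF x); rewrite ?ax.
  - by apply: cvg_at_right_filter; apply: cF; rewrite lexx ltW.
  - by apply: cvg_at_left_filter; apply: cF; rewrite lexx ltW.
move=> x; rewrite in_itv /= => /andP[/ltW ax /ltW xb].
have h : a <= x <= b by rewrite ax.
by rewrite derive1E; case: (dF x h).
Qed.

Lemma prim_exists f a b : a <= b -> cont_on f a b ->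
  exists F, forall x, a <= x <= b -> is_derive x (1 : R) F (f x).
Proof.
move=> ab cf.
(* Clamping to [a, b] extends f continuously to the line, and the primitive starts at a - 1, so the
   fundamental theorem applies at both endpoints. *)
pose cl x := Order.max a (Order.min b x).
have cl_in x : a <= cl x <= b by rewrite /cl le_max lexx /= ge_max ab ge_min lexx.
have clE x : a <= x <= b -> cl x = x by move=> /andP[? ?]; rewrite /cl min_r // max_r.
have ccl : continuous cl.
  move=> x; apply: (@continuous_max R R (fun=> a) (fun x => Order.min b x)); first exact: cvg_cst.
  by apply: (@continuous_min R R (fun=> b) id); [exact: cvg_cst|exact: cvg_id].
pose g x := f (cl x).
have cg : continuous g.
  by move=> x; apply: continuous_comp; [exact: ccl|apply: cf; exact: cl_in].
have ig : mu.-integrable [set` Interval (BLeft (a - 1)) (BRight (b + 1))] (EFin \o g).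
  apply: continuous_compact_integrable; first exact: segment_compact.
  exact: continuous_subspaceT.
exists (fun x => \int[mu]_(t in [set` Interval (BLeft (a - 1)) (BRight x)]) g t) => x /andP[ax xb].
have xu : x < b + 1 by lra.
have aX : a - 1 < x by lra.
have [d1 d2] := continuous_FTC1_closed xu ig aX (cg x).
by apply: DeriveDef => //; rewrite -derive1E d2 /g clE // ax.
Qed.

Lemma cont_onS f a b c d : a <= c -> d <= b -> cont_on f a b -> cont_on f c d.
Proof. by move=> ac db cf x /andP[h1 h2]; apply: cf; rewrite (le_trans ac) //= (le_trans h2). Qed.

Lemma segint_cat f a b c : a <= b -> b <= c -> cont_on f a c ->
  segint f a c = segint f a b + segint f b c.
Proof.
move=> ab bc cf; have [F dF] := prim_exists (le_trans ab bc) cf.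
have E u v : a <= u -> u <= v -> v <= c -> segint f u v = F v - F u.
  move=> au uv vc; apply: segint_prim => //; first exact: cont_onS cf.
  by move=> x h; apply: dF; lra.
by rewrite !E //; [ring|lra].
Qed.

Lemma segint_lin (u v : R) f g a b : a <= b -> cont_on f a b -> cont_on g a b ->
  segint (fun x => u * f x + v * g x) a b = u * segint f a b + v * segint g a b.
Proof.
move=> ab cf cg; have [F dF] := prim_exists ab cf; have [G dG] := prim_exists ab cg.
rewrite (segint_prim ab cf dF) (segint_prim ab cg dG).
have -> : u * (F b - F a) + v * (G b - G a) = (u * F b + v * G b) - (u * F a + v * G a) by ring.
apply: (@segint_prim _ (fun x => u * F x + v * G x)) => //.
  move=> x h; apply: cvgD; apply: cvgM; [exact: cvg_cst|exact: cf|exact: cvg_cst|exact: cg].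
move=> x h; have ? := dF x h; have ? := dG x h.
by apply: is_derive_eq; rewrite /GRing.scale /=; ring.
Qed.

Lemma eq_segint f g a b : (forall x, a <= x <= b -> f x = g x) -> segint f a b = segint g a b.
Proof. by move=> fg; apply: eq_Rintegral => x; rewrite inE /= in_itv /= => /fg. Qed.

Lemma segint_close f g a b M : a <= b -> cont_on f a b -> cont_on g a b ->
  (forall x, a <= x <= b -> `|f x - g x| <= M) -> `|segint f a b - segint g a b| <= M * (b - a).
Proof.
move=> ab cf cg fg; have [F dF] := prim_exists ab cf; have [G dG] := prim_exists ab cg.
rewrite (segint_prim ab cf dF) (segint_prim ab cg dG).
have dFG x : a <= x <= b -> is_derive x (1 : R) (fun x => F x - G x) (f x - g x).
  by move=> h; have ? := dF x h; have ? := dG x h; apply: is_deriveB.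
have [c /[!in_itv] /= hc E] := @MVT_segment _ _ (fun x => f x - g x) a b ab
   (fun x h => dFG x (subset_itv_oo_cc h)) (cont_on_within (is_derive_cont_on dFG)).
have -> : F b - F a - (G b - G a) = (F b - G b) - (F a - G a) by ring.
rewrite E normrM [`|b - a|]ger0_norm ?subr_ge0 //.
by apply: ler_wpM2r; [rewrite subr_ge0|exact: fg].
Qed.

Lemma cont_on_cst c a b : cont_on (fun=> c) a b.
Proof. by move=> x _; exact: cvg_cst. Qed.

Lemma segint0 a b : a <= b -> segint (fun=> 0) a b = 0.
Proof.
move=> ab; transitivity (0 - 0 : R); last by rewrite subrr.
by apply: (@segint_prim _ (fun=> 0)) => //; exact: cont_on_cst.
Qed.

Lemma segint_le f a b M : a <= b -> cont_on f a b ->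
  (forall x, a <= x <= b -> `|f x| <= M) -> `|segint f a b| <= M * (b - a).
Proof.
move=> ab cf fM; rewrite -[segint f a b]subr0 -(segint0 ab); apply: segint_close => //.
  exact: cont_on_cst.
by move=> x h; rewrite subr0; exact: fM.
Qed.

Lemma segint_shift f a b c : a <= b -> cont_on f (a + c) (b + c) ->
  segint (fun x => f (x + c)) a b = segint f (a + c) (b + c).
Proof.
move=> ab cf; have ab' : a + c <= b + c by lra.
have [F dF] := prim_exists ab' cf.
rewrite (segint_prim ab' cf dF); apply: (@segint_prim _ (fun x => F (x + c))) => //.
  move=> x h; apply: (@continuous_comp _ _ _ (fun x => x + c) f).
    by apply: cvgD; [exact: cvg_id|exact: cvg_cst].
  by apply: cf; lra.
move=> x h.
have dl : is_derive x (1 : R) (fun x => x + c) 1 by apply: is_derive_eq; rewrite addr0.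
have dF' : is_derive (x + c) (1 : R) F (f (x + c)) by apply: dF; lra.
have := @is_derive1_comp _ F (fun x => x + c) x _ _ dF' dl.
by rewrite mulr1.
Qed.

Lemma segint_affine (u v m : R) a b : a <= b ->
  segint (fun x => u + v * (x - m)) a b = u * (b - a) + v * ((b - m) ^+ 2 - (a - m) ^+ 2) / 2.
Proof.
move=> ab; transitivity ((u * b + v / 2 * (b - m) ^+ 2) - (u * a + v / 2 * (a - m) ^+ 2)); last by field.
apply: (@segint_prim _ (fun x => u * x + v / 2 * (x - m) ^+ 2)) => //.
  move=> x _; apply: cvgD; first exact: cvg_cst.
  by apply: cvgM; [exact: cvg_cst|apply: cvgB; [exact: cvg_id|exact: cvg_cst]].
move=> x _; apply: is_derive_eq; by rewrite /GRing.scale /=; field.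
Qed.

End Segment.

(** * Goursat's lemma for closed forms on rectangles *)

Section Goursat.
Local Open Scope classical_set_scope.
Variable R : realType.
Implicit Types (P Q : R -> R -> R) (a b c d x y s t p q m h eps del : R).

(** The integral of P dx + Q dy over the positively oriented boundary of [a, b] x [c, d]. *)
Definition formint P Q a b c d : R :=
  segint (fun x => P x c) a b + segint (fun y => Q b y) c d
  - segint (fun x => P x d) a b - segint (fun y => Q a y) c d.

(** P and Q are differentiable at the point, and the shared coefficient [m] says dP/dy = dQ/dx
    there: the form P dx + Q dy is closed pointwise, with no continuity of derivatives. *)
Definition closed_diff_at P Q x y := exists p m q, forall eps, 0 < eps ->
  exists2 del, 0 < del & forall h k, `|h| <= del -> `|k| <= del ->
    `|P (x + h) (y + k) - P x y - (p * h + m * k)| <= eps * (`|h| + `|k|) /\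
    `|Q (x + h) (y + k) - Q x y - (m * h + q * k)| <= eps * (`|h| + `|k|).

Lemma cont_lin (f : R -> R) x p : (exists2 del, 0 < del & forall h, `|h| <= del ->
    `|f (x + h) - f x - p * h| <= `|h|) -> {for x, continuous f}.
Proof.
case=> del d0 H; apply/cvgrPdist_le => /= eps e0.
have m0 : 0 < `|p| + 1 by rewrite ltr_wpDl.
near=> z.
have hz : `|z - x| <= eps / (`|p| + 1).
  near: z; apply/nbhs_ballP; exists (eps / (`|p| + 1)); rewrite /= ?divr_gt0 //.
  by move=> z /=; rewrite distrC => /ltW.
have hz' : `|z - x| <= del.
  near: z; apply/nbhs_ballP; exists del => //.
  by move=> z /=; rewrite distrC => /ltW.
have := H _ hz'; rewrite [x + _]addrC subrK => H1.
rewrite distrC.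
have -> : f z - f x = (f z - f x - p * (z - x)) + p * (z - x) by ring.
apply: le_trans (ler_normD _ _) _; rewrite normrM.
move: hz; rewrite ler_pdivlMr // => hz; lra.
Unshelve. all: by end_near. Qed.

Lemma closed_diff_contl P Q x y : closed_diff_at P Q x y -> {for x, continuous (fun x => P x y)}.
Proof.
case=> p [m [q /(_ 1 ltr01)[del d0 H]]]; apply: (cont_lin (p := p)); exists del => // h hd.
have [] := H h 0 hd; first by rewrite normr0 ltW.
by rewrite addr0 mulr0 !addr0 mul1r normr0 addr0.
Qed.

Lemma closed_diff_contr P Q x y : closed_diff_at P Q x y -> {for y, continuous (fun y => Q x y)}.
Proof.
case=> p [m [q /(_ 1 ltr01)[del d0 H]]]; apply: (cont_lin (p := q)); exists del => // h hd.
have [] := H 0 h _ hd; first by rewrite normr0 ltW.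
by move=> _; rewrite addr0 mulr0 !add0r mul1r normr0 add0r.
Qed.

Definition closed_diff_on P Q a b c d :=
  forall x y, a <= x <= b -> c <= y <= d -> closed_diff_at P Q x y.

Lemma formint_split P Q a b c d x y : a <= x <= b -> c <= y <= d -> closed_diff_on P Q a b c d ->
  formint P Q a b c d = formint P Q a x c y + formint P Q x b c y +
                        formint P Q a x y d + formint P Q x b y d.
Proof.
move=> /andP[ax xb] /andP[cy yd] H.
have cP z u v : c <= z <= d -> a <= u -> v <= b -> cont_on (fun x => P x z) u v.
  by move=> hz au vb w /andP[h1 h2]; apply: closed_diff_contl (H _ _ _ hz); lra.
have cQ z u v : a <= z <= b -> c <= u -> v <= d -> cont_on (fun y => Q z y) u v.
  by move=> hz au vb w /andP[h1 h2]; apply: closed_diff_contr (H _ _ hz _); lra.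
rewrite /formint.
rewrite (segint_cat (f := P^~ c) ax xb) ?(segint_cat (f := P^~ d) ax xb); try by apply: cP; lra.
rewrite (segint_cat (f := Q b) cy yd) ?(segint_cat (f := Q a) cy yd); try by apply: cQ; lra.
ring.
Qed.

(** The affine parts form an exact differential, because of the common coefficient [m], and drop out
    of the boundary integral. Each side then contributes at most eps times the half-perimeter times
    its length. *)
Lemma formint_near_linear P Q a b c d x y p m q eps :
  a <= x <= b -> c <= y <= d -> closed_diff_on P Q a b c d ->
  (forall h k, `|h| <= b - a -> `|k| <= d - c ->
    `|P (x + h) (y + k) - P x y - (p * h + m * k)| <= eps * (`|h| + `|k|) /\
    `|Q (x + h) (y + k) - Q x y - (m * h + q * k)| <= eps * (`|h| + `|k|)) ->
  0 <= eps -> `|formint P Q a b c d| <= 2 * eps * ((b - a) + (d - c)) ^+ 2.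
Proof.
move=> hx hy H E e0.
have ab : a <= b by lra.
have cd : c <= d by lra.
have cP z : c <= z <= d -> cont_on (fun x => P x z) a b.
  by move=> hz w h; apply: closed_diff_contl (H _ _ h hz).
have cQ z : a <= z <= b -> cont_on (fun y => Q z y) c d.
  by move=> hz w h; apply: closed_diff_contr (H _ _ hz h).
have ca u v w a' b' : cont_on (fun x => u + v * (x - w) : R) a' b'.
  move=> z _; apply: cvgD; first exact: cvg_cst.
  by apply: cvgM; [exact: cvg_cst|apply: cvgB; [exact: cvg_id|exact: cvg_cst]].
have eb (u v : R) : `|u| <= b - a -> `|v| <= d - c -> eps * (`|u| + `|v|) <= eps * ((b - a) + (d - c)).
  by move=> h1 h2; rewrite ler_wpM2l // lerD.
have bP z : c <= z <= d -> `|segint (fun x => P x z) a b -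
    segint (fun w => (P x y + m * (z - y)) + p * (w - x)) a b| <= eps * ((b - a) + (d - c)) * (b - a).
  move=> hz; apply: segint_close => //; first exact: cP.
  move=> w hw; have h1 : `|w - x| <= b - a by rewrite ler_norml; lra.
  have h2 : `|z - y| <= d - c by rewrite ler_norml; lra.
  have [+ _] := E _ _ h1 h2; rewrite (addrC x) (addrC y) !subrK => E1.
  apply: le_trans (eb _ _ h1 h2); apply: le_trans E1; rewrite le_eqVlt; apply/orP; left; apply/eqP.
  by congr `|_|; ring.
have bQ z : a <= z <= b -> `|segint (fun y => Q z y) c d -
    segint (fun w => (Q x y + m * (z - x)) + q * (w - y)) c d| <= eps * ((b - a) + (d - c)) * (d - c).
  move=> hz; apply: segint_close => //; first exact: cQ.
  move=> w hw; have h1 : `|z - x| <= b - a by rewrite ler_norml; lra.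
  have h2 : `|w - y| <= d - c by rewrite ler_norml; lra.
  have [_ +] := E _ _ h1 h2; rewrite (addrC x) (addrC y) !subrK => E1.
  apply: le_trans (eb _ _ h1 h2); apply: le_trans E1; rewrite le_eqVlt; apply/orP; left; apply/eqP.
  by congr `|_|; ring.
have hc : c <= c <= d by rewrite lexx.
have hd : c <= d <= d by rewrite lexx andbT.
have ha : a <= a <= b by rewrite lexx.
have hb : a <= b <= b by rewrite lexx andbT.
move: (bP c hc) (bP d hd) (bQ a ha) (bQ b hb).
rewrite !segint_affine // /formint.
set I1 := segint _ _ _; set I2 := segint _ _ _; set I3 := segint _ _ _; set I4 := segint _ _ _.
set M1 := (X in `|_ - X| <= _ -> _); set M2 := (X in _ -> `|_ - X| <= _ -> _).
set M3 := (X in _ -> _ -> `|_ - X| <= _ -> _); set M4 := (X in _ -> _ -> _ -> `|_ - X| <= _ -> _).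
move=> h1 h2 h3 h4.
have -> : I1 + I4 - I2 - I3 = (I1 - M1) + (I4 - M4) - (I2 - M2) - (I3 - M3).
  by rewrite /M1 /M2 /M3 /M4; field.
apply: le_trans (ler_normB _ _) _; apply: le_trans (lerD (ler_normB _ _) (lexx _)) _.
apply: le_trans (lerD (lerD (ler_normD _ _) (lexx _)) (lexx _)) _.
apply: le_trans (lerD (lerD (lerD h1 h4) h2) h3) _.
by rewrite le_eqVlt; apply/orP; left; apply/eqP; ring.
Qed.

Lemma nested_point (u w : nat -> R) : (forall k, u k <= u k.+1) -> (forall k, w k.+1 <= w k) ->
  (forall k, u k <= w k) -> exists x, forall k, u k <= x <= w k.
Proof.
move=> iu dw uw.
have mu := homo_leq (@lexx _ _) le_trans iu.
have mw : {homo w : i j / (i <= j)%N >-> j <= i}.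
  by apply: homo_leq => // y x z xy yz; exact: le_trans yz xy.
have uw' j k : u j <= w k.
  have [/mu|/ltnW/mw] := leqP j k => h; first exact: le_trans h (uw k).
  exact: le_trans (uw j) h.
have ub : ubound (range u) (w 0%N) by move=> _ [j _ <-].
exists (sup (range u)) => k; apply/andP; split.
  by apply: ub_le_sup; [exists (w 0%N)|exists k].
by apply: ge_sup; [exists (u 0%N), 0%N|move=> _ [j _ <-]].
Qed.

Lemma halving_gt0 (v : R) eps : 0 <= v -> 0 < eps -> exists k : nat, v / 2 ^+ k <= eps.
Proof.
move=> v0 e0; exists (Num.bound (v / eps)); rewrite ler_pdivrMr ?exprn_gt0 //.
have h : v / eps < (Num.bound (v / eps))%:R by rewrite archi_boundP // divr_ge0 // ltW.
rewrite ltr_pdivrMr // in h; apply: le_trans (ltW h) _; rewrite mulrC.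
rewrite ler_wpM2l ?(ltW e0) // -natrX ler_nat; apply: ltnW; exact: ltn_expl.
Qed.

Lemma halved_interval a b x x' (u v : R) : a <= x -> x + v <= b -> v = u + u -> x <= x' <= x + u ->
  [/\ a <= x', x' + u <= b, x <= x' & x' + u <= x + v].
Proof. by move=> h1 h2 vE /andP[h3 h4]; split; lra. Qed.

(** Bisection: some quarter carries at least a quarter of the integral, while near the common point
    of the nested rectangles [formint_near_linear] makes the integral small against the square of
    the size. *)
Lemma goursat P Q a b c d : a <= b -> c <= d -> closed_diff_on P Q a b c d ->
  formint P Q a b c d = 0.
Proof.
move=> ab cd H; apply/eqP; rewrite -normr_le0 leNgt; apply/negP => I0.
set I := `|_| in I0.
pose s := b - a; pose t := d - c.
have s0 : 0 <= s by rewrite subr_ge0.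
have t0 : 0 <= t by rewrite subr_ge0.
pose sg k := s / 2 ^+ k; pose tg k := t / 2 ^+ k.
have p2 k : 0 < 2 ^+ k :> R by rewrite exprn_gt0.
have sg0 k : 0 <= sg k by rewrite divr_ge0 // ltW.
have tg0 k : 0 <= tg k by rewrite divr_ge0 // ltW.
have sgS k : sg k = sg k.+1 + sg k.+1 by rewrite /sg exprS; field; rewrite gt_eqF.
have tgS k : tg k = tg k.+1 + tg k.+1 by rewrite /tg exprS; field; rewrite gt_eqF.
(* A rectangle of generation k has sides [sg k] and [tg k], so its lower left corner determines
   it. *)
pose ok k (p : R * R) := [/\ a <= p.1, p.1 + sg k <= b, c <= p.2 & p.2 + tg k <= d].
pose J k (p : R * R) := `|formint P Q p.1 (p.1 + sg k) p.2 (p.2 + tg k)|.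
have stepE (kp : nat * (R * R)) : exists p' : R * R, ok kp.1 kp.2 ->
  [/\ ok kp.1.+1 p', kp.2.1 <= p'.1, p'.1 + sg kp.1.+1 <= kp.2.1 + sg kp.1, kp.2.2 <= p'.2 &
      p'.2 + tg kp.1.+1 <= kp.2.2 + tg kp.1 /\ J kp.1 kp.2 <= 4 * J kp.1.+1 p'].
  case: kp => k [x y] /=.
  have [kok|nok] := pselect (ok k (x, y)); last by exists (x, y).
  have [/= h1 h2 h3 h4] := kok.
  have s1 := sg0 k.+1; have s2 := sgS k; have t1 := tg0 k.+1; have t2 := tgS k.
  pose x' := x + sg k.+1; pose y' := y + tg k.+1.
  have Hk : closed_diff_on P Q x (x + sg k) y (y + tg k).
    by move=> u v hu hv; apply: H; lra.
  have hx' : x <= x' <= x + sg k by rewrite /x'; lra.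
  have hy' : y <= y' <= y + tg k by rewrite /y'; lra.
  have := formint_split hx' hy' Hk.
  have -> : x + sg k = x' + sg k.+1 by rewrite /x' s2; ring.
  have -> : y + tg k = y' + tg k.+1 by rewrite /y' t2; ring.
  move=> E.
  have Ek : J k (x, y) <= J k.+1 (x, y) + J k.+1 (x', y) + J k.+1 (x, y') + J k.+1 (x', y').
    rewrite /J /= s2 t2 !addrA -/x' -/y' E.
    apply: le_trans (ler_normD _ _) _; rewrite lerD2r.
    by apply: le_trans (ler_normD _ _) _; rewrite lerD2r; exact: ler_normD.
  have good (x1 y1 : R) : x <= x1 <= x' -> y <= y1 <= y' -> J k (x, y) <= 4 * J k.+1 (x1, y1) ->
    exists p' : R * R, ok k (x, y) -> [/\ ok k.+1 p', x <= p'.1, p'.1 + sg k.+1 <= x' + sg k.+1, y <= p'.2 &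
      p'.2 + tg k.+1 <= y' + tg k.+1 /\ J k (x, y) <= 4 * J k.+1 p'].
    move=> hx1 hy1 hJ; exists (x1, y1) => _.
    have [? ? ? ?] := halved_interval h1 h2 s2 hx1.
    have [? ? ? ?] := halved_interval h3 h4 t2 hy1.
    by rewrite /x' /y' -!addrA -s2 -t2.
  have xx' : x <= x <= x' by rewrite lexx lerDl.
  have yy' : y <= y <= y' by rewrite lexx lerDl.
  have x'x' : x <= x' <= x' by rewrite lexx lerDl s1.
  have y'y' : y <= y' <= y' by rewrite lexx lerDl t1.
  have [/(good _ _ xx' yy')//|g1] := leP (J k (x, y)) (4 * J k.+1 (x, y)).
  have [/(good _ _ x'x' yy')//|g2] := leP (J k (x, y)) (4 * J k.+1 (x', y)).
  have [/(good _ _ xx' y'y')//|g3] := leP (J k (x, y)) (4 * J k.+1 (x, y')).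
  apply: (good _ _ x'x' y'y'); move: Ek g1 g2 g3.
  move: (J k _) (J k.+1 _) (J k.+1 _) (J k.+1 _) (J k.+1 _) => j0 j1 j2 j3 j4; lra.
have [next hnext] := choice stepE.
pose fix sq k := if k is k'.+1 then next (k', sq k') else (a, c).
have sq_ok k : ok k (sq k).
  elim: k => [|k IH]; last by case: (hnext (k, sq k) IH).
  by split => //=; rewrite /sg /tg expr0 divr1 /s /t; lra.
have sqS k := hnext (k, sq k) (sq_ok k).
have JI k : I <= 4 ^+ k * J k (sq k).
  elim: k => [|k IH].
    rewrite expr0 mul1r /J /= /sg /tg expr0 !divr1 /s /t !(addrC _ (_ - _)) !subrK //.
  case: (sqS k) => _ _ _ _ [_ /= hJ]; apply: le_trans IH _.
  by rewrite exprSr -mulrA ler_wpM2l // exprn_ge0.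
have [x hx] : exists x, forall k, (sq k).1 <= x <= (sq k).1 + sg k.
  apply: (nested_point (u := fun k => (sq k).1) (w := fun k => (sq k).1 + sg k)) => k.
  - by case: (sqS k).
  - by case: (sqS k).
  - by rewrite lerDl.
have [y hy] : exists y, forall k, (sq k).2 <= y <= (sq k).2 + tg k.
  apply: (nested_point (u := fun k => (sq k).2) (w := fun k => (sq k).2 + tg k)) => k.
  - by case: (sqS k).
  - by case: (sqS k) => _ _ _ _ [].
  - by rewrite lerDl.
have hxy : closed_diff_at P Q x y.
  by apply: H; [have [? ? _ _] := sq_ok 0%N; have := hx 0%N|have [_ _ ? ?] := sq_ok 0%N; have := hy 0%N]; lra.
case: hxy => p [m [q E]].
(* Chosen so that 2 eps (s + t)^2 is at most I / 2; the 1 in the denominator takes care of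
   degenerate rectangles. *)
pose eps := I / (4 * (s + t + 1) ^+ 2).
have st0 : 0 < (s + t + 1) ^+ 2 by rewrite exprn_gt0 //; lra.
have e0 : 0 < eps by rewrite divr_gt0 // mulr_gt0.
have [del d0 {}E] := E eps e0.
have [k hk] := halving_gt0 (addr_ge0 s0 t0) d0.
have sgk : sg k + tg k <= del by rewrite /sg /tg -mulrDl.
have : J k (sq k) <= 2 * eps * (sg k + tg k) ^+ 2.
  have -> : sg k + tg k = ((sq k).1 + sg k - (sq k).1) + ((sq k).2 + tg k - (sq k).2) by ring.
  apply: formint_near_linear (hx k) (hy k) _ _ (ltW e0).
    by move=> u v hu hv; have [? ? ? ?] := sq_ok k; apply: H; lra.
  have := sg0 k; have := tg0 k => h1 h2 h k' hh hk'; apply: E; lra.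
move=> hJ; have := JI k; rewrite leNgt => /negP; apply.
apply: le_lt_trans (_ : I / 2 < I); last by lra.
apply: le_trans (ler_wpM2l (exprn_ge0 k (ler0n R 4)) hJ) _.
have -> : 4 ^+ k * (2 * eps * (sg k + tg k) ^+ 2) = 2 * eps * (s + t) ^+ 2.
  have -> : 4 = 2 ^+ 2 :> R by ring.
  by rewrite -exprM mulnC exprM /sg /tg -mulrDl expr_div_n; field; rewrite gt_eqF.
have -> : I / 2 = 2 * eps * (s + t + 1) ^+ 2 by rewrite /eps; field; rewrite gt_eqF //; lra.
rewrite ler_wpM2l //; first lra.
by rewrite ler_sqr ?nnegrE; lra.
Qed.

End Goursat.

Section Cmod.
Variable R : realType.
Implicit Types (z w : R[i]) (a b x : R).

Lemma cmod_normc z : cmod z = ComplexField.Normc.normc z.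
Proof. by case: z. Qed.

Lemma cmod_ge0 z : 0 <= cmod z.
Proof. exact: sqrtr_ge0. Qed.

Lemma cmodM z w : cmod (z * w) = cmod z * cmod w.
Proof. by rewrite !cmod_normc ComplexField.Normc.normcM. Qed.

Lemma cmodD z w : cmod (z + w) <= cmod z + cmod w.
Proof. by rewrite !cmod_normc; exact: (@le_normcD R z w). Qed.

Lemma cmodN z : cmod (- z) = cmod z.
Proof. by case: z => a b; rewrite /cmod /= !sqrrN. Qed.

Lemma cmodB z w : cmod (z - w) <= cmod z + cmod w.
Proof. by rewrite -(cmodN w); exact: cmodD. Qed.

Lemma cmodV z : cmod z^-1 = (cmod z)^-1.
Proof. by rewrite !cmod_normc ComplexField.Normc.normcV. Qed.

Lemma cmod0 : cmod (0 : R[i]) = 0.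
Proof. by rewrite cmod_normc ComplexField.Normc.normc0. Qed.

Lemma cmod1 : cmod (1 : R[i]) = 1.
Proof. by rewrite cmod_normc ComplexField.Normc.normc1. Qed.

Lemma cmod_eq0 z : (cmod z == 0) = (z == 0).
Proof.
apply/eqP/eqP => [|->]; last exact: cmod0.
by rewrite cmod_normc; exact: ComplexField.Normc.eq0_normc.
Qed.

Lemma cmod_gt0 z : (0 < cmod z) = (z != 0).
Proof. by rewrite lt_neqAle cmod_ge0 andbT eq_sym cmod_eq0. Qed.

Lemma cmodX z k : cmod (z ^+ k) = cmod z ^+ k.
Proof. by elim: k => [|k IH]; rewrite ?expr0 ?cmod1 // !exprS cmodM IH. Qed.

Lemma cmod_real x : cmod (Complex x 0) = `|x|.
Proof. by rewrite /cmod /= expr0n addr0 sqrtr_sqr. Qed.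

Lemma cmod_prod I (s : seq I) (P : pred I) (F : I -> R[i]) :
  cmod (\prod_(i <- s | P i) F i) = \prod_(i <- s | P i) cmod (F i).
Proof. by apply: (big_morph (@cmod R) cmodM); exact: cmod1. Qed.

Lemma cmod_sum I (s : seq I) (P : pred I) (F : I -> R[i]) :
  cmod (\sum_(i <- s | P i) F i) <= \sum_(i <- s | P i) cmod (F i).
Proof.
elim/big_rec2: _ => [|i y z _ h]; first by rewrite cmod0.
by apply: le_trans (cmodD _ _) _; rewrite lerD2l.
Qed.

Lemma normr_Re z : `|complex.Re z| <= cmod z.
Proof. by rewrite -sqrtr_sqr ler_sqrt ?lerDl ?addr_ge0 ?sqr_ge0. Qed.

Lemma normr_Im z : `|complex.Im z| <= cmod z.
Proof. by rewrite -sqrtr_sqr ler_sqrt ?lerDr ?addr_ge0 ?sqr_ge0. Qed.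

Lemma cmod_le_sum z : cmod z <= `|complex.Re z| + `|complex.Im z|.
Proof.
rewrite -[leRHS]ger0_norm ?addr_ge0 // -sqrtr_sqr ler_sqrt ?sqr_ge0 //.
rewrite sqrrD !real_normK ?num_real // -addrA lerD2l lerDr.
by rewrite mulrn_wge0 // mulr_ge0.
Qed.

Lemma ReD z w : complex.Re (z + w) = complex.Re z + complex.Re w. Proof. by case: z; case: w. Qed.
Lemma ImD z w : complex.Im (z + w) = complex.Im z + complex.Im w. Proof. by case: z; case: w. Qed.
Lemma ReN z : complex.Re (- z) = - complex.Re z. Proof. by case: z. Qed.
Lemma ImN z : complex.Im (- z) = - complex.Im z. Proof. by case: z. Qed.
Lemma ReM z w : complex.Re (z * w) = complex.Re z * complex.Re w - complex.Im z * complex.Im w.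
Proof. by case: z; case: w. Qed.
Lemma ImM z w : complex.Im (z * w) = complex.Re z * complex.Im w + complex.Im z * complex.Re w.
Proof. by case: z; case: w. Qed.

End Cmod.

(** * Complex contour integrals over rectangles *)

Section ContourIntegral.
Local Open Scope classical_set_scope.
Variable R : realType.
Implicit Types (P Q u v : R -> R -> R) (a b c d x y s t p q m h eps del M : R) (f g : R -> R -> R[i]).

Definition side_cont u a b c d :=
  [/\ cont_on (fun x => u x c) a b, cont_on (fun x => u x d) a b,
      cont_on (u a) c d & cont_on (u b) c d].

Lemma formint_lin p q P Q P' Q' a b c d : a <= b -> c <= d ->
  side_cont P a b c d -> side_cont Q a b c d -> side_cont P' a b c d -> side_cont Q' a b c d ->
  formint (fun x y => p * P x y + q * P' x y) (fun x y => p * Q x y + q * Q' x y) a b c d =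
  p * formint P Q a b c d + q * formint P' Q' a b c d.
Proof.
move=> ab cd [? ? ? ?] [? ? ? ?] [? ? ? ?] [? ? ? ?].
by rewrite /formint !segint_lin //; ring.
Qed.

Lemma eq_formint P Q P' Q' a b c d :
  (forall x y, a <= x <= b -> c <= y <= d -> [\/ x = a, x = b, y = c | y = d] ->
     P x y = P' x y /\ Q x y = Q' x y) -> a <= b -> c <= d ->
  formint P Q a b c d = formint P' Q' a b c d.
Proof.
move=> E ab cd; rewrite /formint.
congr (_ + _ - _ - _); apply: eq_segint => z hz.
- by case: (E z c hz) => //; rewrite ?lexx //; constructor 3.
- by case: (E b z _ hz) => //; rewrite ?lexx ?ab //; constructor 2.
- by case: (E z d hz) => //; rewrite ?lexx ?cd //; constructor 4.
- by case: (E a z _ hz) => //; rewrite ?lexx ?ab //; constructor 1.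
Qed.

Lemma formint_le P Q a b c d M : a <= b -> c <= d ->
  side_cont P a b c d -> side_cont Q a b c d ->
  (forall x y, a <= x <= b -> c <= y <= d -> [\/ x = a, x = b, y = c | y = d] ->
     `|P x y| <= M /\ `|Q x y| <= M) ->
  `|formint P Q a b c d| <= 2 * M * ((b - a) + (d - c)).
Proof.
move=> ab cd [c1 c2 _ _] [_ _ c3 c4] E.
have h1 : `|segint (fun x => P x c) a b| <= M * (b - a).
  by apply: segint_le => // z hz; case: (E z c hz) => //; rewrite ?lexx //; constructor 3.
have h2 : `|segint (Q b) c d| <= M * (d - c).
  by apply: segint_le => // z hz; case: (E b z _ hz) => //; rewrite ?lexx ?ab //; constructor 2.
have h3 : `|segint (fun x => P x d) a b| <= M * (b - a).
  by apply: segint_le => // z hz; case: (E z d hz) => //; rewrite ?lexx ?cd //; constructor 4.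
have h4 : `|segint (Q a) c d| <= M * (d - c).
  by apply: segint_le => // z hz; case: (E a z _ hz) => //; rewrite ?lexx ?ab //; constructor 1.
rewrite /formint.
apply: le_trans (ler_normB _ _) _; apply: le_trans (lerD (ler_normB _ _) h4) _.
apply: le_trans (lerD (lerD (ler_normD _ _) h3) (lexx _)) _.
apply: le_trans (lerD (lerD (lerD h1 h2) (lexx _)) (lexx _)) _.
by rewrite le_eqVlt; apply/orP; left; apply/eqP; ring.
Qed.

(** Goursat's lemma on the four rectangles around the inner one: a bottom and a top strip of full
    width, and a left and a right piece between them. *)
Lemma formint_annulus P Q a b c d a' b' c' d' : a <= a' -> a' <= b' -> b' <= b ->
  c <= c' -> c' <= d' -> d' <= d ->
  (forall x y, a <= x <= b -> c <= y <= d -> ~~ ((a' < x < b') && (c' < y < d')) ->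
     closed_diff_at P Q x y) ->
  formint P Q a b c d = formint P Q a' b' c' d'.
Proof.
move=> aa ab bb cc cd dd H.
have F1 : formint P Q a b c c' = 0.
  apply: goursat => //; first lra; move=> x y hx hy; apply: H; [done|lra|].
  by apply/negP => /andP[_]; lra.
have F2 : formint P Q a b d' d = 0.
  apply: goursat => //; first lra; move=> x y hx hy; apply: H; [done|lra|].
  by apply/negP => /andP[_]; lra.
have F3 : formint P Q a a' c' d' = 0.
  apply: goursat => //; move=> x y hx hy; apply: H; [lra|lra|].
  by apply/negP => /andP[+ _]; lra.
have F4 : formint P Q b' b c' d' = 0.
  apply: goursat => //; move=> x y hx hy; apply: H; [lra|lra|].
  by apply/negP => /andP[+ _]; lra.
have cP z : c <= z <= d -> ~~ (c' < z < d') -> cont_on (fun x => P x z) a b.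
  move=> hz nz w hw; apply: (@closed_diff_contl _ P Q); apply: H => //.
  by apply: contra nz => /andP[].
have cQ z : a <= z <= b -> ~~ (a' < z < b') -> cont_on (fun y => Q z y) c d.
  move=> hz nz w hw; apply: (@closed_diff_contr _ P Q); apply: H => //.
  by apply: contra nz => /andP[].
have sP z : c <= z <= d -> ~~ (c' < z < d') -> segint (fun x => P x z) a b =
    segint (fun x => P x z) a a' + segint (fun x => P x z) a' b' + segint (fun x => P x z) b' b.
  move=> h1 h2; rewrite (segint_cat (le_trans aa ab) bb (cP z h1 h2)) (segint_cat aa ab) //.
  exact: cont_onS (lexx _) bb (cP z h1 h2).
have sQ z : a <= z <= b -> ~~ (a' < z < b') -> segint (Q z) c d =
    segint (Q z) c c' + segint (Q z) c' d' + segint (Q z) d' d.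
  move=> h1 h2; rewrite (segint_cat (le_trans cc cd) dd (cQ z h1 h2)) (segint_cat cc cd) //.
  exact: cont_onS (lexx _) dd (cQ z h1 h2).
rewrite -[RHS]addr0 -F1 -[RHS]addr0 -F2 -[RHS]addr0 -F3 -[RHS]addr0 -F4 /formint.
rewrite (sQ b) ?(sQ a) ?(sP c') ?(sP d'); first ring.
all: by clear F1 F2 F3 F4 sP sQ cP cQ H; try (apply/negP => /andP[]); lra.
Qed.

(* [crect g a b c d] is the integral of [g(x + iy) (dx + i dy)] over the boundary of a rectangle *)
Definition crect g a b c d : R[i] := Complex
  (formint (fun x y => complex.Re (g x y)) (fun x y => - complex.Im (g x y)) a b c d)
  (formint (fun x y => complex.Im (g x y)) (fun x y => complex.Re (g x y)) a b c d).

Definition cside_cont g a b c d := side_cont (fun x y => complex.Re (g x y)) a b c d /\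
  side_cont (fun x y => complex.Im (g x y)) a b c d.

Lemma side_contN u a b c d : side_cont u a b c d -> side_cont (fun x y => - u x y) a b c d.
Proof. by case=> h1 h2 h3 h4; split=> z hz; apply: cvgN; [exact: h1|exact: h2|exact: h3|exact: h4]. Qed.

Lemma side_contD u v a b c d : side_cont u a b c d -> side_cont v a b c d ->
  side_cont (fun x y => u x y + v x y) a b c d.
Proof.
case=> h1 h2 h3 h4 [k1 k2 k3 k4].
by split=> z hz; apply: cvgD;
  [exact: h1|exact: k1|exact: h2|exact: k2|exact: h3|exact: k3|exact: h4|exact: k4].
Qed.

Lemma side_contM u v a b c d : side_cont u a b c d -> side_cont v a b c d ->
  side_cont (fun x y => u x y * v x y) a b c d.
Proof.
case=> h1 h2 h3 h4 [k1 k2 k3 k4].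
by split=> z hz; apply: cvgM;
  [exact: h1|exact: k1|exact: h2|exact: k2|exact: h3|exact: k3|exact: h4|exact: k4].
Qed.

Lemma side_cont_cst m a b c d : side_cont (fun _ _ => m) a b c d.
Proof. by split; exact: cont_on_cst. Qed.

Lemma cside_contM f g a b c d : cside_cont f a b c d -> cside_cont g a b c d ->
  cside_cont (fun x y => f x y * g x y) a b c d.
Proof.
move=> [f1 f2] [g1 g2]; split.
  rewrite (_ : (fun x y : R => _) = fun x y => complex.Re (f x y) * complex.Re (g x y) +
      - (complex.Im (f x y) * complex.Im (g x y))).
    by apply: side_contD; [|apply: side_contN]; apply: side_contM.
  by apply/funext => x; apply/funext => y; rewrite ReM.
rewrite (_ : (fun x y : R => _) = fun x y => complex.Re (f x y) * complex.Im (g x y) +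
      complex.Im (f x y) * complex.Re (g x y)).
  by apply: side_contD; apply: side_contM.
by apply/funext => x; apply/funext => y; rewrite ImM.
Qed.

Lemma cside_contD f g a b c d : cside_cont f a b c d -> cside_cont g a b c d ->
  cside_cont (fun x y => f x y + g x y) a b c d.
Proof.
move=> [f1 f2] [g1 g2]; split.
  under eq_fun do under eq_fun do rewrite ReD; exact: side_contD.
under eq_fun do under eq_fun do rewrite ImD; exact: side_contD.
Qed.

Lemma cside_cont_cst (z : R[i]) a b c d : cside_cont (fun _ _ => z) a b c d.
Proof. by split; exact: side_cont_cst. Qed.

Lemma eq_crect f g a b c d :
  (forall x y, a <= x <= b -> c <= y <= d -> [\/ x = a, x = b, y = c | y = d] -> f x y = g x y) ->
  a <= b -> c <= d -> crect f a b c d = crect g a b c d.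
Proof.
move=> E ab cd; rewrite /crect; congr Complex; apply: eq_formint => // x y hx hy h.
  by rewrite E.
by rewrite E.
Qed.

Lemma crectZ (z : R[i]) g a b c d : a <= b -> c <= d -> cside_cont g a b c d ->
  crect (fun x y => z * g x y) a b c d = z * crect g a b c d.
Proof.
move=> ab cd [gr gi]; case: z => p q; rewrite /crect.
rewrite -[RHS]/(Complex (p * _ - q * _) (p * _ + q * _)); congr Complex.
  rewrite -mulNr -formint_lin //; try exact: side_contN.
  by apply: eq_formint => // x y _ _ _; case: (g x y) => g1 g2 /=; split; ring.
rewrite -formint_lin //; try exact: side_contN.
by apply: eq_formint => // x y _ _ _; case: (g x y) => g1 g2 /=; split; ring.
Qed.

Lemma crectD f g a b c d : a <= b -> c <= d -> cside_cont f a b c d -> cside_cont g a b c d ->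
  crect (fun x y => f x y + g x y) a b c d = crect f a b c d + crect g a b c d.
Proof.
move=> ab cd [fr fi] [gr gi]; rewrite /crect -[RHS]/(Complex (_ + _) (_ + _)).
have E P Q P' Q' : side_cont P a b c d -> side_cont Q a b c d -> side_cont P' a b c d ->
    side_cont Q' a b c d -> formint P Q a b c d + formint P' Q' a b c d =
    formint (fun x y => P x y + P' x y) (fun x y => Q x y + Q' x y) a b c d.
  move=> ? ? ? ?; rewrite -[X in X + _]mul1r -[X in _ + X]mul1r -formint_lin //.
  by apply: eq_formint => // x y _ _ _; rewrite !mul1r.
rewrite !E //; try exact: side_contN.
congr Complex; apply: eq_formint => // x y _ _ _; rewrite !(ReD, ImD) //.
by rewrite opprD.
Qed.

Lemma crect_le g a b c d M : a <= b -> c <= d -> cside_cont g a b c d ->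
  (forall x y, a <= x <= b -> c <= y <= d -> [\/ x = a, x = b, y = c | y = d] -> cmod (g x y) <= M) ->
  cmod (crect g a b c d) <= 4 * M * ((b - a) + (d - c)).
Proof.
move=> ab cd [gr gi] gM; apply: le_trans (cmod_le_sum _) _.
have h1 : `|complex.Re (crect g a b c d)| <= 2 * M * ((b - a) + (d - c)).
  apply: formint_le => //; first exact: side_contN.
  move=> x y hx hy h; have h' := gM x y hx hy h.
  by rewrite normrN !(le_trans (normr_Re _) h', le_trans (normr_Im _) h').
have h2 : `|complex.Im (crect g a b c d)| <= 2 * M * ((b - a) + (d - c)).
  apply: formint_le => //.
  move=> x y hx hy h; have h' := gM x y hx hy h.
  by rewrite !(le_trans (normr_Re _) h', le_trans (normr_Im _) h').
by apply: le_trans (lerD h1 h2) _; rewrite le_eqVlt; apply/orP; left; apply/eqP; ring.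
Qed.

Definition cdiff_at g x y := exists z : R[i], forall eps, 0 < eps ->
  exists2 del, 0 < del & forall h k : R, `|h| <= del -> `|k| <= del ->
    cmod (g (x + h) (y + k) - g x y - z * Complex h k) <= eps * (`|h| + `|k|).

Lemma cdiff_closed g x y : cdiff_at g x y ->
  closed_diff_at (fun x y => complex.Re (g x y)) (fun x y => - complex.Im (g x y)) x y /\
  closed_diff_at (fun x y => complex.Im (g x y)) (fun x y => complex.Re (g x y)) x y.
Proof.
case=> -[p q] H; split.
  exists p, (- q), (- p) => eps /H[del d0 {}H]; exists del => // h k hd kd.
  have {H} := H h k hd kd; move: (g (x + h) _) (g x y) => [u v] [u' v'] /= H.
  split.
    apply: le_trans H; apply: le_trans (normr_Re _); rewrite /=.
    by rewrite le_eqVlt; apply/orP; left; apply/eqP; congr `|_|; ring.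
  apply: le_trans H; apply: le_trans (normr_Im _); rewrite /= -normrN.
  by rewrite le_eqVlt; apply/orP; left; apply/eqP; congr `|_|; ring.
exists q, p, (- q) => eps /H[del d0 {}H]; exists del => // h k hd kd.
have {H} := H h k hd kd; move: (g (x + h) _) (g x y) => [u v] [u' v'] /= H.
split.
  apply: le_trans H; apply: le_trans (normr_Im _); rewrite /=.
  by rewrite le_eqVlt; apply/orP; left; apply/eqP; congr `|_|; ring.
apply: le_trans H; apply: le_trans (normr_Re _); rewrite /=.
by rewrite le_eqVlt; apply/orP; left; apply/eqP; congr `|_|; ring.
Qed.

Lemma crect_annulus g a b c d a' b' c' d' : a <= a' -> a' <= b' -> b' <= b ->
  c <= c' -> c' <= d' -> d' <= d ->
  (forall x y, a <= x <= b -> c <= y <= d -> ~~ ((a' < x < b') && (c' < y < d')) ->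
     cdiff_at g x y) ->
  crect g a b c d = crect g a' b' c' d'.
Proof.
move=> aa ab bb cc cd dd H; rewrite /crect; congr Complex; apply: formint_annulus => // x y hx hy h.
  by case: (cdiff_closed (H x y hx hy h)).
by case: (cdiff_closed (H x y hx hy h)).
Qed.

Lemma cdiff_cside_cont g a b c d : a <= b -> c <= d ->
  (forall x y, a <= x <= b -> c <= y <= d -> [\/ x = a, x = b, y = c | y = d] -> cdiff_at g x y) ->
  cside_cont g a b c d.
Proof.
move=> ab cd H.
have cx y : y = c \/ y = d -> cont_on (fun x => complex.Re (g x y)) a b /\
    cont_on (fun x => complex.Im (g x y)) a b.
  move=> hy; have hy' : c <= y <= d by case: hy => ->; rewrite lexx ?cd.
  have K x : a <= x <= b -> cdiff_at g x y.
    by move=> hx; apply: H => //; case: hy => ->; [constructor 3|constructor 4].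
  split=> x /K /cdiff_closed[].
    by move=> /closed_diff_contl.
  by move=> _ /closed_diff_contl.
have cy x : x = a \/ x = b -> cont_on (fun y => complex.Re (g x y)) c d /\
    cont_on (fun y => complex.Im (g x y)) c d.
  move=> hx; have hx' : a <= x <= b by case: hx => ->; rewrite lexx ?ab.
  have K y : c <= y <= d -> cdiff_at g x y.
    by move=> hy; apply: H => //; case: hx => ->; [constructor 1|constructor 2].
  split=> y /K /cdiff_closed[].
    by move=> _ /closed_diff_contr.
  move=> /closed_diff_contr h _.
  have -> : (fun y => complex.Im (g x y)) = (fun y => - - complex.Im (g x y)).
    by apply/funext => z; rewrite opprK.
  exact: cvgN.
have [a1 a2] := cx c (or_introl erefl); have [b1 b2] := cx d (or_intror erefl).
have [c1 c2] := cy a (or_introl erefl); have [d1 d2] := cy b (or_intror erefl).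
by split; split.
Qed.

End ContourIntegral.

(** * Cauchy's formula on a square *)

Section Cauchy.
Local Open Scope classical_set_scope.
Variable R : realType.
Implicit Types (a b c d x y s t p q m eps del M : R) (f g : R -> R -> R[i]).

Lemma cmod_Complex p q : cmod (Complex p q) <= `|p| + `|q|.
Proof. exact: cmod_le_sum. Qed.

Lemma cdiffM f g x y : cdiff_at f x y -> cdiff_at g x y -> cdiff_at (fun x y => f x y * g x y) x y.
Proof.
case=> z Hf [w Hg]; exists (z * g x y + f x y * w) => eps e0.
pose F := cmod (f x y); pose G := cmod (g x y); pose Z := cmod z; pose W := cmod w.
have F0 : 0 <= F := cmod_ge0 _; have G0 : 0 <= G := cmod_ge0 _.
have Z0 : 0 <= Z := cmod_ge0 _; have W0 : 0 <= W := cmod_ge0 _.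
pose e1 := Num.min 1 (eps / (2 * (F + G + 1))).
have FG : 0 < F + G + 1 by lra.
have e10 : 0 < e1 by rewrite lt_min ltr01 divr_gt0 // mulr_gt0.
have e11 : e1 <= 1 by rewrite ge_min lexx.
have e1E : (F + G) * e1 <= eps / 2.
  have : e1 <= eps / (2 * (F + G + 1)) by rewrite ge_min lexx orbT.
  rewrite ler_pdivlMr ?mulr_gt0 // => h.
  rewrite ler_pdivlMr //; apply: le_trans h; clear -e10; lra.
have [d1 d10 {}Hf] := Hf e1 e10; have [d2 d20 {}Hg] := Hg e1 e10.
have ZW : 0 < 4 * ((Z + 1) * (W + 1)) by rewrite !mulr_gt0 //; lra.
pose d3 := eps / (4 * ((Z + 1) * (W + 1))).
exists (Num.min (Num.min d1 d2) d3); first by rewrite !lt_min d10 d20 divr_gt0.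
move=> h k; rewrite !le_min => /andP[/andP[h1 h2] h3] /andP[/andP[k1 k2] k3].
have A := Hf h k h1 k1; have B := Hg h k h2 k2.
pose N := `|h| + `|k|.
have N0 : 0 <= N by rewrite addr_ge0.
have N3 : (Z + 1) * (W + 1) * N <= eps / 2.
  have : N <= d3 + d3 by exact: lerD.
  rewrite /d3 -mulrDl ler_pdivlMr // => H; rewrite ler_pdivlMr //; lra.
set et := Complex h k in A B *.
have etN : cmod et <= N by exact: cmod_Complex.
set u := f (x + h) (y + k) - f x y - z * et in A.
set v := g (x + h) (y + k) - g x y - w * et in B.
have -> : f (x + h) (y + k) * g (x + h) (y + k) - f x y * g x y - (z * g x y + f x y * w) * et =
  f x y * v + g x y * u + (z * et + u) * (w * et + v) by rewrite /u /v; ring.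
have zu : cmod (z * et + u) <= (Z + 1) * N.
  apply: le_trans (cmodD _ _) _; rewrite cmodM mulrDl mul1r; apply: lerD.
    by apply: ler_wpM2l.
  by apply: le_trans A _; rewrite -[leRHS]mul1r ler_wpM2r.
have wv : cmod (w * et + v) <= (W + 1) * N.
  apply: le_trans (cmodD _ _) _; rewrite cmodM mulrDl mul1r; apply: lerD.
    by apply: ler_wpM2l.
  by apply: le_trans B _; rewrite -[leRHS]mul1r ler_wpM2r.
apply: le_trans (cmodD _ _) _; apply: le_trans (lerD (cmodD _ _) (lexx _)) _; rewrite !cmodM.
have t1 : cmod (f x y) * cmod v <= F * (e1 * N) by apply: ler_wpM2l.
have t2 : cmod (g x y) * cmod u <= G * (e1 * N) by apply: ler_wpM2l.
have t3 : cmod (z * et + u) * cmod (w * et + v) <= (Z + 1) * N * ((W + 1) * N).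
  by apply: ler_pM; rewrite ?cmod_ge0.
apply: le_trans (lerD (lerD t1 t2) t3) _.
have -> : F * (e1 * N) + G * (e1 * N) + (Z + 1) * N * ((W + 1) * N) =
  ((F + G) * e1 + (Z + 1) * (W + 1) * N) * N by ring.
apply: ler_wpM2r => //; lra.
Qed.

Lemma cdiffB_cst g x y (z : R[i]) : cdiff_at g x y -> cdiff_at (fun x y => g x y - z) x y.
Proof.
case=> w H; exists w => eps /H[del d0 {}H]; exists del => // h k hd kd.
have -> : g (x + h) (y + k) - z - (g x y - z) - w * Complex h k =
          g (x + h) (y + k) - g x y - w * Complex h k by ring.
exact: H.
Qed.

Lemma cdiff_near g x y : cdiff_at g x y -> forall eps, 0 < eps ->
  exists2 del, 0 < del & forall h k : R, `|h| <= del -> `|k| <= del ->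
    cmod (g (x + h) (y + k) - g x y) <= eps.
Proof.
case=> z /(_ 1 ltr01)[d d0 H] eps e0.
pose Z := cmod z; have Z0 : 0 <= Z := cmod_ge0 _.
have Z1 : 0 < 2 * (Z + 1) by lra.
exists (Num.min d (eps / (2 * (Z + 1)))); first by rewrite lt_min d0 divr_gt0.
move=> h k; rewrite !le_min !ler_pdivlMr // => /andP[h1 h2] /andP[k1 k2].
have := H h k h1 k1; rewrite mul1r => H1.
have -> : g (x + h) (y + k) - g x y = (g (x + h) (y + k) - g x y - z * Complex h k) + z * Complex h k.
  by ring.
apply: le_trans (cmodD _ _) _; rewrite cmodM.
have : Z * cmod (Complex h k) <= Z * (`|h| + `|k|) by apply: ler_wpM2l => //; exact: cmod_Complex.
rewrite -/Z => h3; clear -h2 k2 H1 h3; lra.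
Qed.

(** The Cauchy kernel 1/(z - t). The pole is real: values on the real axis of the square are enough
    to differentiate in real directions. *)
Definition kern t x y : R[i] := (Complex (x - t) y)^-1.

Lemma Complex_eq0 p q : (Complex p q == 0 :> R[i]) = (p == 0) && (q == 0).
Proof. by rewrite eq_complex /=. Qed.

Lemma cdiff_kern t x y : Complex (x - t) y != 0 -> cdiff_at (kern t) x y.
Proof.
set ze := Complex _ _ => z0; exists (- ze ^- 2) => eps e0.
pose Z := cmod ze; have Z0 : 0 < Z by rewrite cmod_gt0.
exists (Num.min (Z / 4) (eps * Z ^+ 3 / 4)).
  by rewrite lt_min !divr_gt0 // mulr_gt0 // exprn_gt0.
move=> h k; rewrite !le_min => /andP[h1 h2] /andP[k1 k2].
set et := Complex h k; pose N := `|h| + `|k|.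
have etN : cmod et <= N by exact: cmod_Complex.
have N1 : N <= Z / 2 by rewrite /N; lra.
have N2 : N <= eps * Z ^+ 3 / 2 by rewrite /N; lra.
have hz : Z / 2 <= cmod (ze + et).
  have : cmod ze <= cmod (ze + et) + cmod et.
    have -> : cmod ze = cmod ((ze + et) - et) by rewrite addrK.
    exact: cmodB.
  rewrite -/Z; lra.
have ne0 : ze + et != 0 by rewrite -cmod_gt0; lra.
have E1 : kern t (x + h) (y + k) = (ze + et)^-1.
  by rewrite /kern /ze /et; congr (_^-1); rewrite -[RHS]/(Complex _ _); congr Complex; ring.
rewrite E1 -[kern t x y]/(ze^-1).
have -> : (ze + et)^-1 - ze^-1 - - ze ^- 2 * et = et ^+ 2 * (ze ^- 2 * (ze + et)^-1).
  by field; rewrite ne0 z0.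
rewrite !cmodM !cmodV !cmodX -/Z.
have i1 : (cmod (ze + et))^-1 <= 2 / Z.
  have -> : 2 / Z = (Z / 2)^-1 by field; rewrite gt_eqF.
  by rewrite lef_pV2 // ?posrE ?divr_gt0 ?cmod_gt0.
have i2 : cmod et ^+ 2 <= N * (eps * Z ^+ 3 / 2).
  by rewrite expr2; apply: ler_pM; rewrite ?cmod_ge0 //; apply: le_trans N2.
apply: le_trans (ler_pM _ _ i2 (ler_wpM2l _ i1)) _; rewrite ?sqr_ge0 ?mulr_ge0 ?invr_ge0 ?sqr_ge0 ?cmod_ge0 //.
rewrite le_eqVlt; apply/orP; left; apply/eqP; rewrite -/N.
by field; rewrite gt_eqF.
Qed.

(** The contour integral of 1/z over the unit square, classically 2 pi i. It is carried as a
    constant, and [kappa_neq0] is what permits division by it. *)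
Definition kappa : R[i] := crect (kern 0) (-1) 1 (-1) 1.

(** The four sides contribute equally to the imaginary part, each the integral of 1/(1 + x^2) over
    [-1, 1]. On it the integrand is within 1/4 of 3/4, so that the integral is within 1/2 of 3/2. *)
Lemma kappa_neq0 : kappa != 0.
Proof.
have E : complex.Im kappa = 4 * segint (fun x => (1 + x ^+ 2)^-1) (-1) 1.
  have P x : {for x, continuous (fun x : R => (1 + x ^+ 2)^-1)}.
    apply: cvgV; first by rewrite gt_eqF // ltr_pwDl // sqr_ge0.
    by apply: cvgD; [exact: cvg_cst|exact: exprn_continuous].
  have N : segint (fun x => - (1 + x ^+ 2)^-1) (-1) 1 = - segint (fun x => (1 + x ^+ 2)^-1) (-1) 1.
    have := @segint_lin _ (-1) 0 _ (fun=> 0) (-1) 1 _ (fun x _ => P x) (@cont_on_cst _ 0 (-1) 1).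
    rewrite [0 * segint _ _ _]mul0r addr0 [RHS]mulN1r => <-; last lra.
    by apply: eq_segint => x _; rewrite mul0r addr0 mulN1r.
  have e1 : segint (fun x => complex.Im (kern 0 x (-1))) (-1) 1 = segint (fun x => (1 + x ^+ 2)^-1) (-1) 1.
    by apply: eq_segint => x _; rewrite /kern /= subr0 sqrrN expr1n mulN1r opprK addrC.
  have e2 : segint (fun y => complex.Re (kern 0 1 y)) (-1) 1 = segint (fun x => (1 + x ^+ 2)^-1) (-1) 1.
    by apply: eq_segint => x _; rewrite /kern /= subr0 expr1n mul1r.
  have e3 : segint (fun x => complex.Im (kern 0 x 1)) (-1) 1 = segint (fun x => - (1 + x ^+ 2)^-1) (-1) 1.
    by apply: eq_segint => x _; rewrite /kern /= subr0 expr1n mul1r addrC.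
  have e4 : segint (fun y => complex.Re (kern 0 (-1) y)) (-1) 1 = segint (fun x => - (1 + x ^+ 2)^-1) (-1) 1.
    by apply: eq_segint => x _; rewrite /kern /= subr0 sqrrN expr1n mulN1r.
  rewrite /kappa -[complex.Im _]/(formint _ _ _ _ _ _) /formint e1 e2 e3 e4.
  rewrite N; ring.
apply/eqP => k0; move: E; rewrite k0 /= => /eqP; rewrite eq_sym mulf_eq0 pnatr_eq0 /= => /eqP I0.
have := @segint_close _ (fun x => (1 + x ^+ 2)^-1) (fun=> 3 / 4) (-1) 1 (1 / 4).
rewrite I0 (@eq_segint _ (fun=> 3 / 4) (fun x => 3 / 4 + 0 * (x - 0))); last by move=> x _; lra.
rewrite segint_affine; last lra.
have -> : 0 - (3 / 4 * (1 - -1) + 0 * ((1 - 0) ^+ 2 - (-1 - 0) ^+ 2) / 2) = - (3 / 2) :> R by field.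
rewrite normrN ger0_norm; last lra.
suff K : forall x : R, -1 <= x <= 1 -> `|(1 + x ^+ 2)^-1 - 3 / 4| <= 1 / 4.
  move=> /(_ _ _ _ K) h; have : (3 / 2 <= 1 / 4 * (1 - -1) :> R) by apply: h; [lra| |exact: cont_on_cst];
    move=> x _; apply: cvgV; [by rewrite gt_eqF // ltr_pwDl // sqr_ge0|
      by apply: cvgD; [exact: cvg_cst|exact: exprn_continuous]].
  by lra.
move=> x hx; have x2 : 0 <= x ^+ 2 <= 1.
  rewrite sqr_ge0 /= -subr_ge0; have -> : 1 - x ^+ 2 = (1 - x) * (1 + x) by ring.
  by apply: mulr_ge0; lra.
have p : 0 < 1 + x ^+ 2 by lra.
have h1 : (1 + x ^+ 2)^-1 <= 1 by rewrite invf_le1; lra.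
have h2 : 2^-1 <= (1 + x ^+ 2)^-1 by rewrite lef_pV2 ?posrE; lra.
by rewrite ler_norml; lra.
Qed.

Lemma crect_kern s : 0 < s -> crect (kern 0) (- s) s (- s) s = kappa.
Proof.
move=> s0; have K x y u : 0 < u -> ~~ ((- u < x < u) && (- u < y < u)) -> cdiff_at (kern 0) x y.
  move=> u0 h; apply: cdiff_kern; rewrite subr0 Complex_eq0; apply: contra h => /andP[/eqP-> /eqP->].
  by rewrite oppr_lt0 u0.
rewrite /kappa; have [s1|s1] := leP s 1.
  by apply/esym/crect_annulus; try lra; move=> x y _ _; apply: K.
by apply: crect_annulus; try lra; move=> x y _ _; apply: K.
Qed.

Lemma crect_shift g a b c d t : a <= b -> c <= d -> cside_cont g (a + t) (b + t) c d ->
  crect (fun x y => g (x + t) y) a b c d = crect g (a + t) (b + t) c d.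
Proof.
move=> ab cd [[r1 r2 r3 r4] [i1 i2 i3 i4]]; rewrite /crect /formint.
rewrite (segint_shift (f := fun x => complex.Re (g x c))) //.
rewrite (segint_shift (f := fun x => complex.Re (g x d))) //.
rewrite (segint_shift (f := fun x => complex.Im (g x c))) //.
by rewrite (segint_shift (f := fun x => complex.Im (g x d))).
Qed.

Lemma cmod_kern_square x y s : 0 < s -> - s <= x <= s -> - s <= y <= s ->
  [\/ x = - s, x = s, y = - s | y = s] -> cmod (Complex x y)^-1 <= s^-1.
Proof.
move=> s0 hx hy h; rewrite cmodV.
have H : s <= cmod (Complex x y).
  have n1 := normr_Re (Complex x y); have n2 := normr_Im (Complex x y).
  have nN : `|- s| = s by rewrite normrN gtr0_norm.
  have nP : `|s| = s by rewrite gtr0_norm.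
  by case: h => E; rewrite ?E /= in n1 n2 *; rewrite ?nN ?nP in n1 n2.
by rewrite lef_pV2 // posrE //; exact: lt_le_trans H.
Qed.

Lemma square_side_neq0 (x y s : R) : 0 < s -> [\/ x = - s, x = s, y = - s | y = s] -> Complex x y != 0.
Proof. by move=> s0 h; rewrite Complex_eq0; apply/negP => /andP[/eqP ? /eqP ?]; case: h; lra. Qed.

Theorem cauchy_square f s t : 0 < s -> `|t| < s ->
  (forall x y, - s <= x <= s -> - s <= y <= s -> cdiff_at f x y) ->
  crect (fun x y => f x y * kern t x y) (- s) s (- s) s = kappa * f t 0.
Proof.
move=> s0; rewrite ltr_norml => /andP[ts1 ts2] H.
have ft : cdiff_at f t 0 by apply: H; lra.
apply/eqP; rewrite -subr_eq0 -cmod_eq0 eq_le cmod_ge0 andbT leNgt.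
move De : (cmod _) => D; apply/negP => c0.
(* On a square of half-side eta around t the kernel is at most 1/eta, and [crect_le] bounds the
   integral of (f - f(t)) times the kernel by 4 (D / 32 / eta) (4 eta) = D / 2, which contradicts D
   > 0. *)
have D32 : 0 < D / 32 by lra.
have [del d0 near] := cdiff_near ft D32.
(* The small square has to lie inside the large one and where f is within D / 32 of f(t). *)
pose eta := Num.min del (Num.min ((s - t) / 2) ((s + t) / 2)).
have e0 : 0 < eta by rewrite !lt_min d0 /=; lra.
have e1 : eta <= del by rewrite ge_min lexx.
have e2 : eta <= (s - t) / 2 by rewrite !ge_min lexx ?orbT.
have e3 : eta <= (s + t) / 2 by rewrite !ge_min lexx ?orbT.
clearbody eta.
have ee : - eta <= eta by lra.
have nz x y : ~~ ((t - eta < x < t + eta) && (- eta < y < eta)) -> Complex (x - t) y != 0.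
  move=> h; rewrite Complex_eq0; apply: contra h => /andP[/eqP hx /eqP hy]; lra.
have C x y : - s <= x <= s -> - s <= y <= s -> ~~ ((t - eta < x < t + eta) && (- eta < y < eta)) ->
    cdiff_at (fun x y => f x y * kern t x y) x y.
  by move=> hx hy h; apply: cdiffM; [exact: H|apply: cdiff_kern; exact: nz].
have A : crect (fun x y => f x y * kern t x y) (- s) s (- s) s =
    crect (fun x y => f x y * kern t x y) (t - eta) (t + eta) (- eta) eta.
  by apply: crect_annulus; try lra; exact: C.
have B : crect (fun x y => f x y * kern t x y) (t - eta) (t + eta) (- eta) eta =
    crect (fun x y => f (x + t) y * kern 0 x y) (- eta) eta (- eta) eta.
  have -> : t - eta = - eta + t by ring.
  rewrite [t + eta]addrC -crect_shift; [|lra|lra|].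
    by apply: eq_crect; [|lra|lra] => x y _ _ _; rewrite /kern addrK subr0.
  apply: cdiff_cside_cont; [lra|lra|] => x y hx hy h; apply: C; [lra|lra|].
  by apply/negP => /andP[/andP[? ?] /andP[? ?]]; case: h; lra.
have cg : cside_cont (fun x y => (f (x + t) y - f t 0) * kern 0 x y) (- eta) eta (- eta) eta.
  apply: cside_contM; last first.
    apply: cdiff_cside_cont; [exact: ee|exact: ee|] => x y hx hy h; apply: cdiff_kern.
    by rewrite subr0; exact: square_side_neq0 e0 h.
  apply: cdiff_cside_cont; [exact: ee|exact: ee|] => x y hx hy h; apply: cdiffB_cst.
  have [z Hz] : cdiff_at f (x + t) y by apply: H; lra.
  exists z => eps /Hz[dl dl0 K]; exists dl => // u v hu hv.
  by rewrite (addrAC x); exact: K.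
have ck : cside_cont (kern 0) (- eta) eta (- eta) eta.
  apply: cdiff_cside_cont; [exact: ee|exact: ee|] => x y hx hy h; apply: cdiff_kern.
  by rewrite subr0; exact: square_side_neq0 e0 h.
have E : crect (fun x y => f (x + t) y * kern 0 x y) (- eta) eta (- eta) eta =
    crect (fun x y => (f (x + t) y - f t 0) * kern 0 x y) (- eta) eta (- eta) eta + f t 0 * kappa.
  have cfk := cside_contM (cside_cont_cst (f t 0) (- eta) eta (- eta) eta) ck.
  have E2 := crectZ (f t 0) ee ee ck; rewrite (crect_kern e0) in E2.
  have E1 := crectD ee ee cg cfk; rewrite -E2 -E1.
  by apply: eq_crect => // x y _ _ _; ring.
have DE : D = cmod (crect (fun x y => (f (x + t) y - f t 0) * kern 0 x y) (- eta) eta (- eta) eta).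
  by rewrite -De A B E; congr cmod; ring.
have : D <= 4 * (D / 32 / eta) * ((eta - - eta) + (eta - - eta)).
  rewrite {1}DE; apply: crect_le => // x y hx hy h.
  rewrite cmodM; apply: ler_pM; [exact: cmod_ge0|exact: cmod_ge0| |].
    by rewrite [x + t]addrC -{1}[y]add0r; apply: near; rewrite ler_norml; lra.
  by rewrite /kern subr0; apply: cmod_kern_square.
have -> : 4 * (D / 32 / eta) * ((eta - - eta) + (eta - - eta)) = D / 2 by field; rewrite gt_eqF.
lra.
Qed.

End Cauchy.

(** * Holomorphic functions on the tube *)

Section Slice.
Local Open Scope classical_set_scope.
Variables (R : realType) (n : nat).
Notation V := 'rV[R]_(n + n).
Implicit Types (F G : V -> R[i]) (w : V) (v : 'rV[R]_n) (x y t s rho M eps : R).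

(** The displacement (x + iy) v, in the encoding of a point by its real and imaginary parts side by
    side. *)
Definition cplx_dir v x y : V := x *: row_mx v 0 + y *: row_mx 0 v.

Definition slice F w v x y : R[i] := F (w + cplx_dir v x y).

Lemma cplx_dirE v x y : cplx_dir v x y = row_mx (x *: v) (y *: v).
Proof. by rewrite /cplx_dir !scale_row_mx !scaler0 add_row_mx addr0 add0r. Qed.

Lemma norm_cplx_dir v x y : `|x| <= 1 -> `|y| <= 1 -> `|cplx_dir v x y| <= `|v|.
Proof.
move=> x1 y1; rewrite cplx_dirE; apply: norm_le_coord => // i k; rewrite ord1.
have H z j : `|z| <= 1 -> `|(z *: v) 0 j| <= `|v|.
  move=> z1; rewrite mxE normrM; apply: le_trans (coord_norm_le v 0 j).
  by rewrite -[leRHS]mul1r ler_wpM2r.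
case: (splitP k) => j kj.
  by rewrite (_ : k = lshift n j) ?row_mxEl; [exact: H|apply: val_inj].
by rewrite (_ : k = rshift n j) ?row_mxEr; [exact: H|apply: val_inj].
Qed.

Definition ccont F w := {for w, continuous (ReF F)} /\ {for w, continuous (ImF F)}.

Lemma ccont_near F w : ccont F w -> forall eps, 0 < eps ->
  exists2 del, 0 < del & forall w', `|w' - w| < del -> cmod (F w' - F w) <= eps.
Proof.
move=> [cr ci] eps e0; have e2 : 0 < eps / 2 by rewrite divr_gt0.
have /cvgrPdist_le/(_ _ e2)/nbhs_ballP[d1 /= d10 H1] := cr.
have /cvgrPdist_le/(_ _ e2)/nbhs_ballP[d2 /= d20 H2] := ci.
exists (Num.min d1 d2); first by rewrite lt_min d10.
move=> w'; rewrite lt_min => /andP[h1 h2].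
have /= k1 := H1 w' _; have /= k2 := H2 w' _.
apply: le_trans (cmod_le_sum _) _; rewrite [eps]splitr; apply: lerD.
  by rewrite -[complex.Re _]/(complex.Re (F w' + - F w)) ReD ReN distrC; apply: k1; rewrite -ball_normE /= distrC.
by rewrite -[complex.Im _]/(complex.Im (F w' + - F w)) ImD ImN distrC; apply: k2; rewrite -ball_normE /= distrC.
Qed.

Lemma near_ccont F w : (forall eps, 0 < eps -> exists2 del, 0 < del &
    forall w', `|w' - w| < del -> cmod (F w' - F w) <= eps) -> ccont F w.
Proof.
move=> H; split; apply/(@cvgrPdist_le _ _ _ (nbhs w)) => /= eps /H[del d0 {}H]; apply/nbhs_ballP; exists del => //= w';
  rewrite -ball_normE /= distrC => /H h; apply: le_trans h; rewrite distrC.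
  apply: le_trans (normr_Re _); rewrite ReD ReN //.
by apply: le_trans (normr_Im _); rewrite ImD ImN.
Qed.

Lemma ccont_comp F (f : R -> V) x : {for x, continuous f} -> ccont F (f x) ->
  {for x, continuous (fun x => complex.Re (F (f x)))} /\ {for x, continuous (fun x => complex.Im (F (f x)))}.
Proof.
move=> cf [h1 h2]; split.
  exact: (@continuous_comp _ _ _ f (ReF F)).
exact: (@continuous_comp _ _ _ f (ImF F)).
Qed.

Lemma slice_side_cont F w v : (forall w', `|w' - w| <= `|v| -> ccont F w') ->
  cside_cont (slice F w v) (-1) 1 (-1) 1.
Proof.
move=> H.
have cx y x : {for x, continuous (fun x => w + cplx_dir v x y)}.
  apply: cvgD; first exact: cvg_cst.
  by apply: cvgD; [apply: cvgZr_tmp; exact: cvg_id|exact: cvg_cst].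
have cy x y : {for y, continuous (fun y => w + cplx_dir v x y)}.
  apply: cvgD; first exact: cvg_cst.
  by apply: cvgD; [exact: cvg_cst|apply: cvgZr_tmp; exact: cvg_id].
have K x y : -1 <= x <= 1 -> -1 <= y <= 1 -> ccont F (w + cplx_dir v x y).
  move=> hx hy; apply: H; rewrite addrC addKr; apply: norm_cplx_dir; rewrite ler_norml //.
have m1 : -1 <= (-1 : R) <= 1 by lra.
have p1 : -1 <= (1 : R) <= 1 by lra.
split; split=> z hz.
- by case: (ccont_comp (cx (-1) z) (K _ _ hz m1)).
- by case: (ccont_comp (cx 1 z) (K _ _ hz p1)).
- by case: (ccont_comp (cy (-1) z) (K _ _ m1 hz)).
- by case: (ccont_comp (cy 1 z) (K _ _ p1 hz)).
- by case: (ccont_comp (cx (-1) z) (K _ _ hz m1)).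
- by case: (ccont_comp (cx 1 z) (K _ _ hz p1)).
- by case: (ccont_comp (cy (-1) z) (K _ _ m1 hz)).
- by case: (ccont_comp (cy 1 z) (K _ _ p1 hz)).
Qed.

(* Continuity plus Cauchy's formula on the squares of complex lines with real direction; unlike
   differentiability this passes to uniform limits. *)
Definition hol w0 rho F := (forall w, `|w - w0| < rho -> ccont F w) /\
  forall w v t, `|w - w0| + `|v| < rho -> `|t| < 1 ->
    crect (fun x y => slice F w v x y * kern t x y) (-1) 1 (-1) 1 = kappa R * slice F w v t 0.

Lemma hol_slice_side_cont w0 rho F w v : hol w0 rho F -> `|w - w0| + `|v| < rho ->
  cside_cont (slice F w v) (-1) 1 (-1) 1.
Proof.
move=> [H _] wv; apply: slice_side_cont => w' hw'; apply: H.
have -> : w' - w0 = (w' - w) + (w - w0) by rewrite addrA subrK.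
by apply: le_lt_trans (ler_normD _ _) _; apply: le_lt_trans wv; rewrite addrC lerD2l.
Qed.

Lemma kern_side_cont t : `|t| < 1 -> cside_cont (@kern R t) (-1) 1 (-1) 1.
Proof.
rewrite ltr_norml => /andP[t1 t2]; apply: cdiff_cside_cont; [lra|lra|] => x y hx hy h.
apply: cdiff_kern; rewrite Complex_eq0; apply/negP => /andP[/eqP ? /eqP ?]; case: h; lra.
Qed.

Lemma kern_le t x y : `|t| < 1 -> -1 <= x <= 1 -> -1 <= y <= 1 ->
  [\/ x = -1, x = 1, y = -1 | y = 1] -> cmod (kern t x y) <= (1 - `|t|)^-1.
Proof.
move=> t1 hx hy h; rewrite /kern cmodV.
have H : 1 - `|t| <= cmod (Complex (x - t) y).
  have := cmodD (Complex (x - t) y) (Complex t 0).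
  rewrite cmod_real.
  have -> : Complex (x - t) y + Complex t 0 = Complex x y.
    by rewrite -[LHS]/(Complex _ _); congr Complex; ring.
  have H1 : 1 <= cmod (Complex x y).
    have := cmod_kern_square ltr01 hx hy h; rewrite cmodV invr1 invf_le1 //.
    by rewrite cmod_gt0 Complex_eq0; apply/negP => /andP[/eqP ? /eqP ?]; case: h; lra.
  lra.
by rewrite lef_pV2 // posrE ?subr_gt0 //; apply: lt_le_trans H; rewrite subr_gt0.
Qed.

Lemma hol_lin w0 rho F G (a b : R[i]) : hol w0 rho F -> hol w0 rho G ->
  hol w0 rho (fun w => a * F w + b * G w).
Proof.
move=> [cF HF] [cG HG]; split.
  move=> w hw; apply: near_ccont => eps e0.
  pose m := cmod a + cmod b + 1.
  have m0 : 0 < m by rewrite ltr_wpDl // addr_ge0 ?cmod_ge0.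
  have e1 : 0 < eps / m by rewrite divr_gt0.
  have [d1 d10 h1] := ccont_near (cF w hw) e1; have [d2 d20 h2] := ccont_near (cG w hw) e1.
  exists (Num.min d1 d2); first by rewrite lt_min d10.
  move=> w'; rewrite lt_min => /andP[/h1 k1 /h2 k2].
  have -> : a * F w' + b * G w' - (a * F w + b * G w) = a * (F w' - F w) + b * (G w' - G w) by ring.
  apply: le_trans (cmodD _ _) _; rewrite !cmodM.
  apply: le_trans (lerD (ler_wpM2l (cmod_ge0 _) k1) (ler_wpM2l (cmod_ge0 _) k2)) _.
  have -> : cmod a * (eps / m) + cmod b * (eps / m) = (m - 1) * (eps / m) by rewrite /m; ring.
  have {2}-> : eps = m * (eps / m) by field; rewrite gt_eqF.
  by apply: ler_wpM2r; [exact: ltW|lra].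
move=> w v t wv t1.
have k := kern_side_cont t1.
have sF := hol_slice_side_cont (conj cF HF) wv; have sG := hol_slice_side_cont (conj cG HG) wv.
have m1 : -1 <= 1 :> R by lra.
have fk := cside_contM sF k; have gk := cside_contM sG k.
have cc z := cside_cont_cst z (-1 : R) 1 (-1) 1.
have E := crectD m1 m1 (cside_contM (cc a) fk) (cside_contM (cc b) gk).
rewrite (crectZ a m1 m1 fk) (crectZ b m1 m1 gk) HF // HG // in E.
rewrite (_ : kappa R * _ = a * (kappa R * slice F w v t 0) + b * (kappa R * slice G w v t 0)); last first.
  by rewrite /slice; ring.
by rewrite -E; apply: eq_crect => // x y _ _ _; rewrite /slice; ring.
Qed.

Lemma hol_shift w0 rho rho' F c : `|c| <= rho - rho' -> hol w0 rho F -> hol w0 rho' (fun w => F (w + c)).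
Proof.
move=> hc [cF HF].
have nc w : `|w + c - w0| <= `|w - w0| + `|c|.
  by rewrite addrAC; exact: ler_normD.
split.
  move=> w hw; apply: near_ccont => eps e0.
  have wc : `|w + c - w0| < rho by have := nc w; lra.
  have [d d0 h] := ccont_near (cF _ wc) e0; exists d => // w' hw'.
  by apply: h; rewrite opprD addrACA subrr addr0.
move=> w v t wv t1; have wcv : `|w + c - w0| + `|v| < rho by have := nc w; lra.
have E z z' : slice (fun w1 => F (w1 + c)) w v z z' = slice F (w + c) v z z'.
  by rewrite /slice addrAC.
rewrite E -(HF _ _ _ wcv t1).
by apply: eq_crect; [|lra|lra] => x y _ _ _; rewrite E.
Qed.

Lemma holS w0 rho rho' F : rho' <= rho -> hol w0 rho F -> hol w0 rho' F.
Proof.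
move=> h [cF HF]; split; first by move=> w hw; apply: cF; exact: lt_le_trans h.
by move=> w v t hw; apply: HF; exact: lt_le_trans h.
Qed.

(** Both sides of Cauchy's formula depend continuously on F for the uniform norm, as do the
    continuity conditions. *)
Lemma hol_lim w0 rho F : (forall eps, 0 < eps -> exists2 G, hol w0 rho G &
    forall w, `|w - w0| < rho -> cmod (G w - F w) <= eps) -> hol w0 rho F.
Proof.
move=> H.
have cF w : `|w - w0| < rho -> ccont F w.
  move=> hw; apply: near_ccont => eps e0; have e3 : 0 < eps / 3 by lra.
  have [G [cG _] GF] := H _ e3; have [d d0 h] := ccont_near (cG w hw) e3.
  exists (Num.min d (rho - `|w - w0|)); first by rewrite lt_min d0 subr_gt0.
  move=> w'; rewrite lt_min => /andP[h1 h2].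
  have hw' : `|w' - w0| < rho.
    have -> : w' - w0 = (w' - w) + (w - w0) by rewrite addrA subrK.
    by apply: le_lt_trans (ler_normD _ _) _; lra.
  have -> : F w' - F w = (G w' - G w) - (G w' - F w') + (G w - F w) by ring.
  apply: le_trans (cmodD _ _) _; apply: le_trans (lerD (cmodB _ _) (lexx _)) _.
  have := h w' h1; have := GF w hw; have := GF w' hw'; lra.
split=> // w v t wv t1; apply/eqP; rewrite -subr_eq0 -cmod_eq0 eq_le cmod_ge0 andbT leNgt; apply/negP.
set D := cmod _ => D0.
have pt : 0 < 1 - `|t| by rewrite subr_gt0.
(* Error per unit of uniform distance: |kappa| from the value at t and 16 / (1 - |t|) from the
   contour, by [kern_le] and [crect_le]. At distance D / (2m) the discrepancy D would be at most D /
   2. *)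
pose m := 16 * (1 - `|t|)^-1 + cmod (kappa R).
have m0 : 0 < m by rewrite ltr_wpDr ?cmod_ge0 // mulr_gt0 // invr_gt0.
have e0 : 0 < D / (2 * m) by rewrite divr_gt0 // mulr_gt0.
have [G hG GF] := H _ e0.
have m1 : -1 <= 1 :> R by lra.
have inb x y : -1 <= x <= 1 -> -1 <= y <= 1 -> `|w + cplx_dir v x y - w0| < rho.
  move=> hx hy; rewrite addrAC; apply: le_lt_trans (ler_normD _ _) _; apply: le_lt_trans wv.
  by rewrite lerD2l; apply: norm_cplx_dir; rewrite ler_norml.
have k := kern_side_cont t1.
have sG := hol_slice_side_cont hG wv.
have sF : cside_cont (slice F w v) (-1) 1 (-1) 1.
  apply: slice_side_cont => w' hw'; apply: cF.
  have -> : w' - w0 = (w' - w) + (w - w0) by rewrite addrA subrK.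
  by apply: le_lt_trans (ler_normD _ _) _; apply: le_lt_trans wv; rewrite addrC lerD2l.
have cc z := cside_cont_cst z (-1 : R) 1 (-1) 1.
have sN := cside_contM (cside_contD sG (cside_contM (cc (-1)) sF)) k.
have fk := cside_contM sF k.
have E := crectD m1 m1 sN fk.
have E1 : crect (fun x y => slice G w v x y * kern t x y) (-1) 1 (-1) 1 = kappa R * slice G w v t 0.
  by case: hG => _; apply.
have E2 : crect (fun x y => slice G w v x y * kern t x y) (-1) 1 (-1) 1 =
    crect (fun x y => (slice G w v x y + -1 * slice F w v x y) * kern t x y) (-1) 1 (-1) 1 +
    crect (fun x y => slice F w v x y * kern t x y) (-1) 1 (-1) 1.
  by rewrite -E; apply: eq_crect => // x y _ _ _; ring.
have B1 : cmod (crect (fun x y => (slice G w v x y + -1 * slice F w v x y) * kern t x y) (-1) 1 (-1) 1)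
    <= 4 * (D / (2 * m) * (1 - `|t|)^-1) * ((1 - -1) + (1 - -1)).
  apply: crect_le => // x y hx hy h; rewrite cmodM mulN1r.
  apply: ler_pM; rewrite ?cmod_ge0 //; last exact: kern_le.
  by apply: GF; exact: inb.
have B2 : cmod (slice G w v t 0 - slice F w v t 0) <= D / (2 * m).
  by apply: GF; apply: inb; [move: t1; rewrite ltr_norml => /andP[]; lra|lra].
have DE : D = cmod (kappa R * (slice G w v t 0 - slice F w v t 0) -
   crect (fun x y => (slice G w v x y + -1 * slice F w v x y) * kern t x y) (-1) 1 (-1) 1).
  rewrite /D; congr cmod; rewrite mulrBr -E1 E2; ring.
have : D <= cmod (kappa R) * (D / (2 * m)) + 4 * (D / (2 * m) * (1 - `|t|)^-1) * ((1 - -1) + (1 - -1)).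
  rewrite {1}DE; apply: le_trans (cmodB _ _) _; rewrite cmodM; apply: lerD => //.
  by rewrite ler_wpM2l ?cmod_ge0.
have -> : cmod (kappa R) * (D / (2 * m)) + 4 * (D / (2 * m) * (1 - `|t|)^-1) * ((1 - -1) + (1 - -1)) =
  D / (2 * m) * m by rewrite /m; ring.
have -> : D / (2 * m) * m = D / 2 by field; rewrite gt_eqF.
lra.
Qed.

End Slice.

(** * Derivatives in real directions *)

Section Derivative.
Local Open Scope classical_set_scope.
Variables (R : realType) (n : nat).
Notation V := 'rV[R]_(n + n).
Implicit Types (F G : V -> R[i]) (w : V) (u v : 'rV[R]_n) (x y t s rho M eps : R).

Definition cder (h : V) F w : R[i] := Complex ('D_h (ReF F) w) ('D_h (ImF F) w).

Definition hdir v : V := row_mx v 0.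

Lemma ex_hdir k : ex R k = hdir (delta_mx 0 k).
Proof. exact: delta_mx_lshift. Qed.

(** Directional differentiability with a quadratic remainder. The estimate determines d
    ([quad_cder]), so additivity and symmetry of derivatives reduce to adding remainders. *)
Definition quad F w (h : V) (d : R[i]) := exists C del, 0 < del /\
  forall t, `|t| <= del -> cmod (F (w + t *: h) - F w - Complex t 0 * d) <= C * t ^+ 2.

Lemma derive_quad (f : V -> R) w h (d C del : R) : 0 < del ->
  (forall t, `|t| <= del -> `|f (w + t *: h) - f w - t * d| <= C * t ^+ 2) -> 'D_h f w = d.
Proof.
move=> d0 H; apply: cvg_lim => //; apply/cvgrPdist_le => /= eps e0.
have m0 : 0 < `|C| + 1 by rewrite ltr_wpDl.
apply/nbhs_ballP; exists (Num.min del (eps / (`|C| + 1))); first by rewrite /= lt_min d0 divr_gt0.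
move=> t; rewrite -ball_normE /= sub0r normrN lt_min => /andP[td te] t0.
have t0' : 0 < `|t| by rewrite normr_gt0.
rewrite [t *: h + w]addrC /GRing.scale /=.
have -> : d - t^-1 * (f (w + t *: h) - f w) = - (t^-1 * (f (w + t *: h) - f w - t * d)).
  by field.
rewrite normrN normrM normfV mulrC ler_pdivrMr //.
apply: le_trans (H t (ltW td)) _; rewrite -normr_id -real_normK ?num_real // normr_id expr2 mulrA.
apply: ler_wpM2r => //; move: te; rewrite ltr_pdivlMr // => te.
apply: le_trans (ltW te); rewrite mulrC ler_wpM2l //.
by apply: le_trans (ler_norm C) _; rewrite lerDl.
Qed.

Lemma quad_cder F w h d : quad F w h d -> cder h F w = d.
Proof.
case: d => p q [C [del [d0 H]]]; rewrite /cder; congr Complex.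
  apply: derive_quad d0 _ => t td; apply: le_trans (H t td); apply: le_trans (normr_Re _).
  by rewrite !(ReD, ReN) /= mul0r subr0.
apply: derive_quad d0 _ => t td; apply: le_trans (H t td); apply: le_trans (normr_Im _).
by rewrite !(ImD, ImN) /= mul0r addr0.
Qed.

Lemma quad_lin F G w h d e (a b : R[i]) : quad F w h d -> quad G w h e ->
  quad (fun w => a * F w + b * G w) w h (a * d + b * e).
Proof.
case=> C1 [d1 [d10 H1]] [C2 [d2 [d20 H2]]].
exists (cmod a * C1 + cmod b * C2), (Num.min d1 d2); split; first by rewrite lt_min d10.
move=> t; rewrite le_min => /andP[t1 t2].
set X := (X in cmod X).
have -> : X = a * (F (w + t *: h) - F w - Complex t 0 * d) + b * (G (w + t *: h) - G w - Complex t 0 * e).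
  by rewrite /X; ring.
apply: le_trans (cmodD _ _) _; rewrite !cmodM mulrDl -!mulrA.
by apply: lerD; apply: ler_wpM2l; rewrite ?cmod_ge0 //; [exact: H1|exact: H2].
Qed.

Lemma quad_scale F w h d c : quad F w h d -> quad F w (c *: h) (Complex c 0 * d).
Proof.
case=> C [del [d0 H]]; exists (C * c ^+ 2), (del / (`|c| + 1)).
have m0 : 0 < `|c| + 1 by rewrite ltr_wpDl.
split; first by rewrite divr_gt0.
move=> t; rewrite ler_pdivlMr // => td; rewrite scalerA mulrA.
have -> : Complex t 0 * Complex c 0 = Complex (t * c) 0 :> R[i].
  by rewrite -[LHS]/(Complex _ _); congr Complex; ring.
have -> : C * c ^+ 2 * t ^+ 2 = C * (t * c) ^+ 2 by ring.
apply: H; rewrite normrM; apply: le_trans td; apply: ler_wpM2l => //.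
by rewrite lerDl.
Qed.

(** On the unit square [crect_le] gives 4 * 4 = 16 times the supremum; the kernel with pole |t| <=
    1/2 contributes 2, and Cauchy's formula divides by |kappa|. *)
Definition cauchy_const : R := 32 / cmod (kappa R).

Lemma cauchy_const_gt0 : 0 < cauchy_const.
Proof. by rewrite divr_gt0 // cmod_gt0 kappa_neq0. Qed.

(** From 1/(z - t) = 1/z + t/z^2 + t^2/(z^2 (z - t)) under the contour integral. The middle term
    identifies d as the integral of F/z^2 divided by kappa, and the last one is the remainder. *)
Lemma hol_quad w0 rho M F w v : hol w0 rho F -> (forall w, `|w - w0| < rho -> cmod (F w) <= M) ->
  `|w - w0| + `|v| < rho -> exists2 d, cmod d <= cauchy_const * M &
  forall t, `|t| <= 2^-1 -> cmod (F (w + t *: hdir v) - F w - Complex t 0 * d) <= cauchy_const * M * t ^+ 2.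
Proof.
move=> hF FM wv.
have m1 : -1 <= 1 :> R by lra.
have M0 : 0 <= M.
  by apply: le_trans (cmod_ge0 (F w)) (FM w _); apply: le_lt_trans wv; rewrite lerDl.
have inb x y : -1 <= x <= 1 -> -1 <= y <= 1 -> cmod (slice F w v x y) <= M.
  move=> hx hy; apply: FM; rewrite addrAC; apply: le_lt_trans (ler_normD _ _) _; apply: le_lt_trans wv.
  by rewrite lerD2l; apply: norm_cplx_dir; rewrite ler_norml.
have sF := hol_slice_side_cont hF wv.
have n0 : `|0 : R| < 1 by rewrite normr0.
have k0 := kern_side_cont n0.
have cc z := cside_cont_cst z (-1 : R) 1 (-1) 1.
have kap0 : 0 < cmod (kappa R) by rewrite cmod_gt0 kappa_neq0.
pose I2 := crect (fun x y => slice F w v x y * (kern 0 x y * kern 0 x y)) (-1) 1 (-1) 1.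
have c2 := cside_contM sF (cside_contM k0 k0).
have kb x y : -1 <= x <= 1 -> -1 <= y <= 1 -> [\/ x = -1, x = 1, y = -1 | y = 1] -> cmod (kern 0 x y) <= 1.
  by move=> hx hy h; have := kern_le n0 hx hy h; rewrite normr0 subr0 invr1.
exists ((kappa R)^-1 * I2).
  rewrite cmodM cmodV mulrC ler_pdivrMr // /cauchy_const.
  have -> : 32 / cmod (kappa R) * M * cmod (kappa R) = 32 * M by field; rewrite gt_eqF.
  have : cmod I2 <= 4 * M * ((1 - -1) + (1 - -1)).
    apply: crect_le => // x y hx hy h; rewrite !cmodM -[leRHS]mulr1.
    apply: ler_pM; rewrite ?mulr_ge0 ?cmod_ge0 //; first exact: inb.
    by rewrite -[leRHS]mulr1; apply: ler_pM; rewrite ?cmod_ge0 //; exact: kb.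
  lra.
move=> t t2; have t1 : `|t| < 1 by lra.
have kt := kern_side_cont t1.
have E0 : crect (fun x y => slice F w v x y * kern 0 x y) (-1) 1 (-1) 1 = kappa R * F w.
  by case: hF => _ /(_ w v 0 wv n0) ->; rewrite /slice /cplx_dir !scale0r !addr0.
have Et : crect (fun x y => slice F w v x y * kern t x y) (-1) 1 (-1) 1 = kappa R * F (w + t *: hdir v).
  by case: hF => _ /(_ w v t wv t1) ->; rewrite /slice /cplx_dir !scale0r !addr0.
set X := _ - _ - _.
have ck3 := cside_contM sF (cside_contM (cc (Complex (t ^+ 2) 0)) (cside_contM (cside_contM k0 k0) kt)).
have cz := cside_contM (cc (Complex t 0)) c2.
have c0 := cside_contM sF k0.
have EX : kappa R * X = crect (fun x y => slice F w v x y *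
    (Complex (t ^+ 2) 0 * (kern 0 x y * kern 0 x y * kern t x y))) (-1) 1 (-1) 1.
  have -> : kappa R * X = kappa R * F (w + t *: hdir v) - kappa R * F w - Complex t 0 * I2.
    by rewrite /X; field; rewrite kappa_neq0.
  rewrite -Et -E0.
  have A1 := crectZ (Complex t 0) m1 m1 c2; rewrite -/I2 in A1.
  have A2 := crectD m1 m1 ck3 c0; have A3 := crectD m1 m1 (cside_contD ck3 c0) cz.
  rewrite A1 A2 in A3.
  apply/eqP; rewrite subr_eq subr_eq; apply/eqP; rewrite [RHS]addrAC.
  rewrite -A3; apply: eq_crect => // x y hx hy h.
  have z0 : Complex x y != 0 :> R[i].
    by rewrite Complex_eq0; apply/negP => /andP[/eqP ? /eqP ?]; case: h; lra.
  have zt : Complex x y - Complex t 0 != 0 :> R[i].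
    rewrite -[_ - _]/(Complex _ _) Complex_eq0; apply/negP => /andP[/eqP ? /eqP ?].
    by move: t2; rewrite ler_norml => /andP[? ?]; case: h; lra.
  have -> : kern t x y = (Complex x y - Complex t 0)^-1.
    by rewrite /kern; congr (_^-1); rewrite -[RHS]/(Complex _ _); congr Complex; ring.
  have -> : Complex (t ^+ 2) 0 = Complex t 0 * Complex t 0 :> R[i].
    by rewrite -[RHS]/(Complex _ _); congr Complex; ring.
  rewrite /kern subr0; field; by rewrite z0 zt.
rewrite -(ler_pM2l kap0) -cmodM EX /cauchy_const.
have -> : cmod (kappa R) * (32 / cmod (kappa R) * M * t ^+ 2) = 4 * (M * (t ^+ 2 * (1 * 1 * 2))) * ((1 - -1) + (1 - -1)).
  by field; rewrite gt_eqF.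
apply: crect_le => // x y hx hy h; rewrite !cmodM cmod_real ger0_norm ?sqr_ge0 //.
have kt2 : cmod (kern t x y) <= 2.
  apply: le_trans (kern_le t1 hx hy h) _.
  have -> : 2 = (2^-1)^-1 :> R by rewrite invrK.
  by rewrite lef_pV2 ?posrE //; lra.
have k1 := kb x y hx hy h.
have p0 (a b : R[i]) : 0 <= cmod a * cmod b by rewrite mulr_ge0 ?cmod_ge0.
apply: ler_pM; [exact: cmod_ge0| |exact: inb|].
  by apply: mulr_ge0; [exact: sqr_ge0|apply: mulr_ge0 => //; exact: cmod_ge0].
apply: (@ler_wpM2l _ (t ^+ 2)); first exact: sqr_ge0.
apply: ler_pM; rewrite ?mulr_ge0 ?cmod_ge0 //.
by apply: ler_pM; rewrite ?cmod_ge0.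
Qed.

Definition bounded_on w0 rho M F := forall w, `|w - w0| < rho -> cmod (F w) <= M.

Definition holb w0 rho M F := hol w0 rho F /\ bounded_on w0 rho M F.

Lemma norm_hdir v : `|hdir v| <= `|v|.
Proof.
have -> : hdir v = cplx_dir v 1 0 by rewrite /cplx_dir scale1r scale0r addr0.
by apply: norm_cplx_dir; rewrite ?normr1 ?normr0.
Qed.

Lemma hdirZ c v : hdir (c *: v) = c *: hdir v.
Proof. by rewrite /hdir scale_row_mx scaler0. Qed.

Lemma hdirD u v : hdir (u + v) = hdir u + hdir v.
Proof. by rewrite /hdir add_row_mx addr0. Qed.

Lemma holb_quad w0 rho M F rho' u w : holb w0 rho M F -> 0 < rho' -> rho' < rho -> `|u| <= 1 ->
  `|w - w0| < rho' ->
  cmod (cder (hdir u) F w) <= cauchy_const * M * (2 / (rho - rho')) /\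
  forall t, `|t| <= (rho - rho') / 4 ->
    cmod (F (w + t *: hdir u) - F w - Complex t 0 * cder (hdir u) F w) <=
    cauchy_const * M * (2 / (rho - rho')) ^+ 2 * t ^+ 2.
Proof.
move=> [hF FM] r0 rr u1 hw.
(* The direction is scaled so that its unit square fits between the two balls; derivative and
   remainder then pick up 1/l and 1/l^2. *)
pose l := (rho - rho') / 2; have l0 : 0 < l by rewrite /l; lra.
have wl : `|w - w0| + `|l *: u| < rho.
  have : `|l *: u| <= l * 1 by rewrite normrZ gtr0_norm // ler_wpM2l // ltW.
  by rewrite /l; lra.
have [d dM H] := hol_quad hF FM wl.
have K t : `|t| <= (rho - rho') / 4 -> cmod (F (w + t *: hdir u) - F w - Complex t 0 * (Complex l^-1 0 * d)) <=
    cauchy_const * M * (2 / (rho - rho')) ^+ 2 * t ^+ 2.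
  move=> tl; have tl' : `|t / l| <= 2^-1.
    by rewrite normrM normfV (gtr0_norm l0) ler_pdivrMr // /l; lra.
  have := H _ tl'; rewrite hdirZ scalerA divfK ?gt_eqF // mulrA.
  have -> : Complex t 0 * Complex l^-1 0 = Complex (t / l) 0 :> R[i].
    by rewrite -[LHS]/(Complex _ _); congr Complex; ring.
  by move=> h; apply: le_trans h _; rewrite le_eqVlt; apply/orP; left; apply/eqP; rewrite /l; field; lra.
have -> : cder (hdir u) F w = Complex l^-1 0 * d.
  apply: quad_cder; exists (cauchy_const * M * (2 / (rho - rho')) ^+ 2), ((rho - rho') / 4).
  by split=> //; lra.
split => //; rewrite cmodM cmod_real ger0_norm ?invr_ge0 ?(ltW l0) //.
have -> : 2 / (rho - rho') = l^-1 by rewrite /l; field; lra.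
by rewrite mulrC ler_wpM2r // invr_ge0 ltW.
Qed.

Lemma holb_ge0 w0 rho M F : 0 < rho -> holb w0 rho M F -> 0 <= M.
Proof. by move=> r0 [_ /(_ w0)]; rewrite subrr normr0 => /(_ r0); apply: le_trans; exact: cmod_ge0. Qed.

(** On the smaller ball the difference quotients converge uniformly, by the remainder in
    [holb_quad]; they satisfy [hol], which is stable under uniform limits. *)
Lemma holb_cder w0 rho M F rho' u : holb w0 rho M F -> 0 < rho' -> rho' < rho -> `|u| <= 1 ->
  holb w0 rho' (cauchy_const * M * (2 / (rho - rho'))) (cder (hdir u) F).
Proof.
move=> HF r0 rr u1; split; last by move=> w hw; case: (holb_quad HF r0 rr u1 hw).
have M0 : 0 <= M by apply: holb_ge0 HF; lra.
apply: hol_lim => eps e0.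
pose C := cauchy_const * M * (2 / (rho - rho')) ^+ 2.
have C0 : 0 <= C.
  by apply: mulr_ge0; [apply: mulr_ge0 => //; exact: ltW cauchy_const_gt0|exact: sqr_ge0].
pose t := Num.min ((rho - rho') / 4) (eps / (C + 1)).
have C1 : 0 < C + 1 by lra.
have t0 : 0 < t by rewrite lt_min; apply/andP; split; [lra|exact: divr_gt0].
have t1 : t <= (rho - rho') / 4 by rewrite ge_min lexx.
have t2 : t * (C + 1) <= eps by rewrite -ler_pdivlMr // ge_min lexx orbT.
clearbody t.
exists (fun w => Complex t^-1 0 * F (w + t *: hdir u) + - Complex t^-1 0 * F w).
  apply: hol_lin; last by apply: holS (ltW rr) _; case: HF.
  apply: (@hol_shift _ _ _ rho); last by case: HF.
  rewrite normrZ gtr0_norm //.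
  have : t * `|hdir u| <= t * 1 by rewrite ler_pM2l //; apply: le_trans (norm_hdir u) u1.
  lra.
move=> w hw; have [_ /(_ t)] := holb_quad HF r0 rr u1 hw; rewrite gtr0_norm // => /(_ t1) H.
set X := (X in cmod X).
have tt : Complex t^-1 0 * Complex t 0 = 1 :> R[i].
  by rewrite -[LHS]/(Complex _ _) !mulr0 !mul0r mulVf ?gt_eqF // subr0 addr0.
have -> : X = Complex t^-1 0 * (F (w + t *: hdir u) - F w - Complex t 0 * cder (hdir u) F w).
  by rewrite mulrBr mulrA tt mul1r /X; ring.
rewrite cmodM cmod_real gtr0_norm ?invr_gt0 // mulrC ler_pdivrMr //.
apply: le_trans H _; rewrite -/C expr2 mulrA; apply: ler_wpM2r; first exact: ltW.
by apply: le_trans t2; rewrite mulrC ler_wpM2l ?(ltW t0) //; lra.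
Qed.

Definition germ F w := exists rho M, 0 < rho /\ holb w rho M F.

Lemma germ_quad1 F w u : germ F w -> `|u| <= 1 -> quad F w (hdir u) (cder (hdir u) F w).
Proof.
case=> rho [M [r0 HF]] u1; have r2 : 0 < rho / 2 by lra.
have rr : rho / 2 < rho by lra.
have ww : `|w - w| < rho / 2 by rewrite subrr normr0.
have [_ H] := holb_quad HF r2 rr u1 ww.
by exists (cauchy_const * M * (2 / (rho - rho / 2)) ^+ 2), ((rho - rho / 2) / 4); split=> //; lra.
Qed.

Lemma norm_unit u : exists2 c, 0 < c & `|c^-1 *: u| <= 1.
Proof.
exists (`|u| + 1); first by rewrite ltr_wpDl.
have m0 : 0 < `|u| + 1 by rewrite ltr_wpDl.
by rewrite normrZ gtr0_norm ?invr_gt0 // mulrC ler_pdivrMr // mul1r lerDl.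
Qed.

Lemma germ_quad F w u : germ F w -> quad F w (hdir u) (cder (hdir u) F w).
Proof.
move=> g; have [c c0 u1] := norm_unit u.
have /(@quad_scale _ _ _ _ c) := germ_quad1 g u1.
rewrite -hdirZ scalerA divff ?gt_eqF // scale1r => q.
by rewrite (quad_cder q).
Qed.

Lemma cderZ F w u c : germ F w -> cder (hdir (c *: u)) F w = Complex c 0 * cder (hdir u) F w.
Proof. by move=> g; apply: quad_cder; rewrite hdirZ; apply: quad_scale; exact: germ_quad. Qed.

Lemma cder_lin F G w u (a b : R[i]) : germ F w -> germ G w ->
  cder (hdir u) (fun w => a * F w + b * G w) w = a * cder (hdir u) F w + b * cder (hdir u) G w.
Proof. by move=> gF gG; apply: quad_cder; apply: quad_lin; exact: germ_quad. Qed.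

Lemma holbS w0 w1 rho rho' M F : `|w1 - w0| + rho' <= rho -> holb w0 rho M F -> holb w1 rho' M F.
Proof.
move=> h [[cF HF] FM].
have K w : `|w - w1| < rho' -> `|w - w0| < rho.
  move=> hw; have -> : w - w0 = (w - w1) + (w1 - w0) by rewrite addrA subrK.
  by apply: le_lt_trans (ler_normD _ _) _; lra.
split; [split|] => [w /K|w v t hw|w /K]; [exact: cF| |exact: FM].
apply: HF; have -> : w - w0 = (w - w1) + (w1 - w0) by rewrite addrA subrK.
by have := ler_normD (w - w1) (w1 - w0); lra.
Qed.

Lemma holb_germ w0 rho M F w : holb w0 rho M F -> `|w - w0| < rho -> germ F w.
Proof.
move=> HF hw; exists (rho - `|w - w0|), M; split; first by rewrite subr_gt0.
by apply: holbS HF; lra.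
Qed.

Lemma germ_cder F w u : germ F w -> germ (cder (hdir u) F) w.
Proof.
case=> rho [M [r0 HF]]; have r2 : 0 < rho / 2 by lra.
have rr : rho / 2 < rho by lra.
have [c c0 u1] := norm_unit u.
have [H1 H2] := holb_cder HF r2 rr u1.
have E w' : `|w' - w| < rho / 2 -> cder (hdir u) F w' = Complex c 0 * cder (hdir (c^-1 *: u)) F w' + 0 * F w'.
  move=> hw; rewrite mul0r addr0 -cderZ ?scalerA ?divff ?gt_eqF ?scale1r //.
  by apply: holb_germ HF _; lra.
have H3 := hol_lin (Complex c 0) 0 H1 (holS (ltW rr) HF.1).
exists (rho / 2), (cmod (Complex c 0 : R[i]) * (cauchy_const * M * (2 / (rho - rho / 2)))).
split; first exact: r2.
split; last first.
  by move=> w' hw; rewrite E // mul0r addr0 cmodM ler_wpM2l ?cmod_ge0 // H2.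
apply: hol_lim => eps e0; eexists; first exact: H3.
by move=> w' hw; rewrite E // subrr cmod0 ltW.
Qed.

(** The displacement goes along v and then along u. The derivative along u at the intermediate point
    differs by O(t) from its value at w, which costs O(t^2). *)
Lemma cderD1 F w u v : germ F w -> `|u| <= 1 -> `|v| <= 1 ->
  cder (hdir (u + v)) F w = cder (hdir u) F w + cder (hdir v) F w.
Proof.
case=> rho [M [r0 HF]] u1 v1; have r2 : 0 < rho / 2 by lra.
have rr : rho / 2 < rho by lra.
have ww : `|w - w| < rho by rewrite subrr normr0.
have gF := holb_germ HF ww.
have [C1 [d1 [d10 H1]]] := germ_quad v gF.
have [C2 [d2 [d20 H2]]] := germ_quad v (germ_cder u gF).
set A := cder (hdir u) F in H2 *; set a := cder (hdir v) A w in H2.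
pose C := cauchy_const * M * (2 / (rho - rho / 2)) ^+ 2.
pose del := Num.min (Num.min d1 d2) (Num.min (rho / 8) 1).
apply: quad_cder; exists (C + C1 + cmod a + `|C2|), del.
split; first by rewrite !lt_min d10 d20 ltr01 andbT; lra.
move=> t; rewrite !le_min => /andP[/andP[t1 t2] /andP[t3 t4]].
have tv : `|w + t *: hdir v - w| < rho / 2.
  rewrite addrC addKr normrZ; have : `|t| * `|hdir v| <= `|t| * 1.
    by rewrite ler_wpM2l //; apply: le_trans (norm_hdir v) v1.
  by lra.
have t3' : `|t| <= (rho - rho / 2) / 4 by lra.
have [_ /(_ t t3') K] := holb_quad HF r2 rr u1 tv.
rewrite -/C -/A in K.
have {}H1 := H1 t t1; have {}H2 := H2 t t2.
have E : w + t *: hdir (u + v) = w + t *: hdir v + t *: hdir u.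
  by rewrite hdirD scalerDr addrA addrAC.
set X := (X in cmod X).
have -> : X = (F (w + t *: hdir v + t *: hdir u) - F (w + t *: hdir v) - Complex t 0 * A (w + t *: hdir v))
  + (F (w + t *: hdir v) - F w - Complex t 0 * cder (hdir v) F w)
  + Complex t 0 * ((A (w + t *: hdir v) - A w - Complex t 0 * a) + Complex t 0 * a).
  by rewrite /X E -/A; ring.
apply: le_trans (cmodD _ _) _; apply: le_trans (lerD (cmodD _ _) (lexx _)) _.
have T2 : `|t| * `|t| = t ^+ 2 by rewrite -expr2 real_normK ?num_real.
have L : cmod (Complex t 0 * ((A (w + t *: hdir v) - A w - Complex t 0 * a) + Complex t 0 * a)) <=
    (cmod a + `|C2|) * t ^+ 2.
  rewrite cmodM cmod_real; apply: le_trans (ler_wpM2l (normr_ge0 t) (cmodD _ _)) _.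
  rewrite cmodM cmod_real mulrDr [leRHS]mulrDl [leRHS]addrC mulrA T2 [t ^+ 2 * cmod a]mulrC lerD2r.
  apply: le_trans (_ : 1 * (`|C2| * t ^+ 2) <= _); last by rewrite mul1r.
  apply: ler_pM; rewrite ?cmod_ge0 //; apply: le_trans H2 _.
  by rewrite ler_wpM2r ?sqr_ge0 // ler_norm.
apply: le_trans (lerD (lerD K H1) L) _.
by rewrite -!mulrDl !addrA.
Qed.

Lemma cderD F w u v : germ F w -> cder (hdir (u + v)) F w = cder (hdir u) F w + cder (hdir v) F w.
Proof.
move=> g; pose c := `|u| + `|v| + 1.
have c0 : 0 < c by rewrite ltr_wpDl // addr_ge0.
have K (z : 'rV[R]_n) : `|z| <= c -> `|c^-1 *: z| <= 1.
  by move=> h; rewrite normrZ gtr0_norm ?invr_gt0 // mulrC ler_pdivrMr // mul1r.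
have cE (z : 'rV[R]_n) : `|z| <= c -> exists2 z', z = c *: z' & `|z'| <= 1.
  by move=> /K h; exists (c^-1 *: z) => //; rewrite scalerA divff ?gt_eqF // scale1r.
have uc : `|u| <= c by have := normr_ge0 v; rewrite /c; lra.
have vc : `|v| <= c by have := normr_ge0 u; rewrite /c; lra.
clearbody c; have [u' -> u1] := cE u uc; have [v' -> v1] := cE v vc.
by rewrite -scalerDr !cderZ // -mulrDr cderD1.
Qed.

(** F(z + tv) - F(z) - t (d_v F)(z) is O(t^2) uniformly on a ball. Cauchy's estimate makes its
    derivative along u also O(t^2), and this is the expansion of d_u F in the direction v with
    coefficient d_u d_v F. *)
Lemma cder_comm1 F w u v : germ F w -> `|u| <= 1 -> `|v| <= 1 ->
  cder (hdir v) (cder (hdir u) F) w = cder (hdir u) (cder (hdir v) F) w.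
Proof.
case=> rho [M [r0 HF]] u1 v1; have r2 : 0 < rho / 2 by lra.
have rr : rho / 2 < rho by lra.
have ww : `|w - w| < rho by rewrite subrr normr0.
have gF := holb_germ HF ww.
have HB := holb_cder HF r2 rr v1.
set A := cder (hdir u) F; set B := cder (hdir v) F in HB *.
pose C := cauchy_const * M * (2 / (rho - rho / 2)) ^+ 2.
pose C' := cauchy_const * C * (2 / (rho / 2 - rho / 4)).
apply: quad_cder; exists C', (rho / 8); split; first lra.
move=> t t8.
have tv z : `|z - w| < rho / 2 -> `|z + t *: hdir v - w| < rho.
  move=> hz; rewrite addrAC; apply: le_lt_trans (ler_normD _ _) _; rewrite normrZ.
  have : `|t| * `|hdir v| <= `|t| * 1 by rewrite ler_wpM2l //; apply: le_trans (norm_hdir v) v1.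
  lra.
pose H z := 1 * (1 * F (z + t *: hdir v) + (-1) * F z) + (- Complex t 0) * B z.
have hH : holb w (rho / 2) (C * t ^+ 2) H.
  split.
    apply: hol_lin HB.1; apply: hol_lin; last exact: holS (ltW rr) HF.1.
    apply: hol_shift HF.1; rewrite normrZ.
    have : `|t| * `|hdir v| <= `|t| * 1 by rewrite ler_wpM2l //; apply: le_trans (norm_hdir v) v1.
    lra.
  move=> z hz; have t8' : `|t| <= (rho - rho / 2) / 4 by lra.
  have [_ /(_ t t8')] := holb_quad HF r2 rr v1 hz.
  by rewrite /H !mul1r mulN1r mulNr.
have r4 : 0 < rho / 4 by lra.
have r42 : rho / 4 < rho / 2 by lra.
have w4 : `|w - w| < rho / 4 by rewrite subrr normr0.
have [K _] := holb_quad hH r4 r42 u1 w4.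
have w2 : `|w - w| < rho / 2 by rewrite subrr normr0.
have gFt := holb_germ HF (tv w w2).
have q1 : quad (fun z => F (z + t *: hdir v)) w (hdir u) (A (w + t *: hdir v)).
  have [c1 [e1 [e10 q]]] := germ_quad u gFt; exists c1, e1; split=> // s /q.
  by rewrite [w + _ + _]addrAC.
have q2 : quad F w (hdir u) (A w) by exact: germ_quad.
have q3 : quad B w (hdir u) (cder (hdir u) B w) by apply: germ_quad; exact: germ_cder.
have q := quad_lin 1 (- Complex t 0) (quad_lin 1 (-1) q1 q2) q3.
move: K; rewrite (quad_cder q) !mul1r mulN1r mulNr => K; apply: le_trans K _.
by rewrite /C' le_eqVlt; apply/orP; left; apply/eqP; ring.
Qed.

End Derivative.

(** * Constant-coefficient operators under affine maps *)

Section BoxAlgebra.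
Local Open Scope classical_set_scope.
Variables (R : realType) (n : nat).
Notation V := 'rV[R]_(n + n).
Notation I := (- 'i : R[i]).
Implicit Types (F G : V -> R[i]) (w : V) (U : set V) (P Q : mpoly.mpoly n R).

Definition opn U := forall w, U w -> exists2 del : R, 0 < del & forall w', `|w' - w| < del -> U w'.

Definition hol_on U F := forall w, U w -> germ F w.

Lemma pdx_cder k F : pdx k F = cder (hdir (delta_mx 0 k)) F.
Proof. by rewrite -ex_hdir. Qed.

Lemma quad_local F G w h d (del : R) : 0 < del -> (forall w', `|w' - w| < del -> F w' = G w') ->
  quad F w h d -> quad G w h d.
Proof.
move=> d0 E [C [e [e0 H]]]; have m0 : 0 < `|h| + 1 by rewrite ltr_wpDl.
exists C, (Num.min e (del / (2 * (`|h| + 1)))); split; first by rewrite lt_min e0 divr_gt0 // mulr_gt0.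
move=> t; rewrite le_min => /andP[/H + t2]; rewrite !E ?subrr ?normr0 //.
rewrite addrC addKr normrZ; move: t2; rewrite ler_pdivlMr ?mulr_gt0 // => t2.
have : `|t| * `|h| <= `|t| * (`|h| + 1) by rewrite ler_wpM2l // lerDl.
lra.
Qed.

Lemma cder_congr U F G w u : opn U -> (forall w, U w -> F w = G w) -> hol_on U F -> U w ->
  cder (hdir u) F w = cder (hdir u) G w.
Proof.
move=> oU E hF Uw; have [del d0 HU] := oU w Uw.
apply/esym/quad_cder/(quad_local d0 _ (germ_quad u (hF w Uw))).
by move=> w' /HU /E.
Qed.

Definition ders (s : seq 'I_n) F := foldr (@pdx R n) F s.

Lemma hol_ders U F s : hol_on U F -> hol_on U (ders s F).
Proof.
move=> hF w Uw; elim: s => [|k s IH] /=; first exact: hF.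
by rewrite pdx_cder; exact: germ_cder.
Qed.

Lemma ders_congr U F G s w : opn U -> (forall w, U w -> F w = G w) -> hol_on U F -> U w ->
  ders s F w = ders s G w.
Proof.
move=> oU E hF; elim: s w => [|k s IH] w Uw /=; first exact: E.
by rewrite !pdx_cder; apply: cder_congr oU IH _ Uw; exact: hol_ders.
Qed.

Lemma norm_delta (k : 'I_n) : `|delta_mx 0 k : 'rV[R]_n| <= 1.
Proof.
apply: norm_le_coord => // i j; rewrite mxE.
by case: (_ && _); rewrite ?normr1 ?normr0.
Qed.

Lemma ders_rem U F s k w : opn U -> hol_on U F -> k \in s -> U w ->
  ders s F w = ders (k :: rem k s) F w.
Proof.
move=> oU hF; elim: s w => [|a s IH] //= w; rewrite inE eq_sym.
have [->//|nak /= ks] := eqVneq a k => Uw /=.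
transitivity (pdx a (pdx k (ders (rem k s) F)) w).
  rewrite !(pdx_cder a); apply: cder_congr oU _ _ Uw; last exact: hol_ders.
  by move=> w' Uw'; rewrite IH.
rewrite !pdx_cder; apply: cder_comm1; [exact: (hol_ders _ hF)|exact: norm_delta|exact: norm_delta].
Qed.

Lemma ders_perm U F s s' w : opn U -> hol_on U F -> perm_eq s s' -> U w -> ders s F w = ders s' F w.
Proof.
move=> oU hF; elim: s s' w => [|a s IH] s' w.
  by move=> /perm_size /esym /size0nil ->.
move=> p Uw; have as' : a \in s' by rewrite -(perm_mem p) mem_head.
rewrite (ders_rem oU hF as' Uw) /= !pdx_cder; apply: cder_congr oU _ _ Uw; last exact: hol_ders.
move=> w' Uw'; apply: IH => //; rewrite -(perm_cons a); apply: (perm_trans p); exact: perm_to_rem.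
Qed.

Lemma ders_lin U F G (a b : R[i]) s w : opn U -> hol_on U F -> hol_on U G -> U w ->
  ders s (fun w => a * F w + b * G w) w = a * ders s F w + b * ders s G w.
Proof.
move=> oU hF hG; elim: s w => [|k s IH] w Uw //=.
rewrite !pdx_cder -cder_lin; [|exact: (hol_ders _ hF)|exact: (hol_ders _ hG)].
apply/esym/cder_congr/Uw; first exact: oU.
  by move=> w' Uw'; rewrite IH.
move=> w' Uw'.
have [r1 [M1 [r10 [h1 b1]]]] := @hol_ders _ _ s hF w' Uw'.
have [r2 [M2 [r20 [h2 b2]]]] := @hol_ders _ _ s hG w' Uw'.
exists (Num.min r1 r2), (cmod a * M1 + cmod b * M2); split; first by rewrite lt_min r10.
split; first by apply: hol_lin; [apply: holS h1|apply: holS h2]; rewrite ge_min lexx ?orbT.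
move=> z; rewrite lt_min => /andP[/b1 z1 /b2 z2]; apply: le_trans (cmodD _ _) _; rewrite !cmodM.
by apply: lerD; apply: ler_wpM2l; rewrite ?cmod_ge0.
Qed.

(** A multi-index unfolded into a list of variables, so that commutation of derivatives becomes
    invariance under permutation ([ders_perm]). *)
Definition mlist (al : mpoly.multinom n) : seq 'I_n :=
  flatten [seq nseq (mpoly.fun_of_multinom al k) k | k <- enum 'I_n].

Lemma pdxm_ders al F : pdxm al F = ders (mlist al) F.
Proof.
rewrite /pdxm /mlist /ders; elim: (enum _) => [|k s IH] //=.
rewrite foldr_cat -IH; move: (foldr _ _ s) => G.
by elim: (mpoly.fun_of_multinom al k) => //= j ->.
Qed.

Lemma count_mlist al x : count_mem x (mlist al) = mpoly.fun_of_multinom al x.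
Proof.
have H s : count_mem x (flatten [seq nseq (mpoly.fun_of_multinom al k) k | k <- s]) =
    (mpoly.fun_of_multinom al x * count_mem x s)%N.
  elim: s => [|k s IH] /=; first by rewrite muln0.
  by rewrite count_cat IH count_nseq /= mulnDr; case: eqP => [->|_]; rewrite ?mul1n ?muln1 ?mul0n ?muln0.
by rewrite /mlist H count_uniq_mem ?enum_uniq // mem_enum muln1.
Qed.

Lemma pdxm_succ U F al k w : opn U -> hol_on U F -> U w ->
  pdxm (mpoly.mnm_add (mpoly.mnm1 k) al) F w = pdxm al (pdx k F) w.
Proof.
move=> oU hF Uw; rewrite !pdxm_ders.
have -> : ders (mlist al) (pdx k F) = ders (rcons (mlist al) k) F by rewrite /ders foldr_rcons.
apply: ders_perm oU hF _ Uw; apply/allP => x _ /=; apply/eqP.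
by rewrite -cats1 count_cat !count_mlist /= addn0 mpoly.mnmDE mpoly.mnm1E addnC.
Qed.

Lemma BoxOp_supp P F w (s : seq (mpoly.multinom n)) : uniq s -> {subset mpoly.msupp P <= s} ->
  BoxOp P F w = \sum_(al <- s) Complex (mpoly.mcoeff al P) 0 * I ^+ mpoly.mdeg al * pdxm al F w.
Proof.
move=> us sub; rewrite /BoxOp.
rewrite [RHS](bigID (fun al => al \in mpoly.msupp P)) /= [X in _ + X]big1 ?addr0; last first.
  by move=> al /mpoly.memN_msupp_eq0 ->; rewrite mul0r mul0r.
rewrite -[RHS]big_filter; apply: perm_big; apply: uniq_perm.
- exact: mpoly.msupp_uniq.
- by rewrite filter_uniq.
by move=> al; rewrite mem_filter; case E : (al \in _) => //=; rewrite sub.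
Qed.

Lemma BoxOpD P Q F w : BoxOp (P + Q) F w = BoxOp P F w + BoxOp Q F w.
Proof.
pose s := undup (mpoly.msupp P ++ mpoly.msupp Q ++ mpoly.msupp (P + Q)).
have us : uniq s by exact: undup_uniq.
rewrite !(BoxOp_supp F w us); first last.
- by move=> al h; rewrite mem_undup !mem_cat h !orbT.
- by move=> al h; rewrite mem_undup !mem_cat h.
- by move=> al h; rewrite mem_undup !mem_cat h !orbT.
rewrite -big_split; apply: eq_bigr => al _ /=; rewrite mpoly.mcoeffD.
have -> (a b : R) : Complex (a + b) 0 = Complex a 0 + Complex b 0 :> R[i].
  by rewrite -[RHS]/(Complex _ _) addr0.
by rewrite !mulrDl.
Qed.

Lemma BoxOpZ c P F w : BoxOp (c *: P) F w = Complex c 0 * BoxOp P F w.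
Proof.
rewrite (@BoxOp_supp (c *: P) F w (mpoly.msupp P)) ?mpoly.msupp_uniq //; last exact: mpoly.msuppZ_le.
rewrite /BoxOp mulr_sumr; apply: eq_bigr => al _; rewrite mpoly.mcoeffZ.
have -> (a b : R) : Complex (a * b) 0 = Complex a 0 * Complex b 0 :> R[i].
  by rewrite -[RHS]/(Complex _ _) !(mul0r, mulr0, addr0, subr0).
by rewrite !mulrA.
Qed.

Lemma BoxOp0 F w : BoxOp 0 F w = 0.
Proof. by rewrite /BoxOp mpoly.msupp0 big_nil. Qed.

Lemma BoxOp_sum (T : Type) (s : seq T) (Q : T -> mpoly.mpoly n R) F w :
  BoxOp (\sum_(t <- s) Q t) F w = \sum_(t <- s) BoxOp (Q t) F w.
Proof.
elim: s => [|t s IH]; first by rewrite !big_nil BoxOp0.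
by rewrite !big_cons BoxOpD IH.
Qed.

Lemma BoxOpX al F w : BoxOp (mpoly.mpolyX R al) F w = I ^+ mpoly.mdeg al * pdxm al F w.
Proof.
rewrite /BoxOp mpoly.msuppX big_seq1 mpoly.mcoeffX eqxx.
by rewrite -[Complex _ _]/(1 : R[i]) mul1r.
Qed.

Lemma BoxOp_mulX U P F k w : opn U -> hol_on U F -> U w ->
  BoxOp (mpoly.mpolyX R (mpoly.mnm1 k) * P) F w = I * BoxOp P (pdx k F) w.
Proof.
move=> oU hF Uw.
rewrite {1}(mpoly.mpolyE P) mulr_sumr BoxOp_sum [in RHS]/BoxOp mulr_sumr; apply: eq_bigr => al _.
rewrite -scalerAr BoxOpZ -mpoly.mpolyXD BoxOpX (pdxm_succ _ _ oU hF Uw) mpoly.mdegD mpoly.mdeg1 exprS.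
by ring.
Qed.

Lemma BoxOp_lin U P F G (a b : R[i]) w : opn U -> hol_on U F -> hol_on U G -> U w ->
  BoxOp P (fun w => a * F w + b * G w) w = a * BoxOp P F w + b * BoxOp P G w.
Proof.
move=> oU hF hG Uw; rewrite /BoxOp !mulr_sumr -big_split; apply: eq_bigr => al _ /=.
by rewrite !pdxm_ders (ders_lin _ _ _ oU hF hG Uw); ring.
Qed.

Lemma BoxOp_congr U P F G w : opn U -> (forall w, U w -> F w = G w) -> hol_on U F -> U w ->
  BoxOp P F w = BoxOp P G w.
Proof.
move=> oU E hF Uw; apply: eq_bigr => al _; rewrite !pdxm_ders.
by rewrite (ders_congr _ oU E hF Uw).
Qed.

Lemma hol_on_pdx U F k : hol_on U F -> hol_on U (pdx k F).
Proof. by move=> hF; exact: (@hol_ders _ _ [:: k] hF). Qed.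

Lemma hol_on_lin U F G (a b : R[i]) : hol_on U F -> hol_on U G ->
  hol_on U (fun w => a * F w + b * G w).
Proof.
move=> hF hG w Uw.
have [r1 [M1 [r10 [h1 b1]]]] := hF w Uw; have [r2 [M2 [r20 [h2 b2]]]] := hG w Uw.
exists (Num.min r1 r2), (cmod a * M1 + cmod b * M2); split; first by rewrite lt_min r10.
split; first by apply: hol_lin; [apply: holS h1|apply: holS h2]; rewrite ge_min lexx ?orbT.
move=> z; rewrite lt_min => /andP[/b1 z1 /b2 z2]; apply: le_trans (cmodD _ _) _; rewrite !cmodM.
by apply: lerD; apply: ler_wpM2l; rewrite ?cmod_ge0.
Qed.

(** The affine map z -> x + zg with real x and g: one matrix acts on the real and on the imaginary
    part. *)
Definition tube_map (x : 'rV[R]_n) (g : 'M[R]_n) w : V :=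
  row_mx (x + lsubmx w *m g) (rsubmx w *m g).

Lemma tube_mapD x g w h : tube_map x g (w + h) = tube_map x g w + row_mx (lsubmx h *m g) (rsubmx h *m g).
Proof. by rewrite /tube_map !linearD /= !mulmxDl addrA add_row_mx. Qed.

Lemma tube_map_cplx x g w v a b : tube_map x g (w + cplx_dir v a b) = tube_map x g w + cplx_dir (v *m g) a b.
Proof. by rewrite tube_mapD !cplx_dirE row_mxKl row_mxKr -!scalemxAl. Qed.

Lemma norm_mulmx (g : 'M[R]_n) (v : 'rV[R]_n) : `|v *m g| <= (n%:R * `|g|) * `|v|.
Proof.
apply: norm_le_coord; first by rewrite !mulr_ge0.
move=> i k; rewrite ord1 mxE; apply: le_trans (ler_norm_sum _ _ _) _.
have -> : n%:R * `|g| * `|v| = \sum_(j < n) `|v| * `|g|.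
  by rewrite sumr_const card_ord -mulr_natl; ring.
by apply: ler_sum => j _; rewrite normrM; apply: ler_pM => //; exact: coord_norm_le.
Qed.

Lemma norm_lsubmx w : `|lsubmx w| <= `|w|.
Proof. by apply: norm_le_coord => // i k; rewrite mxE; exact: coord_norm_le. Qed.

Lemma norm_rsubmx w : `|rsubmx w| <= `|w|.
Proof. by apply: norm_le_coord => // i k; rewrite mxE; exact: coord_norm_le. Qed.

Lemma norm_row_mx (u v : 'rV[R]_n) (a : R) : `|u| <= a -> `|v| <= a -> `|row_mx u v| <= a.
Proof.
move=> ua va; apply: norm_le_coord; first exact: le_trans ua.
move=> i k; rewrite ord1; case: (splitP k) => j kj.
  rewrite (_ : k = lshift n j) ?row_mxEl; last exact: val_inj.
  exact: le_trans (coord_norm_le _ _ _) ua.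
rewrite (_ : k = rshift n j) ?row_mxEr; last exact: val_inj.
exact: le_trans (coord_norm_le _ _ _) va.
Qed.

Lemma tube_map_lip x g w w' : `|tube_map x g w' - tube_map x g w| <= (n%:R * `|g| + 1) * `|w' - w|.
Proof.
have -> : w' = w + (w' - w) by rewrite addrC subrK.
rewrite tube_mapD [_ + row_mx _ _]addrC addrK [w + _]addrC addrK.
set h := w' - w; have gn : 0 <= n%:R * `|g| by rewrite mulr_ge0.
by apply: norm_row_mx; apply: le_trans (norm_mulmx _ _) _; apply: ler_pM => //; rewrite ?lerDl //;
  [exact: norm_lsubmx|exact: norm_rsubmx].
Qed.

Lemma ccont_tube_map x g F w : ccont F (tube_map x g w) -> ccont (fun w => F (tube_map x g w)) w.
Proof.
move=> c; apply: near_ccont => eps /(ccont_near c)[d d0 H].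
have m0 : 0 < n%:R * `|g| + 1 by rewrite ltr_wpDl // mulr_ge0.
exists (d / (n%:R * `|g| + 1)); first by rewrite divr_gt0.
move=> w'; rewrite ltr_pdivlMr // mulrC => h; apply: H.
exact: le_lt_trans (tube_map_lip _ _ _ _) h.
Qed.

Lemma germ_tube_map x g F w : germ F (tube_map x g w) -> germ (fun w => F (tube_map x g w)) w.
Proof.
case=> rho [M [r0 [[cF HF] FM]]]; pose m := n%:R * `|g| + 1.
have m0 : 0 < m by rewrite ltr_wpDl // mulr_ge0.
have K w' (c : R) : `|w' - w| + c < rho / m -> `|tube_map x g w' - tube_map x g w| + m * c < rho.
  have L : `|tube_map x g w' - tube_map x g w| <= m * `|w' - w| by exact: tube_map_lip.
  rewrite ltr_pdivlMr // => h; clear -L h; lra.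
have K0 w' : `|w' - w| < rho / m -> `|tube_map x g w' - tube_map x g w| < rho.
  by move=> h; have := K w' 0; rewrite !addr0 mulr0 addr0; apply.
exists (rho / m), M; split; first by rewrite divr_gt0.
split; last by move=> w' /K0 /FM.
split; first by move=> w' /K0 /cF /ccont_tube_map.
move=> w' v t /K h t1.
have E a b : slice (fun w => F (tube_map x g w)) w' v a b = slice F (tube_map x g w') (v *m g) a b.
  by rewrite /slice tube_map_cplx.
rewrite E -HF //; last first.
  apply: le_lt_trans h; rewrite lerD2l; apply: le_trans (norm_mulmx _ _) _.
  by rewrite ler_wpM2r // lerDl.
by apply: eq_crect; [|lra|lra] => a b _ _ _; rewrite E.
Qed.

Lemma cder_tube_map x g F w u : cder (hdir u) (fun w => F (tube_map x g w)) w =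
  cder (hdir (u *m g)) F (tube_map x g w).
Proof.
have E (t : R) : tube_map x g (t *: hdir u + w) = t *: hdir (u *m g) + tube_map x g w.
  rewrite addrC tube_mapD [RHS]addrC; congr (_ + _).
  by rewrite -!hdirZ /hdir row_mxKl row_mxKr mul0mx -scalemxAl.
have D (f : V -> R) : 'D_(hdir u) (fun w => f (tube_map x g w)) w = 'D_(hdir (u *m g)) f (tube_map x g w).
  by rewrite /derive; under eq_fun do rewrite /= E.
by rewrite /cder; congr Complex; [exact: (D (ReF F))|exact: (D (ImF F))].
Qed.

Lemma cder_sum F w (c : 'I_n -> R) (z : 'I_n -> 'rV[R]_n) (s : seq 'I_n) : germ F w ->
  cder (hdir (\sum_(l <- s) c l *: z l)) F w = \sum_(l <- s) Complex (c l) 0 * cder (hdir (z l)) F w.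
Proof.
move=> gF; elim: s => [|l s IH].
  rewrite !big_nil; have := cderZ 0 0 gF; rewrite scale0r => ->.
  by rewrite -[Complex 0 0]/(0 : R[i]) mul0r.
by rewrite !big_cons cderD // IH cderZ.
Qed.


Lemma hol_on0 U F : hol_on U F -> hol_on U (fun _ => 0).
Proof.
move=> hF; have := hol_on_lin 0 0 hF hF.
by under eq_fun do rewrite !mul0r addr0.
Qed.

Lemma hol_on_sum U F (s : seq 'I_n) (c : 'I_n -> R[i]) (G : 'I_n -> V -> R[i]) : hol_on U F ->
  (forall l, hol_on U (G l)) -> hol_on U (fun w => \sum_(l <- s) c l * G l w).
Proof.
move=> hF hG; elim: s => [|l s IH].
  by under eq_fun do rewrite big_nil; exact: hol_on0 hF.
have := hol_on_lin (c l) 1 (hG l) IH; congr (hol_on U _).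
by apply/funext => w; rewrite big_cons mul1r.
Qed.

Lemma BoxOp_sumF U P F (s : seq 'I_n) (c : 'I_n -> R[i]) (G : 'I_n -> V -> R[i]) w : opn U -> hol_on U F ->
  (forall l, hol_on U (G l)) -> U w ->
  BoxOp P (fun w => \sum_(l <- s) c l * G l w) w = \sum_(l <- s) c l * BoxOp P (G l) w.
Proof.
move=> oU hF hG Uw; elim: s => [|l s IH].
  rewrite big_nil; under [fun w => _]eq_fun do rewrite big_nil.
  have := BoxOp_lin P 0 0 oU hF hF Uw.
  by under [fun w => _]eq_fun do rewrite !mul0r addr0; rewrite !mul0r addr0.
rewrite big_cons -IH -[X in _ + X]mul1r -(BoxOp_lin _ _ _ oU (hG l) (hol_on_sum s c hF hG) Uw).
by congr (BoxOp P _ w); apply/funext => z; rewrite big_cons mul1r.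
Qed.

(** Q is the symbol of P after the change of variables. As a relation it can be built monomial by
    monomial; [box_cov_exists] then identifies Q through its values P(v g^T). *)
Definition box_cov (g : 'M[R]_n) P Q := forall U F x w, opn U -> hol_on U F -> U (tube_map x g w) ->
  BoxOp P (fun w => F (tube_map x g w)) w = BoxOp Q F (tube_map x g w).

Lemma opn_tube_map U x g : opn U -> opn [set w | U (tube_map x g w)].
Proof.
move=> oU w /= /oU[d d0 H]; have m0 : 0 < n%:R * `|g| + 1 by rewrite ltr_wpDl // mulr_ge0.
exists (d / (n%:R * `|g| + 1)); first by rewrite divr_gt0.
move=> w'; rewrite ltr_pdivlMr // mulrC => h; apply: H.
exact: le_lt_trans (tube_map_lip _ _ _ _) h.
Qed.

Lemma box_cov_mulX g P Q k : box_cov g P Q ->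
  box_cov g (mpoly.mpolyX R (mpoly.mnm1 k) * P)
    ((\sum_(l <- enum 'I_n) g k l *: mpoly.mpolyX R (mpoly.mnm1 l)) * Q).
Proof.
move=> cov U F x w oU hF Uw.
have oU' := opn_tube_map (x := x) (g := g) oU.
have hF' : hol_on [set w | U (tube_map x g w)] (fun w => F (tube_map x g w)).
  by move=> z /= Uz; apply: germ_tube_map; exact: hF.
rewrite (BoxOp_mulX _ _ oU' hF' Uw).
pose G z := \sum_(l <- enum 'I_n) Complex (g k l) 0 * pdx l F z.
have E z : U (tube_map x g z) -> pdx k (fun w => F (tube_map x g w)) z = G (tube_map x g z).
  move=> Uz; rewrite pdx_cder cder_tube_map.
  have -> : delta_mx 0 k *m g = \sum_(l <- enum 'I_n) g k l *: (delta_mx 0 l : 'rV_n).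
    rewrite -rowE {1}(row_sum_delta (row k g)) big_enum.
    by apply: eq_bigr => l _; rewrite mxE.
  by rewrite (cder_sum _ _ _ (hF _ Uz)); apply: eq_bigr => l _; rewrite pdx_cder.
have hG : hol_on U G by apply: hol_on_sum (hF) _ => l; exact: hol_on_pdx.
rewrite (BoxOp_congr P oU' E (hol_on_pdx k hF') Uw) (cov U G x w oU hG Uw).
rewrite mulr_suml BoxOp_sum (BoxOp_sumF Q _ _ oU hF (fun l => hol_on_pdx l hF) Uw) mulr_sumr.
apply: eq_bigr => l _; rewrite -scalerAl BoxOpZ (BoxOp_mulX _ _ oU hF Uw).
ring.
Qed.

Lemma box_cov1 g : box_cov g 1 1.
Proof.
move=> U F x w oU hF Uw.
have E F' w' : BoxOp 1 F' w' = F' w'.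
  rewrite -(mpoly.mpolyX0 n R) BoxOpX mpoly.mdeg0 expr0 mul1r /pdxm.
  by elim: (enum _) => //= k s IH; rewrite mpoly.mnm0E.
by rewrite !E.
Qed.

Lemma box_cov_exists g P : exists2 Q, box_cov g P Q & forall v, peval Q v = peval P (v *m g^T).
Proof.
have pevalZ c (P' : mpoly.mpoly n R) v : peval (c *: P') v = c * peval P' v.
  by rewrite -mpoly.mul_mpolyC pevalM pevalC.
have peval_sum (s : seq 'I_n) (Q : 'I_n -> mpoly.mpoly n R) v :
    peval (\sum_(l <- s) Q l) v = \sum_(l <- s) peval (Q l) v.
  elim: s => [|l s IH]; first by rewrite !big_nil -mpoly.mpolyC0 pevalC.
  by rewrite !big_cons pevalD IH.
have mono d : forall al, mpoly.mdeg al = d ->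
    exists2 Q, box_cov g (mpoly.mpolyX R al) Q & forall v, peval Q v = peval (mpoly.mpolyX R al) (v *m g^T).
  elim: d => [|d IH] al dal.
    have -> : al = mpoly.mnm0 by apply/eqP; rewrite -mpoly.mdeg_eq0 dal.
    rewrite mpoly.mpolyX0; exists 1; first exact: box_cov1.
    by move=> v; rewrite -mpoly.mpolyC1 !pevalC.
  have [k alk] : exists k, mpoly.fun_of_multinom al k != 0%N.
    apply: contrapT => H; have : al = mpoly.mnm0.
      apply/mpoly.mnmP => k; rewrite mpoly.mnm0E; apply/eqP/negPn/negP => h.
      by apply: H; exists k.
    by move=> al0; rewrite al0 mpoly.mdeg0 in dal.
  rewrite -mpoly.lep1mP in alk; have E := mpoly.submK alk.
  set be := mpoly.mnm_sub _ _ in E.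
  have dbe : mpoly.mdeg be = d.
    by move: dal; rewrite -E mpoly.mdegD mpoly.mdeg1 addn1 => -[].
  have [Q cQ eQ] := IH be dbe.
  have -> : mpoly.mpolyX R al = mpoly.mpolyX R (mpoly.mnm1 k) * mpoly.mpolyX R be.
    by rewrite -{1}E mpoly.mpolyXD mulrC.
  eexists; first exact: box_cov_mulX cQ.
  move=> v; rewrite !pevalM eQ; congr (_ * _).
  rewrite peval_sum pevalX mxE big_enum; apply: eq_bigr => l _.
  by rewrite pevalZ pevalX mxE mulrC.
elim/mpoly.mpolyind: P => [|c al P _ _ [Q cQ eQ]].
  exists 0; first by move=> *; rewrite !BoxOp0.
  by move=> v; rewrite -mpoly.mpolyC0 !pevalC.
have [Q' cQ' eQ'] := mono _ al erefl.
exists (c *: Q' + Q).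
  by move=> U F x w oU hF Uw; rewrite !BoxOpD !BoxOpZ (cQ' _ _ _ _ oU hF Uw) (cQ _ _ _ _ oU hF Uw).
by move=> v; rewrite !pevalD !pevalZ eQ eQ'.
Qed.

(** Along coordinate lines the partial derivatives of P vanish everywhere too. Induction on the
    degree then reaches every coefficient, the constant one being the value at 0. *)
Lemma peval_eq0 P : (forall v, peval P v = 0) -> P = 0.
Proof.
suff H d : forall P', (forall v, peval P' v = 0) -> forall al, mpoly.mdeg al = d -> mpoly.mcoeff al P' = 0.
  by move=> P0; apply/mpoly.mpolyP => al; rewrite mpoly.mcoeff0; exact: H P0 al erefl.
elim: d => [|d IH] P' P0 al dal.
  have -> : al = mpoly.mnm0 by apply/eqP; rewrite -mpoly.mdeg_eq0 dal.
  rewrite -(P0 0); elim/mpoly_ring_ind: {P0} P' => [c|i|p q ep eq|p q ep eq].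
  - by rewrite mpoly.mcoeffC eqxx mulr1 pevalC.
  - by rewrite mpoly.mcoeffX pevalX mxE mpoly.mnm1_eq0.
  - by rewrite mpoly.mcoeffD pevalD ep eq.
  - by rewrite (rmorphM (mpoly.mcoeff mpoly.mnm0)) pevalM -ep -eq.
have [k alk] : exists k, mpoly.fun_of_multinom al k != 0%N.
  apply: contrapT => H; have : al = mpoly.mnm0.
    apply/mpoly.mnmP => k; rewrite mpoly.mnm0E; apply/eqP/negPn/negP => h.
    by apply: H; exists k.
  by move=> al0; rewrite al0 mpoly.mdeg0 in dal.
rewrite -mpoly.lep1mP in alk; have E := mpoly.submK alk.
set be := mpoly.mnm_sub _ _ in E.
have dbe : mpoly.mdeg be = d.
  by move: dal; rewrite -E mpoly.mdegD mpoly.mdeg1 addn1 => -[].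
have D0 v : peval (mpoly.mderiv k P') v = 0.
  have [p [pE _ p1]] := peval_line P' v (delta_mx 0 k).
  have p0 : p = 0 by apply: poly_eq0_fun => t; rewrite pE.
  move: p1; rewrite p0 coef0 /grad (bigD1 k) //= big1 => [|j jk].
    by rewrite addr0 mxE !eqxx mul1r => ->.
  by rewrite mxE (negbTE jk) andbF mul0r.
have := IH _ D0 be dbe; rewrite mpoly.mcoeff_deriv E => /eqP.
by rewrite mulrn_eq0 /= => /eqP.
Qed.

Lemma BoxOp_tube_map (c : R) P g U F x w : (forall v, peval P (v *m g^T) = c * peval P v) ->
  opn U -> hol_on U F -> U (tube_map x g w) ->
  BoxOp P (fun w => F (tube_map x g w)) w = Complex c 0 * BoxOp P F (tube_map x g w).
Proof.
move=> Pg oU hF Uw; have [Q cov eQ] := box_cov_exists g P.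
rewrite (cov U F x w oU hF Uw) -BoxOpZ; congr (BoxOp _ F _).
apply/eqP; rewrite -subr_eq0; apply/eqP/peval_eq0 => v.
by rewrite -scaleN1r !pevalD -!mpoly.mul_mpolyC !pevalM !pevalC eQ Pg mulN1r subrr.
Qed.

Lemma ders_bound rho rho' s : 0 < rho' -> rho' < rho -> exists2 K, 0 <= K &
  forall w0 M F, holb w0 rho M F -> holb w0 rho' (K * M) (ders s F).
Proof.
elim: s rho' => [|k s IH] rho' r0 rr.
  exists 1 => // w0 M F h; rewrite mul1r; apply: holbS h; rewrite subrr normr0 add0r; exact: ltW.
(* Each derivative consumes half of the remaining margin between the radii, so any finite number of
   them can be taken. *)
pose r := (rho + rho') / 2; have [r1 r2] : rho' < r /\ r < rho by rewrite /r; lra.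
have [K K0 H] := IH r (lt_trans r0 r1) r2.
have c0 := @cauchy_const_gt0 R.
exists (cauchy_const R * K * (2 / (r - rho'))).
  apply: mulr_ge0; first by apply: mulr_ge0 => //; exact: ltW.
  by rewrite divr_ge0 // subr_ge0 ltW.
move=> w0 M F /H h; have := holb_cder h r0 r1 (norm_delta k); rewrite /= pdx_cder.
by have -> : cauchy_const R * (K * M) * (2 / (r - rho')) = cauchy_const R * K * (2 / (r - rho')) * M by ring.
Qed.

Lemma BoxOp_bound P rho : 0 < rho -> exists2 K, 0 <= K &
  forall w0 M F, holb w0 rho M F -> cmod (BoxOp P F w0) <= K * M.
Proof.
move=> r0; have r2 : 0 < rho / 2 by lra.
have rr : rho / 2 < rho by lra.
have /choice[K hK] : forall al : mpoly.multinom n, exists K : R, 0 <= K /\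
    forall w0 M F, holb w0 rho M F -> cmod (pdxm al F w0) <= K * M.
  move=> al; have [K K0 H] := ders_bound (mlist al) r2 rr; exists K; split=> // w0 M F /H[_].
  by move=> /(_ w0); rewrite subrr normr0 pdxm_ders; exact.
exists (\sum_(al <- mpoly.msupp P) cmod (Complex (mpoly.mcoeff al P) 0 * I ^+ mpoly.mdeg al) * K al).
  by apply: sumr_ge0 => al _; rewrite mulr_ge0 ?cmod_ge0 //; case: (hK al).
move=> w0 M F h; rewrite /BoxOp mulr_suml; apply: le_trans (cmod_sum _ _ _) _.
apply: ler_sum => al _; rewrite cmodM -mulrA; apply: ler_wpM2l; rewrite ?cmod_ge0 //.
by case: (hK al) => _; apply.
Qed.

End BoxAlgebra.

(** * Functions holomorphic on the tube satisfy Cauchy's formula *)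

Section Holomorphic.
Local Open Scope classical_set_scope.
Variables (R : realType) (n : nat).
Notation V := 'rV[R]_(n + n).

Lemma diff_eps (f : V -> R) (w : V) (eps : R) : differentiable f w -> 0 < eps ->
  exists2 del, 0 < del & forall h : V, `|h| <= del -> `|f (w + h) - f w - 'd f w h| <= eps * `|h|.
Proof.
move=> df e0; have [_ /eqaddoP H0] := (diff_locallyP _ _).1 df.
have /nbhs_ballP[d /= d0 H] := H0 _ e0.
exists (d / 2); first by rewrite divr_gt0.
move=> h hd; have hd' : `|h| < d by apply: le_lt_trans hd _; lra.
have := H h; rewrite -ball_normE /= sub0r normrN => /(_ hd').
by rewrite !fctE /= /cst [h + w]addrC opprD addrA.
Qed.

Lemma cplx_dir_sum (v : 'rV[R]_n) a b :
  cplx_dir v a b = \sum_(l < n) ((a * v 0 l) *: ex R l + (b * v 0 l) *: ey R l).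
Proof.
rewrite cplx_dirE big_split /=.
have E1 : \sum_(l < n) (a * v 0 l) *: ex R l = row_mx (a *: v) 0.
  rewrite {2}(row_sum_delta v) scaler_sumr.
  rewrite (_ : row_mx _ _ = \sum_(l < n) row_mx (a *: (v 0 l *: delta_mx 0 l)) 0); last first.
    by elim/big_rec2: _ => [|l x y _ <-]; rewrite ?row_mx0 // add_row_mx addr0.
  by apply: eq_bigr => l _; rewrite ex_hdir /hdir scale_row_mx scaler0 scalerA.
have E2 : \sum_(l < n) (b * v 0 l) *: ey R l = row_mx 0 (b *: v).
  rewrite {2}(row_sum_delta v) scaler_sumr.
  rewrite (_ : row_mx _ _ = \sum_(l < n) row_mx 0 (b *: (v 0 l *: delta_mx 0 l))); last first.
    by elim/big_rec2: _ => [|l x y _ <-]; rewrite ?row_mx0 // add_row_mx addr0.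
  by apply: eq_bigr => l _; rewrite /ey delta_mx_rshift scale_row_mx scaler0 scalerA.
by rewrite E1 E2 add_row_mx addr0 add0r.
Qed.

Variables (Om : set 'rV[R]_n) (f : 'rV[R]_n -> 'rV[R]_n -> R[i]).
Hypothesis hf : holo_tube Om f.
Notation F := (uncurryT f).

(** The Cauchy-Riemann equations in each variable turn the real differential, applied to (a + ib) v,
    into multiplication of a + ib by one complex number p + iq. *)
Lemma holo_cdiff w (v : 'rV[R]_n) x y : in_tube Om (w + cplx_dir v x y) -> cdiff_at (slice F w v) x y.
Proof.
move=> /hf[dR dI CR]; set w1 := w + _ in dR dI CR.
pose p := \sum_(l < n) v 0 l * 'D_(ex R l) (ReF F) w1.
pose q := \sum_(l < n) v 0 l * 'D_(ex R l) (ImF F) w1.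
have LR a b : 'd (ReF F) w1 (cplx_dir v a b) = a * p - b * q.
  rewrite cplx_dir_sum linear_sum /p /q !mulr_sumr -sumrB; apply: eq_bigr => l _.
  rewrite linearD !linearZ /= -!deriveE //; have [_ ->] := CR l.
  by rewrite /GRing.scale /=; ring.
have LI a b : 'd (ImF F) w1 (cplx_dir v a b) = a * q + b * p.
  rewrite cplx_dir_sum linear_sum /p /q !mulr_sumr -big_split; apply: eq_bigr => l _.
  rewrite linearD !linearZ /= -!deriveE //; have [<- _] := CR l.
  by rewrite /GRing.scale /=; ring.
exists (Complex p q) => eps e0; have m0 : 0 < `|v| + 1 by rewrite ltr_wpDl.
have e2 : 0 < eps / (2 * (`|v| + 1)) by rewrite divr_gt0 // mulr_gt0.
have [d1 d10 H1] := diff_eps dR e2; have [d2 d20 H2] := diff_eps dI e2.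
exists (Num.min d1 d2 / (`|v| + 1)); first by rewrite divr_gt0 // lt_min d10.
move=> h k; rewrite !ler_pdivlMr // => hd kd.
pose N := `|h| + `|k|; have N0 : 0 <= N by rewrite addr_ge0.
have nd : `|cplx_dir v h k| <= Num.max `|h| `|k| * `|v|.
  rewrite cplx_dirE; apply: norm_row_mx; rewrite normrZ ler_wpM2r // le_max lexx ?orbT //.
have mx : Num.max `|h| `|k| <= N by rewrite ge_max /N lerDl lerDr !normr_ge0.
have mx0 : 0 <= Num.max `|h| `|k| by rewrite le_max normr_ge0.
have nN : `|cplx_dir v h k| <= N * (`|v| + 1).
  by apply: le_trans nd _; apply: ler_pM => //; rewrite lerDl.
have nD : `|cplx_dir v h k| <= Num.min d1 d2.
  apply: le_trans nd _; apply: le_trans (_ : Num.max `|h| `|k| * (`|v| + 1) <= _).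
    by apply: ler_wpM2l; rewrite ?lerDl.
  by case: (leP `|h| `|k|).
have E : slice F w v (x + h) (y + k) = F (w1 + cplx_dir v h k).
  by rewrite /slice /w1 -addrA; congr (F (_ + _)); rewrite /cplx_dir !scalerDl addrACA.
have [n1 n2] : `|cplx_dir v h k| <= d1 /\ `|cplx_dir v h k| <= d2.
  by move: nD; rewrite le_min => /andP[].
have K1 := H1 _ n1; have K2 := H2 _ n2; rewrite LR in K1; rewrite LI in K2.
have B : eps / (2 * (`|v| + 1)) * `|cplx_dir v h k| <= eps / 2 * N.
  apply: le_trans (ler_wpM2l (ltW e2) nN) _; rewrite le_eqVlt; apply/orP; left; apply/eqP.
  by field; rewrite gt_eqF.
rewrite E -[slice F w v x y]/(F w1).
apply: le_trans (cmod_le_sum _) _.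
have -> : eps * (`|h| + `|k|) = eps / 2 * N + eps / 2 * N by rewrite /N; field.
apply: lerD.
  apply: le_trans (le_trans K1 B); rewrite !(ReD, ReN, ReM) /= /ReF le_eqVlt; apply/orP; left; apply/eqP.
  by congr `|_|; ring.
apply: le_trans (le_trans K2 B); rewrite !(ImD, ImN, ImM) /= /ImF le_eqVlt; apply/orP; left; apply/eqP.
by congr `|_|; ring.
Qed.

Lemma holo_ccont w : in_tube Om w -> ccont F w.
Proof. by move=> /hf[dR dI _]; split; exact: differentiable_continuous. Qed.

Lemma holo_hol w0 rho : (forall w, `|w - w0| < rho -> in_tube Om w) -> hol w0 rho F.
Proof.
move=> H; split; first by move=> w /H; exact: holo_ccont.
move=> w v t wv t1; apply: cauchy_square => // x y hx hy; apply: holo_cdiff; apply: H.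
rewrite addrAC; apply: le_lt_trans (ler_normD _ _) _; apply: le_lt_trans wv.
by rewrite lerD2l; apply: norm_cplx_dir; rewrite ler_norml.
Qed.

Lemma holo_hol_on : open Om -> opn (in_tube Om) /\ hol_on (in_tube Om) F.
Proof.
move=> oO.
have oT : opn (in_tube Om).
  move=> w Tw; have /nbhs_ballP[d /= d0 H] : nbhs (rsubmx w) Om by exact: open_nbhs_nbhs.
  exists d => // w' hw; apply: H; rewrite -ball_normE /= distrC -linearB /=.
  exact: le_lt_trans (norm_rsubmx _) hw.
split=> // w Tw; have [d d0 H] := oT w Tw.
have [d1 d10 K] := ccont_near (holo_ccont Tw) ltr01.
exists (Num.min d d1), (cmod (F w) + 1); split; first by rewrite lt_min d0.
split.
  by apply: holo_hol => w'; rewrite lt_min => /andP[/H].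
move=> w'; rewrite lt_min => /andP[_ /K h].
by have := cmodD (F w' - F w) (F w); rewrite subrK addrC; lra.
Qed.

End Holomorphic.

(** * Mean values *)

Section SquareMean.
Local Open Scope classical_set_scope.
Local Open Scope ereal_scope.
Variable R : realType.
Notation mu := (@lebesgue_measure R).

Lemma int_opp (f : R -> \bar R) : measurable_fun [set: R] f -> (forall x, 0 <= f x) ->
  \int[mu]_(t in setT) f (- t)%R = \int[mu]_(t in setT) f t.
Proof.
move=> mf f0.
pose phi (t : measurableTypeR R) : measurableTypeR R := (- t)%R.
have mphi : measurable_fun setT phi by exact: measurable_funN.
pose m1 : {measure set (measurableTypeR R) -> \bar R} :=
  measure_function_pushforward__canonical__measure_function_Measure mu mphi.
have E A : measurable A -> mu A = m1 A.
  move=> mA; apply: (@lebesgue_measure_unique R m1) => // _ [[x y]] _ <-.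
  transitivity (mu (phi @^-1` `]x, y])) => //.
  have -> : phi @^-1` `]x, y] = `[(- y)%R, (- x)%R[%classic.
    by apply/seteqP; split => t; rewrite /= !in_itv /phi /= lerNl ltrNr andbC.
  rewrite !lebesgue_measure_itv /= !lte_fin ltrN2.
  by case: ifP => _ //; rewrite -!EFinB opprK addrC.
transitivity (\int[m1]_(t in setT) f t).
  by rewrite ge0_integral_pushforward.
by apply: eq_measure_integral => A mA _; exact/esym/E.
Qed.

Lemma int_sum4 (f1 f2 f3 f4 : R -> \bar R) : measurable_fun [set: R] f1 -> measurable_fun [set: R] f2 ->
  measurable_fun [set: R] f3 -> measurable_fun [set: R] f4 -> (forall x, 0 <= f1 x) -> (forall x, 0 <= f2 x) ->
  (forall x, 0 <= f3 x) -> (forall x, 0 <= f4 x) ->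
  measurable_fun [set: R] (fun x => f1 x + f2 x + f3 x + f4 x) /\
  \int[mu]_(x in [set: R]) (f1 x + f2 x + f3 x + f4 x) =
  \int[mu]_(x in [set: R]) f1 x + \int[mu]_(x in [set: R]) f2 x +
  \int[mu]_(x in [set: R]) f3 x + \int[mu]_(x in [set: R]) f4 x.
Proof.
move=> m1 m2 m3 m4 p1 p2 p3 p4.
have m12 := emeasurable_funD m1 m2; have m123 := emeasurable_funD m12 m3.
split; first exact: (emeasurable_funD m123 m4).
rewrite ge0_integralD //; last by move=> x _; rewrite !adde_ge0.
rewrite ge0_integralD //; last by move=> x _; rewrite !adde_ge0.
by rewrite ge0_integralD.
Qed.

Definition borel2 (h : R -> R -> \bar R) := forall d (T : measurableType d) (f g : T -> R),
  measurable_fun setT f -> measurable_fun setT g -> measurable_fun setT (fun x => h (f x) (g x)).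

(** The perimeter inequality is integrated over del/2 < s < del. Each of the four families of sides
    sweeps part of the plane once, whence the factor 4. *)
Lemma square_mean (h : R -> R -> \bar R) (c del : R) : (0 < del)%R -> (0 <= c)%R -> borel2 h ->
  (forall a b, 0 <= h a b) ->
  (forall s : R, (del / 2 < s < del)%R -> c%:E <= \int[mu]_(t in [set: R]) h t s +
     \int[mu]_(t in [set: R]) h t (- s)%R + \int[mu]_(t in [set: R]) h s t +
     \int[mu]_(t in [set: R]) h (- s)%R t) ->
  (c * (del / 2))%:E <= 4%:E * \int[mu]_(a in [set: R]) \int[mu]_(b in [set: R]) h a b.
Proof.
move=> d0 c0 bh h0 H.
have mh : measurable_fun [set: R * R] (fun z => h z.1 z.2).
  by apply: bh; [exact: measurable_fst|exact: measurable_snd].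
have mh' : measurable_fun [set: R * R] (fun z => h z.2 z.1).
  by apply: bh; [exact: measurable_snd|exact: measurable_fst].
have tot : \int[mu]_(s in [set: R]) \int[mu]_(t in [set: R]) h t s =
    \int[mu]_(a in [set: R]) \int[mu]_(b in [set: R]) h a b.
  by rewrite (fubini_tonelli (m1 := mu) (m2 := mu) _ mh) // => -[? ?]; exact: h0.
have m3 : measurable_fun [set: R] (fun s => \int[mu]_(t in [set: R]) h s t).
  by have := measurable_fun_fubini_tonelli_F (m2 := mu) _ mh; apply=> -[? ?]; exact: h0.
have m1 : measurable_fun [set: R] (fun s => \int[mu]_(t in [set: R]) h t s).
  by have := measurable_fun_fubini_tonelli_F (m2 := mu) _ mh'; apply=> -[? ?]; exact: h0.
have mN : measurable_fun [set: R] (fun s : R => (- s)%R) by exact: measurable_funN.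
have m2 : measurable_fun [set: R] (fun s => \int[mu]_(t in [set: R]) h t (- s)%R).
  exact: (measurableT_comp m1 mN).
have m4 : measurable_fun [set: R] (fun s => \int[mu]_(t in [set: R]) h (- s)%R t).
  exact: (measurableT_comp m3 mN).
have i0 (g : R -> \bar R) : (forall t, 0 <= g t) -> 0 <= \int[mu]_(t in [set: R]) g t.
  by move=> g0; apply: integral_ge0.
have p1 s : 0 <= \int[mu]_(t in [set: R]) h t s by apply: i0.
have p3 s : 0 <= \int[mu]_(t in [set: R]) h s t by apply: i0.
have [mS ES] := int_sum4 m1 m2 m3 m4 p1 (fun s => p1 (- s)%R) p3 (fun s => p3 (- s)%R).
have S0 s : 0 <= \int[mu]_(t in [set: R]) h t s + \int[mu]_(t in [set: R]) h t (- s)%R +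
    \int[mu]_(t in [set: R]) h s t + \int[mu]_(t in [set: R]) h (- s)%R t.
  exact: (adde_ge0 (adde_ge0 (adde_ge0 (p1 s) (p1 (- s)%R)) (p3 s)) (p3 (- s)%R)).
pose I1 s := \int[mu]_(t in [set: R]) h t s; pose I3 s := \int[mu]_(t in [set: R]) h s t.
pose S s := I1 s + I1 (- s)%R + I3 s + I3 (- s)%R.
have {}mS : measurable_fun [set: R] S := mS; have {}S0 s : 0 <= S s := S0 s.
have {}H s : (del / 2 < s < del)%R -> c%:E <= S s := H s.
have {}ES : \int[mu]_(s in [set: R]) S s = \int[mu]_(s in [set: R]) I1 s + \int[mu]_(s in [set: R]) I1 (- s)%R +
   \int[mu]_(s in [set: R]) I3 s + \int[mu]_(s in [set: R]) I3 (- s)%R := ES.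
have {}tot : \int[mu]_(s in [set: R]) I1 s = \int[mu]_(a in [set: R]) I3 a := tot.
have {}p3 s : 0 <= I3 s := p3 s; have {}p1 s : 0 <= I1 s := p1 s.
have {}m1 : measurable_fun [set: R] I1 := m1; have {}m3 : measurable_fun [set: R] I3 := m3.
change ((c * (del / 2))%:E <= 4%:E * \int[mu]_(a in [set: R]) I3 a).
clear m2 m4 mh mh' bh h0; clearbody S; clearbody I1 I3.
have -> : 4%:E * \int[mu]_(a in [set: R]) I3 a = \int[mu]_(s in [set: R]) S s.
  rewrite ES (int_opp m1 p1) (int_opp m3 p3) tot.
  pose I := \int[mu]_(a in [set: R]) I3 a.
  have I0 : 0 <= I by apply: i0.
  change (4%:E * I = I + I + I + I).
  clearbody I; case: I I0 => [x x0| |] //; first by rewrite -EFinM -!EFinD; congr EFin; ring.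
  by move=> _; rewrite gt0_muley ?lte_fin.
apply: le_trans (_ : \int[mu]_(s in `](del / 2)%R, del[) S s <= _); last first.
  by apply: ge0_subset_integral => //.
apply: le_trans (_ : \int[mu]_(s in `](del / 2)%R, del[) (cst c%:E) s <= _); last first.
  apply: ge0_le_integral => //; first exact: measurable_funTS.
rewrite integral_cst //= lebesgue_measure_itv /= lte_fin.
have -> : (del / 2 < del)%R by lra.
by rewrite -EFinB -EFinM lee_fin; lra.
Qed.

End SquareMean.

(** * From one complex coordinate to all of them *)

Section BoxMean.
Local Open Scope classical_set_scope.
Local Open Scope ereal_scope.
Variable R : realType.
Notation mu := (@lebesgue_measure R).

(** Adds a complex coordinate a + ib in front. Real and imaginary parts are stored in separate
    halves, so each half is extended by itself. *)
Definition glue n (a b : R) (w : 'rV[R]_(n + n)) : 'rV[R]_(n.+1 + n.+1) :=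
  row_mx (row_mx (const_mx a) (lsubmx w) : 'rV_(1 + n)) (row_mx (const_mx b) (rsubmx w) : 'rV_(1 + n)).

Lemma row_mx_add1 n (a : R) (x : 'rV[R]_n) (s : R) k :
  (row_mx (const_mx a : 'rV[R]_1) (x + s *: delta_mx 0 k)%R : 'rV[R]_n.+1) =
  (row_mx (const_mx a : 'rV[R]_1) x + s *: delta_mx 0 (lift ord0 k))%R.
Proof.
apply/rowP => j; rewrite [RHS]mxE; case: (unliftP ord0 j) => [i|] ->.
  by rewrite !row_mx_lift0 !mxE !eqxx /= (inj_eq lift_inj).
by rewrite !row_mx_ord0 !mxE /= mulr0 addr0.
Qed.

Lemma row_mx_add0 n (a : R) : (row_mx (const_mx a : 'rV[R]_1) 0%R : 'rV[R]_n.+1) = (a *: delta_mx 0 ord0)%R.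
Proof.
apply/rowP => j; rewrite [RHS]mxE; case: (unliftP ord0 j) => [i|] ->.
  by rewrite row_mx_lift0 !mxE /= mulr0.
by rewrite row_mx_ord0 !mxE /= mulr1.
Qed.

Lemma dirE n (s t : R) (k : 'I_n) (x y : 'rV[R]_n) :
  (row_mx x y + (s *: ex R k + t *: ey R k))%R = row_mx (x + s *: delta_mx 0 k)%R (y + t *: delta_mx 0 k)%R.
Proof. by rewrite /ex /ey delta_mx_lshift delta_mx_rshift !scale_row_mx !scaler0 !add_row_mx addr0 add0r. Qed.

Lemma glueD n a b (w : 'rV[R]_(n + n)) s t k :
  glue a b (w + (s *: ex R k + t *: ey R k))%R =
  (glue a b w + (s *: ex R (lift ord0 k) + t *: ey R (lift ord0 k)))%R.
Proof.
rewrite -{1}[w]hsubmxK dirE /glue row_mxKl row_mxKr [RHS]dirE.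
exact (@row_mx_congr R n.+1 n.+1 _ _ _ _ (@row_mx_add1 n a (lsubmx w) s k) (@row_mx_add1 n b (rsubmx w) t k)).
Qed.

Lemma glue0 n a b : glue a b (0 : 'rV[R]_(n + n)) = (0 + (a *: ex R ord0 + b *: ey R ord0))%R.
Proof.
rewrite -[X in (X + _)%R](row_mx0 _ _ n.+1 n.+1) dirE !add0r /glue !linear0.
exact (@row_mx_congr R n.+1 n.+1 _ _ _ _ (@row_mx_add0 n a) (@row_mx_add0 n b)).
Qed.

(** Starting from 0, one complex coordinate after the other is spread over the plane. The mean value
    inequality for the k-th coordinate is applied while that coordinate is still 0, and so is
    assumed at such points only. *)
Lemma box_mean n (C : R) (h : 'rV[R]_(n + n) -> \bar R) : (0 <= C)%R -> borel h -> (forall u, 0 <= h u) ->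
  (forall (k : 'I_n) (u : 'rV[R]_(n + n)), u 0%R (lshift n k) = 0%R -> u 0%R (rshift n k) = 0%R ->
    h u <= \int[mu]_(a in [set: R]) \int[mu]_(b in [set: R]) (C%:E * h (u + (a *: ex R k + b *: ey R k))%R)) ->
  h 0%R <= iint (fun u => (C ^+ n)%:E * h u).
Proof.
move=> C0; elim: n h => [|n IH] h bh h0 H; first by rewrite expr0 /= mul1e.
have Cn0 m : (0 <= C ^+ m)%R by exact: exprn_ge0.
have := H ord0 0%R; rewrite !mxE => /(_ erefl erefl) H0; apply: le_trans H0 _.
have bg a b : borel (fun w : 'rV[R]_(n + n) => h (glue a b w)).
  move=> d T L mL; apply: bh; apply: (@measurable_row_mx _ n.+1 n.+1) => k;
    apply: (@measurable_row_mx _ 1 n) => j; under eq_fun do rewrite !mxE;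
    [exact: measurable_cst|exact: mL|exact: measurable_cst|exact: mL].
have K a b : C%:E * h (0 + (a *: ex R ord0 + b *: ey R ord0))%R <=
    iint (fun x => iint (fun y => (C ^+ n.+1)%:E * h (glue a b (row_mx x y)))).
  rewrite -glue0 -(iint_split (fun w => (C ^+ n.+1)%:E * h (glue a b w))).
  apply: le_trans (_ : C%:E * iint (fun w => (C ^+ n)%:E * h (glue a b w)) <= _).
    apply: lee_wpmul2l; rewrite ?lee_fin //; apply: (IH (fun w => h (glue a b w))) => // k u uk1 uk2.
    have E1 : (glue a b u) 0%R (lshift n.+1 (lift ord0 k)) = 0%R.
      by rewrite /glue row_mxEl row_mx_lift0 mxE.
    have E2 : (glue a b u) 0%R (rshift n.+1 (lift ord0 k)) = 0%R.
      by rewrite /glue row_mxEr row_mx_lift0 mxE.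
    apply: le_trans (H _ _ E1 E2) _; rewrite le_eqVlt; apply/orP; left; apply/eqP.
    by apply: eq_integral => s _; apply: eq_integral => t _; rewrite glueD.
  rewrite -iintZl //; last by move=> w; apply: mule_ge0; rewrite ?lee_fin.
    by apply: le_iint => w; rewrite muleA -EFinM -exprS ?mule_ge0 ?lee_fin.
  exact: (borelM (@borel_cst _ _ (C ^+ n)%:E) (bg a b)).
apply: le_trans (_ : \int[mu]_(a in [set: R]) \int[mu]_(b in [set: R])
    iint (fun x => iint (fun y => (C ^+ n.+1)%:E * h (glue a b (row_mx x y)))) <= _).
  apply: le_int => a; first by apply: integral_ge0 => b _; rewrite mule_ge0 ?lee_fin.
  by apply: le_int => b; [rewrite mule_ge0 ?lee_fin|exact: K].
rewrite (@iint_split R n.+1 n.+1) /= le_eqVlt; apply/orP; left; apply/eqP.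
apply: eq_integral => a _.
pose g (w : 'rV[R]_(1 + n)) := iint (fun y => (C ^+ n.+1)%:E *
  h (row_mx (row_mx (const_mx a) (rsubmx w) : 'rV_(1 + n)) (row_mx (lsubmx w) y : 'rV_(1 + n)) : 'rV_(n.+1 + n.+1))).
have g0 w : 0 <= g w by apply: iint_ge0 => y; rewrite mule_ge0 ?lee_fin.
have bgg : borel g.
  pose g3 (w : 'rV[R]_((1 + n) + n)) := (C ^+ n.+1)%:E *
    h (row_mx (row_mx (const_mx a) (rsubmx (lsubmx w)) : 'rV_(1 + n))
              (row_mx (lsubmx (lsubmx w)) (rsubmx w) : 'rV_(1 + n)) : 'rV_(n.+1 + n.+1)).
  have bg3 : borel g3.
    apply: borelM; first exact: borel_cst.
    move=> d T L mL; apply: bh; apply: (@measurable_row_mx _ n.+1 n.+1) => k;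
      apply: (@measurable_row_mx _ 1 n) => j; under eq_fun do rewrite !mxE;
      [exact: measurable_cst|exact: mL|exact: mL|exact: mL].
  have g30 w : 0 <= g3 w by rewrite /g3 mule_ge0 ?lee_fin.
  have := borel_iint bg3 g30; congr (borel _); apply/funext => w.
  by apply: eq_iint => y; rewrite /g3 !row_mxKl !row_mxKr.
transitivity (\int[mu]_(b in [set: R]) iint (fun x => g (row_mx (const_mx b) x))).
  apply: eq_integral => b _; apply: eq_iint => x; apply: eq_iint => y.
  by rewrite /g /glue !row_mxKl !row_mxKr.
rewrite (int_iint_swap bgg g0); apply: eq_iint => x; apply: eq_integral => b _.
by rewrite /g row_mxKl row_mxKr.
Qed.

End BoxMean.

(** * Measurability by lower semicontinuity *)

Section LowerSemicontinuous.
Local Open Scope classical_set_scope.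
Local Open Scope ereal_scope.
Variable R : realType.

Lemma lt_powR_inv (a x p : R) : (0 < p)%R -> (0 <= a)%R -> (0 <= x)%R ->
  (a < x `^ p)%R = (a `^ p^-1 < x)%R.
Proof.
move=> p0 a0 x0; have pi0 : (0 < p^-1)%R by rewrite invr_gt0.
have pn : p != 0%R by rewrite gt_eqF.
apply/idP/idP => h.
  rewrite ltNge; apply/negP => h'; move: h; rewrite ltNge => /negP; apply.
  have -> : a = ((a `^ p^-1) `^ p)%R by rewrite -powRrM mulVf // powRr1.
  by apply: ge0_ler_powR; rewrite ?nnegrE ?powR_ge0 // ltW.
have -> : a = ((a `^ p^-1) `^ p)%R by rewrite -powRrM mulVf // powRr1.
by apply: gt0_ltr_powR; rewrite ?nnegrE ?powR_ge0.
Qed.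

(** A nonnegative continuous function on an open set, extended by 0, is lower semicontinuous. The
    positive exponent lets superlevel sets be described by p-th roots. *)
Lemma borel_restrict_powR N (U : set 'rV[R]_N) (psi : 'rV[R]_N -> R) (p : R) : (0 < p)%R -> open U ->
  (forall u, U u -> {for u, continuous psi}) -> (forall u, U u -> (0 <= psi u)%R) ->
  borel (fun u => if `[< U u >] then (psi u `^ p)%:E else 0).
Proof.
move=> p0 oU cpsi psi0; apply: borel_lsc => a; have [a0|a0] := ltP a 0%R.
  rewrite (_ : [set x | _] = setT); first exact: openT.
  apply/seteqP; split=> // x _ /=; case: ifP => _; last by rewrite lte_fin.
  by rewrite lte_fin; apply: lt_le_trans a0 (powR_ge0 _ _).
rewrite openE => x /=; case: asboolP => [Ux|_]; last by rewrite lte_fin ltNge a0.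
rewrite lte_fin (lt_powR_inv p0 a0 (psi0 x Ux)) => h.
have n1 : nbhs x U by exact: open_nbhs_nbhs.
have n2 : \forall y \near x, (a `^ p^-1 < psi y)%R.
  have e0 : (0 < psi x - a `^ p^-1)%R by rewrite subr_gt0.
  have /cvgrPdist_lt/(_ _ e0) := cpsi x Ux; apply: filterS => y.
  by rewrite ltr_norml => /andP[_]; lra.
rewrite /interior; near=> y => /=.
have Uy : U y by near: y.
rewrite (asboolT Uy) lte_fin (lt_powR_inv p0 a0 (psi0 y Uy)).
by near: y.
Unshelve. all: by end_near. Qed.

Lemma continuous_cmod n (F : 'rV[R]_(n + n) -> R[i]) w : ccont F w ->
  {for w, continuous (fun w => cmod (F w))}.
Proof.
move=> c; apply/(@cvgrPdist_le _ _ _ (nbhs w)) => /= eps /(ccont_near c)[d d0 H].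
apply/nbhs_ballP; exists d => //= w'; rewrite -ball_normE /= distrC => /H h.
have h1 := cmodB (F w') (F w' - F w)%R; rewrite subKr in h1.
have h2 := cmodD (F w' - F w)%R (F w); rewrite subrK in h2.
by apply: le_trans h; rewrite ler_norml; lra.
Qed.

End LowerSemicontinuous.

(** * The mean value inequality for powers of the modulus *)

Section Submean.
Local Open Scope classical_set_scope.
Variables (R : realType) (n : nat).
Notation V := 'rV[R]_(n + n).
Notation mu := (@lebesgue_measure R).

Lemma segint_ge0 (f : R -> R) a b : (forall x, a <= x <= b -> 0 <= f x) -> 0 <= segint f a b.
Proof. by move=> h; apply: Rintegral_ge0 => x; rewrite /= in_itv /= => /h. Qed.

Lemma segint_norm (f g : R -> R) a b : a <= b -> cont_on f a b -> cont_on g a b ->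
  (forall x, a <= x <= b -> `|f x| <= g x) -> `|segint f a b| <= segint g a b.
Proof.
move=> ab cf cg fg.
have h1 : 0 <= segint (fun x => 1 * g x + (-1) * f x) a b.
  by apply: segint_ge0 => x /fg; rewrite ler_norml => /andP[]; lra.
have h2 : 0 <= segint (fun x => 1 * g x + 1 * f x) a b.
  by apply: segint_ge0 => x /fg; rewrite ler_norml => /andP[]; lra.
by rewrite segint_lin // in h1; rewrite segint_lin // in h2; rewrite ler_norml; lra.
Qed.

Lemma crect_L1 (g : R -> R -> R[i]) : cside_cont g (-1) 1 (-1) 1 ->
  side_cont (fun x y => cmod (g x y)) (-1) 1 (-1) 1 ->
  cmod (crect g (-1) 1 (-1) 1) <=
  2 * (segint (fun x => cmod (g x (-1))) (-1) 1 + segint (fun y => cmod (g 1 y)) (-1) 1 +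
       segint (fun x => cmod (g x 1)) (-1) 1 + segint (fun y => cmod (g (-1) y)) (-1) 1).
Proof.
move=> [[r1 r2 r3 r4] [i1 i2 i3 i4]] [n1 n2 n3 n4].
have m1 : -1 <= 1 :> R by lra.
have N (f : R -> R) : cont_on f (-1) 1 -> cont_on (fun x => - f x) (-1) 1.
  by move=> cf x hx; apply: cvgN; exact: cf.
have K (f h : R -> R) : cont_on f (-1) 1 -> cont_on h (-1) 1 -> (forall x, `|f x| <= h x) ->
  `|segint f (-1) 1| <= segint h (-1) 1 by move=> cf ch fh; apply: segint_norm.
apply: le_trans (cmod_le_sum _) _; rewrite /crect /= /formint.
have a1 := K _ _ r1 n1 (fun x => normr_Re _); have a2 := K _ _ r2 n2 (fun x => normr_Re _).
have a3 := K _ _ r3 n3 (fun x => normr_Re _); have a4 := K _ _ r4 n4 (fun x => normr_Re _).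
have b1 := K _ _ i1 n1 (fun x => normr_Im _); have b2 := K _ _ i2 n2 (fun x => normr_Im _).
have nI (z : R[i]) : `|- complex.Im z| <= cmod z by rewrite normrN normr_Im.
have b3 := K _ _ (N _ i3) n3 (fun x => nI _); have b4 := K _ _ (N _ i4) n4 (fun x => nI _).
have T (x y z t : R) : `|x + y - z - t| <= `|x| + `|y| + `|z| + `|t|.
  apply: le_trans (ler_normB _ _) _; rewrite lerD2r; apply: le_trans (ler_normB _ _) _.
  by rewrite lerD2r; exact: ler_normD.
apply: le_trans (lerD (T _ _ _ _) (T _ _ _ _)) _.
move: a1 a2 a3 a4 b1 b2 b3 b4; lra.
Qed.

Local Open Scope ereal_scope.

(** Pointwise psi <= lam + lam^(1-p) psi^p, according to whether psi is at most lam or not. This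
    stands in for Hölder's inequality, with a free level lam to be fixed later. *)
Lemma segint_Lp (psi : R -> R) (H : R -> \bar R) (lam p : R) : (1 <= p)%R -> (0 < lam)%R ->
  cont_on psi (-1) 1 -> (forall x, (-1 <= x <= 1)%R -> (0 <= psi x)%R) ->
  measurable_fun [set: R] H -> (forall t, 0 <= H t) ->
  (forall t, (-1 <= t <= 1)%R -> (psi t `^ p)%:E <= H t) ->
  (segint psi (-1) 1)%:E <= (2 * lam)%:E + (lam `^ (1 - p))%:E * \int[mu]_(t in [set: R]) H t.
Proof.
move=> p1 l0 cpsi psi0 mH H0 psiH.
have m1 : (-1 <= 1 :> R)%R by lra.
have I1 : mu.-integrable `[(-1)%R, 1%R] (EFin \o psi).
  by apply: continuous_compact_integrable; [exact: segment_compact|exact: cont_on_within].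
rewrite /segint /Rintegral fineK; last exact: integrable_fin_num.
pose k : R := (lam `^ (1 - p))%R; have k0 : (0 <= k)%R := powR_ge0 _ _.
have pt x : (-1 <= x <= 1)%R -> (psi x)%:E <= lam%:E + k%:E * H x.
  move=> hx; have x0 := psi0 x hx.
  apply: le_trans (_ : (lam + k * psi x `^ p)%:E <= _); last first.
    by rewrite EFinD EFinM leeD2l // lee_wpmul2l ?lee_fin // psiH.
  rewrite lee_fin; have [h|h] := leP (psi x) lam.
    by apply: le_trans h _; rewrite lerDl mulr_ge0 ?powR_ge0.
  have xp : (0 < psi x)%R by apply: lt_trans h.
  apply: le_trans (_ : (k * psi x `^ p <= _)%R); last by rewrite lerDr ltW.
  have -> : (psi x `^ p = psi x * psi x `^ (p - 1))%R.
    by rewrite mulr_powRB1 // ?ltW //; lra.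
  suff h1 : (1 <= k * psi x `^ (p - 1))%R.
    by rewrite mulrCA -[leLHS]mulr1; apply: ler_wpM2l.
  have E1 : (k * lam `^ (p - 1) = 1)%R.
    rewrite /k -powRD; last by rewrite (gt_eqF l0) implybT.
    have -> : (1 - p + (p - 1) = 0)%R by ring.
    by rewrite powRr0.
  apply: le_trans (_ : (k * lam `^ (p - 1) <= _)%R); first by rewrite E1.
  by apply: ler_wpM2l => //; apply: ge0_ler_powR; rewrite ?nnegrE //; [rewrite subr_ge0|exact: ltW|exact: ltW].
have mD : measurable (`[(-1)%R, 1%R]%classic : set R) by exact: measurable_itv.
have mkH : measurable_fun (`[(-1)%R, 1%R]%classic : set R) (fun x => k%:E * H x).
  by apply: measurable_funeM; exact: measurable_funTS.
apply: le_trans (_ : \int[mu]_(x in `[(-1)%R, 1%R]) (lam%:E + k%:E * H x) <= _).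
  rewrite integral_mkcond [leRHS]integral_mkcond; apply: le_int => x; rewrite !patchE; case: ifP => // hx.
    by move: hx; rewrite inE /= in_itv /= => /psi0; rewrite lee_fin.
  by move: hx; rewrite inE /= in_itv /= => /pt.
rewrite ge0_integralD //; last 2 first.
- by move=> x _; rewrite lee_fin ltW.
- by move=> x _; rewrite mule_ge0 ?lee_fin.
apply: leeD.
  rewrite (integral_cst mu mD) /= lebesgue_measure_itv /= lte_fin.
  have -> : (-1 < 1 :> R)%R by lra.
  by rewrite -EFinB -EFinM lee_fin; lra.
rewrite ge0_integralZl //; last exact: measurable_funTS.
by apply: lee_wpmul2l; rewrite ?lee_fin //; apply: ge0_subset_integral.
Qed.

(** The four terms in lam add up to 16 lam = X / 2 and are absorbed on the left; if some x_i is
    infinite there is nothing to prove. *)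
Lemma ereal_absorb4 (X lam k s1 s2 s3 s4 : R) (x1 x2 x3 x4 : \bar R) : (0 < k)%R ->
  0 <= x1 -> 0 <= x2 -> 0 <= x3 -> 0 <= x4 ->
  s1%:E <= (2 * lam)%:E + k%:E * x1 -> s2%:E <= (2 * lam)%:E + k%:E * x2 ->
  s3%:E <= (2 * lam)%:E + k%:E * x3 -> s4%:E <= (2 * lam)%:E + k%:E * x4 ->
  (X <= 2 * (s1 + s2 + s3 + s4))%R -> (16 * lam = X / 2)%R ->
  (X / (2 * (2 * k)))%:E <= x1 + x2 + x3 + x4.
Proof.
move=> k0; case: x1 => [x1| |] // p1; case: x2 => [x2| |] // p2; case: x3 => [x3| |] // p3;
  case: x4 => [x4| |] // p4; rewrite ?(addey, addye) ?leey //.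
rewrite -!EFinM -!EFinD !lee_fin => h1 h2 h3 h4 hX hl.
by rewrite ler_pdivrMr ?mulr_gt0 //; lra.
Qed.

Definition box_powR (w0 : V) (G : V -> R[i]) (del p : R) (u : V) : \bar R :=
  if `[< (`|u| < del)%R >] then ((cmod (G (w0 + u)%R)) `^ p)%:E else 0.

Lemma box_powR_ge0 w0 G del p u : 0 <= box_powR w0 G del p u.
Proof. by rewrite /box_powR; case: ifP => // _; rewrite lee_fin powR_ge0. Qed.

Lemma borel_box_powR w0 rho G del p : (0 < p)%R -> (del <= rho)%R -> hol w0 rho G -> borel (box_powR w0 G del p).
Proof.
move=> p0 dr [cG _]; apply: (@borel_restrict_powR R (n + n) [set u | (`|u| < del)%R]) => //.
- rewrite (_ : [set u | _] = ball (0%R : V) del); first exact: ball_open.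
  by apply/seteqP; split=> u; rewrite -ball_normE /= sub0r normrN.
- move=> u /= hu; apply: (@continuous_cmod _ _ (fun u => G (w0 + u)%R)).
  apply: near_ccont => eps e0.
  have hw : (`|w0 + u - w0| < rho)%R by rewrite addrC addKr; exact: lt_le_trans dr.
  have [d d0 K] := ccont_near (cG _ hw) e0; exists d => // u' hu'; apply: K.
  by rewrite opprD addrACA subrr add0r.
- by move=> u _; exact: cmod_ge0.
Qed.

(** The value that the last computation of [submean_coord] produces when lam = |kappa| A / 32, with
    A the modulus at the centre; the powers of A cancel, so [del] and [p] are all that remains. *)
Definition submean_const (del p : R) : R :=
  (4 / (cmod (kappa R) * del ^+ 2 / 16 * (cmod (kappa R) / 32) `^ (p - 1)))%R.

Lemma submean_const_gt0 del p : (0 < del)%R -> (0 < submean_const del p)%R.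
Proof.
move=> d0; have k0 : (0 < cmod (kappa R))%R by rewrite cmod_gt0 kappa_neq0.
by rewrite /submean_const !(divr_gt0, mulr_gt0, exprn_gt0, powR_gt0).
Qed.

(** Cauchy's formula at the centre of the squares of half-side s in the k-th complex coordinate,
    del/2 < s < del, followed by [square_mean]. Since the k-th coordinate of u is 0, these squares
    stay in the box of radius [del] for the sup norm. *)
Lemma submean_coord w0 rho G del p (k : 'I_n) (u : V) : (1 <= p)%R -> (0 < del)%R -> (2 * del <= rho)%R ->
  hol w0 rho G -> u 0%R (lshift n k) = 0%R -> u 0%R (rshift n k) = 0%R ->
  box_powR w0 G del p u <= \int[mu]_(a in [set: R]) \int[mu]_(b in [set: R])
    ((submean_const del p)%:E * box_powR w0 G del p (u + (a *: ex R k + b *: ey R k))%R).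
Proof.
move=> p1 d0 dr hG uk1 uk2.
have p0 : (0 < p)%R by lra.
have C0 := submean_const_gt0 p d0.
have bh : borel (box_powR w0 G del p) by apply: borel_box_powR hG => //; lra.
pose h a b := box_powR w0 G del p (u + (a *: ex R k + b *: ey R k))%R.
have h0 a b : 0 <= h a b by exact: box_powR_ge0.
have bh2 : borel2 h.
  move=> d T f g mf mg; apply: bh => j.
  under eq_fun do rewrite !mxE.
  apply: measurable_funD; first exact: measurable_cst.
  by apply: measurable_funD; apply: measurable_funM => //; exact: measurable_cst.
rewrite {1}/box_powR; case: asboolP => [hu|_]; last first.
  by apply: integral_ge0 => a _; apply: integral_ge0 => b _; apply: mule_ge0; [rewrite lee_fin ltW|exact: box_powR_ge0].
pose A := cmod (G (w0 + u)%R); rewrite -/A.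
have [A0|A0] := eqVneq A 0%R.
  rewrite A0 powR0 ?gt_eqF //.
  by apply: integral_ge0 => a _; apply: integral_ge0 => b _; apply: mule_ge0; [rewrite lee_fin ltW|exact: box_powR_ge0].
have {}A0 : (0 < A)%R by rewrite lt_neqAle eq_sym A0 cmod_ge0.
pose K := cmod (kappa R); have K0 : (0 < K)%R by rewrite /K cmod_gt0 kappa_neq0.
(* Makes 16 lam half of K A, as [ereal_absorb4] requires. *)
pose lam := (K * A / 32)%R; have l0 : (0 < lam)%R by rewrite divr_gt0 ?mulr_gt0.
pose c := (K * A / (2 * (4 * lam `^ (1 - p) / del)))%R.
have lp0 : (0 < lam `^ (1 - p))%R by rewrite powR_gt0.
have c0 : (0 <= c)%R by rewrite /c ltW // !(divr_gt0, mulr_gt0).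
have main s : (del / 2 < s < del)%R -> c%:E <= \int[mu]_(t in [set: R]) h t s +
     \int[mu]_(t in [set: R]) h t (- s)%R + \int[mu]_(t in [set: R]) h s t +
     \int[mu]_(t in [set: R]) h (- s)%R t.
  move=> /andP[s1 s2]; have s0 : (0 < s)%R by lra.
  pose w := (w0 + u)%R; pose v : 'rV[R]_n := (s *: delta_mx 0 k)%R.
  have nv : (`|v| <= s)%R.
    rewrite normrZ gtr0_norm // -[leRHS]mulr1.
    by apply: ler_wpM2l; [exact: ltW|exact: norm_delta].
  have wv : (`|w - w0| + `|v| < rho)%R.
    have -> : (w - w0 = u)%R by rewrite /w addrC addKr.
    apply: lt_le_trans dr; clear -hu nv s2; lra.
  have hkern : cmod (crect (fun x y => slice G w v x y * kern 0 x y)%R (-1) 1 (-1) 1) = (K * A)%R.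
    case: hG => _ /(_ w v 0%R wv); rewrite normr0 ltr01 => /(_ isT) ->.
    by rewrite cmodM /slice /cplx_dir !scale0r !addr0.
  have n0 : (`|0 : R| < 1)%R by rewrite normr0.
  have sk := kern_side_cont n0; have sG := hol_slice_side_cont hG wv.
  have E (x y : R) : slice G w v x y = G (w0 + (u + ((s * x) *: ex R k + (s * y) *: ey R k)))%R.
    rewrite /slice /w -addrA cplx_dirE; congr (G (_ + (_ + _)))%R.
    rewrite -[RHS]add0r -(row_mx0 _ 1 n n) dirE !add0r /v !scalerA ![(_ * s)%R]mulrC //.
  have inb (x y : R) : (-1 <= x <= 1)%R -> (-1 <= y <= 1)%R ->
      (`|u + ((s * x) *: ex R k + (s * y) *: ey R k)| < del)%R.
    move=> hx hy; apply: le_lt_trans (_ : (Num.max `|u| s < del)%R); last by rewrite gt_max hu.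
    apply: norm_le_coord => [|i j]; first by rewrite le_max normr_ge0.
    rewrite ord1.
    have bs z : (-1 <= z <= 1)%R -> (`|s * z| <= s)%R.
      move=> hz; rewrite normrM gtr0_norm // -[leRHS]mulr1.
      by apply: ler_wpM2l; [exact: ltW|rewrite ler_norml].
    rewrite !mxE !eqxx /=.
    have [->|nj] := eqVneq j (lshift n k).
      by rewrite uk1 eq_lrshift mulr1 mulr0 addr0 add0r le_max bs ?orbT.
    have [->|nj'] := eqVneq j (rshift n k).
      by rewrite uk2 mulr1 mulr0 !add0r le_max bs ?orbT.
    by rewrite !mulr0 !addr0 le_max coord_norm_le.
  have cc w' : (`|w' - w| <= `|v|)%R -> ccont G w'.
    move=> hw'; case: hG => cG _; apply: cG.
    have -> : (w' - w0 = (w' - w) + (w - w0))%R by rewrite addrA subrK.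
    by apply: le_lt_trans (ler_normD _ _) _; apply: le_lt_trans wv; rewrite addrC lerD2l.
  have cN : side_cont (fun x y => cmod (slice G w v x y)) (-1) 1 (-1) 1.
    have cd (x y : R) : (-1 <= x <= 1)%R -> (-1 <= y <= 1)%R -> {for (w + cplx_dir v x y)%R, continuous (fun w => cmod (G w))}.
      move=> hx hy; apply: continuous_cmod; apply: cc; rewrite addrC addKr.
      by apply: norm_cplx_dir; rewrite ler_norml.
    have cx y x : {for x, continuous (fun x => w + cplx_dir v x y)%R}.
      apply: cvgD; first exact: cvg_cst.
      by apply: cvgD; [apply: cvgZr_tmp; exact: cvg_id|exact: cvg_cst].
    have cy x y : {for y, continuous (fun y => w + cplx_dir v x y)%R}.
      apply: cvgD; first exact: cvg_cst.
      by apply: cvgD; [exact: cvg_cst|apply: cvgZr_tmp; exact: cvg_id].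
    have m1 : (-1 <= (-1 : R) <= 1)%R by rewrite lexx (le_trans (lerN10 R) ler01).
    have q1 : (-1 <= (1 : R) <= 1)%R by rewrite lexx (le_trans (lerN10 R) ler01).
    split=> z hz.
    - exact: (continuous_comp (cx (-1)%R z) (cd _ _ hz m1)).
    - exact: (continuous_comp (cx 1%R z) (cd _ _ hz q1)).
    - exact: (continuous_comp (cy (-1)%R z) (cd _ _ m1 hz)).
    - exact: (continuous_comp (cy 1%R z) (cd _ _ q1 hz)).
  have kE (x y : R) : (-1 <= x <= 1)%R -> (-1 <= y <= 1)%R -> [\/ x = -1, x = 1, y = -1 | y = 1]%R ->
      (cmod (kern 0 x y) <= 1)%R.
    by move=> hx hy hh; have := kern_le n0 hx hy hh; rewrite normr0 subr0 invr1.
  have cK : side_cont (fun x y : R => cmod (kern 0 x y)) (-1) 1 (-1) 1.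
    have sq (r1 r2 : R -> R) z : {for z, continuous r1} -> {for z, continuous r2} ->
        {for z, continuous (fun z => Num.sqrt (r1 z ^+ 2 + r2 z ^+ 2))%R}.
      move=> c1 c2; apply: (@continuous_comp _ _ _ (fun z => r1 z ^+ 2 + r2 z ^+ 2)%R Num.sqrt).
        by apply: cvgD; apply: cvgM.
      exact: sqrt_continuous.
    case: sk => -[r1 r2 r3 r4] [i1 i2 i3 i4].
    split=> z hz.
    - exact: (sq _ _ z (r1 z hz) (i1 z hz)).
    - exact: (sq _ _ z (r2 z hz) (i2 z hz)).
    - exact: (sq _ _ z (r3 z hz) (i3 z hz)).
    - exact: (sq _ _ z (r4 z hz) (i4 z hz)).
  have cP : side_cont (fun x y => cmod (slice G w v x y * kern 0 x y)%R) (-1) 1 (-1) 1.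
    rewrite (_ : (fun x y : R => _) = (fun x y : R => (cmod (slice G w v x y) * cmod (kern 0 x y))%R)).
      exact: side_contM.
    by apply/funext => x; apply/funext => y; rewrite cmodM.
  have L1 := crect_L1 (cside_contM sG sk) cP; rewrite hkern in L1.
  pose k' := (lam `^ (1 - p))%R.
  have mh1 b : measurable_fun [set: R] (fun t => h t b).
    by apply: bh2; [exact: measurable_id|exact: measurable_cst].
  have mh2 a : measurable_fun [set: R] (fun t => h a t).
    by apply: bh2; [exact: measurable_cst|exact: measurable_id].
  have ms : measurable_fun [set: R] (fun t : R => (s * t)%R) by apply: measurable_funM.
  (* Passing from the unit square to half-side s costs 1/s, at most 2/del in this range of s. *)
  have scal (f : R -> \bar R) : measurable_fun [set: R] f -> (forall t, 0 <= f t) ->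
      \int[mu]_(t in [set: R]) f (s * t)%R <= (2 / del)%:E * \int[mu]_(t in [set: R]) f t.
    move=> mf f0; rewrite -(int_affine 0 s0 mf f0) muleA -EFinM.
    under [X in _ <= _ * X]eq_integral do rewrite addr0.
    rewrite -{1}[X in X <= _]mul1e; apply: lee_wpmul2r; first exact: integral_ge0.
    by rewrite lee_fin mulrC mulrA ler_pdivlMr //; lra.
  have side (q : R -> R) (f : R -> \bar R) : measurable_fun [set: R] f -> (forall t, 0 <= f t) ->
      cont_on q (-1) 1 -> (forall x, (0 <= q x)%R) ->
      (forall t, (-1 <= t <= 1)%R -> (q t `^ p)%:E <= f (s * t)%R) ->
      (segint q (-1) 1)%:E <= (2 * lam)%:E + (k' * (2 / del))%:E * \int[mu]_(t in [set: R]) f t.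
    move=> mf f0 cq q0 qf.
    have mfs : measurable_fun [set: R] (fun t => f (s * t)%R) := measurableT_comp mf ms.
    apply: le_trans (segint_Lp p1 l0 cq (fun x _ => q0 x) mfs (fun t => f0 _) qf) _.
    rewrite leeD2l // -/k' EFinM -muleA; apply: lee_wpmul2l; first by rewrite lee_fin powR_ge0.
    exact: scal.
  have cmodp (x y : R) : (-1 <= x <= 1)%R -> (-1 <= y <= 1)%R -> [\/ x = -1, x = 1, y = -1 | y = 1]%R ->
      (cmod (slice G w v x y * kern 0 x y)%R `^ p)%:E <= h (s * x)%R (s * y)%R.
    move=> hx hy hh; rewrite /h /box_powR (asboolT (inb _ _ hx hy)) -E lee_fin.
    apply: ge0_ler_powR; [exact: ltW|by rewrite nnegrE cmod_ge0|by rewrite nnegrE cmod_ge0|rewrite cmodM].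
    by rewrite -[leRHS]mulr1 ler_wpM2l ?cmod_ge0 // kE.
  case: cP => c1 c2 c3 c4.
  have m1 : (-1 <= (-1 : R) <= 1)%R by rewrite lexx (le_trans (lerN10 R) ler01).
  have q1 : (-1 <= (1 : R) <= 1)%R by rewrite lexx (le_trans (lerN10 R) ler01).
  have D1 : (segint (fun x => cmod (slice G w v x (-1) * kern 0 x (-1))%R) (-1) 1)%:E <=
      (2 * lam)%:E + (k' * (2 / del))%:E * \int[mu]_(t in [set: R]) h t (- s)%R.
    apply: side (mh1 (- s)%R) (fun t => h0 _ _) c1 (fun x => cmod_ge0 _) _ => t ht.
    by have := cmodp t (-1)%R ht m1 (ltac:(by constructor 3)); rewrite mulrN1.
  have D2 : (segint (fun x => cmod (slice G w v x 1 * kern 0 x 1)%R) (-1) 1)%:E <=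
      (2 * lam)%:E + (k' * (2 / del))%:E * \int[mu]_(t in [set: R]) h t s.
    apply: side (mh1 s) (fun t => h0 _ _) c2 (fun x => cmod_ge0 _) _ => t ht.
    by have := cmodp t 1%R ht q1 (ltac:(by constructor 4)); rewrite mulr1.
  have D3 : (segint (fun y => cmod (slice G w v (-1) y * kern 0 (-1) y)%R) (-1) 1)%:E <=
      (2 * lam)%:E + (k' * (2 / del))%:E * \int[mu]_(t in [set: R]) h (- s)%R t.
    apply: side (mh2 (- s)%R) (fun t => h0 _ _) c3 (fun x => cmod_ge0 _) _ => t ht.
    by have := cmodp (-1)%R t m1 ht (ltac:(by constructor 1)); rewrite mulrN1.
  have D4 : (segint (fun y => cmod (slice G w v 1 y * kern 0 1 y)%R) (-1) 1)%:E <=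
      (2 * lam)%:E + (k' * (2 / del))%:E * \int[mu]_(t in [set: R]) h s t.
    apply: side (mh2 s) (fun t => h0 _ _) c4 (fun x => cmod_ge0 _) _ => t ht.
    by have := cmodp 1%R t q1 ht (ltac:(by constructor 2)); rewrite mulr1.
  have i0 (f : R -> \bar R) : (forall t, 0 <= f t) -> 0 <= \int[mu]_(t in [set: R]) f t.
    by move=> f0; apply: integral_ge0.
  have j1 := i0 _ (fun t => h0 t s); have j2 := i0 _ (fun t => h0 t (- s)%R).
  have j3 := i0 _ (fun t => h0 s t); have j4 := i0 _ (fun t => h0 (- s)%R t).
  have kk0 : (0 < k' * (2 / del))%R by rewrite mulr_gt0 // divr_gt0.
  have -> : c = (K * A / (2 * (2 * (k' * (2 / del)))))%R by rewrite /c -/k'; congr (_ / (_ * _))%R; field; rewrite gt_eqF.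
  apply: (ereal_absorb4 kk0 j1 j2 j3 j4 D2 D1 D4 D3); last by rewrite /lam; field.
  by apply: le_trans L1 _; rewrite le_eqVlt; apply/orP; left; apply/eqP; ring.
have := square_mean d0 c0 bh2 h0 main.
move=> SM.
have mI : measurable_fun [set: R] (fun a => \int[mu]_(b in [set: R]) h a b).
  have mh : measurable_fun [set: R * R] (fun z => h z.1 z.2).
    by apply: bh2; [exact: measurable_fst|exact: measurable_snd].
  by have := measurable_fun_fubini_tonelli_F (m2 := mu) _ mh; apply=> -[? ?]; exact: h0.
have -> : \int[mu]_(a in [set: R]) \int[mu]_(b in [set: R]) ((submean_const del p)%:E * h a b) =
    (submean_const del p)%:E * \int[mu]_(a in [set: R]) \int[mu]_(b in [set: R]) h a b.
  rewrite -ge0_integralZl //; last 2 first.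
  - by move=> a _; apply: integral_ge0.
  - by rewrite lee_fin ltW.
  apply: eq_integral => a _; rewrite ge0_integralZl //; last by rewrite lee_fin ltW.
  by apply: bh2; [exact: measurable_cst|exact: measurable_id].
have -> : (A `^ p = submean_const del p / 4 * (c * (del / 2)))%R.
  have -> : (A `^ p = A * A `^ (p - 1))%R by rewrite mulr_powRB1 // ltW.
  have lE : (lam `^ (1 - p) = (K / 32) `^ (1 - p) * A `^ (1 - p))%R.
    by rewrite -powRM ?divr_ge0 ?ltW //; congr (_ `^ _)%R; rewrite /lam; ring.
  have iv (x : R) : (0 < x)%R -> (x `^ (1 - p) = (x `^ (p - 1))^-1)%R.
    by move=> x0; rewrite -powRN; congr (_ `^ _)%R; ring.
  rewrite /c lE !iv ?divr_gt0 // /submean_const -/K.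
  have k32 : (0 < (K / 32) `^ (p - 1))%R by rewrite powR_gt0 // divr_gt0.
  have Ap : (0 < A `^ (p - 1))%R by rewrite powR_gt0.
  by field; rewrite !gt_eqF.
rewrite EFinM; apply: le_trans (lee_wpmul2l _ SM) _; first by rewrite lee_fin divr_ge0 // ltW.
rewrite muleA -EFinM divfK //.
Qed.

Lemma submean w0 rho G del p : (1 <= p)%R -> (0 < del)%R -> (2 * del <= rho)%R -> hol w0 rho G ->
  ((cmod (G w0)) `^ p)%:E <= (submean_const del p ^+ n)%:E * iint (box_powR w0 G del p).
Proof.
move=> p1 d0 dr hG; have C0 := submean_const_gt0 p d0.
have bh : borel (box_powR w0 G del p) by apply: borel_box_powR hG; lra.
have := box_mean (ltW C0) bh (box_powR_ge0 _ _ _ _) (fun k u h1 h2 => submean_coord p1 d0 dr hG h1 h2).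
have Cn : (0 <= submean_const del p ^+ n)%R by apply: exprn_ge0; exact: ltW.
rewrite (iintZl Cn bh (box_powR_ge0 _ _ _ _)).
have -> : box_powR w0 G del p 0%R = ((cmod (G w0)) `^ p)%:E by rewrite /box_powR normr0 addr0 asboolT.
by [].
Qed.

End Submean.

(** * The local estimate *)

Section Cone.
Local Open Scope classical_set_scope.
Variables (R : realType) (n r : nat) (jm : 'rV[R]_n -> 'rV[R]_n -> 'rV[R]_n).
Variables (e : 'rV[R]_n) (tr : 'rV[R]_n -> R) (Delta : mpoly.mpoly n R).
Hypothesis eja : is_EJA jm e.
Hypothesis jrank : is_jrank jm e r.
Hypothesis r2 : (1 < r)%N.
Hypothesis trdet : is_trace_det jm e r tr Delta.
Hypothesis dottr : forall x y : 'rV[R]_n, dotr x y = tr (jm x y).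
Hypothesis irr : irreducible_cone (sym_cone jm).
Notation V := 'rV[R]_(n + n).
Notation pd := (pd jm).
Notation Om := (sym_cone jm).
Notation d := (n%:R / r%:R : R).

Lemma tube_pd (w : V) : in_tube Om w <-> pd (rsubmx w).
Proof. exact: (sym_coneP eja). Qed.

Lemma pd_near_e : exists2 rho : R, 0 < rho & forall h : 'rV[R]_n, `|h| < rho -> pd (e + h).
Proof.
have Oe : Om e by apply/(sym_coneP eja); exact: (pd_e eja).
have /nbhs_ballP[rho /= r0 H] : nbhs e Om.
  by apply: open_nbhs_nbhs; split => //; exact: sym_cone_open.
exists rho => // h hr; apply/(sym_coneP eja)/H.
by rewrite -ball_normE /= opprD addrA subrr add0r normrN.
Qed.

(** With y = u^2, associativity gives (x|u^2) = (xu|u). *)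
Lemma dotr_psd_ge0 x y : psd jm x -> psd jm y -> 0 <= dotr x y.
Proof.
move=> px /(psdP eja)[u <-]; have := px u.
by rewrite (jmC eja x) (dotr_jm eja).
Qed.

Lemma norm_sqrt_dotr (v : 'rV[R]_n) : `|v| <= Num.sqrt (dotr v v).
Proof.
apply: norm_le_coord => [|i k]; first exact: sqrtr_ge0.
rewrite ord1 -sqrtr_sqr ler_sqrt ?dotr_ge0 // /dotr (bigD1 k) //= -expr2 lerDl.
by apply: sumr_ge0 => j _; rewrite -expr2 sqr_ge0.
Qed.

(** Inner products of elements of the cone are nonnegative. From (w|2e - w) and (e|2e - w) one gets
    |w|^2 <= 2 (e|w) <= 4 |e|^2 in the Euclidean norm, and from (w + x|w - x) that |x| <= |w|. *)
Lemma order_interval_bounded : exists2 R0 : R, 0 < R0 & forall w x, pd w -> pd (2 *: e - w) ->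
  pd (w + x) -> pd (w - x) -> `|w| < R0 /\ `|x| < R0.
Proof.
exists (Num.sqrt (4 * dotr e e) + 1); first by rewrite ltr_wpDl ?sqrtr_ge0.
move=> w x pw pew px px'.
have h1 := dotr_psd_ge0 (pdW pw) (pdW pew); have h2 := dotr_psd_ge0 (pdW (pd_e eja)) (pdW pew).
have h3 := dotr_psd_ge0 (pdW px) (pdW px').
rewrite (dotrC w) dotrDl dotrNl dotrZl in h1; rewrite (dotrC e) dotrDl dotrNl dotrZl in h2.
rewrite !(dotrDl, dotrNl) (dotrC _ (w - x)) (dotrC x (w - x)) !(dotrDl, dotrNl) (dotrC x w) in h3.
rewrite (dotrC w e) in h2.
have B (v : 'rV[R]_n) : dotr v v <= 4 * dotr e e -> `|v| < Num.sqrt (4 * dotr e e) + 1.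
  move=> h; apply: le_lt_trans (norm_sqrt_dotr v) _.
  apply: le_lt_trans (_ : Num.sqrt (4 * dotr e e) < _); last by rewrite ltrDl.
  by rewrite ler_sqrt // mulr_ge0 // dotr_ge0.
by split; apply: B; lra.
Qed.

(** The neighbourhood T(z): in the order of the cone, Im w lies between Im z / 2 and 2 Im z, and Re
    w - Re z between -Im z and Im z. Stated by the order alone, it is carried along by real
    translations and by linear automorphisms of the cone. The relation is symmetric in the imaginary
    parts but not in the real ones. *)
Definition cone_rel (z w : V) := [/\ pd (2 *: rsubmx w - rsubmx z), pd (2 *: rsubmx z - rsubmx w),
  pd (rsubmx z + (lsubmx w - lsubmx z)) & pd (rsubmx z - (lsubmx w - lsubmx z))].

Lemma pd_half (x y : 'rV[R]_n) : pd y -> pd (2 *: x - y) -> pd x.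
Proof.
move=> py pxy; have := pdZ eja (_ : 0 < 2^-1 :> R) (pdD eja pxy (pdW py)); rewrite subrK scalerA mulVf //.
by rewrite scale1r; apply; rewrite invr_gt0.
Qed.

Lemma cone_rel_tube z w : in_tube Om z -> cone_rel z w -> in_tube Om w.
Proof. by move=> /tube_pd pz [h _ _ _]; apply/tube_pd; exact: pd_half h. Qed.

Lemma lsubmx_continuous N : continuous (fun w : 'rV[R]_(N + N) => lsubmx w).
Proof.
move=> w; apply/(@cvgrPdist_le _ _ _ (nbhs w)) => /= eps e0; apply/nbhs_ballP; exists eps => //= w'.
by rewrite -ball_normE /= -linearB => h; apply: le_trans (norm_lsubmx _) _; exact: ltW.
Qed.

Lemma rsubmx_continuous N : continuous (fun w : 'rV[R]_(N + N) => rsubmx w).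
Proof.
move=> w; apply/(@cvgrPdist_le _ _ _ (nbhs w)) => /= eps e0; apply/nbhs_ballP; exists eps => //= w'.
by rewrite -ball_normE /= -linearB => h; apply: le_trans (norm_rsubmx _) _; exact: ltW.
Qed.

Lemma open_pd N (f : 'rV[R]_N -> 'rV[R]_n) : continuous f -> open [set u | pd (f u)].
Proof.
move=> cf; have -> : [set u | pd (f u)] = f @^-1` Om.
  by apply/seteqP; split=> u /= /(sym_coneP eja).
by apply: open_comp; [move=> u _; exact: cf|exact: sym_cone_open].
Qed.

Lemma open_cone_rel N (fz fw : 'rV[R]_N -> V) : continuous fz -> continuous fw ->
  open [set u | cone_rel (fz u) (fw u)].
Proof.
move=> cz cw.
have cr (f : 'rV[R]_N -> V) : continuous f -> continuous (fun u => rsubmx (f u)).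
  by move=> cf u; apply: continuous_comp; [exact: cf|exact: rsubmx_continuous].
have cl (f : 'rV[R]_N -> V) : continuous f -> continuous (fun u => lsubmx (f u)).
  by move=> cf u; apply: continuous_comp; [exact: cf|exact: lsubmx_continuous].
have cD (f g : 'rV[R]_N -> 'rV[R]_n) : continuous f -> continuous g -> continuous (fun u => f u + g u).
  by move=> cf cg u; exact: (cvgD (cf u) (cg u)).
have c2 (f : 'rV[R]_N -> 'rV[R]_n) : continuous f -> continuous (fun u => 2 *: f u).
  by move=> cf; under eq_fun do rewrite scaler_nat mulr2n; exact: cD.
have cB (f g : 'rV[R]_N -> 'rV[R]_n) : continuous f -> continuous g -> continuous (fun u => f u - g u).
  by move=> cf cg u; exact: (cvgB (cf u) (cg u)).
have o1 := open_pd (cB _ _ (c2 _ (cr _ cw)) (cr _ cz)).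
have o2 := open_pd (cB _ _ (c2 _ (cr _ cz)) (cr _ cw)).
have o3 := open_pd (cD _ _ (cr _ cz) (cB _ _ (cl _ cw) (cl _ cz))).
have o4 := open_pd (cB _ _ (cr _ cz) (cB _ _ (cl _ cw) (cl _ cz))).
have := openI (openI o1 o2) (openI o3 o4); congr open.
by apply/seteqP; split=> u /= => [[[? ?] [? ?]]|[? ? ? ?]].
Qed.

Lemma tube_map_cov x (g : 'M[R]_n) (Phi : V -> \bar R) : posdef g -> borel Phi -> (forall w, (0 <= Phi w)%E) ->
  0 < \det g /\ (((\det g) ^+ 2)%:E * iint (fun z => Phi (tube_map x g z)) = iint Phi)%E.
Proof.
move=> pg bP P0; have [dg _] := iint_posdef pg (@borel_cst R n 0%E) (fun=> lexx _); split=> //.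
pose A : 'M[R]_(n + n) := block_mx g 0 0 g.
have mA (a b : 'rV[R]_n) : row_mx a b *m A = row_mx (a *m g) (b *m g).
  by rewrite mul_row_block !mulmx0 addr0 add0r.
have pA : posdef A.
  case: pg => gT gp; split; first by rewrite /A tr_block_mx !trmx0 gT.
  move=> v v0; rewrite -[v]hsubmxK mA dotr_row_mx.
  have P (u : 'rV[R]_n) : 0 <= dotr (u *m g) u.
    by have [->|/gp/ltW//] := eqVneq u 0; rewrite mul0mx dotr0l.
  have [l0|/gp h] := eqVneq (lsubmx v) 0; last by rewrite ltr_wpDr.
  have r0 : rsubmx v != 0.
    by apply: contra_neq v0 => r0; rewrite -[v]hsubmxK l0 r0 row_mx0.
  by rewrite ltr_wpDl // gp.
have dA : \det A = (\det g) ^+ 2 by rewrite /A det_ublock expr2.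
have [_ E] := iint_posdef pA (borel_shift (row_mx x 0) bP) (fun w => P0 _).
rewrite -(iint_shift (row_mx x 0) bP P0) -E dA; congr (_ * _)%E; apply: eq_iint => z; congr Phi.
by rewrite -{2}[z]hsubmxK mA add_row_mx addr0 /tube_map addrC.
Qed.

Lemma hol_sub w0 w1 rho rho' (F : V -> R[i]) : `|w1 - w0| + rho' <= rho -> hol w0 rho F -> hol w1 rho' F.
Proof.
move=> h [cF HF].
split=> [w hw|w v t hw].
  apply: cF; have -> : w - w0 = (w - w1) + (w1 - w0) by rewrite addrA subrK.
  by apply: le_lt_trans (ler_normD _ _) _; lra.
apply: HF; have -> : w - w0 = (w - w1) + (w1 - w0) by rewrite addrA subrK.
by have := ler_normD (w - w1) (w1 - w0); lra.
Qed.

Lemma hol_tube_map f x g w0 rho : holo_tube Om f ->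
  (forall w, `|w - w0| < rho -> in_tube Om (tube_map x g w)) ->
  hol w0 rho (fun w => uncurryT f (tube_map x g w)).
Proof.
move=> hf H; split.
  by move=> w /H Tw; apply: ccont_tube_map; exact: (holo_ccont hf).
move=> w v t wv t1.
have E a b : slice (fun w => uncurryT f (tube_map x g w)) w v a b =
    slice (uncurryT f) (tube_map x g w) (v *m g) a b by rewrite /slice tube_map_cplx.
rewrite E -(@cauchy_square _ (slice (uncurryT f) (tube_map x g w) (v *m g)) 1 t) //.
  by apply: eq_crect; [|lra|lra] => a b _ _ _; rewrite E.
move=> a b ha hb; apply: (holo_cdiff hf); rewrite -tube_map_cplx; apply: H.
rewrite addrAC; apply: le_lt_trans (ler_normD _ _) _; apply: le_lt_trans wv.
by rewrite lerD2l; apply: norm_cplx_dir; rewrite ler_norml.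
Qed.

Definition local_powR f (p : R) (z w : V) : \bar R :=
  if `[< cone_rel z w >] then (cmod (uncurryT f w) `^ p)%:E else 0%E.

Lemma local_powR_ge0 f p z w : (0 <= local_powR f p z w)%E.
Proof. by rewrite /local_powR; case: ifP => // _; rewrite lee_fin powR_ge0. Qed.

Lemma borel_local_powR f p z : 0 < p -> holo_tube Om f -> in_tube Om z -> borel (local_powR f p z).
Proof.
move=> p0 hf Tz; apply: (@borel_restrict_powR R (n + n) [set w | cone_rel z w]) => //.
- have c1 : continuous (fun _ : V => z) by exact: cst_continuous.
  have c2 : continuous (id : V -> V) by move=> u; exact: cvg_id.
  exact: (open_cone_rel c1 c2).
- by move=> w /= /(cone_rel_tube Tz) Tw; apply: continuous_cmod; exact: (holo_ccont hf).
- by move=> w _; exact: cmod_ge0.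
Qed.

Lemma cone_rel_image (x : 'rV[R]_n) g (u : V) : (forall xi, pd (xi *m g) <-> pd xi) ->
  cone_rel (row_mx x (e *m g)) (tube_map x g u) <->
  [/\ pd (2 *: rsubmx u - e), pd (2 *: e - rsubmx u), pd (e + lsubmx u) & pd (e - lsubmx u)].
Proof.
move=> gp; rewrite /cone_rel /tube_map !row_mxKl !row_mxKr [x + _ - x]addrAC subrr add0r.
have E xi : pd (xi *m g) = pd xi by apply/propext; exact: gp.
by rewrite !scalemxAl -!mulmxBl -mulmxDl !E.
Qed.

(** For G, the pull-back of f to the point ie, the mean value inequality on boxes of radius rho/4
    bounds |G|^p by [Y] on the ball of radius rho/2. Cauchy's estimates on that ball bound Box
    G(ie), which equals D Box f(z) because Delta(vg) = D Delta(v) and g is symmetric. *)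
Lemma local_estimate (p : R) : 1 <= p -> exists2 C : R, 0 < C & forall f, holo_tube Om f ->
  forall z, in_tube Om z -> forall j : R, 0 <= j -> (iint (local_powR f p z) <= j%:E)%E ->
  let D := peval Delta (rsubmx z) in
  cmod (uncurryT f z) `^ p <= C * (j / (D `^ d) ^+ 2) /\
  (D * cmod (BoxOp Delta (uncurryT f) z)) `^ p <= C * (j / (D `^ d) ^+ 2).
Proof.
move=> p1; have p0 : 0 < p by lra.
have [rho0 r00 He] := pd_near_e.
(* Halved because the condition [pd (2 *: rsubmx u - e)] doubles the displacement from [e]. *)
pose rho := rho0 / 2; have r0 : 0 < rho by rewrite /rho; lra.
have rh2 : 0 < rho / 2 by lra.
have [K K0 HK] := BoxOp_bound Delta rh2.
pose C1 := submean_const (rho / 4) p ^+ n.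
have C10 : 0 < C1 by apply: exprn_gt0; apply: submean_const_gt0; lra.
have C0 : 0 < C1 * (1 + K `^ p) by rewrite mulr_gt0 // ltr_pwDl // powR_ge0.
exists (C1 * (1 + K `^ p)) => // f hf z Tz j j0 Jj /=.
have pz := (tube_pd z).1 Tz; set D := peval Delta (rsubmx z).
have [g [gpos gT eg [gpd gD gdet]]] := cone_automorphism eja jrank r2 trdet dottr irr pz.
rewrite -/D in gD gdet.
have D0 : 0 < D by exact: (Delta_gt0 eja jrank r2 trdet dottr).
pose x := lsubmx z; pose w0 : V := row_mx 0 e.
pose G w := uncurryT f (tube_map x g w).
have zE : tube_map x g w0 = z.
  by rewrite /tube_map /w0 row_mxKl row_mxKr mul0mx addr0 eg hsubmxK.
have rel u : `|u - w0| < rho -> cone_rel z (tube_map x g u).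
  move=> hu; have -> : z = row_mx x (e *m g) by rewrite eg hsubmxK.
  apply/(cone_rel_image _ _ gpd).
  have hl : `|lsubmx u| < rho.
    apply: le_lt_trans hu; have := norm_lsubmx (u - w0).
    by rewrite linearB /= /w0 row_mxKl subr0.
  have hr : `|rsubmx u - e| < rho.
    apply: le_lt_trans hu; have := norm_rsubmx (u - w0).
    by rewrite linearB /= /w0 row_mxKr.
  split.
  - have -> : 2 *: rsubmx u - e = e + 2 *: (rsubmx u - e).
      by rewrite scalerBr addrCA; congr (_ + _); rewrite scaler_nat mulr2n opprD addrA subrr add0r.
    by apply: He; rewrite normrZ ger0_norm //; move: hr; rewrite /rho; lra.
  - have -> : 2 *: e - rsubmx u = e + (- (rsubmx u - e)).
      by rewrite opprB scaler_nat mulr2n addrA.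
    by apply: He; rewrite normrN; move: hr; rewrite /rho; lra.
  - by apply: He; move: hl; rewrite /rho; lra.
  - by apply: He; rewrite normrN; move: hl; rewrite /rho; lra.
have hG : hol w0 rho G.
  by apply: hol_tube_map hf _ => u /rel h; exact: cone_rel_tube Tz h.
have bP := borel_local_powR p0 hf Tz.
have P0 := local_powR_ge0 f p z.
have pg : posdef g by split.
have [dg cov] := tube_map_cov x pg bP P0.
pose Phi u := local_powR f p z (tube_map x g u).
have bPhi : borel Phi.
  have sg : posdef g := pg.
  move=> dd T L mL; apply: bP => k; rewrite /tube_map.
  apply: measurable_row_mx => l.
    under eq_fun do rewrite mxE.
    apply: measurable_funD; first exact: measurable_cst.
    have := borel_mulmx g (@borel_coord R n l).
    by move=> /(_ _ _ (fun x => lsubmx (L x))) h; apply/measurable_EFinP; apply: h => i;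
      under eq_fun do rewrite mxE; exact: mL.
  have := borel_mulmx g (@borel_coord R n l).
  by move=> /(_ _ _ (fun x => rsubmx (L x))) h; apply/measurable_EFinP; apply: h => i;
    under eq_fun do rewrite mxE; exact: mL.
have iPhi : (iint Phi <= (j / (\det g) ^+ 2)%:E)%E.
  have dg2 : 0 < (\det g) ^+ 2 by exact: exprn_gt0.
  have : (((\det g) ^+ 2)%:E * iint Phi <= j%:E)%E by rewrite cov.
  have : (0 <= iint Phi)%E by apply: iint_ge0 => u; exact: local_powR_ge0.
  case: (iint Phi) => [i| |] // i0.
    by rewrite -EFinM !lee_fin mulrC ler_pdivlMr.
  by rewrite gt0_muley ?lte_fin.
pose Y := C1 * (j / (\det g) ^+ 2).
have Y0 : 0 <= Y by rewrite mulr_ge0 ?(ltW C10) // divr_ge0 // sqr_ge0.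
have GY w1 : `|w1 - w0| < rho / 2 -> cmod (G w1) `^ p <= Y.
  move=> hw1; have h1 : hol w1 (rho / 2) G by apply: hol_sub hG; lra.
  have rh4 : 0 < rho / 4 by lra.
  have rh42 : 2 * (rho / 4) <= rho / 2 by lra.
  have := submean p1 rh4 rh42 h1; rewrite -lee_fin => h; apply: le_trans h _.
  rewrite /Y EFinM; apply: lee_wpmul2l; first by rewrite lee_fin ltW.
  have S := iint_shift w1 bPhi (fun u => local_powR_ge0 f p z _).
  apply: le_trans iPhi; apply: (@le_trans _ _ (iint (fun u => Phi (u + w1)))); last exact: (eq_ind_r (fun v => (v <= iint Phi)%E) (lexx _) S).
  apply: le_iint => u; first exact: box_powR_ge0.
  rewrite /box_powR; case: asboolP => hu; last exact: local_powR_ge0.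
  rewrite /Phi /local_powR asboolT; first by rewrite [u + w1]addrC.
  apply: rel; rewrite -addrA; apply: le_lt_trans (ler_normD _ _) _; lra.
have pi0 : p != 0 by rewrite gt_eqF.
have rootp (a : R) : 0 <= a -> a `^ p <= Y -> a <= Y `^ p^-1.
  move=> a0 h; have -> : a = (a `^ p) `^ p^-1 by rewrite -powRrM mulfV // powRr1.
  by apply: ge0_ler_powR; rewrite ?nnegrE ?powR_ge0 // invr_ge0 ltW.
pose M := Y `^ p^-1; have M0 : 0 <= M by exact: powR_ge0.
have hbG : holb w0 (rho / 2) M G.
  split; first by apply: holS hG; lra.
  by move=> w /GY h; apply: rootp => //; exact: cmod_ge0.
have YE : j / (D `^ d) ^+ 2 = j / (\det g) ^+ 2 by rewrite gdet.
have XE : C1 * (1 + K `^ p) * (j / (D `^ d) ^+ 2) = (1 + K `^ p) * Y by rewrite YE /Y; ring.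
rewrite XE.
split.
  have -> : cmod (uncurryT f z) = cmod (G w0) by rewrite /G zE.
  apply: le_trans (GY w0 _) _; first by rewrite subrr normr0.
  by rewrite mulrDl mul1r lerDl mulr_ge0 // powR_ge0.
have oO : open Om by exact: sym_cone_open.
have [oT hT] := holo_hol_on hf oO.
have B : BoxOp Delta G w0 = Complex D 0 * BoxOp Delta (uncurryT f) z.
  rewrite /G (@BoxOp_tube_map _ _ D Delta g (in_tube Om)) ?zE //.
  by move=> v; rewrite gT gD.
have hB := HK _ _ _ hbG; rewrite B cmodM cmod_real gtr0_norm // in hB.
apply: le_trans (_ : (K * M) `^ p <= _).
  by apply: ge0_ler_powR; rewrite ?nnegrE ?(ltW p0) // ?mulr_ge0 // ?cmod_ge0 // ltW.
rewrite powRM // /M -powRrM mulVf // powRr1 // mulrDl mul1r.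
by rewrite lerDr.
Qed.

End Cone.

Lemma powR_prod (R : realType) (I : Type) (s : seq I) (P : pred I) (F : I -> R) (a : R) :
  (forall i, 0 <= F i) -> \prod_(i <- s | P i) (F i `^ a) = (\prod_(i <- s | P i) F i) `^ a.
Proof.
move=> F0; suff [] : \prod_(i <- s | P i) (F i `^ a) = (\prod_(i <- s | P i) F i) `^ a /\
  0 <= \prod_(i <- s | P i) F i by [].
apply: (big_ind2 (fun x y => x = y `^ a /\ 0 <= y)) => [|x y x' y' [-> y0] [-> y0']|i _].
- by rewrite powR1.
- by rewrite powRM // mulr_ge0.
- by [].
Qed.

(** With Y_j the p-th root of X_j, each summand times D is at most the product of the Y_j. So D
    times the sum is at most m times that product, whence m^q; the factors a_j^(p-q) supply the
    missing exponent p - q. *)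
Lemma product_bound (R : realType) (m : nat) (a b X : 'I_m -> R) (D p q : R) : 0 < D -> 1 <= q -> q <= p ->
  (forall j, 0 <= a j) -> (forall j, 0 <= b j) ->
  (forall j, a j `^ p <= X j) -> (forall j, (D * b j) `^ p <= X j) ->
  (\sum_j (\prod_(i | i != j) a i) * b j) `^ q * (\prod_j a j `^ (p - q)) * D `^ q <=
  m%:R `^ q * \prod_j X j.
Proof.
move=> D0 q1 qp a0 b0 aX bX; have p0 : 0 < p by lra.
have q0 : 0 <= q by lra.
have pq0 : 0 <= p - q by lra.
have pi0 : p != 0 by rewrite gt_eqF.
pose Y j := X j `^ p^-1.
have Y0 j : 0 <= Y j by exact: powR_ge0.
have root (x : R) j : 0 <= x -> x `^ p <= X j -> x <= Y j.
  move=> x0 h; have -> : x = (x `^ p) `^ p^-1 by rewrite -powRrM mulfV // powRr1.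
  by apply: ge0_ler_powR; rewrite ?nnegrE ?powR_ge0 ?invr_ge0 ?(ltW p0) // (le_trans _ h) // powR_ge0.
have aY j : a j <= Y j by exact: root.
have bY j : D * b j <= Y j by apply: root => //; rewrite mulr_ge0 // ltW.
have X0 j : 0 <= X j by rewrite (le_trans _ (aX j)) // powR_ge0.
pose S := \sum_j (\prod_(i | i != j) a i) * b j.
have S0 : 0 <= S by apply: sumr_ge0 => j _; rewrite mulr_ge0 // prodr_ge0.
have DS : D * S <= m%:R * \prod_j Y j.
  rewrite mulr_sumr (le_trans (_ : _ <= \sum_(j < m) \prod_j Y j)) //.
    apply: ler_sum => j _; rewrite [leRHS](bigD1 j) //= mulrCA mulrC.
    by apply: ler_pM => //; [rewrite mulr_ge0 // ltW|rewrite prodr_ge0|apply: ler_prod => i _; rewrite a0 aY].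
  by rewrite sumr_const card_ord [leRHS]mulr_natl.
have P0 : 0 <= \prod_j Y j by rewrite prodr_ge0.
have A0 : 0 <= \prod_j a j `^ (p - q) by apply: prodr_ge0 => j _; exact: powR_ge0.
rewrite -/S mulrAC -powRM // ?(ltW D0) // mulrC.
have -> : \prod_j X j = (\prod_j Y j) `^ q * \prod_j (Y j `^ (p - q)).
  rewrite -powR_prod // -big_split /=; apply: eq_bigr => j _.
  rewrite -powRD; last by rewrite addrC subrK (negPf pi0).
  by rewrite addrC subrK -powRrM mulVf // powRr1.
rewrite mulrA -powRM ?ler0n // mulrC.
apply: ler_pM => //; first exact: powR_ge0.
  by rewrite mulrC; apply: ge0_ler_powR; rewrite ?nnegrE // ?mulr_ge0 ?ler0n // ltW.
apply: ler_prod => j _; rewrite powR_ge0 /=.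
by apply: ge0_ler_powR; rewrite ?nnegrE.
Qed.

Lemma powR_comparable (R : realType) (a b k s : R) : 0 < a -> 0 < b -> 1 <= k -> a <= k * b -> b <= k * a ->
  a `^ s <= k `^ `|s| * b `^ s.
Proof.
move=> a0 b0 k1 ab ba; have k0 : 0 < k by lra.
have [s0|s0] := leP 0 s.
  by rewrite ger0_norm // -powRM ?(ltW k0) ?(ltW b0) //; apply: ge0_ler_powR; rewrite ?nnegrE ?mulr_ge0 // ltW.
have -> : s = - (- s) by rewrite opprK.
have t0 : 0 <= - s by lra.
move: (- s) t0 => t t0; rewrite normrN ger0_norm // !powRN ler_pdivlMr ?powR_gt0 //.
rewrite mulrC ler_pdivrMr ?powR_gt0 // -powRM ?(ltW k0) ?(ltW a0) //.
by apply: ge0_ler_powR; rewrite ?nnegrE ?mulr_ge0 // ltW.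
Qed.

Lemma peval_bounded (R : realType) (n : nat) (P : mpoly.mpoly n R) (a : R) :
  exists2 K : R, 0 <= K & forall x, `|x| <= a -> `|peval P x| <= K.
Proof.
elim/mpoly_ring_ind: P => [c|i|P Q [K K0 IP] [L L0 IQ]|P Q [K K0 IP] [L L0 IQ]].
- by exists `|c| => // x _; rewrite pevalC.
- by exists `|a| => // x xa; rewrite pevalX (le_trans (coord_norm_le _ _ _)) // (le_trans xa) // ler_norm.
- exists (K + L) => [|x xa]; first exact: addr_ge0.
  by rewrite pevalD (le_trans (ler_normD _ _)) // lerD ?IP ?IQ.
- exists (K * L) => [|x xa]; first exact: mulr_ge0.
  by rewrite pevalM normrM ler_pM ?IP ?IQ.
Qed.

Lemma peval_continuous (R : realType) (n : nat) (P : mpoly.mpoly n R) : continuous (peval P).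
Proof.
elim/mpoly_ring_ind: P => [c|i|P Q IP IQ|P Q IP IQ] x.
- by rewrite (_ : peval _ = cst c) //; [exact: cst_continuous|apply/funext => y; rewrite pevalC].
- rewrite (_ : peval _ = fun y : 'rV[R]_n => y 0 i); first exact: coord_continuous.
  by apply/funext => y; rewrite pevalX.
- rewrite (_ : peval _ = fun y => peval P y + peval Q y); first exact: cvgD (IP x) (IQ x).
  by apply/funext => y; rewrite pevalD.
- rewrite (_ : peval _ = fun y => peval P y * peval Q y); first exact: cvgM (IP x) (IQ x).
  by apply/funext => y; rewrite pevalM.
Qed.

(** * Integration over the tube *)

Section Volume.
Local Open Scope classical_set_scope.
Local Open Scope ereal_scope.
Variable R : realType.

Lemma iint_box N (a : R) : (0 < a)%R ->
  iint (fun u : 'rV[R]_N => if `[< forall k, (`|u 0 k| < a)%R >] then 1 else 0) <= ((2 * a) ^+ N)%:E.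
Proof.
move=> a0; elim: N => [|N IH].
  by rewrite /= expr0; case: asboolP.
rewrite /=.
have L : 0 <= ((2 * a) ^+ N)%:E by rewrite lee_fin exprn_ge0 // mulr_ge0 // ltW.
apply: (@le_trans _ _ (\int[@lebesgue_measure R]_t (((2 * a) ^+ N)%:E * (\1_(`](- a)%R, a[%classic) t)%:E))).
  apply: le_int => t.
    by apply: iint_ge0 => v; case: asboolP.
  rewrite indicE; have [ta|ta] := boolP (t \in _).
    rewrite mule1; apply: le_trans IH; apply: le_iint => v; first by case: asboolP.
    case: asboolP => h; last by case: asboolP.
    by rewrite asboolT // => k; have := h (lift ord0 k); rewrite row_mx_lift0.
  rewrite mule0 (_ : (fun v => _) = fun v => 0 * cst 0 v).
    rewrite iintZl ?mul0e //; exact: borel_cst.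
  apply/funext => v; rewrite mul0e; case: asboolP => // /(_ ord0).
  rewrite row_mx_ord0 mxE => h; case/negP: ta.
  by rewrite inE /= in_itv /= -ltr_norml.
rewrite ge0_integralZl //; last by apply/measurable_EFinP; exact: measurable_indic.
have E : @lebesgue_measure R `](- a)%R, a[%classic = (2 * a)%:E.
  rewrite lebesgue_measure_itv /= lte_fin ifT; last by lra.
  by rewrite -EFinB; congr (_%:E); ring.
rewrite integral_indic // setIT.
by rewrite [X in _ * X]E -EFinM exprSr.
Qed.

End Volume.

Lemma iint0 (R : realType) N : iint (fun _ : 'rV[R]_N => 0 : \bar R)%E = 0%E.
Proof.
have -> : (fun _ : 'rV[R]_N => 0 : \bar R)%E = (fun u => 0 * cst 0 u)%E by apply/funext => u; rewrite mul0e.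
by rewrite iintZl ?mul0e //; exact: borel_cst.
Qed.

Section Estimate.
Local Open Scope classical_set_scope.
Variables (R : realType) (n r : nat) (jm : 'rV[R]_n -> 'rV[R]_n -> 'rV[R]_n).
Variables (e : 'rV[R]_n) (tr : 'rV[R]_n -> R) (Delta : mpoly.mpoly n R).
Hypothesis eja : is_EJA jm e.
Hypothesis jrank : is_jrank jm e r.
Hypothesis r2 : (1 < r)%N.
Hypothesis trdet : is_trace_det jm e r tr Delta.
Hypothesis dottr : forall x y : 'rV[R]_n, dotr x y = tr (jm x y).
Hypothesis irr : irreducible_cone (sym_cone jm).
Notation V := 'rV[R]_(n + n).
Notation pd := (pd jm).
Notation Om := (sym_cone jm).
Notation d := (n%:R / r%:R : R).
Notation cone_rel := (cone_rel jm).
Notation local_powR := (local_powR jm).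
Notation DeltaY w := (peval Delta (rsubmx w)).

Lemma tube_Delta_gt0 (w : V) : in_tube Om w -> 0 < DeltaY w.
Proof. by move=> /(tube_pd eja); exact: (Delta_gt0 eja jrank r2 trdet dottr). Qed.

Lemma open_tube N (f : 'rV[R]_N -> V) : continuous f -> open [set u | in_tube Om (f u)].
Proof.
move=> cf; apply: (@open_comp _ _ (fun u => rsubmx (f u)) Om); last exact: sym_cone_open.
by move=> u _; apply: continuous_comp; [exact: cf|exact: rsubmx_continuous].
Qed.

(** The automorphism sending e to y reduces the claim to y = e. There y' is in the order interval
    from 0 to 2e, which is bounded, and a polynomial is bounded on it. *)
Lemma Delta_comparable : exists2 k : R, 1 <= k & forall y y', pd y -> pd y' -> pd (2 *: y - y') ->
  peval Delta y' <= k * peval Delta y.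
Proof.
have [R0 R00 HR] := order_interval_bounded eja.
have [K K0 HK] := peval_bounded Delta R0.
exists (1 + K) => [|y y' py py' pyy']; first by rewrite lerDl.
have [g [_ gT eg [gpd gD gdet]]] := cone_automorphism eja jrank r2 trdet dottr irr py.
have gu : g \in unitmx.
  rewrite unitmxE unitfE gdet gt_eqF // powR_gt0 //.
  exact: (Delta_gt0 eja jrank r2 trdet dottr).
pose u := y' *m invmx g; have uE : y' = u *m g by rewrite mulmxKV.
have pu : pd u by apply/gpd; rewrite -uE.
have pue : pd (2 *: e - u) by apply/gpd; rewrite mulmxBl -scalemxAl eg -uE.
have [uR _] : `|u| < R0 /\ `|0 : 'rV[R]_n| < R0 by apply: HR; rewrite ?addr0 ?subr0.
rewrite uE gD mulrC; apply: ler_wpM2r; first exact: ltW (Delta_gt0 eja jrank r2 trdet dottr py).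
by have := HK u (ltW uR); rewrite ler_norml => /andP[_ h]; lra.
Qed.

Lemma cone_rel_powR (s : R) : exists2 k : R, 0 < k & forall z w, in_tube Om z -> cone_rel z w ->
  DeltaY z `^ s <= k * DeltaY w `^ s /\ DeltaY w `^ s <= k * DeltaY z `^ s.
Proof.
have [k k1 Hk] := Delta_comparable; exists (k `^ `|s|) => [|z w Tz zw].
  by rewrite powR_gt0 //; lra.
have Tw := cone_rel_tube eja Tz zw; have [h1 h2 _ _] := zw.
have [/(tube_pd eja) pz /(tube_pd eja) pw] := (Tz, Tw).
have [z0 w0] := (tube_Delta_gt0 Tz, tube_Delta_gt0 Tw).
by split; apply: powR_comparable => //; exact: Hk.
Qed.

(** The exponent s may have any sign, while [borel_restrict_powR] takes positive ones; the power is
    therefore rewritten as the first power of exp(s ln Delta). *)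
Lemma borel_tube_powR N (f : 'rV[R]_N -> V) (s : R) : continuous f ->
  borel (fun u => if `[< in_tube Om (f u) >] then (DeltaY (f u) `^ s)%:E else 0%E).
Proof.
move=> cf; pose psi u := expR (s * ln (DeltaY (f u))).
have : borel (fun u => if `[< in_tube Om (f u) >] then (psi u `^ 1)%:E else 0%E).
  apply: borel_restrict_powR => //; first exact: open_tube.
  - move=> u Tu; apply: continuous_comp; last exact: continuous_expR.
    apply: (continuous_comp (f := fun u => ln (DeltaY (f u))) (g := fun t => s * t)); last exact: mulrl_continuous.
    apply: (continuous_comp (f := fun u => DeltaY (f u)) (g := @ln R)); last first.
      by apply: continuous_ln; exact: tube_Delta_gt0.
    apply: (continuous_comp (f := fun u => rsubmx (f u)) (g := peval Delta)).
      by apply: continuous_comp; [exact: cf|exact: rsubmx_continuous].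
    exact: peval_continuous.
  - by move=> u _; exact: expR_ge0.
congr borel; apply/funext => u; case: asboolP => // Tu.
by rewrite powRr1 ?expR_ge0 // /powR gt_eqF // tube_Delta_gt0.
Qed.

Lemma borel_cmod_powR f p N (U : set 'rV[R]_N) (h : 'rV[R]_N -> V) : 0 < p -> holo_tube Om f ->
  open U -> continuous h -> (forall u, U u -> in_tube Om (h u)) ->
  borel (fun u => if `[< U u >] then (cmod (uncurryT f (h u)) `^ p)%:E else 0%E).
Proof.
move=> p0 hf oU ch UT.
apply: (@borel_restrict_powR R N U (fun u => cmod (uncurryT f (h u)))) => //; last first.
  by move=> u _; exact: cmod_ge0.
move=> u /UT Tu; apply: (continuous_comp (f := h) (g := fun w => cmod (uncurryT f w))); first exact: ch.
by apply: continuous_cmod; exact: (holo_ccont hf).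
Qed.

Local Open Scope ereal_scope.

Definition Apnorm_density (p nu : R) f (w : V) : \bar R :=
  if `[< in_tube Om w >] then (cmod (uncurryT f w) `^ p * DeltaY w `^ (nu - d))%:E else 0.

Lemma Apnorm_density_ge0 p nu f w : 0 <= Apnorm_density p nu f w.
Proof. by rewrite /Apnorm_density; case: asboolP => // _; rewrite lee_fin mulr_ge0 // powR_ge0. Qed.

Lemma borel_Apnorm_density p nu f : (0 < p)%R -> holo_tube Om f -> borel (Apnorm_density p nu f).
Proof.
move=> p0 hf.
have cid : continuous (id : V -> V) by move=> u; exact: cvg_id.
have := borelM (borel_cmod_powR p0 hf (open_tube cid) cid (fun u h => h)) (borel_tube_powR (nu - d) cid).
congr borel; apply/funext => w; rewrite /Apnorm_density.
by case: asboolP => /= Tw; rewrite ?EFinM ?mul0e.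
Qed.

Lemma borel_cone_rel w : borel (fun z => if `[< cone_rel z w >] then 1 else 0 : \bar R).
Proof.
have cc : continuous (fun _ : V => w) by exact: cst_continuous.
have cid : continuous (id : V -> V) by move=> u; exact: cvg_id.
have := @borel_restrict_powR R _ [set z | cone_rel z w] (fun=> 1%R) 1%R ltr01 (open_cone_rel eja cid cc).
have c1 : continuous (fun _ : V => 1%R : R) by exact: cst_continuous.
move/(_ (fun u _ => c1 u) (fun u _ => ler01)).
by congr borel; apply/funext => z; rewrite powR1.
Qed.

(** Pulled back by the automorphism attached to w, the set of z becomes a fixed one. There the real
    part is controlled by the imaginary part of the variable point rather than by [e], which is the
    situation of [order_interval_bounded]; so the set lies in a box, and the Jacobian is (det
    g)^2. *)
Lemma iint_cone_rel : exists2 C : R, (0 < C)%R & forall w, in_tube Om w ->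
  iint (fun z => if `[< cone_rel z w >] then 1 else 0) <= (C * (DeltaY w `^ d) ^+ 2)%:E.
Proof.
have [R0 R00 HR] := order_interval_bounded eja.
exists ((2 * R0) ^+ (n + n))%R => [|w Tw]; first by rewrite exprn_gt0 // mulr_gt0.
have pw := (tube_pd eja w).1 Tw.
have [g [gpos gT eg [gpd gD gdet]]] := cone_automorphism eja jrank r2 trdet dottr irr pw.
pose Phi (z : V) : \bar R := if `[< cone_rel z w >] then 1 else 0.
have Phi0 z : 0 <= Phi z by rewrite /Phi; case: asboolP.
have bPhi : borel Phi by exact: borel_cone_rel.
have pg : posdef g by split.
have [dg cov] := tube_map_cov (lsubmx w) pg bPhi Phi0.
rewrite -gdet [(_ * \det g ^+ 2)%R]mulrC EFinM.
change (iint Phi <= (\det g ^+ 2)%:E * ((2 * R0) ^+ (n + n))%:E).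
rewrite -cov; apply: lee_wpmul2l; first by rewrite lee_fin sqr_ge0.
apply: le_trans (iint_box _ R00); apply: le_iint => u //.
rewrite /Phi; case: asboolP => [h|_]; last by case: asboolP.
have [h1 h2 h3 h4] : [/\ pd (2 *: e - rsubmx u), pd (2 *: rsubmx u - e),
    pd (rsubmx u + lsubmx u) & pd (rsubmx u - lsubmx u)]%R.
  have E xi : pd (xi *m g) = pd xi by apply/propext; exact: gpd.
  move: h; rewrite /cone_rel /tube_map !row_mxKl !row_mxKr -eg.
  have -> : (lsubmx w - (lsubmx w + lsubmx u *m g) = - (lsubmx u *m g))%R.
    by rewrite opprD addrA subrr sub0r.
  rewrite opprK.
  by rewrite !scalemxAl -!mulmxBl -mulmxDl !E => -[].
have [a b] := HR _ _ (pd_half eja (pd_e eja) h2) h1 h3 h4.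
rewrite asboolT // => k; apply: le_lt_trans (coord_norm_le _ _ _) _.
rewrite -[u]hsubmxK; apply: le_lt_trans (_ : (Num.max `|lsubmx u| `|rsubmx u| < R0)%R).
  by apply: norm_row_mx; rewrite le_max lexx ?orbT.
by rewrite gt_max b a.
Qed.

Lemma iint_local_powR p nu : (0 < p)%R -> exists2 C : R, (0 < C)%R & forall f, holo_tube Om f ->
  forall z, in_tube Om z ->
  iint (local_powR f p z) <= (C * DeltaY z `^ (- (nu - d)))%:E * iint (Apnorm_density p nu f).
Proof.
move=> p0; have [k k0 Hk] := cone_rel_powR (nu - d); exists k => // f hf z Tz.
have z0 := tube_Delta_gt0 Tz.
have c0 : (0 <= k * DeltaY z `^ (- (nu - d)))%R by rewrite mulr_ge0 ?powR_ge0 // ltW.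
rewrite -iintZl //; [|exact: borel_Apnorm_density|exact: Apnorm_density_ge0].
apply: le_iint => w; first exact: local_powR_ge0.
rewrite /local_powR; case: asboolP => zw; last by rewrite mule_ge0 ?Apnorm_density_ge0 // lee_fin.
rewrite /Apnorm_density asboolT; last exact: (cone_rel_tube eja Tz zw).
rewrite -EFinM lee_fin powRN mulrCA -[leLHS]mulr1; apply: ler_wpM2l; first exact: powR_ge0.
have [h _] := Hk _ _ Tz zw; move: (powR_gt0 (nu - d) z0) h.
by move: (DeltaY z `^ _)%R (DeltaY w `^ _)%R => a b a0 h; rewrite mulrAC ler_pdivlMr // mul1r.
Qed.

(* The integrand of the double integral over the pairs [(z, w)] encoded as [row_mx z w]. *)
Definition pair_density f (p t : R) (u : 'rV[R]_((n + n) + (n + n))) : \bar R :=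
  (if `[< in_tube Om (lsubmx u) >] then (DeltaY (lsubmx u) `^ t)%:E else 0) *
  (if `[< in_tube Om (lsubmx u) /\ cone_rel (lsubmx u) (rsubmx u) >]
   then (cmod (uncurryT f (rsubmx u)) `^ p)%:E else 0).

Lemma pair_density_ge0 f p t u : 0 <= pair_density f p t u.
Proof.
by rewrite /pair_density mule_ge0 //; case: asboolP => // _; rewrite lee_fin powR_ge0.
Qed.

Lemma borel_pair_density f p t : (0 < p)%R -> holo_tube Om f -> borel (pair_density f p t).
Proof.
move=> p0 hf.
have cl : continuous (fun u : 'rV[R]_((n + n) + (n + n)) => lsubmx u) by exact: lsubmx_continuous.
have cr : continuous (fun u : 'rV[R]_((n + n) + (n + n)) => rsubmx u) by exact: rsubmx_continuous.
apply: (borelM (borel_tube_powR t cl)).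
apply: (@borel_cmod_powR f p _ [set u | in_tube Om (lsubmx u) /\ cone_rel (lsubmx u) (rsubmx u)] _ p0 hf) => //.
  exact: openI (open_tube cl) (open_cone_rel eja cl cr).
by move=> u [Tl lr]; exact: (cone_rel_tube eja Tl lr).
Qed.

Lemma iint_pair_density_right f p t z : (0 < p)%R -> holo_tube Om f ->
  iint (fun w => pair_density f p t (row_mx z w)) =
  if `[< in_tube Om z >] then (DeltaY z `^ t)%:E * iint (local_powR f p z) else 0.
Proof.
move=> p0 hf.
case: asboolP => Tz.
  rewrite -iintZl ?powR_ge0 //; last 2 first.
  - exact: (borel_local_powR eja p0 hf Tz).
  - exact: local_powR_ge0.
  apply: eq_iint => w; rewrite /pair_density row_mxKl row_mxKr asboolT //; congr (_ * _).
  by rewrite /local_powR; case: asboolP => [[_ h]|h]; [rewrite asboolT|rewrite asboolF // => h'; exact: h].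
rewrite -[RHS](iint0 R (n + n)); apply: eq_iint => w.
by rewrite /pair_density row_mxKl asboolF // mul0e.
Qed.

(** The weight Delta(Im z)^(nu - 3d) is replaced by its value at w, and the volume of the set of z
    contributes 2d: together nu - d, the weight of the norm. *)
Lemma iint_pair_density_left p nu : (0 < p)%R -> exists2 C : R, (0 < C)%R & forall f w,
  iint (fun z => pair_density f p (nu - 3 * d) (row_mx z w)) <= C%:E * Apnorm_density p nu f w.
Proof.
move=> p0; set t := (nu - 3 * d)%R; have [k k0 Hk] := cone_rel_powR t.
have [C C0 HC] := iint_cone_rel.
exists (k * C)%R => [|f w]; first exact: mulr_gt0.
have [Tw|Tw] := pselect (in_tube Om w); last first.
  apply: (@le_trans _ _ 0); last by rewrite mule_ge0 ?Apnorm_density_ge0 // lee_fin ltW // mulr_gt0.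
  rewrite -[leRHS](iint0 R (n + n)); apply: le_iint => z; first exact: pair_density_ge0.
  rewrite /pair_density row_mxKl row_mxKr [X in _ * X]ifF ?mule0 //.
  by apply/asboolF => -[Tz zw]; apply: Tw; exact: (cone_rel_tube eja Tz zw).
have w0 := tube_Delta_gt0 Tw.
pose a := (k * DeltaY w `^ t * cmod (uncurryT f w) `^ p)%R.
have a0 : (0 <= a)%R by rewrite !mulr_ge0 ?powR_ge0 // ltW.
apply: (@le_trans _ _ (iint (fun z => a%:E * if `[< cone_rel z w >] then 1 else 0))).
  apply: le_iint => z; first exact: pair_density_ge0.
  rewrite /pair_density row_mxKl row_mxKr; case: (asboolP (_ /\ _)) => [[Tz zw]|_]; last first.
    by rewrite mule0 mule_ge0 ?lee_fin //; case: asboolP.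
  rewrite !asboolT // mule1 -EFinM lee_fin /a; apply: ler_wpM2r; first exact: powR_ge0.
  by have [] := Hk _ _ Tz zw.
rewrite iintZl //; [|exact: borel_cone_rel|by move=> z; case: asboolP].
apply: (@le_trans _ _ (a%:E * (C * (DeltaY w `^ d) ^+ 2)%:E)).
  by apply: lee_wpmul2l; [rewrite lee_fin|exact: HC].
rewrite /Apnorm_density asboolT // -!EFinM lee_fin /a /t.
have -> : (nu - d = (nu - 3 * d) + d * 2)%R by ring.
rewrite [(DeltaY w `^ (_ + d * 2))%R]powRD; last by rewrite (gt_eqF w0) implybT.
rewrite powRrM powR_mulrn ?powR_ge0 //.
by rewrite le_eqVlt; apply/orP; left; apply/eqP; ring.
Qed.

Lemma iint_pair_density p nu : (0 < p)%R -> exists2 C : R, (0 < C)%R & forall f, holo_tube Om f ->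
  iint (fun z => iint (fun w => pair_density f p (nu - 3 * d) (row_mx z w))) <=
  C%:E * iint (Apnorm_density p nu f).
Proof.
move=> p0; have [C C0 HC] := iint_pair_density_left nu p0; exists C => // f hf.
rewrite iint_swap; [|exact: borel_pair_density|exact: pair_density_ge0].
rewrite -iintZl ?(ltW C0) //; [|exact: borel_Apnorm_density|exact: Apnorm_density_ge0].
by apply: le_iint => w; [apply: iint_ge0 => z; exact: pair_density_ge0|exact: HC].
Qed.

(** Powers of D: -2d from the factor with J, -(nu + d) from each of the m others, and (m+1)(nu + d)
    - 2d from the weight. The total is nu - 3d. *)
Lemma exponent_count (D C k J PN nu : R) (m : nat) : (0 < D)%R ->
  ((C * (J / (D `^ d) ^+ 2)) * ((C * ((k * D `^ (- (nu - d))) / (D `^ d) ^+ 2)) ^+ m * PN) *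
   (D `^ (m.+1%:R * (nu + d)) / D `^ (2 * d)) =
  (C ^+ m.+1 * k ^+ m * PN) * (D `^ (nu - 3 * d) * J))%R.
Proof.
move=> D0; have Dn : D != 0%R by rewrite gt_eqF.
have add a b : (D `^ (a + b) = D `^ a * D `^ b)%R by rewrite powRD // Dn implybT.
set E := (D `^ d)%R; set u := (D `^ nu)%R.
have En : E != 0%R by rewrite gt_eqF // powR_gt0.
have un : u != 0%R by rewrite gt_eqF // powR_gt0.
have -> : (D `^ (- (nu - d)) = E / u)%R by rewrite opprB add powRN.
have -> : (D `^ (m.+1%:R * (nu + d)) = (u * E) ^+ m.+1)%R.
  by rewrite mulrC powRrM powR_mulrn ?powR_ge0 // add.
have -> : (D `^ (2 * d) = E ^+ 2)%R by rewrite mulrC powRrM powR_mulrn // powR_ge0.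
have -> : (D `^ (nu - 3 * d) = u / E ^+ 3)%R.
  by rewrite add powRN [(3 * d)%R]mulrC powRrM powR_mulrn // powR_ge0.
have X : ((C * (k * (E / u) / E ^+ 2)) ^+ m * (u * E) ^+ m = C ^+ m * k ^+ m)%R.
  by rewrite -!exprMn; congr (_ ^+ _)%R; field; rewrite En un.
rewrite ![(_ ^+ m.+1)%R]exprS.
transitivity ((C * (k * (E / u) / E ^+ 2)) ^+ m * (u * E) ^+ m * (C * (J / E ^+ 2) * PN * (u * E) / E ^+ 2))%R.
  by ring.
by rewrite X; field.
Qed.

End Estimate.

Theorem theorem9 (R : realType) (n r : nat)
    (jm : 'rV[R]_n -> 'rV[R]_n -> 'rV[R]_n) (e : 'rV[R]_n)
    (tr : 'rV[R]_n -> R) (Delta : mpoly.mpoly n R) :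
  is_EJA jm e ->
  is_jrank jm e r ->
  (2 <= r)%N ->
  is_trace_det jm e r tr Delta ->
  (forall x y : 'rV[R]_n, dotr x y = tr (jm x y)) ->
  irreducible_cone (sym_cone jm) ->
  forall (m : nat) (nu p q : R),
    (1 <= m)%N -> n%:R / r%:R - 1 < nu -> 1 <= q -> q <= p ->
    exists C : R, 0 < C /\
      forall f : 'I_m -> 'rV[R]_n -> 'rV[R]_n -> R[i],
        (forall j, in_Apnu r jm Delta p nu (f j)) ->
        (lhs9 r jm Delta p q nu f <=
           (C * m%:R `^ q)%:E * \prod_(j < m) Apnorm_p r jm Delta p nu (f j))%E.
Proof.
move=> eja jrank r2 trdet dottr irr [//|m] nu p q _ _ q1 qp.
have p1 : 1 <= p by lra.
have p0 : 0 < p by lra.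
have [C C0 HC] := local_estimate eja jrank r2 trdet dottr irr p1.
have [k k0 Hk] := iint_local_powR eja jrank r2 trdet dottr irr nu p0.
have [L L0 HL] := iint_pair_density eja jrank r2 trdet dottr irr nu p0.
exists (C ^+ m.+1 * k ^+ m * L); split; first by rewrite !mulr_gt0 // exprn_gt0.
move=> f hf; set d : R := n%:R / r%:R in HC Hk HL *.
have hol j : holo_tube (sym_cone jm) (f j) by have [] := hf j.
have dens0 j w : (0 <= Apnorm_density r jm Delta p nu (f j) w)%E by exact: Apnorm_density_ge0.
pose N j := fine (Apnorm_p r jm Delta p nu (f j)).
have A0 j : (0 <= Apnorm_p r jm Delta p nu (f j))%E by exact: (iint_ge0 (dens0 j)).
have NE j : Apnorm_p r jm Delta p nu (f j) = (N j)%:E.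
  by rewrite /N fineK // ge0_fin_numE //; have [] := hf j.
have N0 j : 0 <= N j by rewrite -lee_fin -NE.
(* The factor of index 0 is the one that keeps its local integral; [PN] collects the norms of the
   others. *)
pose PN := \prod_(j < m.+1 | j != ord0) N j.
have PN0 : 0 <= PN by exact: prodr_ge0.
pose K := C ^+ m.+1 * k ^+ m * PN * m.+1%:R `^ q.
have K0 : 0 <= K by rewrite !mulr_ge0 ?powR_ge0 ?exprn_ge0 // ltW.
pose t := nu - 3 * d.
pose G z := iint (fun w => pair_density jm Delta (f ord0) p t (row_mx z w)).
have G0 z : (0 <= G z)%E by apply: iint_ge0 => w; exact: pair_density_ge0.
have bG : borel G.
  apply: (borel_iint (g := pair_density jm Delta (f ord0) p t)).
    exact: (borel_pair_density eja jrank r2 trdet dottr t p0 (hol ord0)).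
  exact: pair_density_ge0.
have step : (iint (fun z => K%:E * G z) <= (K * (L * N ord0))%:E)%E.
  rewrite iintZl // (EFinM K); apply: lee_wpmul2l; first by rewrite lee_fin.
  by rewrite (EFinM L) -NE; exact: (HL _ (hol ord0)).
have -> : (\prod_(j < m.+1) Apnorm_p r jm Delta p nu (f j) = (\prod_(j < m.+1) N j)%R%:E)%E.
  by rewrite (big_morph EFin (@EFinM R) erefl); apply: eq_bigr => j _; exact: NE.
have -> : ((C ^+ m.+1 * k ^+ m * L * m.+1%:R `^ q)%:E * (\prod_(j < m.+1) N j)%R%:E =
    (K * (L * N ord0))%:E)%E.
  by rewrite -EFinM; congr (_%:E); rewrite (bigD1 ord0) //= -/PN /K; ring.
(* From here on the comparison is pointwise in z: [le_iint] leaves the measurability to the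
   majorant, settled by [bG]. *)
apply: le_trans step; rewrite /lhs9; apply: le_iint => z.
  case: asboolP => // _; rewrite lee_fin !mulr_ge0 ?powR_ge0 ?invr_ge0 ?powR_ge0 //.
  by apply: prodr_ge0 => j _; exact: powR_ge0.
rewrite /G (iint_pair_density_right Delta eja t z p0 (hol ord0)); case: asboolP => Tz; last by rewrite mule0.
have D0 := tube_Delta_gt0 eja jrank r2 trdet dottr Tz.
set D := peval Delta (rsubmx z) in D0 *.
have I0 j : (0 <= iint (local_powR jm (f j) p z))%E by apply: iint_ge0 => w; exact: local_powR_ge0.
have IN j : (iint (local_powR jm (f j) p z) <= (k * D `^ (- (nu - d)) * N j)%:E)%E.
  by rewrite EFinM -NE; exact: (Hk _ (hol j) _ Tz).
pose J := fine (iint (local_powR jm (f ord0) p z)).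
have JE : iint (local_powR jm (f ord0) p z) = J%:E.
  by rewrite /J fineK // ge0_fin_numE // (le_lt_trans (IN ord0)) // ltry.
have J0 : 0 <= J by rewrite -lee_fin -JE.
rewrite JE -!EFinM lee_fin.
(* For index 0 the local integral [J] is retained, to be integrated in z; for the other indices it
   has been replaced by its global bound. *)
pose X (j : 'I_m.+1) := C * ((if j == ord0 then J else k * D `^ (- (nu - d)) * N j) / (D `^ d) ^+ 2).
have bound j : cmod (uncurryT (f j) z) `^ p <= X j /\
    (D * cmod (BoxOp Delta (uncurryT (f j)) z)) `^ p <= X j.
  rewrite /X; case: eqVneq => [->|_]; apply: (HC _ (hol _) _ Tz) => //.
  - by rewrite JE.
  - by rewrite !mulr_ge0 ?powR_ge0 // ltW.
have := product_bound D0 q1 qp (fun j => cmod_ge0 (uncurryT (f j) z))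
  (fun j => cmod_ge0 (BoxOp Delta (uncurryT (f j)) z)) (fun j => (bound j).1) (fun j => (bound j).2).
have XE : \prod_j X j = (C * (J / (D `^ d) ^+ 2)) *
    ((C * ((k * D `^ (- (nu - d))) / (D `^ d) ^+ 2)) ^+ m * PN).
  rewrite (bigD1 ord0) //= {1}/X eqxx; congr (_ * _).
  rewrite (eq_bigr (fun j => C * ((k * D `^ (- (nu - d))) / (D `^ d) ^+ 2) * N j)); last first.
    by move=> j j0; rewrite /X (negPf j0); ring.
  by rewrite big_split /= prodr_const cardC1 card_ord.
rewrite XE; set S := \sum_j _; set P := \prod_j _ => h.
have P0 : 0 <= P by apply: prodr_ge0 => j _; exact: powR_ge0.
have BS : cmod (BoxProd Delta f z) `^ q <= S `^ q.
  have le : cmod (BoxProd Delta f z) <= S.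
    apply: le_trans (cmod_sum _ _ _) _; apply: ler_sum => j _.
    by rewrite cmodM cmod_prod.
  by apply: ge0_ler_powR; rewrite ?nnegrE ?cmod_ge0 ?(le_trans _ le) ?cmod_ge0 //; lra.
have Dq : D `^ (m.+1%:R * (nu + d) + q) = D `^ q * D `^ (m.+1%:R * (nu + d)).
  by rewrite addrC powRD // (gt_eqF D0) implybT.
pose W := D `^ (m.+1%:R * (nu + d)) / D `^ (2 * d).
have W0 : 0 <= W by rewrite divr_ge0 // powR_ge0.
have KE := exponent_count n r C k J PN nu m D0.
apply: (@le_trans _ _ (m.+1%:R `^ q * ((C * (J / (D `^ d) ^+ 2)) *
    ((C * ((k * D `^ (- (nu - d))) / (D `^ d) ^+ 2)) ^+ m * PN)) * W)); last first.
  by rewrite -mulrA KE /K /t /d le_eqVlt; apply/orP; left; apply/eqP; ring.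
apply: le_trans (ler_wpM2r W0 h).
have -> : cmod (BoxProd Delta f z) `^ q * P * D `^ (m.+1%:R * (nu + d) + q) / D `^ (2 * d) =
    cmod (BoxProd Delta f z) `^ q * (P * D `^ q * W) by rewrite Dq /W; ring.
have -> : S `^ q * P * D `^ q * W = S `^ q * (P * D `^ q * W) by ring.
exact: (ler_wpM2r (mulr_ge0 (mulr_ge0 P0 (powR_ge0 _ _)) W0) BS).
Qed.
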